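(* Let $0<\varepsilon<1/2$. There exists a constant $c>0$ such that, as $x\to\infty$, $$\sum_{n\le x}\mathbf{1}_{\mathbf E}(n)=\frac{1}{\pi}\int_{1/2+\varepsilon}^1 G(\sigma)\frac{x^\sigma}{\sigma|\sigma-1|^{1/2}}\,d\sigma+O\big(x\exp(-c\sqrt{\log x})\big),$$ where $G(s)=(\zeta(s)(s-1))^{1/2}L(s,\chi_4)^{1/2}(1-2^{-s})^{-1/2}\prod_{p\equiv3\,(4)}(1-p^{-2s})^{-1/2}$. If the Riemann Hypothesis holds for $\zeta(s)$ and $L(s,\chi_4)$, the error term can be replaced by $O(x^{1/2+\varepsilon})$.
   Context: $\mathbf{1}_{\mathbf E}$ is the indicator function of the set $\mathbf E=\{a^2+b^2:a,b\in\mathbb{Z}\}$ of sums of two squares; $\chi_4$ is the non-principal Dirichlet character mod 4. For real $\sigma\in(1/2,1]$ the quantities $\zeta(\sigma)(\sigma-1)$, $L(\sigma,\chi_4)$, $1-2^{-\sigma}$, $1-p^{-2\sigma}$ are positive and the square roots are the positive ones. *)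

(* Defs.v *)
From Stdlib Require Import Reals ZArith Znumtheory List ClassicalEpsilon.
From Coquelicot Require Import Coquelicot.
Open Scope R_scope.

Definition inE (n : nat) : Prop :=
  exists a b : Z, Z.of_nat n = (a ^ 2 + b ^ 2)%Z.

Definition indE (n : nat) : R :=
  if excluded_middle_informative (inE n) then 1 else 0.

Definition countE (x : R) : R :=
  fold_right Rplus 0 (map indE (List.seq 1 (Z.to_nat (Int_part x)))).

Definition chi4 (n : nat) : R :=
  if Nat.eqb (n mod 2) 0 then 0
  else if Nat.eqb (n mod 4) 1 then 1 else -1.

(* complex numbers s = (a, b) = a + i b ; n^{-s} for n >= 1 *)
Definition cpow_neg (n : nat) (s : C) : C :=
  (exp (- fst s * ln (INR n)) * cos (snd s * ln (INR n)),
   - (exp (- fst s * ln (INR n)) * sin (snd s * ln (INR n)))).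

Definition cdirichlet (a : nat -> R) (s : C) : C :=
  (Series (fun k => a (S k) * fst (cpow_neg (S k) s)),
   Series (fun k => a (S k) * snd (cpow_neg (S k) s))).

(* Dirichlet eta function, convergent for Re s > 0 *)
Definition eta_C (s : C) : C := cdirichlet (fun n => (-1) ^ (S n)) s.

(* Riemann zeta on Re s > 0 (s not a zero of 1 - 2^{1-s}) via its standard
   continuation zeta(s) = eta(s) / (1 - 2^{1-s}) *)
Definition zeta_C (s : C) : C :=
  Cdiv (eta_C s) (Cminus (RtoC 1) (Cmult (RtoC 2) (cpow_neg 2 s))).

(* L(s, chi_4), convergent for Re s > 0 *)
Definition L4_C (s : C) : C := cdirichlet chi4 s.

Definition RH_zeta : Prop :=
  forall a b : R, 0 < a < 1 -> zeta_C (a, b) = 0%C -> a = 1/2.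
Definition RH_L4 : Prop :=
  forall a b : R, 0 < a < 1 -> L4_C (a, b) = 0%C -> a = 1/2.

(* zeta(sigma)(sigma - 1) for real sigma > 0; at sigma = 1 its limit value 1 *)
Definition zeta_times (sigma : R) : R :=
  if Req_EM_T sigma 1 then 1 else fst (zeta_C (sigma, 0)) * (sigma - 1).

Definition L4 (sigma : R) : R := fst (L4_C (sigma, 0)).

Fixpoint prod3 (sigma : R) (N : nat) : R :=
  match N with
  | O => 1
  | S k => prod3 sigma k *
      (if prime_dec (Z.of_nat k) then
         (if Nat.eqb (k mod 4) 3 then / sqrt (1 - Rpower (INR k) (-2 * sigma)) else 1)
       else 1)
  end.

Definition prod3_inf (sigma : R) : R := real (Lim_seq (prod3 sigma)).

Definition G (sigma : R) : R :=
  sqrt (zeta_times sigma) * sqrt (L4 sigma) / sqrt (1 - Rpower 2 (- sigma))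
  * prod3_inf sigma.

Definition integrand (x sigma : R) : R :=
  G sigma * Rpower x sigma / (sigma * sqrt (Rabs (sigma - 1))).

(* Main.v *)
Require Import Defs.
From Stdlib Require Import Reals ZArith Lra Lia List Classical Znumtheory ClassicalEpsilon.
From Stdlib Require Ranalysis5.
From mathcomp Require all_boot all_algebra finfield.
From Coquelicot Require Import Coquelicot.
Set Bullet Behavior "Strict Subproofs".
Open Scope R_scope.

(** The Dirichlet series F(s) of the indicator of E satisfies F(s)^2 = zeta(s) L(s,chi_4) H(s) / (1 - 2^-s) for
    Re s > 1, where H(s) is the product of (1 - p^-2s)^-1 over the primes p = 3 mod 4; hence F(s) = G(s) / sqrt(s - 1).
    Perron's formula with the kernel of the averages of the counting function over [x, x + h] expresses these averages
    through the integral of F over a vertical line Re s = c > 1, truncated at height T. By symmetry only the upper half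
    of the line matters; it is moved to Re s = a < 1 along a rectangle whose lower side lies on the real axis and runs
    through the branch point 1, and the segment [a, 1] contributes the main term.

    Unconditionally, zeta L has no zeros for Re s > 1 - c / log T and |Im s| < T: Landau's lemma bounds the logarithmic
    derivative of (s - 1) zeta(s) L(s,chi_4) from below in terms of a nearby zero, and this contradicts the 3-4-1
    inequality, which is applied in the form that |Z(x)^3 Z(x + it)^4 Z(x + 2it)| decreases in x > 1 for Z = zeta L.
    One takes T = exp(k sqrt(log x)). Under the Riemann Hypothesis, log (zeta L) exists on Re s > 1/2 and the
    Borel-Caratheodory inequality on two discs gives |zeta L| << |t|^eta; one takes a slightly above 1/2 and T = x^2. *)

(** * Complex differentiability *)

(** Squaring F is what makes its Euler product usable: the identity for F^2 holds prime by prime, so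
    no root of an infinite product is taken. The root is taken once, as half a logarithm of a
    holomorphic function on a rectangle, and positivity on the real axis fixes its sign. Averaging
    over [x, x + h] yields a kernel of size 1/|s|^2, so truncation at height T costs a multiple of
    1/T and integers close to x need no separate treatment; the price is an error of order h.
    Reality on the axis takes the place of the two edges of a cut: right of 1 the root of s - 1 is
    real and the axis contributes nothing, left of 1 it is imaginary and the whole integral is kept.
    The choice T = exp(k sqrt(log x)) balances a power of 1/T against x^(a - 1), where 1 - a has
    order 1 / log T. One contour estimate serves both halves of the theorem; they differ only in a,
    h, T and in the growth bound for zeta L. *)

Lemma Cmod_fst (z : C) : Rabs (fst z) <= Cmod z.
Proof. eapply Rle_trans; [apply Rmax_l | apply Rmax_Cmod]. Qed.

Lemma Cmod_snd (z : C) : Rabs (snd z) <= Cmod z.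
Proof. eapply Rle_trans; [apply Rmax_r | apply Rmax_Cmod]. Qed.

Lemma Cmod_le_sum (z : C) : Cmod z <= Rabs (fst z) + Rabs (snd z).
Proof.
  unfold Cmod. rewrite <- (sqrt_pow2 (Rabs (fst z) + Rabs (snd z))).
  2:{ generalize (Rabs_pos (fst z)) (Rabs_pos (snd z)); lra. }
  apply sqrt_le_1_alt. rewrite <- (pow2_abs (fst z)), <- (pow2_abs (snd z)).
  generalize (Rabs_pos (fst z)) (Rabs_pos (snd z)); nra.
Qed.

Lemma Cmod_sq (z : C) : Cmod z * Cmod z = fst z * fst z + snd z * snd z.
Proof. unfold Cmod. rewrite sqrt_sqrt; nra. Qed.

Lemma Cmod_minus_sym (z w : C) : Cmod (z - w) = Cmod (w - z).
Proof. rewrite <- Cmod_opp. f_equal. ring. Qed.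

Lemma Cmod_tri_minus (z w u : C) : Cmod (z - w) <= Cmod (z - u) + Cmod (u - w).
Proof. replace (z - w)%C with ((z - u) + (u - w))%C by ring. apply Cmod_triangle. Qed.

Lemma Cmod_minus_le (z w : C) : Cmod (z - w) <= Cmod z + Cmod w.
Proof. rewrite <- (Cmod_opp w). apply Cmod_triangle. Qed.

Lemma Cmod_ge_minus (z w : C) : Cmod z - Cmod w <= Cmod (z - w).
Proof.
  assert (H := Cmod_triangle (z - w) w). replace (z - w + w)%C with z in H by ring. lra.
Qed.

Lemma Cmod_self_0 (z : C) : Cmod (z - z) = 0.
Proof. replace (z - z)%C with (RtoC 0) by ring. apply Cmod_0. Qed.

Lemma Cminus_neq_0 (z w : C) : z <> w -> (z - w)%C <> 0%C.
Proof. intros H E. apply H. replace z with ((z - w) + w)%C by ring. rewrite E. ring. Qed.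

Definition Ccont (f : C -> C) (z : C) :=
  forall eps, 0 < eps -> exists d, 0 < d /\ forall w, Cmod (w - z) < d -> Cmod (f w - f z) < eps.

(** The difference quotient is multiplied out and the bound is not strict, so w = z is allowed and
    no punctured neighbourhood or division occurs. *)
Definition Cderiv (f : C -> C) (z l : C) :=
  forall eps, 0 < eps -> exists d, 0 < d /\
    forall w, Cmod (w - z) < d -> Cmod (f w - f z - l * (w - z)) <= eps * Cmod (w - z).

Definition Copen (D : C -> Prop) :=
  forall z, D z -> exists d, 0 < d /\ forall w, Cmod (w - z) < d -> D w.

(* Continuity of the derivative is part of the definition, so that Green's theorem
   applies directly and Goursat's theorem is not needed. *)
Definition holo (D : C -> Prop) (f : C -> C) :=
  exists f', forall z, D z -> Cderiv f z (f' z) /\ Ccont f' z.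

Definition disc (z0 : C) (r : R) (z : C) := Cmod (z - z0) < r.

Definition rect (a b c d : R) (z : C) := a < fst z < b /\ c < snd z < d.

Lemma disc_open z0 r : Copen (disc z0 r).
Proof.
  intros z Hz. unfold disc in *. exists (r - Cmod (z - z0)). split. lra.
  intros w Hw. assert (H := Cmod_tri_minus w z0 z). lra.
Qed.

Lemma rect_open a b c d : Copen (rect a b c d).
Proof.
  intros z [[H1 H2] [H3 H4]].
  exists (Rmin (Rmin (fst z - a) (b - fst z)) (Rmin (snd z - c) (d - snd z))). split.
  repeat apply Rmin_glb_lt; lra.
  intros w Hw.
  assert (E1 := Cmod_fst (w - z)%C). assert (E2 := Cmod_snd (w - z)%C).
  simpl in E1, E2. apply Rmin_Rgt in Hw. destruct Hw as [A B].
  apply Rmin_Rgt in A, B. destruct A as [A1 A2], B as [B1 B2].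
  unfold Rabs in E1, E2. unfold rect.
  destruct (Rcase_abs (fst w + - fst z)); destruct (Rcase_abs (snd w + - snd z)); lra.
Qed.

Lemma Ccont_ext_loc f g z d : 0 < d -> (forall w, Cmod (w - z) < d -> f w = g w) ->
  Ccont f z -> Ccont g z.
Proof.
  intros Hd E H eps He. destruct (H eps He) as [d' [Hd' K]].
  exists (Rmin d d'). split. apply Rmin_glb_lt; lra.
  intros w Hw. apply Rmin_Rgt in Hw. rewrite <- !E; try lra. apply K; lra.
  rewrite Cmod_self_0; lra.
Qed.

Lemma Cderiv_ext_loc f g z l d : 0 < d -> (forall w, Cmod (w - z) < d -> f w = g w) ->
  Cderiv f z l -> Cderiv g z l.
Proof.
  intros Hd E H eps He. destruct (H eps He) as [d' [Hd' K]].
  exists (Rmin d d'). split. apply Rmin_glb_lt; lra.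
  intros w Hw. apply Rmin_Rgt in Hw. rewrite <- !E; try lra. apply K; lra.
  rewrite Cmod_self_0; lra.
Qed.

Lemma Cderiv_cont f z l : Cderiv f z l -> Ccont f z.
Proof.
  intros H eps He. destruct (H 1) as [d [Hd K]]. lra.
  assert (P : 0 < 1 + Cmod l) by (generalize (Cmod_ge_0 l); lra).
  exists (Rmin d (eps / (1 + Cmod l))). split.
  apply Rmin_glb_lt. lra. apply Rdiv_lt_0_compat; lra.
  intros w Hw. apply Rmin_Rgt in Hw. destruct Hw as [H1 H2].
  specialize (K w H1).
  assert (T := Cmod_triangle (f w - f z - l * (w - z)) (l * (w - z))).
  replace (f w - f z - l * (w - z) + l * (w - z))%C with (f w - f z)%C in T by ring.
  rewrite Cmod_mult in T.
  assert (Cmod (w - z) * (1 + Cmod l) < eps).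
  { apply Rmult_lt_compat_r with (r := 1 + Cmod l) in H2; [|lra].
    unfold Rdiv in H2. rewrite Rmult_assoc, Rinv_l in H2; lra. }
  lra.
Qed.

Lemma Cderiv_unique f z l m : Cderiv f z l -> Cderiv f z m -> l = m.
Proof.
  intros H1 H2. destruct (Ceq_dec l m) as [E|N]; auto. exfalso.
  assert (P : 0 < Cmod (l - m)) by (apply Cmod_gt_0, Cminus_neq_0, N).
  destruct (H1 (Cmod (l - m) / 4)) as [d1 [Hd1 K1]]. lra.
  destruct (H2 (Cmod (l - m) / 4)) as [d2 [Hd2 K2]]. lra.
  set (h := Rmin d1 d2 / 2).
  assert (Hh : 0 < h) by (unfold h; generalize (Rmin_glb_lt d1 d2 0 Hd1 Hd2); lra).
  assert (h < d1 /\ h < d2) as [L1 L2].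
  { unfold h. generalize (Rmin_l d1 d2) (Rmin_r d1 d2); unfold h in Hh; lra. }
  assert (M : Cmod (z + RtoC h - z) = h).
  { replace (z + RtoC h - z)%C with (RtoC h) by ring. rewrite Cmod_R, Rabs_pos_eq; lra. }
  specialize (K1 (z + RtoC h)%C). specialize (K2 (z + RtoC h)%C).
  rewrite M in K1, K2. specialize (K1 L1). specialize (K2 L2).
  assert (T := Cmod_tri_minus (f (z + RtoC h) - f z - m * (z + RtoC h - z))%C
     (f (z + RtoC h) - f z - l * (z + RtoC h - z))%C (RtoC 0)).
  replace (f (z + RtoC h) - f z - m * (z + RtoC h - z) -
    (f (z + RtoC h) - f z - l * (z + RtoC h - z)))%C with ((l - m) * h)%C in T by ring.
  rewrite Cmod_mult, Cmod_R, (Rabs_pos_eq h) in T by lra.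
  rewrite (Cmod_minus_sym 0) in T.
  replace (f (z + h) - f z - m * (z + h - z) - 0)%C with (f (z + h) - f z - m * (z + h - z))%C in T by ring.
  replace (f (z + h) - f z - l * (z + h - z) - 0)%C with (f (z + h) - f z - l * (z + h - z))%C in T by ring.
  assert (Cmod (l - m) * h <= Cmod (l-m) / 2 * h) by lra.
  nra.
Qed.

Lemma Cderiv_const c z : Cderiv (fun _ => c) z 0.
Proof.
  intros eps He. exists 1. split. lra. intros w _.
  replace (c - c - 0 * (w - z))%C with (RtoC 0) by ring. rewrite Cmod_0.
  apply Rmult_le_pos. lra. apply Cmod_ge_0.
Qed.

Lemma Cderiv_id z : Cderiv (fun w => w) z 1.
Proof.
  intros eps He. exists 1. split. lra. intros w _.
  replace (w - z - 1 * (w - z))%C with (RtoC 0) by ring. rewrite Cmod_0.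
  apply Rmult_le_pos. lra. apply Cmod_ge_0.
Qed.

Lemma Cderiv_eq f z l m : Cderiv f z l -> l = m -> Cderiv f z m.
Proof. intros H <-. exact H. Qed.

Lemma Cderiv_plus f g z l m : Cderiv f z l -> Cderiv g z m ->
  Cderiv (fun w => f w + g w)%C z (l + m).
Proof.
  intros H1 H2 eps He.
  destruct (H1 (eps/2)) as [d1 [Hd1 K1]]. lra.
  destruct (H2 (eps/2)) as [d2 [Hd2 K2]]. lra.
  exists (Rmin d1 d2). split. apply Rmin_glb_lt; lra.
  intros w Hw. apply Rmin_Rgt in Hw. destruct Hw as [A1 A2].
  specialize (K1 w A1). specialize (K2 w A2).
  replace (f w + g w - (f z + g z) - (l + m) * (w - z))%C with
    ((f w - f z - l * (w - z)) + (g w - g z - m * (w - z)))%C by ring.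
  eapply Rle_trans. apply Cmod_triangle. lra.
Qed.

Lemma Cderiv_mult f g z l m : Cderiv f z l -> Cderiv g z m ->
  Cderiv (fun w => f w * g w)%C z (l * g z + f z * m).
Proof.
  intros H1 H2 eps He.
  destruct (Cderiv_cont _ _ _ H1 1) as [d0 [Hd0 K0]]. lra.
  set (A := Cmod (f z) + 1 + Cmod (g z) + Cmod m + 1).
  assert (HA : 0 < A) by (unfold A; generalize (Cmod_ge_0 (f z)) (Cmod_ge_0 (g z)) (Cmod_ge_0 m); lra).
  assert (HeA : 0 < eps / (3 * A)) by (apply Rdiv_lt_0_compat; lra).
  destruct (Cderiv_cont _ _ _ H1 (eps / (3 * A))) as [d3 [Hd3 K3]]. lra.
  destruct (H1 (eps/ (3*A))) as [d1 [Hd1 K1]]. lra.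
  destruct (H2 (eps/ (3*A))) as [d2 [Hd2 K2]]. lra.
  exists (Rmin (Rmin d0 d3) (Rmin d1 d2)). split. repeat apply Rmin_glb_lt; lra.
  intros w Hw. apply Rmin_Rgt in Hw. destruct Hw as [B1 B2].
  apply Rmin_Rgt in B1, B2. destruct B1 as [C0 C3], B2 as [C1 C2].
  specialize (K0 w C0). specialize (K1 w C1). specialize (K2 w C2). specialize (K3 w C3).
  replace (f w * g w - f z * g z - (l * g z + f z * m) * (w - z))%C with
    ((f w - f z - l * (w - z)) * g z + f w * (g w - g z - m * (w - z))
      + (f w - f z) * m * (w - z))%C by ring.
  eapply Rle_trans. apply Cmod_triangle.
  eapply Rle_trans. apply Rplus_le_compat_r. apply Cmod_triangle.
  rewrite !Cmod_mult.
  assert (Fw : Cmod (f w) <= Cmod (f z) + 1).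
  { assert (T := Cmod_ge_minus (f w) (f z)). lra. }
  assert (E0 : eps / (3 * A) * A = eps / 3) by (field; lra).
  set (e := eps / (3*A)) in *. set (h := Cmod (w - z)) in *.
  assert (Hh : 0 <= h) by apply Cmod_ge_0.
  assert (Gz := Cmod_ge_0 (g z)). assert (Fz := Cmod_ge_0 (f z)). assert (Mm := Cmod_ge_0 m).
  assert (Q1 : Cmod (f w - f z - l * (w - z)) * Cmod (g z) <= e * h * Cmod (g z))
    by (apply Rmult_le_compat_r; lra).
  assert (Q2 : Cmod (f w) * Cmod (g w - g z - m * (w - z)) <= (Cmod (f z) + 1) * (e * h)).
  { apply Rmult_le_compat; try apply Cmod_ge_0; lra. }
  assert (Q3 : Cmod (f w - f z) * Cmod m * h <= e * Cmod m * h).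
  { apply Rmult_le_compat_r; auto. apply Rmult_le_compat_r; lra. }
  assert (e * h * Cmod (g z) + (Cmod (f z) + 1) * (e * h) + e * Cmod m * h <= e * A * h).
  { unfold A. assert (0 <= e * h) by (apply Rmult_le_pos; lra). nra. }
  rewrite E0 in H. assert (0 <= eps * h) by (apply Rmult_le_pos; lra). lra.
Qed.

Lemma Cderiv_comp f g z l m : Cderiv g z l -> Cderiv f (g z) m ->
  Cderiv (fun w => f (g w)) z (m * l).
Proof.
  intros H1 H2 eps He.
  set (A := 1 + Cmod l + Cmod m).
  assert (HA : 1 <= A) by (unfold A; generalize (Cmod_ge_0 l) (Cmod_ge_0 m); lra).
  assert (HeA : 0 < eps / (2 * A)) by (apply Rdiv_lt_0_compat; lra).
  destruct (H2 _ HeA) as [d2 [Hd2 K2]].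
  destruct (Cderiv_cont _ _ _ H1 d2 Hd2) as [d0 [Hd0 K0]].
  destruct (H1 (Rmin 1 (eps / (2 * A)))) as [d1 [Hd1 K1]]. apply Rmin_glb_lt; lra.
  exists (Rmin d0 d1). split. apply Rmin_glb_lt; lra.
  intros w Hw. apply Rmin_Rgt in Hw. destruct Hw as [B1 B2].
  specialize (K0 w B1). specialize (K1 w B2). specialize (K2 (g w) K0).
  set (h := Cmod (w - z)) in *. assert (Hh : 0 <= h) by apply Cmod_ge_0.
  assert (T1 : Cmod (g w - g z) <= (1 + Cmod l) * h).
  { replace (g w - g z)%C with ((g w - g z - l * (w - z)) + l * (w - z))%C by ring.
    eapply Rle_trans. apply Cmod_triangle. rewrite Cmod_mult. fold h.
    generalize (Rmin_l 1 (eps / (2 * A))); intros. nra. }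
  replace (f (g w) - f (g z) - m * l * (w - z))%C with
    ((f (g w) - f (g z) - m * (g w - g z)) + m * (g w - g z - l * (w - z)))%C by ring.
  eapply Rle_trans. apply Cmod_triangle. rewrite Cmod_mult.
  assert (E0 : eps / (2 * A) * A = eps / 2) by (field; lra).
  assert (X := Rmin_r 1 (eps / (2 * A))). set (e := eps / (2 * A)) in *.
  assert (Y := Cmod_ge_0 m). assert (Y' := Cmod_ge_0 l).
  assert (Cmod (f (g w) - f (g z) - m * (g w - g z)) <= e * ((1 + Cmod l) * h)).
  { eapply Rle_trans. apply K2. apply Rmult_le_compat_l; lra. }
  assert (Cmod m * Cmod (g w - g z - l * (w - z)) <= Cmod m * (e * h)).
  { apply Rmult_le_compat_l; auto. eapply Rle_trans. apply K1. apply Rmult_le_compat_r; auto. }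
  assert (e * ((1 + Cmod l) * h) + Cmod m * (e * h) = e * A * h) by (unfold A; ring).
  rewrite E0 in H3. assert (0 <= eps * h) by (apply Rmult_le_pos; lra). lra.
Qed.

Lemma Cderiv_inv (z : C) : z <> 0%C -> Cderiv Cinv z (- / (z * z)).
Proof.
  intros Hz eps He.
  assert (P : 0 < Cmod z) by (apply Cmod_gt_0, Hz).
  set (k := Cmod z) in *.
  exists (Rmin (k / 2) (eps * (k * k * k) / 2)). split.
  { apply Rmin_glb_lt. lra. assert (0 < k * k * k) by (repeat apply Rmult_lt_0_compat; lra).
    assert (0 < eps * (k*k*k)) by (apply Rmult_lt_0_compat; lra). lra. }
  intros w Hw. apply Rmin_Rgt in Hw. destruct Hw as [A B].
  assert (W : k / 2 < Cmod w).
  { assert (T := Cmod_ge_minus z w). fold k in T. rewrite Cmod_minus_sym in T. lra. }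
  assert (Wn : w <> 0%C) by (apply Cmod_gt_0; lra).
  replace (/ w - / z - - / (z * z) * (w - z))%C with ((w - z) * (w - z) * / (w * z * z))%C
    by (field; auto).
  rewrite !Cmod_mult, Cmod_inv by (repeat apply Cmult_neq_0; auto).
  rewrite !Cmod_mult. fold k. set (h := Cmod (w - z)) in *.
  assert (Hh : 0 <= h) by apply Cmod_ge_0.
  rewrite Rmult_assoc, (Rmult_comm eps). apply Rmult_le_compat_l; auto.
  assert (0 < k * k * k / 2) by (assert (0 < k * k * k) by (repeat apply Rmult_lt_0_compat; lra); lra).
  assert (k * k * k / 2 <= Cmod w * k * k).
  { replace (k * k * k / 2) with (k / 2 * k * k) by field.
    repeat apply Rmult_le_compat_r; lra. }
  apply Rle_trans with (h * / (k * k * k / 2)).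
  apply Rmult_le_compat_l; auto. apply Rinv_le_contravar; auto.
  apply Rmult_le_reg_r with (k * k * k / 2); auto.
  rewrite Rmult_assoc, Rinv_l by lra. lra.
Qed.

Lemma Ccont_const c z : Ccont (fun _ => c) z.
Proof. exact (Cderiv_cont _ _ _ (Cderiv_const c z)). Qed.

Lemma Ccont_id z : Ccont (fun w => w) z.
Proof. exact (Cderiv_cont _ _ _ (Cderiv_id z)). Qed.

Lemma Ccont_plus f g z : Ccont f z -> Ccont g z -> Ccont (fun w => f w + g w)%C z.
Proof.
  intros H1 H2 eps He.
  destruct (H1 (eps/2)) as [d1 [Hd1 K1]]. lra.
  destruct (H2 (eps/2)) as [d2 [Hd2 K2]]. lra.
  exists (Rmin d1 d2). split. apply Rmin_glb_lt; lra.
  intros w Hw. apply Rmin_Rgt in Hw. destruct Hw as [A1 A2].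
  specialize (K1 w A1). specialize (K2 w A2).
  replace (f w + g w - (f z + g z))%C with ((f w - f z) + (g w - g z))%C by ring.
  eapply Rle_lt_trans. apply Cmod_triangle. lra.
Qed.

Lemma Ccont_mult f g z : Ccont f z -> Ccont g z -> Ccont (fun w => f w * g w)%C z.
Proof.
  intros H1 H2 eps He.
  set (A := Cmod (f z) + Cmod (g z) + 1).
  assert (F0 := Cmod_ge_0 (f z)). assert (G0 := Cmod_ge_0 (g z)).
  assert (HA : 1 <= A) by (unfold A; lra).
  set (e := Rmin 1 (eps / (2 * A))).
  assert (E1 : 0 < e) by (apply Rmin_glb_lt; [lra|apply Rdiv_lt_0_compat; lra]).
  destruct (H1 e E1) as [d1 [Hd1 K1]]. destruct (H2 e E1) as [d2 [Hd2 K2]].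
  exists (Rmin d1 d2). split. apply Rmin_glb_lt; lra.
  intros w Hw. apply Rmin_Rgt in Hw. destruct Hw as [A1 A2].
  specialize (K1 w A1). specialize (K2 w A2).
  replace (f w * g w - f z * g z)%C with ((f w - f z) * (g w - g z) + (f w - f z) * g z + f z * (g w - g z))%C by ring.
  eapply Rle_lt_trans. apply Cmod_triangle.
  eapply Rle_lt_trans. apply Rplus_le_compat_r, Cmod_triangle.
  rewrite !Cmod_mult.
  assert (X1 : e <= 1) by apply Rmin_l. assert (X2 : e <= eps / (2 * A)) by apply Rmin_r.
  assert (X3 : e * A <= eps / 2).
  { apply Rmult_le_compat_r with (r := A) in X2; [|lra].
    replace (eps / (2 * A) * A) with (eps / 2) in X2 by (field; lra). lra. }
  assert (P1 := Cmod_ge_0 (f w - f z)). assert (P2 := Cmod_ge_0 (g w - g z)).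
  assert (Cmod (f w - f z) * Cmod (g w - g z) <= e * 1) by (apply Rmult_le_compat; lra).
  assert (Cmod (f w - f z) * Cmod (g z) <= e * Cmod (g z)) by (apply Rmult_le_compat_r; lra).
  assert (Cmod (f z) * Cmod (g w - g z) <= Cmod (f z) * e) by (apply Rmult_le_compat_l; lra).
  unfold A in X3. lra.
Qed.

Lemma Ccont_comp f g z : Ccont g z -> Ccont f (g z) -> Ccont (fun w => f (g w)) z.
Proof.
  intros H1 H2 eps He. destruct (H2 eps He) as [d [Hd K]].
  destruct (H1 d Hd) as [d' [Hd' K']]. exists d'. split; auto.
Qed.

Lemma Ccont_inv f z : Ccont f z -> f z <> 0%C -> Ccont (fun w => / f w)%C z.
Proof.
  intros H N. apply (Ccont_comp Cinv f); auto.
  eapply Cderiv_cont, Cderiv_inv, N.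
Qed.

Lemma holo_intro D f f' : (forall z, D z -> Cderiv f z (f' z)) ->
  (forall z, D z -> Ccont f' z) -> holo D f.
Proof. intros H1 H2. exists f'. auto. Qed.

Lemma holo_cont D f z : holo D f -> D z -> Ccont f z.
Proof. intros [f' H] Hz. eapply Cderiv_cont, (H z Hz). Qed.

Lemma holo_sub (D D' : C -> Prop) f : (forall z, D z -> D' z) -> holo D' f -> holo D f.
Proof. intros S [f' H]. exists f'. auto. Qed.

Lemma holo_ext D f g : Copen D -> (forall z, D z -> f z = g z) -> holo D f -> holo D g.
Proof.
  intros O E [f' H]. exists f'. intros z Hz. destruct (H z Hz) as [H1 H2]. split; auto.
  destruct (O z Hz) as [d [Hd K]]. apply (Cderiv_ext_loc f g z (f' z) d Hd); auto.
Qed.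

(** A choice function glues the local derivatives into one: by uniqueness it agrees near every point
    with a continuous local derivative. *)
Lemma holo_local D f : (forall z, D z -> exists d, 0 < d /\ holo (disc z d) f) -> holo D f.
Proof.
  intros H.
  set (f' := fun z => epsilon (inhabits (RtoC 0)) (fun l : C => Cderiv f z l)).
  assert (S : forall z l, Cderiv f z l -> f' z = l).
  { intros z l K. eapply Cderiv_unique; [|exact K]. unfold f'.
    apply epsilon_spec. exists l; auto. }
  exists f'. intros z Hz. destruct (H z Hz) as [d [Hd [g K]]].
  assert (Z : disc z d z) by (unfold disc; rewrite Cmod_self_0; lra).
  destruct (K z Z) as [K1 K2]. rewrite (S _ _ K1). split; auto.
  apply (Ccont_ext_loc g f' z d Hd); auto. intros w Hw. symmetry. apply S. apply K; auto.
Qed.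

Lemma holo_const D c : holo D (fun _ => c).
Proof. apply (holo_intro _ _ (fun _ => 0%C)); intros. apply Cderiv_const. apply Ccont_const. Qed.

Lemma holo_id D : holo D (fun z => z).
Proof. apply (holo_intro _ _ (fun _ => 1%C)); intros. apply Cderiv_id. apply Ccont_const. Qed.

Lemma holo_plus D f g : holo D f -> holo D g -> holo D (fun z => f z + g z)%C.
Proof.
  intros [f' F] [g' G]. apply (holo_intro _ _ (fun z => f' z + g' z)%C); intros z Hz;
  destruct (F z Hz), (G z Hz). apply Cderiv_plus; auto. apply Ccont_plus; auto.
Qed.

Lemma holo_mult D f g : holo D f -> holo D g -> holo D (fun z => f z * g z)%C.
Proof.
  intros [f' F] [g' G]. apply (holo_intro _ _ (fun z => f' z * g z + f z * g' z)%C); intros z Hz;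
  destruct (F z Hz), (G z Hz). apply Cderiv_mult; auto.
  apply Ccont_plus; apply Ccont_mult; auto; eapply Cderiv_cont; eauto.
Qed.

Lemma holo_opp D f : holo D f -> holo D (fun z => - f z)%C.
Proof.
  intros [f' F]. apply (holo_intro _ _ (fun z => 0 * f z + (-1) * f' z)%C); intros z Hz;
  destruct (F z Hz).
  apply (Cderiv_ext_loc (fun w => (-1) * f w)%C _ z _ 1). lra. intros; ring.
  apply (Cderiv_mult (fun _ => (-1)%C)); auto. apply Cderiv_const.
  apply Ccont_plus; apply Ccont_mult; auto; try apply Ccont_const. eapply Cderiv_cont; eauto.
Qed.

Lemma holo_minus D f g : holo D f -> holo D g -> holo D (fun z => f z - g z)%C.
Proof. intros. apply holo_plus; auto. apply holo_opp; auto. Qed.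

Lemma holo_inv D f : holo D f -> (forall z, D z -> f z <> 0%C) -> holo D (fun z => / f z)%C.
Proof.
  intros [f' F] N. apply (holo_intro _ _ (fun z => - / (f z * f z) * f' z)%C); intros z Hz;
  destruct (F z Hz) as [F1 F2]; assert (Nz := N z Hz).
  apply (Cderiv_comp Cinv f); auto. apply Cderiv_inv; auto.
  assert (Ccont f z) by (eapply Cderiv_cont; eauto).
  apply Ccont_mult; auto.
  apply (Ccont_ext_loc (fun w => (-1) * / (f w * f w))%C _ z 1). lra. intros; ring.
  apply Ccont_mult. apply Ccont_const. apply (Ccont_inv (fun w => f w * f w)%C).
  apply Ccont_mult; auto. apply Cmult_neq_0; auto.
Qed.

Lemma holo_div D f g : holo D f -> holo D g -> (forall z, D z -> g z <> 0%C) ->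
  holo D (fun z => f z / g z)%C.
Proof. intros. apply holo_mult; auto. apply holo_inv; auto. Qed.

Lemma holo_comp D E f g : holo D g -> (forall z, D z -> E (g z)) -> holo E f ->
  holo D (fun z => f (g z)).
Proof.
  intros [g' G] S [f' F]. apply (holo_intro _ _ (fun z => f' (g z) * g' z)%C); intros z Hz;
  destruct (G z Hz) as [G1 G2], (F (g z) (S z Hz)) as [F1 F2].
  apply Cderiv_comp; auto.
  apply Ccont_mult; auto. apply Ccont_comp; auto. eapply Cderiv_cont; eauto.
Qed.

Lemma holo_pow D f n : holo D f -> holo D (fun z => f z ^ n)%C.
Proof. intros H. induction n; simpl. apply holo_const. apply holo_mult; auto. Qed.

(** * The complex exponential *)

Definition Cexp (z : C) : C := (exp (fst z) * cos (snd z), exp (fst z) * sin (snd z)).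

Lemma Cexp_plus z w : Cexp (z + w) = (Cexp z * Cexp w)%C.
Proof.
  unfold Cexp. apply injective_projections; simpl; rewrite exp_plus, ?cos_plus, ?sin_plus; ring.
Qed.

Lemma Cexp_0 : Cexp 0 = 1%C.
Proof. unfold Cexp; apply injective_projections; simpl; rewrite ?exp_0, ?cos_0, ?sin_0; ring. Qed.

Lemma Cmod_Cexp z : Cmod (Cexp z) = exp (fst z).
Proof.
  unfold Cmod, Cexp; simpl.
  replace (_ + _) with (exp (fst z) * exp (fst z) * ((sin (snd z))² + (cos (snd z))²))
    by (unfold Rsqr; ring).
  rewrite sin2_cos2, Rmult_1_r. apply sqrt_square. left; apply exp_pos.
Qed.

Lemma Cexp_neq_0 z : Cexp z <> 0%C.
Proof. apply Cmod_gt_0. rewrite Cmod_Cexp. apply exp_pos. Qed.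

Lemma Cexp_opp z : Cexp (- z) = (/ Cexp z)%C.
Proof.
  assert (E : (Cexp z * Cexp (- z) = 1)%C).
  { rewrite <- Cexp_plus. replace (z + - z)%C with (RtoC 0) by ring. apply Cexp_0. }
  assert (N := Cexp_neq_0 z).
  replace (Cexp (- z)) with (/ Cexp z * (Cexp z * Cexp (-z)))%C by (field; auto).
  rewrite E. ring.
Qed.

Lemma Cexp_RtoC x : Cexp (RtoC x) = RtoC (exp x).
Proof. unfold Cexp, RtoC; apply injective_projections; simpl; rewrite ?cos_0, ?sin_0; ring. Qed.

Lemma Cconj_Cexp z : Cconj (Cexp z) = Cexp (Cconj z).
Proof.
  unfold Cexp, Cconj; apply injective_projections; simpl; rewrite ?cos_neg, ?sin_neg; ring.
Qed.

Lemma derivable_pt_lim_bound f l : derivable_pt_lim f 0 l -> forall eps, 0 < eps ->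
  exists d, 0 < d /\ forall h, Rabs h < d -> Rabs (f h - f 0 - l * h) <= eps * Rabs h.
Proof.
  intros H eps He. destruct (H eps He) as [d K]. exists d. split. apply d.
  intros h Hh. destruct (Req_dec h 0) as [->|N].
  replace (f 0 - f 0 - l * 0) with 0 by ring. rewrite Rabs_R0. lra.
  specialize (K h N Hh). rewrite Rplus_0_l in K.
  replace (f h - f 0 - l * h) with (((f h - f 0) / h - l) * h) by (field; auto).
  rewrite Rabs_mult. apply Rmult_le_compat_r. apply Rabs_pos. lra.
Qed.

(** The functional equation moves the point to 0, where the first-order expansions of exp, sin and
    cos settle the real and the imaginary part. *)
Lemma Cderiv_Cexp z : Cderiv Cexp z (Cexp z).
Proof.
  assert (H0 : forall eps, 0 < eps -> exists d, 0 < d /\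
    forall h, Cmod h < d -> Cmod (Cexp h - 1 - h) <= eps * Cmod h).
  { intros eps He. set (e := Rmin 1 (eps / 6)).
    assert (Ee : 0 < e) by (apply Rmin_glb_lt; lra).
    assert (E1 : e <= 1) by apply Rmin_l. assert (E2 : e <= eps / 6) by apply Rmin_r.
    destruct (derivable_pt_lim_bound exp 1) with (eps := e) as [d1 [Hd1 K1]]; auto.
    { rewrite <- exp_0. apply derivable_pt_lim_exp. }
    destruct (derivable_pt_lim_bound sin 1) with (eps := e/3) as [d2 [Hd2 K2]]; [|lra|].
    { rewrite <- cos_0. apply derivable_pt_lim_sin. }
    destruct (derivable_pt_lim_bound cos 0) with (eps := e/3) as [d3 [Hd3 K3]]; [|lra|].
    { assert (X := derivable_pt_lim_cos 0). rewrite sin_0, Ropp_0 in X. exact X. }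
    exists (Rmin (Rmin d1 (e/2)) (Rmin d2 d3)). split. repeat apply Rmin_glb_lt; lra.
    intros [a b] Hh. apply Rmin_Rgt in Hh. destruct Hh as [A B].
    apply Rmin_Rgt in A, B. destruct A as [A1 A2], B as [B2 B3].
    assert (Ha := Cmod_fst (a, b)). assert (Hb := Cmod_snd (a, b)). simpl in Ha, Hb.
    set (h := Cmod (a, b)) in *.
    specialize (K1 a ltac:(lra)). specialize (K2 b ltac:(lra)). specialize (K3 b ltac:(lra)).
    rewrite exp_0 in K1. rewrite sin_0 in K2. rewrite cos_0 in K3.
    assert (Pa := Rabs_pos a). assert (Pb := Rabs_pos b).
    assert (X : Rabs (exp a - 1) <= 2 * Rabs a).
    { replace (exp a - 1) with ((exp a - 1 - 1 * a) + a) by ring.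
      eapply Rle_trans. apply Rabs_triang. nra. }
    assert (Xe : Rabs (exp a) <= 3).
    { replace (exp a) with ((exp a - 1) + 1) by ring.
      eapply Rle_trans. apply Rabs_triang. rewrite Rabs_R1. lra. }
    eapply Rle_trans. apply Cmod_le_sum. unfold Cexp; simpl.
    replace (exp a * cos b + - (1) + - a) with ((exp a - 1 - 1 * a) + exp a * (cos b - 1 - 0 * b)) by ring.
    replace (exp a * sin b + - 0 + - b) with (exp a * (sin b - 0 - 1 * b) + (exp a - 1) * b) by ring.
    assert (T1 := Rabs_triang (exp a - 1 - 1 * a) (exp a * (cos b - 1 - 0 * b))).
    assert (T2 := Rabs_triang (exp a * (sin b - 0 - 1 * b)) ((exp a - 1) * b)).
    rewrite Rabs_mult in T1. rewrite !Rabs_mult in T2.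
    assert (Y1 : Rabs (exp a) * Rabs (cos b - 1 - 0 * b) <= 3 * (e / 3 * Rabs b)).
    { apply Rmult_le_compat; try apply Rabs_pos; lra. }
    assert (Y2 : Rabs (exp a) * Rabs (sin b - 0 - 1 * b) <= 3 * (e / 3 * Rabs b)).
    { apply Rmult_le_compat; try apply Rabs_pos; lra. }
    assert (Y3 : Rabs (exp a - 1) * Rabs b <= e * Rabs b).
    { apply Rmult_le_compat_r; lra. }
    assert (e * h <= eps / 6 * h) by (apply Rmult_le_compat_r; lra).
    assert (e * Rabs a <= e * h) by (apply Rmult_le_compat_l; lra).
    assert (e * Rabs b <= e * h) by (apply Rmult_le_compat_l; lra).
    assert (0 <= eps * h) by (apply Rmult_le_pos; [lra|apply Cmod_ge_0]). lra. }
  intros eps He. assert (P := exp_pos (fst z)).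
  destruct (H0 (eps / exp (fst z))) as [d [Hd K]]. apply Rdiv_lt_0_compat; lra.
  exists d. split; auto. intros w Hw. specialize (K _ Hw).
  replace w with (z + (w - z))%C at 1 by ring. rewrite Cexp_plus.
  replace (Cexp z * Cexp (w - z) - Cexp z - Cexp z * (w - z))%C with
    (Cexp z * (Cexp (w - z) - 1 - (w - z)))%C by ring.
  rewrite Cmod_mult, Cmod_Cexp.
  apply Rmult_le_compat_l with (r := exp (fst z)) in K; [|lra].
  eapply Rle_trans. apply K. right. field. lra.
Qed.

Lemma holo_Cexp D f : holo D f -> holo D (fun z => Cexp (f z)).
Proof.
  intros H. apply (holo_comp D (fun _ => True) Cexp f); auto.
  apply (holo_intro _ _ Cexp); intros. apply Cderiv_Cexp. eapply Cderiv_cont, Cderiv_Cexp.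
Qed.

(** * Contour integrals and Cauchy's theorem *)

Lemma continuous_eps (f : R -> R) x :
  (forall eps, 0 < eps -> exists d, 0 < d /\ forall y, Rabs (y - x) < d -> Rabs (f y - f x) < eps) ->
  continuous f x.
Proof.
  intros H. apply continuity_pt_filterlim. apply continuity_pt_locally.
  intros eps. destruct (H eps (cond_pos eps)) as [d [Hd K]]. exists (mkposreal d Hd).
  intros y Hy. apply K. exact Hy.
Qed.

Lemma Ccont_2d (m : C -> C) x y : Ccont m (x, y) ->
  continuity_2d_pt (fun u v => fst (m (u, v))) x y /\ continuity_2d_pt (fun u v => snd (m (u, v))) x y.
Proof.
  intros H. split; intros eps; destruct (H eps (cond_pos eps)) as [d [Hd K]];
  assert (H2 : 0 < d / 2) by lra; exists (mkposreal _ H2); simpl; intros u v Hu Hv;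
  assert (X : Cmod ((u, v) - (x, y)) < d)
   by (eapply Rle_lt_trans; [apply Cmod_le_sum|simpl; unfold Rminus in *; lra]);
  specialize (K _ X); eapply Rle_lt_trans; [|exact K| |exact K].
  exact (Cmod_fst (m (u, v) - m (x, y))).
  exact (Cmod_snd (m (u, v) - m (x, y))).
Qed.

Lemma Ccont_path (m : C -> C) (g : R -> C) t : Ccont m (g t) ->
  (forall eps, 0 < eps -> exists d, 0 < d /\ forall u, Rabs (u - t) < d -> Cmod (g u - g t) < eps) ->
  continuous (fun u => fst (m (g u))) t /\ continuous (fun u => snd (m (g u))) t.
Proof.
  intros H Hg. split; apply continuous_eps; intros eps He;
  destruct (H eps He) as [d [Hd K]]; destruct (Hg d Hd) as [d' [Hd' K']];
  exists d'; (split; [auto|]); intros u Hu; specialize (K _ (K' u Hu));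
  eapply Rle_lt_trans; [|exact K| |exact K].
  exact (Cmod_fst (m (g u) - m (g t))).
  exact (Cmod_snd (m (g u) - m (g t))).
Qed.

Lemma Ccont_h (m : C -> C) x y : Ccont m (x, y) ->
  continuous (fun u => fst (m (u, y))) x /\ continuous (fun u => snd (m (u, y))) x.
Proof.
  intros H. apply (Ccont_path m (fun u => (u, y)) x H).
  intros eps He. exists eps. split; auto. intros u Hu.
  eapply Rle_lt_trans. apply Cmod_le_sum. simpl.
  replace (y + - y) with 0 by ring. rewrite Rabs_R0. unfold Rminus in Hu. lra.
Qed.

Lemma Ccont_v (m : C -> C) x y : Ccont m (x, y) ->
  continuous (fun v => fst (m (x, v))) y /\ continuous (fun v => snd (m (x, v))) y.
Proof.
  intros H. apply (Ccont_path m (fun v => (x, v)) y H).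
  intros eps He. exists eps. split; auto. intros u Hu.
  eapply Rle_lt_trans. apply Cmod_le_sum. simpl.
  replace (x + - x) with 0 by ring. rewrite Rabs_R0. unfold Rminus in Hu. lra.
Qed.

Lemma Cderiv_restrict F t l : Cderiv F (RtoC t) l ->
  is_derive (fun u => fst (F (RtoC u))) t (fst l) /\
  is_derive (fun u => snd (F (RtoC u))) t (snd l).
Proof.
  intros H.
  assert (G : forall eps, 0 < eps -> exists d, 0 < d /\ forall h, Rabs h < d ->
     Cmod (F (RtoC (t + h)) - F (RtoC t) - l * RtoC h) <= eps * Rabs h).
  { intros eps He. destruct (H eps He) as [d [Hd K]]. exists d; split; auto.
    intros h Hh. specialize (K (RtoC (t + h))).
    replace (RtoC (t + h) - RtoC t)%C with (RtoC h) in K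
      by (apply injective_projections; simpl; ring).
    rewrite Cmod_R in K. auto. }
  assert (Z : forall (p : C -> R), (forall z, Rabs (p z) <= Cmod z) ->
     (forall z w, p (z - w)%C = p z - p w) -> (forall h, p (l * RtoC h)%C = p l * h) ->
     is_derive (fun u => p (F (RtoC u))) t (p l)).
  { intros p P1 P2 P3. apply is_derive_Reals. intros eps He.
    destruct (G (eps / 2)) as [d [Hd K]]. lra. exists (mkposreal d Hd). intros h Hn Hh.
    specialize (K h Hh). assert (K' := Rle_trans _ _ _ (P1 _) K).
    rewrite !P2, P3 in K'.
    replace ((p (F (RtoC (t + h))) - p (F (RtoC t))) / h - p l) with
      ((p (F (RtoC (t + h))) - p (F (RtoC t)) - p l * h) / h) by (field; auto).
    unfold Rdiv. rewrite Rabs_mult, Rabs_inv.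
    assert (Ph : 0 < Rabs h) by (apply Rabs_pos_lt; auto).
    apply Rmult_lt_reg_r with (Rabs h); auto. rewrite Rmult_assoc, Rinv_l by lra. nra. }
  split; [apply (Z fst)|apply (Z snd)]; intros; simpl; try ring.
  apply Cmod_fst. apply Cmod_snd.
Qed.

Lemma Cderiv_h f x y l : Cderiv f (x, y) l ->
  is_derive (fun u => fst (f (u, y))) x (fst l) /\ is_derive (fun u => snd (f (u, y))) x (snd l).
Proof.
  intros H.
  assert (E : forall u, (RtoC u + (0, y) = (u, y))%C)
    by (intros; apply injective_projections; simpl; ring).
  assert (K : Cderiv (fun z => f (z + (0, y))%C) (RtoC x) l).
  { apply (Cderiv_eq _ _ (l * 1)%C); [|ring].
    apply (Cderiv_comp f (fun z => z + (0, y))%C). 2: rewrite E; auto.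
    apply (Cderiv_eq _ _ (1 + 0)%C); [|ring].
    apply Cderiv_plus. apply Cderiv_id. apply Cderiv_const. }
  destruct (Cderiv_restrict _ _ _ K) as [K1 K2].
  split; [eapply is_derive_ext; [|exact K1]|eapply is_derive_ext; [|exact K2]];
  intros u; simpl; now rewrite E.
Qed.

Lemma Cderiv_v f x y l : Cderiv f (x, y) l ->
  is_derive (fun v => fst (f (x, v))) y (- snd l) /\ is_derive (fun v => snd (f (x, v))) y (fst l).
Proof.
  intros H.
  assert (E : forall u, (Ci * RtoC u + (x, 0) = (x, u))%C)
    by (intros; apply injective_projections; simpl; ring).
  assert (K : Cderiv (fun z => f (Ci * z + (x, 0))%C) (RtoC y) (l * Ci)).
  { apply (Cderiv_comp f (fun z => Ci * z + (x, 0))%C). 2: rewrite E; auto.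
    apply (Cderiv_eq _ _ ((0 * RtoC y + Ci * 1) + 0)%C); [|ring].
    apply (Cderiv_plus (fun z => Ci * z)%C). apply (Cderiv_mult (fun _ => Ci) (fun z => z)).
    apply Cderiv_const. apply Cderiv_id. apply Cderiv_const. }
  destruct (Cderiv_restrict _ _ _ K) as [K1 K2].
  replace (fst (l * Ci)%C) with (- snd l) in K1 by (simpl; ring).
  replace (snd (l * Ci)%C) with (fst l) in K2 by (simpl; ring).
  split; [eapply is_derive_ext; [|exact K1]|eapply is_derive_ext; [|exact K2]];
  intros u; simpl; now rewrite E.
Qed.

(** Differentiate the integral of g(u, .) under the integral sign in u; the fundamental theorem in v
    turns the result into k(u, b) - k(u, a), and integration in u finishes. The margin d supplies
    the open neighbourhoods that differentiation under the integral asks for. *)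
Lemma green_R (g k m : R -> R -> R) (l1 l2 a b d : R) : 0 < d -> l1 <= l2 -> a <= b ->
  (forall u v, l1 - d < u < l2 + d -> a - d < v < b + d ->
     is_derive (fun x => g x v) u (m u v) /\ is_derive (fun y => k u y) v (m u v) /\
     continuity_2d_pt m u v /\ continuous (fun y => g u y) v /\ continuous (fun x => k x v) u) ->
  RInt (g l2) a b - RInt (g l1) a b = RInt (fun u => k u b) l1 l2 - RInt (fun u => k u a) l1 l2.
Proof.
  intros Hd L AB H.
  assert (cm : forall u v, l1 - d < u < l2 + d -> a - d < v < b + d -> continuous (m u) v).
  { intros u v Hu Hv. destruct (H u v Hu Hv) as (_ & _ & Q & _).
    apply continuous_eps. intros eps He. destruct (Q (mkposreal eps He)) as [e K].
    exists e. split. apply e. intros y Hy. apply (K u y). rewrite Rminus_diag, Rabs_R0. apply e. auto. }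
  assert (eg : forall u, l1 - d < u < l2 + d -> ex_RInt (g u) a b).
  { intros u Hu. apply (ex_RInt_continuous (V := R_CompleteNormedModule)). intros v.
    rewrite Rmin_left, Rmax_right by lra. intros Hv. apply (H u v); lra. }
  assert (ek : forall v, a - d < v < b + d -> ex_RInt (fun u => k u v) l1 l2).
  { intros v Hv. apply (ex_RInt_continuous (V := R_CompleteNormedModule)). intros u.
    rewrite Rmin_left, Rmax_right by lra. intros Hu. apply (H u v); lra. }
  assert (D : forall u, l1 <= u <= l2 -> is_derive (fun u => RInt (g u) a b) u (k u b - k u a)).
  { intros u Hu.
    replace (k u b - k u a) with (RInt (fun v => Derive (fun x => g x v) u) a b).
    - apply is_derive_RInt_param.
      + exists (mkposreal d Hd). intros y Hy. simpl in Hy. apply Rabs_def2 in Hy. simpl in Hy.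
        unfold minus, plus, opp in Hy; simpl in Hy.
        rewrite Rmin_left, Rmax_right by lra. intros t Ht.
        exists (m y t). apply (H y t); lra.
      + rewrite Rmin_left, Rmax_right by lra. intros t Ht.
        apply continuity_2d_pt_ext_loc with m. 2: apply (H u t); lra.
        exists (mkposreal d Hd). simpl. intros x y Hx Hy. apply Rabs_def2 in Hx, Hy.
        symmetry. apply is_derive_unique. apply (H x y); lra.
      + exists (mkposreal d Hd). intros y Hy. apply Rabs_def2 in Hy.
        unfold minus, plus, opp in Hy; simpl in Hy. apply eg; lra.
    - rewrite (RInt_ext _ (m u)).
      2:{ intros v. rewrite Rmin_left, Rmax_right by lra. intros Hv.
          apply is_derive_unique. apply (H u v); lra. }
      apply is_RInt_unique. apply (is_RInt_derive (k u) (m u)); intros v;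
      rewrite Rmin_left, Rmax_right by lra; intros Hv.
      apply (H u v); lra. apply cm; lra. }
  assert (R1 : RInt (fun u => k u b - k u a) l1 l2 = RInt (g l2) a b - RInt (g l1) a b).
  { apply is_RInt_unique. apply (is_RInt_derive (fun u => RInt (g u) a b)); intros u;
      rewrite Rmin_left, Rmax_right by lra; intros Hu. apply D; lra.
    apply (continuous_minus (fun u => k u b) (fun u => k u a)); apply (H u); lra. }
  rewrite <- R1. apply (RInt_minus (V := R_CompleteNormedModule)); apply ek; lra.
Qed.

Definition CInt (f : R -> C) (a b : R) : C :=
  (RInt (fun t => fst (f t)) a b, RInt (fun t => snd (f t)) a b).

Definition pcont (f : R -> C) (t : R) :=
  continuous (fun u => fst (f u)) t /\ continuous (fun u => snd (f u)) t.

(** Serves twice: with k = - i g it is Cauchy's theorem on a rectangle, and with the homotopy that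
    shrinks a circle it is the core of Cauchy's formula. *)
Lemma CInt_green (g k m : C -> C) (l1 l2 a b d : R) : 0 < d -> l1 <= l2 -> a <= b ->
  (forall u v, l1 - d < u < l2 + d -> a - d < v < b + d ->
     (is_derive (fun x => fst (g (x, v))) u (fst (m (u, v))) /\
      is_derive (fun x => snd (g (x, v))) u (snd (m (u, v)))) /\
     (is_derive (fun y => fst (k (u, y))) v (fst (m (u, v))) /\
      is_derive (fun y => snd (k (u, y))) v (snd (m (u, v)))) /\
     Ccont m (u, v) /\ Ccont g (u, v) /\ Ccont k (u, v)) ->
  (CInt (fun v => g (l2, v)) a b - CInt (fun v => g (l1, v)) a b =
   CInt (fun u => k (u, b)) l1 l2 - CInt (fun u => k (u, a)) l1 l2)%C.
Proof.
  intros Hd L AB H.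
  apply injective_projections; unfold CInt; simpl.
  - apply (green_R (fun u v => fst (g (u, v))) (fun u v => fst (k (u, v))) (fun u v => fst (m (u, v)))
       l1 l2 a b d); auto.
    intros u v Hu Hv. destruct (H u v Hu Hv) as ([A1 A2] & [B1 B2] & C1 & C2 & C3).
    refine (conj A1 (conj B1 (conj _ (conj _ _)))). apply Ccont_2d; auto. apply Ccont_v; auto. apply Ccont_h; auto.
  - apply (green_R (fun u v => snd (g (u, v))) (fun u v => snd (k (u, v))) (fun u v => snd (m (u, v)))
       l1 l2 a b d); auto.
    intros u v Hu Hv. destruct (H u v Hu Hv) as ([A1 A2] & [B1 B2] & C1 & C2 & C3).
    refine (conj A2 (conj B2 (conj _ (conj _ _)))). apply Ccont_2d; auto. apply Ccont_v; auto. apply Ccont_h; auto.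
Qed.

Lemma pcont_ex (f : R -> C) a b : (forall t, Rmin a b <= t <= Rmax a b -> pcont f t) ->
  ex_RInt (fun t => fst (f t)) a b /\ ex_RInt (fun t => snd (f t)) a b.
Proof.
  intros H. split; apply (ex_RInt_continuous (V := R_CompleteNormedModule)); intros t Ht; apply H; auto.
Qed.

(** The factor 2 comes from bounding the real and the imaginary part separately; it reappears in all
    later constants. *)
Lemma CInt_bound (f : R -> C) a b M : a <= b -> (forall t, a <= t <= b -> pcont f t) ->
  (forall t, a <= t <= b -> Cmod (f t) <= M) -> Cmod (CInt f a b) <= 2 * M * (b - a).
Proof.
  intros AB Hc HM. destruct (pcont_ex f a b) as [E1 E2].
  { rewrite Rmin_left, Rmax_right by lra. auto. }
  eapply Rle_trans. apply Cmod_le_sum. unfold CInt; simpl.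
  assert (X1 : Rabs (RInt (fun t => fst (f t)) a b) <= (b - a) * M).
  { apply abs_RInt_le_const; auto. intros t Ht. eapply Rle_trans. apply Cmod_fst. auto. }
  assert (X2 : Rabs (RInt (fun t => snd (f t)) a b) <= (b - a) * M).
  { apply abs_RInt_le_const; auto. intros t Ht. eapply Rle_trans. apply Cmod_snd. auto. }
  lra.
Qed.

Lemma CInt_bound_fun (f : R -> C) (g : R -> R) a b : a <= b -> (forall t, a <= t <= b -> pcont f t) ->
  ex_RInt g a b -> (forall t, a <= t <= b -> Cmod (f t) <= g t) ->
  Cmod (CInt f a b) <= 2 * RInt g a b.
Proof.
  intros AB Hc Hg HM. destruct (pcont_ex f a b) as [E1 E2].
  { rewrite Rmin_left, Rmax_right by lra. auto. }
  eapply Rle_trans. apply Cmod_le_sum. unfold CInt; simpl.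
  assert (X : forall p : R -> R, (forall t, a <= t <= b -> Rabs (p t) <= Cmod (f t)) -> ex_RInt p a b ->
    Rabs (RInt p a b) <= RInt g a b).
  { intros p Hp Ep.
    eapply Rle_trans. apply (abs_RInt_le p a b); auto.
    apply RInt_le; auto. apply (ex_RInt_norm p); auto.
    intros t Ht. eapply Rle_trans. apply Hp; lra. apply HM; lra. }
  assert (X1 := X (fun t => fst (f t)) (fun t _ => Cmod_fst _) E1).
  assert (X2 := X (fun t => snd (f t)) (fun t _ => Cmod_snd _) E2). lra.
Qed.

Lemma CInt_ext f g a b : (forall t, Rmin a b <= t <= Rmax a b -> f t = g t) -> CInt f a b = CInt g a b.
Proof.
  intros H. unfold CInt. f_equal; apply RInt_ext; intros t Ht; rewrite H; auto; lra.
Qed.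

Lemma CInt_plus f g a b : (forall t, Rmin a b <= t <= Rmax a b -> pcont f t) ->
  (forall t, Rmin a b <= t <= Rmax a b -> pcont g t) ->
  CInt (fun t => f t + g t)%C a b = (CInt f a b + CInt g a b)%C.
Proof.
  intros Hf Hg. destruct (pcont_ex f a b Hf), (pcont_ex g a b Hg).
  unfold CInt. apply injective_projections; simpl;
  apply (RInt_plus (V := R_CompleteNormedModule)); auto.
Qed.

Lemma CInt_scal f c a b : (forall t, Rmin a b <= t <= Rmax a b -> pcont f t) ->
  CInt (fun t => c * f t)%C a b = (c * CInt f a b)%C.
Proof.
  intros Hf. destruct (pcont_ex f a b Hf) as [E1 E2].
  assert (S1 : forall k (p : R -> R), ex_RInt p a b -> ex_RInt (fun t => k * p t) a b).
  { intros k p E. apply (ex_RInt_scal (V := R_NormedModule)); auto. }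
  assert (S2 : forall k (p : R -> R), ex_RInt p a b -> RInt (fun t => k * p t) a b = k * RInt p a b).
  { intros k p E. apply (RInt_scal (V := R_CompleteNormedModule)); auto. }
  unfold CInt. apply injective_projections; simpl.
  - etransitivity. apply (RInt_minus (V := R_CompleteNormedModule)); apply S1; auto.
    unfold minus, plus, opp; simpl. rewrite !S2; auto.
  - etransitivity. apply (RInt_plus (V := R_CompleteNormedModule)); apply S1; auto.
    unfold plus; simpl. rewrite !S2; auto.
Qed.

Lemma pcont_const c t : pcont (fun _ => c) t.
Proof. split; apply continuous_const. Qed.

Lemma pcont_plus f g t : pcont f t -> pcont g t -> pcont (fun u => f u + g u)%C t.
Proof. intros [] []; split; simpl; apply (continuous_plus (V := R_NormedModule)); auto. Qed.

Lemma pcont_mult f g t : pcont f t -> pcont g t -> pcont (fun u => f u * g u)%C t.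
Proof.
  intros [] []; split; simpl.
  apply (continuous_minus (V := R_NormedModule)); apply (continuous_mult (K := R_AbsRing)); auto.
  apply (continuous_plus (V := R_NormedModule)); apply (continuous_mult (K := R_AbsRing)); auto.
Qed.

Lemma pcont_RtoC (f : R -> R) t : continuous f t -> pcont (fun u => RtoC (f u)) t.
Proof. intros H; split; simpl; auto. apply continuous_const. Qed.

Lemma pcont_eps f t : pcont f t ->
  forall eps, 0 < eps -> exists d, 0 < d /\ forall u, Rabs (u - t) < d -> Cmod (f u - f t) < eps.
Proof.
  intros [H1 H2] eps He.
  apply continuity_pt_filterlim in H1. apply continuity_pt_filterlim in H2.
  assert (L1 := proj1 (continuity_pt_locally _ _) H1). assert (L2 := proj1 (continuity_pt_locally _ _) H2).
  assert (E2 : 0 < eps / 2) by lra.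
  destruct (L1 (mkposreal _ E2)) as [d1 K1]. destruct (L2 (mkposreal _ E2)) as [d2 K2].
  exists (Rmin d1 d2). split. apply Rmin_glb_lt; [apply d1|apply d2].
  intros u Hu. apply Rmin_Rgt in Hu. destruct Hu as [A B].
  specialize (K1 u A). specialize (K2 u B). simpl in K1, K2.
  eapply Rle_lt_trans. apply Cmod_le_sum. simpl. unfold Rminus in *. lra.
Qed.

Lemma pcont_comp (m : C -> C) g t : Ccont m (g t) -> pcont g t -> pcont (fun u => m (g u)) t.
Proof. intros H Hg. apply Ccont_path; auto. apply pcont_eps; auto. Qed.

Lemma pcont_h x y : pcont (fun u => (u, y)) x.
Proof. split; simpl. apply continuous_id. apply continuous_const. Qed.

Lemma pcont_v x y : pcont (fun v => (x, v)) y.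
Proof. split; simpl. apply continuous_const. apply continuous_id. Qed.

Lemma rect_cauchy f (l1 l2 a b d : R) : 0 < d -> l1 <= l2 -> a <= b ->
  holo (rect (l1 - d) (l2 + d) (a - d) (b + d)) f ->
  (CInt (fun v => f (l2, v)) a b - CInt (fun v => f (l1, v)) a b =
   - Ci * (CInt (fun u => f (u, b)) l1 l2 - CInt (fun u => f (u, a)) l1 l2))%C.
Proof.
  intros Hd L AB [f' H].
  assert (Hc : forall u v, l1 - d < u < l2 + d -> a - d < v < b + d -> Ccont f (u, v)).
  { intros u v Hu Hv. eapply Cderiv_cont, H. split; simpl; lra. }
  rewrite (CInt_green f (fun z => - Ci * f z)%C f' l1 l2 a b d); auto.
  - rewrite !CInt_scal. ring.
    intros t. rewrite Rmin_left, Rmax_right by lra. intros Ht.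
    apply (pcont_comp f (fun u => (u, a))). apply Hc; lra. apply pcont_h.
    intros t. rewrite Rmin_left, Rmax_right by lra. intros Ht.
    apply (pcont_comp f (fun u => (u, b))). apply Hc; lra. apply pcont_h.
  - intros u v Hu Hv. destruct (H (u, v)) as [H1 H2]. split; simpl; lra.
    refine (conj _ (conj _ (conj H2 (conj (Hc u v Hu Hv) _)))).
    + apply Cderiv_h; auto.
    + assert (K : Cderiv (fun z => - Ci * f z)%C (u, v) (- Ci * f' (u, v))%C).
      { apply (Cderiv_eq _ _ (0 * f (u, v) + (- Ci) * f' (u, v))%C); [|ring].
        apply (Cderiv_mult (fun _ => - Ci)%C f); auto. apply Cderiv_const. }
      apply Cderiv_v in K. destruct K as [K1 K2].
      replace (fst (f' (u, v))) with (- snd (- Ci * f' (u, v))%C) by (simpl; ring).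
      replace (snd (f' (u, v))) with (fst (- Ci * f' (u, v))%C) by (simpl; ring). split; auto.
    + apply Ccont_mult. apply Ccont_const. auto.
Qed.

Fixpoint csum (c : nat -> C) (n : nat) : C :=
  match n with O => 0%C | S k => (csum c k + c k)%C end.

Lemma csum_ext c c' n : (forall k, (k < n)%nat -> c k = c' k) -> csum c n = csum c' n.
Proof. induction n; simpl; intros H; auto. rewrite IHn, H; auto. Qed.

Lemma csum_mult (a : C) c n : csum (fun k => a * c k)%C n = (a * csum c n)%C.
Proof. induction n; simpl. ring. rewrite IHn. ring. Qed.

Lemma pcont_csum (c : nat -> R -> C) n t : (forall k, (k < n)%nat -> pcont (c k) t) ->
  pcont (fun u => csum (fun k => c k u) n) t.
Proof.
  induction n; simpl; intros H. apply pcont_const.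
  apply (pcont_plus (fun u => csum (fun k => c k u) n) (c n)); auto.
Qed.

Lemma CInt_csum (c : nat -> R -> C) n a b :
  (forall k, (k < n)%nat -> forall t, Rmin a b <= t <= Rmax a b -> pcont (c k) t) ->
  CInt (fun t => csum (fun k => c k t) n) a b = csum (fun k => CInt (c k) a b) n.
Proof.
  induction n; intros H; simpl.
  - unfold CInt; simpl. rewrite !RInt_const. unfold scal; simpl; unfold mult; simpl.
    apply injective_projections; simpl; ring.
  - rewrite (CInt_plus (fun t => csum (fun k => c k t) n) (c n)). rewrite IHn; auto.
    intros t Ht. apply pcont_csum. intros; apply H; auto; lia. intros; apply H; auto.
Qed.

Lemma CInt_ftc (F f : C -> C) a b : a <= b ->
  (forall t, a <= t <= b -> Cderiv F (RtoC t) (f (RtoC t))) ->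
  (forall t, a <= t <= b -> Ccont f (RtoC t)) ->
  CInt (fun t => f (RtoC t)) a b = (F (RtoC b) - F (RtoC a))%C.
Proof.
  intros AB H1 H2.
  assert (P : forall t, a <= t <= b -> pcont (fun t => f (RtoC t)) t).
  { intros t Ht. apply (pcont_comp f). auto. apply pcont_RtoC, continuous_id. }
  unfold CInt. apply injective_projections; simpl; apply is_RInt_unique.
  apply (is_RInt_derive (fun t => fst (F (RtoC t))) (fun t => fst (f (RtoC t))));
    intros t; rewrite Rmin_left, Rmax_right by lra; intros Ht. apply Cderiv_restrict; auto. apply P; auto.
  apply (is_RInt_derive (fun t => snd (F (RtoC t))) (fun t => snd (f (RtoC t))));
    intros t; rewrite Rmin_left, Rmax_right by lra; intros Ht. apply Cderiv_restrict; auto. apply P; auto.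
Qed.

(** * Circles, Cauchy's formula and Taylor coefficients *)

Definition circ (r t : R) : C := (RtoC r * Cexp (Ci * RtoC t))%C.

Lemma Cmod_cis t : Cmod (Cexp (Ci * RtoC t)) = 1.
Proof. rewrite Cmod_Cexp. simpl. replace (0 * t - 1 * 0) with 0 by ring. apply exp_0. Qed.

Lemma Cmod_circ r t : 0 <= r -> Cmod (circ r t) = r.
Proof. intros H. unfold circ. rewrite Cmod_mult, Cmod_R, Cmod_cis, Rabs_pos_eq; lra. Qed.

Lemma circ_neq_0 r t : 0 < r -> circ r t <> 0%C.
Proof. intros H. apply Cmod_gt_0. rewrite Cmod_circ; lra. Qed.

Lemma circ_neq r t z : Cmod z < r -> (circ r t - z)%C <> 0%C.
Proof.
  intros H. apply Cminus_neq_0. intros E. assert (K := Cmod_ge_0 z).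
  assert (0 <= r) by lra. rewrite <- E, Cmod_circ in H; lra.
Qed.

Lemma circ_period r : circ r (2 * PI) = circ r 0.
Proof.
  unfold circ, Cexp. apply injective_projections; simpl;
  rewrite ?Rmult_0_l, ?Rmult_1_l, ?Rmult_0_r, ?Rplus_0_l, ?cos_2PI, ?sin_2PI, ?cos_0, ?sin_0; ring.
Qed.

Lemma Cderiv_affine (a b z : C) : Cderiv (fun w => a + b * w)%C z b.
Proof.
  apply (Cderiv_eq _ _ (0 + (0 * z + b * 1))%C); [|ring].
  apply (Cderiv_plus (fun _ => a) (fun w => b * w)%C). apply Cderiv_const.
  apply (Cderiv_mult (fun _ => b) (fun w => w)). apply Cderiv_const. apply Cderiv_id.
Qed.

Lemma Ccont_fst z : Ccont (fun w => RtoC (fst w)) z.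
Proof.
  intros eps He. exists eps. split; auto. intros w Hw. eapply Rle_lt_trans; [|exact Hw].
  replace (RtoC (fst w) - RtoC (fst z))%C with (RtoC (fst (w - z)%C))
    by (apply injective_projections; simpl; ring).
  rewrite Cmod_R. apply Cmod_fst.
Qed.

Lemma Ccont_snd z : Ccont (fun w => RtoC (snd w)) z.
Proof.
  intros eps He. exists eps. split; auto. intros w Hw. eapply Rle_lt_trans; [|exact Hw].
  replace (RtoC (snd w) - RtoC (snd z))%C with (RtoC (snd (w - z)%C))
    by (apply injective_projections; simpl; ring).
  rewrite Cmod_R. apply Cmod_snd.
Qed.

Lemma Ccont_circ r z : Ccont (fun w => circ r (snd w)) z.
Proof.
  unfold circ. apply Ccont_mult. apply Ccont_const.
  apply (Ccont_comp Cexp (fun w => Ci * RtoC (snd w))%C).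
  apply Ccont_mult. apply Ccont_const. apply Ccont_snd. eapply Cderiv_cont, Cderiv_Cexp.
Qed.

Lemma pcont_circ r t : pcont (circ r) t.
Proof.
  apply (pcont_comp (fun w => circ r (snd w)) (fun t => (0, t))). apply Ccont_circ. apply pcont_v.
Qed.

Section Cauchy.
Variables (f : C -> C) (s0 : C) (R0 r : R).
Hypothesis Hr : 0 < r < R0.
Hypothesis Hf : holo (disc s0 R0) f.

Lemma circ_in t : disc s0 R0 (s0 + circ r t)%C.
Proof. unfold disc. replace (s0 + circ r t - s0)%C with (circ r t) by ring. rewrite Cmod_circ; lra. Qed.

Lemma pcont_f_circ t : pcont (fun u => f (s0 + circ r u)%C) t.
Proof.
  apply (pcont_comp f (fun u => s0 + circ r u)%C). eapply holo_cont; eauto. apply circ_in.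
  apply pcont_plus. apply pcont_const. apply pcont_circ.
Qed.

Lemma pcont_kernel z t : Cmod z < r -> pcont (fun u => circ r u / (circ r u - z))%C t.
Proof.
  intros Hz. apply pcont_mult. apply pcont_circ.
  apply (pcont_comp Cinv (fun u => circ r u - z)%C).
  eapply Cderiv_cont, Cderiv_inv, circ_neq; auto.
  apply pcont_plus. apply pcont_circ. apply pcont_const.
Qed.

Lemma kernel_bound z t : Cmod z < r -> Cmod (circ r t / (circ r t - z)) <= r / (r - Cmod z).
Proof.
  intros Hz. rewrite Cmod_div by (apply circ_neq; auto). rewrite Cmod_circ by lra.
  apply Rmult_le_compat_l. lra. apply Rinv_le_contravar. lra.
  assert (T := Cmod_ge_minus (circ r t) z). rewrite Cmod_circ in T; lra.
Qed.

(* Homotopy of the circle to the constant path at [s0 + z]: the derivative in [l] of the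
   integrand is a derivative in the angle, so that it integrates to 0. *)
Lemma cauchy_kernel z : Cmod z < r ->
  CInt (fun t => f (s0 + circ r t) * (circ r t / (circ r t - z)))%C 0 (2 * PI) =
  (f (s0 + z) * CInt (fun t => circ r t / (circ r t - z)) 0 (2 * PI))%C.
Proof.
  intros Hz. destruct Hf as [f' F].
  assert (P2 : 0 < 2 * PI) by (generalize PI_RGT_0; lra).
  set (w := fun p : C => (s0 + z + RtoC (fst p) * (circ r (snd p) - z))%C).
  set (g := fun p : C => (f (w p) * (circ r (snd p) / (circ r (snd p) - z)))%C).
  assert (Win : forall p, - (R0 - r) / (4 * r) < fst p < 1 + (R0 - r) / (4 * r) -> disc s0 R0 (w p)).
  { intros p Hp. unfold disc, w.
    replace (s0 + z + RtoC (fst p) * (circ r (snd p) - z) - s0)%C with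
      (RtoC (1 - fst p) * z + RtoC (fst p) * circ r (snd p))%C by
      (unfold RtoC; apply injective_projections; simpl; ring).
    eapply Rle_lt_trans. apply Cmod_triangle. rewrite !Cmod_mult, !Cmod_R, Cmod_circ by lra.
    set (e := (R0 - r) / (4 * r)) in *.
    replace (- (R0 - r) / (4 * r)) with (- e) in Hp by (unfold e; field; lra).
    assert (E : e * r = (R0 - r) / 4) by (unfold e; field; lra).
    assert (0 < e) by (unfold e; apply Rdiv_lt_0_compat; lra).
    assert (Rabs (1 - fst p) + Rabs (fst p) <= 1 + 2 * e).
    { unfold Rabs. destruct (Rcase_abs (1 - fst p)), (Rcase_abs (fst p)); lra. }
    assert (Rabs (1 - fst p) * Cmod z <= Rabs (1 - fst p) * r)
      by (apply Rmult_le_compat_l; [apply Rabs_pos|lra]).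
    assert ((Rabs (1 - fst p) + Rabs (fst p)) * r <= (1 + 2 * e) * r) by (apply Rmult_le_compat_r; lra).
    lra. }
  assert (Wc : forall p, Ccont w p).
  { intros p. unfold w. apply Ccont_plus. apply Ccont_const. apply Ccont_mult. apply Ccont_fst.
    apply Ccont_plus. apply Ccont_circ. apply Ccont_const. }
  (* The primitive in the angle is f(w) / (i l), singular at l = 0. Hence the homotopy runs only
     from 1 down to e > 0, and the limit e -> 0 is taken afterwards by continuity of f at s0 + z. *)
  assert (Step : forall e, 0 < e < 1 ->
    CInt (fun t => g (1, t)) 0 (2 * PI) = CInt (fun t => g (e, t)) 0 (2 * PI)).
  { intros e He.
    set (m := fun p : C => (f' (w p) * circ r (snd p))%C).
    set (k := fun p : C => (f (w p) * / (Ci * RtoC (fst p)))%C).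
    assert (d0 : 0 < (R0 - r) / (4 * r)) by (apply Rdiv_lt_0_compat; lra).
    assert (G := CInt_green g k m e 1 0 (2 * PI) (Rmin e ((R0 - r) / (4 * r)))).
    assert (L1 := Rmin_l e ((R0 - r) / (4 * r))). assert (L2 := Rmin_r e ((R0 - r) / (4 * r))).
    rewrite (CInt_ext (fun u => k (u, 2 * PI)) (fun u => k (u, 0))) in G.
    2:{ intros t _. unfold k, w. simpl. rewrite circ_period. auto. }
    replace (CInt (fun t => g (1, t)) 0 (2 * PI)) with
     ((CInt (fun t => g (1, t)) 0 (2 * PI) - CInt (fun t => g (e, t)) 0 (2 * PI)) + CInt (fun t => g (e, t)) 0 (2 * PI))%C by ring.
    rewrite G; try lra. ring. apply Rmin_glb_lt; lra.
    intros u v Hu Hv.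
    assert (Hw : disc s0 R0 (w (u, v))).
    { apply Win. simpl.
      replace (- (R0 - r) / (4 * r)) with (- ((R0 - r) / (4 * r))) by (field; lra). lra. }
    destruct (F _ Hw) as [F1 F2].
    assert (Nu : (Ci * RtoC u)%C <> 0%C).
    { apply Cmult_neq_0. intros X; inversion X; lra. intros X; inversion X; lra. }
    assert (Cf : Ccont (fun p => f (w p)) (u, v)).
    { apply Ccont_comp; auto. eapply Cderiv_cont; eauto. }
    refine (conj _ (conj _ (conj _ (conj _ _)))).
    - set (c := (circ r v - z)%C).
      assert (K : Cderiv (fun x => f (s0 + z + c * x)%C * (circ r v / c))%C (RtoC u) (f' (w (u, v)) * circ r v)).
      { apply (Cderiv_eq _ _ (f' (w (u, v)) * c * (circ r v / c) + f (s0 + z + c * RtoC u)%C * 0)%C).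
        2: field; apply circ_neq; auto.
        apply (Cderiv_mult (fun x => f (s0 + z + c * x)%C) (fun _ => circ r v / c)%C).
        2: apply Cderiv_const.
        apply (Cderiv_comp f (fun x => s0 + z + c * x)%C). apply Cderiv_affine.
        replace (s0 + z + c * RtoC u)%C with (w (u, v)) by (unfold w, c; simpl; ring). auto. }
      destruct (Cderiv_restrict _ _ _ K) as [K1 K2].
      split; [eapply is_derive_ext; [|exact K1]|eapply is_derive_ext; [|exact K2]];
      intros x; unfold g, w, c; simpl fst; simpl snd;
      replace (s0 + z + (circ r v - z) * RtoC x)%C with (s0 + z + RtoC x * (circ r v - z))%C by ring;
      reflexivity.
    - assert (K : Cderiv (fun x => f (s0 + z + - (RtoC u * z) + RtoC (u * r) * Cexp (Ci * x))%C * / (Ci * RtoC u))%C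
         (RtoC v) (f' (w (u, v)) * circ r v)).
      { set (c := (/ (Ci * RtoC u))%C).
        assert (Wv : (s0 + z + - (RtoC u * z) + RtoC (u * r) * Cexp (Ci * RtoC v) = w (u, v))%C).
        { unfold w, circ; simpl fst; simpl snd. rewrite RtoC_mult. ring. }
        apply (Cderiv_eq _ _ (f' (w (u, v)) * (RtoC (u * r) * (Cexp (Ci * RtoC v) * Ci)) * c + f (w (u, v)) * 0)%C).
        2:{ unfold circ, c. rewrite RtoC_mult. field. split; intros X; inversion X; lra. }
        rewrite <- Wv at 2.
        apply (Cderiv_mult (fun x => f (s0 + z + - (RtoC u * z) + RtoC (u * r) * Cexp (Ci * x))%C) (fun _ => c)).
        2: apply Cderiv_const.
        apply (Cderiv_comp f (fun x => s0 + z + - (RtoC u * z) + RtoC (u * r) * Cexp (Ci * x))%C).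
        2: rewrite Wv; auto.
        apply (Cderiv_comp (fun y => s0 + z + - (RtoC u * z) + RtoC (u * r) * y)%C (fun x => Cexp (Ci * x))).
        2: apply Cderiv_affine.
        apply (Cderiv_comp Cexp (fun x => Ci * x)%C). 2: apply Cderiv_Cexp.
        apply (Cderiv_ext_loc (fun x => 0 + Ci * x)%C _ _ _ 1). lra. intros; ring. apply Cderiv_affine. }
      destruct (Cderiv_restrict _ _ _ K) as [K1 K2].
      split; [eapply is_derive_ext; [|exact K1]|eapply is_derive_ext; [|exact K2]];
      intros x; unfold k, w, circ; simpl fst; simpl snd;
      replace (s0 + z + - (RtoC u * z) + RtoC (u * r) * Cexp (Ci * RtoC x))%C
        with (s0 + z + RtoC u * (RtoC r * Cexp (Ci * RtoC x) - z))%C by (rewrite RtoC_mult; ring);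
      reflexivity.
    - unfold m. apply Ccont_mult. apply (Ccont_comp f' w); auto. apply Ccont_circ.
    - unfold g. apply Ccont_mult; auto. apply Ccont_mult. apply Ccont_circ.
      apply (Ccont_inv (fun p => circ r (snd p) - z)%C). apply Ccont_plus. apply Ccont_circ. apply Ccont_const.
      apply circ_neq; auto.
    - unfold k. apply Ccont_mult; auto. apply (Ccont_inv (fun p => Ci * RtoC (fst p))%C); auto.
      apply Ccont_mult. apply Ccont_const. apply Ccont_fst. }
  set (K := r / (r - Cmod z)).
  assert (Kp : 0 < K) by (apply Rdiv_lt_0_compat; lra).
  set (I1 := CInt (fun t => g (1, t)) 0 (2 * PI)).
  assert (E1 : CInt (fun t => f (s0 + circ r t) * (circ r t / (circ r t - z)))%C 0 (2 * PI) = I1).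
  { apply CInt_ext. intros t _. unfold g, w; simpl fst; simpl snd. f_equal. f_equal. ring. }
  rewrite E1.
  rewrite <- CInt_scal by (intros; apply pcont_kernel; auto).
  set (I0 := CInt _ 0 (2 * PI)).
  destruct (Ceq_dec I1 I0) as [|N]; auto. exfalso.
  apply Cminus_neq_0, Cmod_gt_0 in N. set (eta := Cmod (I1 - I0)) in *.
  assert (Hsz : disc s0 R0 (s0 + z)%C) by (unfold disc; replace (s0 + z - s0)%C with z by ring; lra).
  (* This tolerance makes the integral bound 2 * (tolerance * K) * 2 PI equal to eta / 2, which
     contradicts the distance eta. *)
  destruct (Cderiv_cont _ _ _ (proj1 (F _ Hsz)) (eta / (8 * PI * K))) as [d [Hd Kd]].
  { apply Rdiv_lt_0_compat; auto. apply Rmult_lt_0_compat; auto. lra. }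
  set (e := Rmin (1/2) (d / (4 * r))).
  assert (He : 0 < e) by (apply Rmin_glb_lt; [lra|apply Rdiv_lt_0_compat; lra]).
  assert (He1 : e <= 1/2) by apply Rmin_l.
  assert (He2 : e * (2 * r) <= d / 2).
  { assert (X : e <= d / (4 * r)) by apply Rmin_r.
    apply Rmult_le_compat_r with (r := 2 * r) in X; [|lra].
    replace (d / (4 * r) * (2 * r)) with (d / 2) in X by (field; lra). auto. }
  assert (B : eta <= 2 * (eta / (8 * PI * K) * K) * (2 * PI - 0)).
  { assert (Ee : eta = Cmod (CInt (fun t => g (e, t)) 0 (2 * PI) - I0)) by (unfold eta, I1; rewrite (Step e) by lra; auto).
    clearbody eta. rewrite Ee at 1.
    assert (Q1 : forall t, pcont (fun t => g (e, t)) t).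
    { intros t. apply (pcont_comp g (fun t => (e, t))). 2: apply pcont_v.
      assert (Hw : disc s0 R0 (w (e, t))).
      { apply Win. simpl. assert (0 < (R0 - r) / (4 * r)) by (apply Rdiv_lt_0_compat; lra).
        replace (- (R0 - r) / (4 * r)) with (- ((R0 - r) / (4 * r))) by (field; lra). lra. }
      unfold g. apply Ccont_mult. apply (Ccont_comp f w); auto. eapply Cderiv_cont, F; auto.
      apply Ccont_mult. apply Ccont_circ.
      apply (Ccont_inv (fun p => circ r (snd p) - z)%C). apply Ccont_plus. apply Ccont_circ. apply Ccont_const.
      apply circ_neq; auto. }
    assert (Q0 : forall t, pcont (fun t => f (s0 + z) * (circ r t / (circ r t - z)))%C t).
    { intros t. apply pcont_mult. apply pcont_const. apply pcont_kernel; auto. }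
    assert (Q2 : forall t, pcont (fun t => (- (1)) * (f (s0 + z) * (circ r t / (circ r t - z))))%C t).
    { intros t. apply pcont_mult. apply pcont_const. apply Q0. }
    replace (CInt (fun t => g (e, t)) 0 (2 * PI) - I0)%C with
      (CInt (fun t => g (e, t)) 0 (2 * PI) + (- (1)) * I0)%C by ring.
    unfold I0. rewrite <- CInt_scal by (intros; apply Q0).
    rewrite <- CInt_plus by (intros; auto).
    apply CInt_bound. lra. intros; apply pcont_plus; auto.
    intros t _. unfold g. simpl snd.
    replace (f (w (e, t)) * (circ r t / (circ r t - z)) + - (1) * (f (s0 + z) * (circ r t / (circ r t - z))))%C
      with ((f (w (e, t)) - f (s0 + z)) * (circ r t / (circ r t - z)))%C by ring.
    rewrite Cmod_mult. apply Rmult_le_compat; try apply Cmod_ge_0.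
    2: apply kernel_bound; auto.
    left. apply Kd. unfold w; simpl fst; simpl snd.
    replace (s0 + z + e * (circ r t - z) - (s0 + z))%C with (RtoC e * (circ r t - z))%C by ring.
    rewrite Cmod_mult, Cmod_R, Rabs_pos_eq by lra.
    eapply Rle_lt_trans. apply Rmult_le_compat_l. lra. apply Cmod_minus_le. rewrite Cmod_circ by lra.
    assert (e * (r + Cmod z) <= e * (2 * r)) by (apply Rmult_le_compat_l; lra). lra. }
  clearbody K eta. assert (PIp := PI_RGT_0).
  replace (2 * (eta / (8 * PI * K) * K) * (2 * PI - 0)) with (eta / 2) in B by (field; split; lra).
  lra.
Qed.
End Cauchy.

(** A finite geometric sum with exact remainder, so that integrating the Cauchy kernel term by term
    involves no limit. *)
Lemma geom_kernel (E z : C) K : E <> 0%C -> (E - z)%C <> 0%C ->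
  (E / (E - z) = csum (fun k => z ^ k * / E ^ k) K + z ^ K * (/ E ^ K * (E / (E - z))))%C.
Proof.
  intros H1 H2. induction K; simpl. field; auto.
  rewrite IHK at 1. rewrite <- Cplus_assoc. f_equal.
  assert (E ^ K <> 0)%C by (apply Cpow_nz; auto). field; auto.
Qed.

(** Cauchy's coefficient integral in the angle variable: dz / (i z) becomes dt, which is why the
    exponent is k instead of k + 1. *)
Definition tcoef (f : C -> C) (s0 : C) (r : R) (k : nat) : C :=
  (/ RtoC (2 * PI) * CInt (fun t => f (s0 + circ r t) * / circ r t ^ k) 0 (2 * PI))%C.

Lemma two_PI_pos : 0 < 2 * PI.
Proof. generalize PI_RGT_0; lra. Qed.

Lemma two_PI_neq : RtoC (2 * PI) <> 0%C.
Proof. intros X. inversion X. generalize PI_RGT_0; lra. Qed.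

Lemma pcont_pow f k t : pcont f t -> pcont (fun u => f u ^ k)%C t.
Proof. intros H. induction k; simpl. apply pcont_const. apply pcont_mult; auto. Qed.

Lemma pcont_circ_inv r k t : 0 < r -> pcont (fun u => / circ r u ^ k)%C t.
Proof.
  intros H. apply (pcont_comp Cinv (fun u => circ r u ^ k)%C).
  eapply Cderiv_cont, Cderiv_inv, Cpow_nz, circ_neq_0; auto.
  apply pcont_pow, pcont_circ.
Qed.

Lemma Cmod_circ_inv r k t : 0 < r -> Cmod (/ circ r t ^ k) = / r ^ k.
Proof.
  intros H. rewrite Cmod_inv by (apply Cpow_nz, circ_neq_0; auto).
  rewrite Cmod_pow, Cmod_circ; lra.
Qed.

Lemma kernel_split f s0 R0 r z K : 0 < r < R0 -> holo (disc s0 R0) f -> Cmod z < r ->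
  CInt (fun t => f (s0 + circ r t) * (circ r t / (circ r t - z)))%C 0 (2 * PI) =
  (RtoC (2 * PI) * csum (fun k => tcoef f s0 r k * z ^ k) K +
   z ^ K * CInt (fun t => (f (s0 + circ r t) * / circ r t ^ K) * (circ r t / (circ r t - z))) 0 (2 * PI))%C.
Proof.
  intros Hr Hf Hz.
  assert (C1 := pcont_f_circ f s0 R0 r Hr Hf).
  assert (C2 : forall k t, pcont (fun t => z ^ k * (f (s0 + circ r t) * / circ r t ^ k))%C t).
  { intros. apply pcont_mult. apply pcont_const. apply pcont_mult; auto. apply pcont_circ_inv; lra. }
  assert (C3 : forall t, pcont (fun t => (f (s0 + circ r t) * / circ r t ^ K) * (circ r t / (circ r t - z)))%C t).
  { intros. apply pcont_mult. apply pcont_mult; auto. apply pcont_circ_inv; lra. apply pcont_kernel; auto. }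
  rewrite (CInt_ext _ (fun t => csum (fun k => z ^ k * (f (s0 + circ r t) * / circ r t ^ k)) K +
     z ^ K * ((f (s0 + circ r t) * / circ r t ^ K) * (circ r t / (circ r t - z))))%C).
  2:{ intros t _. rewrite (geom_kernel (circ r t) z K) at 1.
      2: apply circ_neq_0; lra. 2: apply circ_neq; auto.
      rewrite Cmult_plus_distr_l. rewrite <- csum_mult. f_equal. apply csum_ext. intros; ring. ring. }
  rewrite CInt_plus.
  2:{ intros; apply pcont_csum; auto. }
  2:{ intros. apply pcont_mult. apply pcont_const. auto. }
  rewrite CInt_csum by auto. rewrite CInt_scal by auto. f_equal.
  rewrite <- csum_mult. apply csum_ext. intros k _. rewrite CInt_scal.
  unfold tcoef. field. apply two_PI_neq.
  intros. apply pcont_mult; auto. apply pcont_circ_inv; lra.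
Qed.

Lemma CInt_circ_pow r k : 0 < r ->
  CInt (fun t => / circ r t ^ S k)%C 0 (2 * PI) = 0%C.
Proof.
  intros Hr.
  set (c := (- Ci * RtoC (INR (S k)))%C).
  assert (rn : (RtoC r ^ S k)%C <> 0%C) by (apply Cpow_nz; intros X; apply (f_equal fst) in X; simpl in X; lra).
  assert (cn : c <> 0%C).
  { unfold c. apply Cmult_neq_0. intros X. apply (f_equal snd) in X. simpl in X. lra.
    intros X. apply (f_equal fst) in X. change (INR (S k) = 0) in X.
    assert (0 < INR (S k)) by (apply lt_0_INR; lia). lra. }
  assert (P : forall n t, (Cexp (Ci * RtoC t) ^ n = Cexp (Ci * RtoC (INR n) * RtoC t))%C).
  { induction n; intros; simpl Cpow.
    - simpl. replace (Ci * 0 * RtoC t)%C with (RtoC 0) by ring. rewrite Cexp_0; auto.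
    - rewrite IHn, <- Cexp_plus. f_equal. rewrite S_INR, RtoC_plus. ring. }
  rewrite (CInt_ext _ (fun t => / RtoC r ^ S k * Cexp (c * RtoC t))%C).
  2:{ intros t _. unfold circ. rewrite Cpow_mult_l, P.
      replace (c * RtoC t)%C with (- (Ci * RtoC (INR (S k)) * RtoC t))%C by (unfold c; ring).
      rewrite Cexp_opp. field. split. apply Cexp_neq_0. exact rn. }
  rewrite (CInt_ftc (fun t => / RtoC r ^ S k * (/ c * Cexp (c * t)))%C (fun t => / RtoC r ^ S k * Cexp (c * t))%C).
  - replace (Cexp (c * RtoC (2 * PI))) with (Cexp (c * RtoC 0)). ring.
    unfold c. replace (- Ci * RtoC (INR (S k)) * RtoC 0)%C with (RtoC 0) by ring. rewrite Cexp_0.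
    replace (- Ci * RtoC (INR (S k)) * RtoC (2 * PI))%C with (- (Ci * RtoC (INR (S k)) * RtoC (2 * PI)))%C by ring.
    rewrite Cexp_opp, <- P.
    assert (Z := circ_period 1). unfold circ in Z. rewrite !Cmult_1_l in Z.
    rewrite Z. replace (Ci * RtoC 0)%C with (RtoC 0) by ring. rewrite Cexp_0, Cpow_1_l. field.
  - generalize two_PI_pos; lra.
  - intros t _.
    apply (Cderiv_eq _ _ (0 * (/ c * Cexp (c * RtoC t)) + / RtoC r ^ S k * (0 * Cexp (c * RtoC t) + / c * (Cexp (c * RtoC t) * c)))%C).
    2: field; split; auto.
    apply (Cderiv_mult (fun _ => / RtoC r ^ S k)%C (fun t => / c * Cexp (c * t))%C). apply Cderiv_const.
    apply (Cderiv_mult (fun _ => / c)%C (fun t => Cexp (c * t))%C). apply Cderiv_const.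
    apply (Cderiv_comp Cexp (fun x => c * x)%C). 2: apply Cderiv_Cexp.
    apply (Cderiv_ext_loc (fun x => 0 + c * x)%C _ _ _ 1). lra. intros; ring. apply Cderiv_affine.
  - intros t _. apply Ccont_mult. apply Ccont_const. apply (Ccont_comp Cexp (fun t => c * t)%C).
    apply Ccont_mult. apply Ccont_const. apply Ccont_id. eapply Cderiv_cont, Cderiv_Cexp.
Qed.

Lemma CInt_const c a b : CInt (fun _ => c) a b = (RtoC (b - a) * c)%C.
Proof.
  unfold CInt. rewrite !RInt_const. unfold scal; simpl; unfold mult; simpl.
  apply injective_projections; simpl; ring.
Qed.

Lemma pow_lt_eps q eps : 0 <= q < 1 -> 0 < eps -> exists K, q ^ K < eps.
Proof.
  intros Hq He. destruct (pow_lt_1_zero q) with (y := eps) as [N H]; auto.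
  rewrite Rabs_pos_eq; lra. exists N. specialize (H N ltac:(lia)).
  eapply Rle_lt_trans; [apply Rle_abs|exact H].
Qed.

(** This is [kernel_split] for the constant function 1: orthogonality leaves only the coefficient of
    index 0, and the remainder decays geometrically. *)
Lemma CInt_kernel r z : Cmod z < r ->
  CInt (fun t => circ r t / (circ r t - z))%C 0 (2 * PI) = RtoC (2 * PI).
Proof.
  intros Hz. assert (Z := Cmod_ge_0 z). assert (Hr : 0 < r < r + 1) by lra.
  assert (H1 : holo (disc 0 (r + 1)) (fun _ => 1%C)) by apply holo_const.
  assert (PP := two_PI_pos).
  set (J := CInt _ _ _).
  destruct (Ceq_dec J (RtoC (2 * PI))) as [|N]; auto. exfalso.
  apply Cminus_neq_0, Cmod_gt_0 in N.
  set (B := 2 * (r / (r - Cmod z)) * (2 * PI - 0)).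
  assert (HB : 0 < B).
  { unfold B. repeat apply Rmult_lt_0_compat; try lra. apply Rinv_0_lt_compat; lra. }
  destruct (pow_lt_eps (Cmod z / r) (Cmod (J - RtoC (2 * PI)) / B)) as [K HK].
  { split. apply Rdiv_le_0_compat; lra. apply Rmult_lt_reg_r with r. lra.
    unfold Rdiv; rewrite Rmult_assoc, Rinv_l; lra. }
  { apply Rdiv_lt_0_compat; lra. }
  assert (KS := kernel_split (fun _ => 1%C) 0 (r + 1) r z (S K) Hr H1 Hz).
  rewrite (CInt_ext _ (fun t => circ r t / (circ r t - z))%C) in KS by (intros; ring).
  fold J in KS.
  assert (E0 : forall n, csum (fun k => tcoef (fun _ => 1%C) 0 r k * z ^ k)%C (S n) = 1%C).
  { induction n.
    - simpl. unfold tcoef. rewrite (CInt_ext _ (fun _ => 1%C)). 2: intros; simpl; field.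
      rewrite CInt_const, Rminus_0_r. field. apply two_PI_neq.
    - change (csum (fun k => tcoef (fun _ => 1%C) 0 r k * z ^ k)%C (S n) + tcoef (fun _ => 1%C) 0 r (S n) * z ^ (S n) = 1)%C.
      rewrite IHn. unfold tcoef.
      rewrite (CInt_ext _ (fun t => / circ r t ^ S n)%C) by (intros; ring).
      rewrite CInt_circ_pow by lra. ring. }
  rewrite E0 in KS.
  assert (Q : Cmod (CInt (fun t => 1 * / circ r t ^ S K * (circ r t / (circ r t - z))) 0 (2 * PI))%C
     <= 2 * (/ r ^ S K * (r / (r - Cmod z))) * (2 * PI - 0)).
  { apply CInt_bound. lra.
    intros. apply pcont_mult. apply pcont_mult. apply pcont_const. apply pcont_circ_inv; lra.
    apply pcont_kernel; auto.
    intros t _. rewrite !Cmod_mult, Cmod_1, Cmod_circ_inv, Rmult_1_l by lra.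
    apply Rmult_le_compat_l. left. apply Rinv_0_lt_compat, pow_lt; lra.
    apply (kernel_bound (r + 1)); auto. }
  assert (N2 : Cmod (J - RtoC (2 * PI)) <= (Cmod z / r) ^ S K * B).
  { rewrite KS. replace (RtoC (2 * PI) * 1 + z ^ S K * CInt (fun t => 1 * / circ r t ^ S K * (circ r t / (circ r t - z))) 0 (2 * PI) - RtoC (2 * PI))%C
     with (z ^ S K * CInt (fun t => 1 * / circ r t ^ S K * (circ r t / (circ r t - z))) 0 (2 * PI))%C by ring.
    rewrite Cmod_mult, Cmod_pow. eapply Rle_trans. apply Rmult_le_compat_l. apply pow_le; auto. exact Q.
    right. unfold Rdiv. rewrite Rpow_mult_distr, pow_inv. unfold B, Rdiv. ring. }
  assert (N3 : (Cmod z / r) ^ S K <= (Cmod z / r) ^ K).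
  { simpl. rewrite <- (Rmult_1_l ((Cmod z / r) ^ K)) at 2. apply Rmult_le_compat_r.
    apply pow_le. apply Rdiv_le_0_compat; lra.
    apply Rmult_le_reg_r with r. lra. unfold Rdiv; rewrite Rmult_assoc, Rinv_l; lra. }
  assert (N4 : (Cmod z / r) ^ K * B < Cmod (J - RtoC (2 * PI))).
  { apply Rmult_lt_compat_r with (r := B) in HK; auto. unfold Rdiv at 2 in HK.
    rewrite Rmult_assoc, Rinv_l, Rmult_1_r in HK by lra. auto. }
  assert ((Cmod z / r) ^ S K * B <= (Cmod z / r) ^ K * B) by (apply Rmult_le_compat_r; lra).
  lra.
Qed.

Lemma cauchy_formula f s0 R0 r z : 0 < r < R0 -> holo (disc s0 R0) f -> Cmod z < r ->
  CInt (fun t => f (s0 + circ r t) * (circ r t / (circ r t - z)))%C 0 (2 * PI) =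
  (RtoC (2 * PI) * f (s0 + z))%C.
Proof. intros. rewrite (cauchy_kernel f s0 R0 r), CInt_kernel; auto. ring. Qed.

Lemma taylor f s0 R0 r z M K : 0 < r < R0 -> holo (disc s0 R0) f -> Cmod z < r ->
  (forall t, Cmod (f (s0 + circ r t)%C) <= M) ->
  Cmod (f (s0 + z) - csum (fun k => tcoef f s0 r k * z ^ k) K)%C <= 2 * M * (Cmod z / r) ^ K * (r / (r - Cmod z)).
Proof.
  intros Hr Hf Hz HM. assert (PP := two_PI_pos). assert (Z := Cmod_ge_0 z).
  assert (C := cauchy_formula f s0 R0 r z Hr Hf Hz).
  rewrite (kernel_split f s0 R0 r z K Hr Hf Hz) in C.
  set (X := CInt _ _ _) in C.
  assert (E : (f (s0 + z) - csum (fun k => tcoef f s0 r k * z ^ k) K = / RtoC (2 * PI) * (z ^ K * X))%C).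
  { replace (f (s0 + z)%C) with (/ RtoC (2 * PI) * (RtoC (2 * PI) * f (s0 + z)))%C by (field; apply two_PI_neq).
    rewrite <- C. field. apply two_PI_neq. }
  rewrite E, !Cmod_mult, Cmod_inv, Cmod_R, Rabs_pos_eq, Cmod_pow by (apply two_PI_neq || lra).
  assert (B : Cmod X <= 2 * (M * / r ^ K * (r / (r - Cmod z))) * (2 * PI - 0)).
  { apply CInt_bound. lra.
    intros. apply pcont_mult. apply pcont_mult. apply (pcont_f_circ f s0 R0 r); auto.
    apply pcont_circ_inv; lra. apply pcont_kernel; auto.
    intros t _. rewrite !Cmod_mult, Cmod_circ_inv by lra.
    assert (0 < / r ^ K) by (apply Rinv_0_lt_compat, pow_lt; lra).
    apply Rmult_le_compat; try apply Cmod_ge_0.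
    apply Rmult_le_pos. apply Cmod_ge_0. lra.
    apply Rmult_le_compat_r. lra. auto.
    apply (kernel_bound R0); auto. }
  apply Rmult_le_reg_l with (2 * PI); auto. rewrite <- Rmult_assoc, Rinv_r, Rmult_1_l by lra.
  eapply Rle_trans. apply Rmult_le_compat_l. apply pow_le; auto. exact B.
  right. unfold Rdiv. rewrite Rpow_mult_distr, pow_inv. ring.
Qed.

Lemma tcoef_bound f s0 R0 r M k : 0 < r < R0 -> holo (disc s0 R0) f ->
  (forall t, Cmod (f (s0 + circ r t)%C) <= M) -> Cmod (tcoef f s0 r k) <= 2 * M / r ^ k.
Proof.
  intros Hr Hf HM. assert (PP := two_PI_pos). unfold tcoef.
  rewrite Cmod_mult, Cmod_inv, Cmod_R, Rabs_pos_eq by (apply two_PI_neq || lra).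
  assert (0 < / r ^ k) by (apply Rinv_0_lt_compat, pow_lt; lra).
  assert (B : Cmod (CInt (fun t => f (s0 + circ r t) * / circ r t ^ k) 0 (2 * PI))%C <= 2 * (M * / r ^ k) * (2 * PI - 0)).
  { apply CInt_bound. lra. intros. apply pcont_mult. apply (pcont_f_circ f s0 R0 r); auto.
    apply pcont_circ_inv; lra.
    intros t _. rewrite Cmod_mult, Cmod_circ_inv by lra. apply Rmult_le_compat_r. lra. auto. }
  apply Rmult_le_reg_l with (2 * PI); auto. rewrite <- Rmult_assoc, Rinv_r, Rmult_1_l by lra.
  eapply Rle_trans. exact B. right. unfold Rdiv. ring.
Qed.

Lemma circ_bounded f s0 R0 r : 0 < r < R0 -> holo (disc s0 R0) f ->
  exists M, forall t, Cmod (f (s0 + circ r t)%C) <= M.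
Proof.
  intros Hr Hf.
  assert (P : forall t, continuity_pt (fun t => Cmod (f (s0 + circ r t)%C)) t).
  { intros t. apply continuity_pt_filterlim. apply continuous_eps. intros eps He.
    destruct (pcont_eps _ t (pcont_f_circ f s0 R0 r Hr Hf t) eps He) as [d [Hd K]].
    exists d. split; auto. intros u Hu. specialize (K u Hu). apply Rabs_def1.
    assert (T := Cmod_ge_minus (f (s0 + circ r u)%C) (f (s0 + circ r t)%C)). lra.
    assert (T := Cmod_ge_minus (f (s0 + circ r t)%C) (f (s0 + circ r u)%C)).
    rewrite Cmod_minus_sym in T. lra. }
  destruct (continuity_ab_maj (fun t => Cmod (f (s0 + circ r t)%C)) 0 (2 * PI)) as [Mx [H1 H2]].
  generalize two_PI_pos; lra. intros; auto.
  exists (Cmod (f (s0 + circ r Mx)%C)). intros t.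
  assert (PP := two_PI_pos).
  (* The maximum is known on one period only; the angle is reduced modulo 2 PI. *)
  set (n := Int_part (t / (2 * PI))).
  assert (Hn := base_Int_part (t / (2 * PI))). fold n in Hn.
  set (u := t - IZR n * (2 * PI)).
  assert (Eu : t = u + IZR n * (2 * PI)) by (unfold u; ring).
  assert (Hu : 0 <= u <= 2 * PI).
  { assert (t = t / (2 * PI) * (2 * PI)) by (field; lra). unfold u. split; nra. }
  replace (circ r t) with (circ r u). apply H1; auto.
  assert (CS : forall m : nat, forall x, cos (x + INR m * (2 * PI)) = cos x /\ sin (x + INR m * (2 * PI)) = sin x).
  { intros m x. replace (x + INR m * (2 * PI)) with (x + 2 * INR m * PI) by ring.
    split; [apply cos_period|apply sin_period]. }
  assert (CSZ : cos t = cos u /\ sin t = sin u).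
  { rewrite Eu. clearbody n u. destruct (Z_le_gt_dec 0 n) as [Hp|Hm].
    - rewrite <- (Z2Nat.id n) by lia. rewrite <- INR_IZR_INZ. apply CS.
    - assert (X := CS (Z.to_nat (- n)) (u + IZR n * (2 * PI))).
      rewrite INR_IZR_INZ, Z2Nat.id, opp_IZR in X by lia.
      replace (u + IZR n * (2 * PI) + - IZR n * (2 * PI)) with u in X by ring. split; symmetry; apply X. }
  unfold circ, Cexp. simpl. rewrite !Rmult_0_l, !Rmult_0_r, !Rmult_1_l, !Rplus_0_l.
  destruct CSZ as [-> ->]. auto.
Qed.

Lemma CInt_fst f a b : fst (CInt f a b) = RInt (fun t => fst (f t)) a b.
Proof. reflexivity. Qed.

Lemma Cconj_CInt f a b : (forall t, Rmin a b <= t <= Rmax a b -> pcont f t) ->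
  Cconj (CInt f a b) = CInt (fun t => Cconj (f t)) a b.
Proof.
  intros H. unfold CInt, Cconj; simpl. f_equal. symmetry.
  apply (RInt_opp (V := R_CompleteNormedModule)). apply (pcont_ex f a b H).
Qed.

Lemma pcont_conj f t : pcont f t -> pcont (fun u => Cconj (f u)) t.
Proof. intros [H1 H2]; split; simpl; auto. apply (continuous_opp (V := R_NormedModule)); auto. Qed.

(* Pairing with the vanishing Taylor coefficient of index [-k] leaves only the real part,
   which is one-sided bounded and has known mean. *)
Lemma borel_caratheodory h s0 R0 r M k : 0 < r < R0 -> holo (disc s0 R0) h -> (0 < k)%nat ->
  (forall t, fst (h (s0 + circ r t)%C) <= fst (h s0) + M) ->
  Cmod (tcoef h s0 r k) <= 4 * M / r ^ k.
Proof.
  intros Hr Hh Hk HM. assert (PP := two_PI_pos).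
  assert (Ph := pcont_f_circ h s0 R0 r Hr Hh).
  assert (M0 : RInt (fun t => fst (h (s0 + circ r t)%C)) 0 (2 * PI) = 2 * PI * fst (h s0)).
  { assert (C := cauchy_formula h s0 R0 r 0 Hr Hh). rewrite Cmod_0 in C. specialize (C ltac:(lra)).
    rewrite (CInt_ext _ (fun t => h (s0 + circ r t)%C)) in C.
    2:{ intros. replace (circ r t - 0)%C with (circ r t) by ring. field. apply circ_neq_0; lra. }
    replace (s0 + 0)%C with s0 in C by ring.
    apply (f_equal fst) in C. rewrite CInt_fst in C. rewrite C. simpl. ring. }
  assert (V : CInt (fun t => h (s0 + circ r t) * circ r t ^ k)%C 0 (2 * PI) = 0%C).
  { assert (H2 : holo (disc s0 R0) (fun w => h w * (w - s0) ^ k)%C).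
    { apply holo_mult; auto. apply holo_pow. apply holo_minus. apply holo_id. apply holo_const. }
    assert (C := cauchy_formula _ s0 R0 r 0 Hr H2). rewrite Cmod_0 in C. specialize (C ltac:(lra)).
    rewrite (CInt_ext _ (fun t => h (s0 + circ r t) * circ r t ^ k)%C) in C.
    2:{ intros. replace (s0 + circ r t - s0)%C with (circ r t) by ring.
        replace (circ r t - 0)%C with (circ r t) by ring. field. apply circ_neq_0; lra. }
    rewrite C. replace (s0 + 0 - s0)%C with (RtoC 0) by ring. destruct k. lia. simpl. ring. }
  (* On the circle conjugation inverts [circ] up to the factor r^2, so conjugating the vanishing
     integral V gives the coefficient integral of the conjugate of h. *)
  assert (Conj : forall t, (Cconj (circ r t ^ k) = RtoC (r ^ k * r ^ k) * / circ r t ^ k)%C).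
  { intros t. assert (Nz : (circ r t ^ k)%C <> 0%C) by (apply Cpow_nz, circ_neq_0; lra).
    replace (RtoC (r ^ k * r ^ k)) with (circ r t ^ k * Cconj (circ r t ^ k))%C. field; auto.
    rewrite <- Cmod2_conj. rewrite Cmod_pow, Cmod_circ by lra. f_equal. ring. }
  apply (f_equal Cconj) in V. rewrite Cconj_CInt in V.
  2:{ intros. apply pcont_mult; auto. apply pcont_pow, pcont_circ. }
  assert (R2 : 0 < r ^ k) by (apply pow_lt; lra).
  assert (R3 : RtoC (r ^ k * r ^ k) <> 0%C).
  { intros X. inversion X. assert (0 < r ^ k * r ^ k) by (apply Rmult_lt_0_compat; auto). lra. }
  rewrite (CInt_ext _ (fun t => RtoC (r ^ k * r ^ k) * (Cconj (h (s0 + circ r t)) * / circ r t ^ k))%C) in V.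
  2:{ intros. rewrite Cmult_conj, Conj. ring. }
  assert (P1 : forall t, pcont (fun t => Cconj (h (s0 + circ r t)) * / circ r t ^ k)%C t).
  { intros. apply pcont_mult. apply pcont_conj; auto. apply pcont_circ_inv; lra. }
  rewrite CInt_scal in V by auto.
  assert (V' : CInt (fun t => Cconj (h (s0 + circ r t)) * / circ r t ^ k)%C 0 (2 * PI) = 0%C).
  { replace (CInt (fun t => Cconj (h (s0 + circ r t)) * / circ r t ^ k)%C 0 (2 * PI)) with
     (/ RtoC (r ^ k * r ^ k) * (RtoC (r ^ k * r ^ k) * CInt (fun t => Cconj (h (s0 + circ r t)) * / circ r t ^ k)%C 0 (2 * PI)))%C by (field; auto).
    rewrite V. unfold Cconj; simpl. apply injective_projections; simpl; ring. }
  assert (P2 : forall t, pcont (fun t => h (s0 + circ r t) * / circ r t ^ k)%C t).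
  { intros. apply pcont_mult; auto. apply pcont_circ_inv; lra. }
  assert (P0 : forall t, pcont (fun t => / circ r t ^ k)%C t) by (intros; apply pcont_circ_inv; lra).
  assert (Z0 : CInt (fun t => / circ r t ^ k)%C 0 (2 * PI) = 0%C).
  { destruct k. lia. apply CInt_circ_pow; lra. }
  (* Adding the vanishing conjugate integral replaces h by 2 Re h, and a constant may be subtracted
     because circ^-k has mean 0. The result u is never positive, so |u| = - u, whose integral 4 PI M
     follows from the mean value property. *)
  set (u := fun t => 2 * (fst (h (s0 + circ r t)%C) - (fst (h s0) + M))).
  assert (E : CInt (fun t => h (s0 + circ r t) * / circ r t ^ k)%C 0 (2 * PI) =
     CInt (fun t => RtoC (u t) * / circ r t ^ k)%C 0 (2 * PI)).
  { rewrite (CInt_ext (fun t => RtoC (u t) * / circ r t ^ k)%C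
      (fun t => (h (s0 + circ r t) * / circ r t ^ k + Cconj (h (s0 + circ r t)) * / circ r t ^ k) +
         (RtoC (- 2 * (fst (h s0) + M))) * / circ r t ^ k)%C).
    2:{ intros t _. unfold u. destruct (h (s0 + circ r t)%C) as [p q]. set (e := (/ circ r t ^ k)%C).
        unfold Cconj, RtoC; simpl. apply injective_projections; simpl; ring. }
    rewrite CInt_plus. rewrite CInt_plus, V', CInt_scal, Z0; auto. ring.
    intros; apply pcont_plus; auto. intros; apply pcont_mult; auto. apply pcont_const. }
  unfold tcoef. rewrite E.
  rewrite Cmod_mult, Cmod_inv, Cmod_R, Rabs_pos_eq by (apply two_PI_neq || lra).
  assert (Cu : forall t, continuous u t).
  { intros t. unfold u. apply (continuous_mult (K := R_AbsRing) (fun _ => 2)). apply continuous_const.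
    apply (continuous_minus (V := R_NormedModule)). apply Ph. apply continuous_const. }
  assert (Ex : ex_RInt (fun t => fst (h (s0 + circ r t)%C)) 0 (2 * PI)).
  { apply (ex_RInt_continuous (V := R_CompleteNormedModule)). intros; apply Ph. }
  assert (I : is_RInt (fun t => / r ^ k * (2 * (fst (h s0) + M) - 2 * fst (h (s0 + circ r t)%C))) 0 (2 * PI) (/ r ^ k * (2 * M * (2 * PI)))).
  { apply (is_RInt_scal (V := R_NormedModule)).
    replace (2 * M * (2 * PI)) with ((2 * PI - 0) * (2 * (fst (h s0) + M)) - 2 * (2 * PI * fst (h s0))) by ring.
    apply (is_RInt_minus (V := R_NormedModule)). apply (is_RInt_const (V := R_NormedModule)).
    apply (is_RInt_scal (V := R_NormedModule)). rewrite <- M0. apply (RInt_correct (V := R_CompleteNormedModule)); auto. }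
  assert (B : Cmod (CInt (fun t => RtoC (u t) * / circ r t ^ k)%C 0 (2 * PI)) <=
    2 * RInt (fun t => / r ^ k * (2 * (fst (h s0) + M) - 2 * fst (h (s0 + circ r t)%C))) 0 (2 * PI)).
  { apply CInt_bound_fun. lra. intros; apply pcont_mult; auto. apply pcont_RtoC; auto. eexists; exact I.
    intros t _. rewrite Cmod_mult, Cmod_circ_inv, Cmod_R, Rmult_comm by lra.
    apply Rmult_le_compat_l. left; apply Rinv_0_lt_compat; auto.
    unfold u. rewrite Rabs_left1. lra. specialize (HM t). lra. }
  rewrite (is_RInt_unique _ _ _ _ I) in B.
  apply Rmult_le_reg_l with (2 * PI); auto. rewrite <- Rmult_assoc, Rinv_r, Rmult_1_l by lra.
  eapply Rle_trans. exact B. right. unfold Rdiv. ring.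
Qed.

(** * Series of holomorphic functions *)

(** Total, being a pair of [Series]; statements about it pass through [Cconv], which records actual
    convergence. *)
Definition CSer (c : nat -> C) : C := (Series (fun n => fst (c n)), Series (fun n => snd (c n))).

Definition Cconv (c : nat -> C) (l : C) :=
  forall eps, 0 < eps -> exists N, forall n, (N <= n)%nat -> Cmod (csum c n - l) < eps.

Fixpoint rsum (a : nat -> R) (n : nat) : R :=
  match n with O => 0 | S k => rsum a k + a k end.

Lemma rsum_sum_n a n : sum_n a n = rsum a (S n).
Proof.
  induction n. rewrite sum_O. simpl. symmetry; apply Rplus_0_l. rewrite sum_Sn, IHn. reflexivity.
Qed.

Lemma csum_rsum c n : csum c n = (rsum (fun k => fst (c k)) n, rsum (fun k => snd (c k)) n).
Proof. induction n; simpl; auto. rewrite IHn. reflexivity. Qed.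

Lemma Cmod_csum c M n : (forall k, (k < n)%nat -> Cmod (c k) <= M k) -> Cmod (csum c n) <= rsum M n.
Proof.
  induction n; simpl; intros H. rewrite Cmod_0; lra.
  eapply Rle_trans. apply Cmod_triangle. apply Rplus_le_compat; auto.
Qed.

Lemma rsum_eps a l : is_series a l <->
  forall eps, 0 < eps -> exists N, forall n, (N <= n)%nat -> Rabs (rsum a n - l) < eps.
Proof.
  split.
  - intros H eps He. assert (H' : is_lim_seq (sum_n a) l) by exact H.
    apply is_lim_seq_spec in H'. destruct (H' (mkposreal eps He)) as [N K].
    exists (S N). intros n Hn. destruct n. lia. rewrite <- rsum_sum_n. apply K. lia.
  - intros H. change (is_lim_seq (sum_n a) l). apply is_lim_seq_spec. intros eps. destruct (H eps (cond_pos eps)) as [N K].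
    exists N. intros n Hn. rewrite rsum_sum_n. apply K. lia.
Qed.

Lemma Cconv_series c l : Cconv c l <->
  is_series (fun n => fst (c n)) (fst l) /\ is_series (fun n => snd (c n)) (snd l).
Proof.
  split.
  - intros H. split; apply rsum_eps; intros eps He; destruct (H eps He) as [N K]; exists N;
    intros n Hn; specialize (K n Hn); rewrite csum_rsum in K; eapply Rle_lt_trans; [|exact K| |exact K].
    exact (Cmod_fst ((rsum (fun k => fst (c k)) n, rsum (fun k => snd (c k)) n) - l)%C).
    exact (Cmod_snd ((rsum (fun k => fst (c k)) n, rsum (fun k => snd (c k)) n) - l)%C).
  - intros [H1 H2] eps He.
    destruct (proj1 (rsum_eps _ _) H1 (eps/2)) as [N1 K1]. lra.
    destruct (proj1 (rsum_eps _ _) H2 (eps/2)) as [N2 K2]. lra.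
    exists (max N1 N2). intros n Hn. rewrite csum_rsum. eapply Rle_lt_trans. apply Cmod_le_sum. simpl.
    specialize (K1 n ltac:(lia)). specialize (K2 n ltac:(lia)). unfold Rminus in *. lra.
Qed.

Lemma Cconv_CSer c l : Cconv c l -> CSer c = l.
Proof.
  intros H. apply Cconv_series in H. destruct H as [H1 H2]. unfold CSer.
  rewrite (is_series_unique _ _ H1), (is_series_unique _ _ H2). destruct l; auto.
Qed.

Lemma rsum_le_Series a n : (forall k, 0 <= a k) -> ex_series a -> rsum a n <= Series a.
Proof.
  intros P E. apply Series_correct in E.
  assert (L : is_lim_seq (fun n => rsum a (S n)) (Series a)).
  { eapply is_lim_seq_ext; [|exact E]. intros k. apply rsum_sum_n. }
  apply Rle_trans with (rsum a (S n)). simpl; specialize (P n); lra.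
  apply (is_lim_seq_incr_compare (fun n => rsum a (S n))); auto.
  intros k. simpl. specialize (P (S k)). lra.
Qed.

Lemma ex_series_tail (a : nat -> R) n : ex_series a -> ex_series (fun k => a (n + k)%nat).
Proof. apply ex_series_incr_n. Qed.

Lemma Series_tail (a : nat -> R) n : ex_series a -> Series (fun k => a (n + k)%nat) = Series a - rsum a n.
Proof.
  intros E. destruct n. simpl. rewrite Rminus_0_r. apply Series_ext; auto.
  rewrite (Series_incr_n a (S n)) by (lia || auto). simpl pred.
  replace (sum_f_R0 a n) with (rsum a (S n)). ring.
  rewrite <- rsum_sum_n. apply sum_n_Reals.
Qed.

Lemma tail_small (a : nat -> R) : ex_series a ->
  forall eps, 0 < eps -> exists N, forall n, (N <= n)%nat -> Rabs (Series (fun k => a (n + k)%nat)) < eps.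
Proof.
  intros E eps He. assert (H := Series_correct _ E).
  destruct (proj1 (rsum_eps _ _) H eps He) as [N K]. exists N. intros n Hn.
  rewrite Series_tail, Rabs_minus_sym; auto.
Qed.

Lemma csum_add c n m : csum c (n + m) = (csum c n + csum (fun k => c (n + k)%nat) m)%C.
Proof.
  induction m; simpl. rewrite Nat.add_0_r. ring. rewrite Nat.add_succ_r. simpl. rewrite IHm. ring.
Qed.

Lemma dom_ex c M : (forall k, Cmod (c k) <= M k) -> ex_series M ->
  ex_series (fun k => fst (c k)) /\ ex_series (fun k => snd (c k)).
Proof.
  intros H E. split; apply (ex_series_le (V := R_CompleteNormedModule) _ M); auto; intros n.
  eapply Rle_trans; [apply Cmod_fst|auto]. eapply Rle_trans; [apply Cmod_snd|auto].
Qed.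

Lemma dom_conv c M : (forall k, Cmod (c k) <= M k) -> ex_series M -> Cconv c (CSer c).
Proof.
  intros H E. destruct (dom_ex c M H E). apply Cconv_series. split; apply Series_correct; auto.
Qed.

Lemma Cconv_le c l z B : Cconv c l -> (forall n, Cmod (csum c n - z) <= B) -> Cmod (l - z) <= B.
Proof.
  intros H K. apply le_epsilon. intros eps He. destruct (H eps He) as [N HN].
  specialize (HN N (Nat.le_refl _)). specialize (K N).
  assert (T := Cmod_tri_minus l z (csum c N)). rewrite (Cmod_minus_sym l (csum c N)) in T. lra.
Qed.

Lemma CSer_tail c M n : (forall k, Cmod (c k) <= M k) -> ex_series M ->
  Cmod (CSer c - csum c n) <= Series (fun k => M (n + k)%nat).
Proof.
  intros H E. assert (D := dom_conv c M H E).
  assert (P : forall k, 0 <= M k) by (intros k; eapply Rle_trans; [apply Cmod_ge_0|apply H]).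
  assert (G : Cconv (fun k => c (n + k)%nat) (CSer c - csum c n)).
  { intros eps He. destruct (D eps He) as [N K]. exists N. intros m Hm.
    specialize (K (n + m)%nat ltac:(lia)). rewrite csum_add in K.
    replace (csum (fun k => c (n + k)%nat) m - (CSer c - csum c n))%C with
      (csum c n + csum (fun k => c (n + k)%nat) m - CSer c)%C by ring. auto. }
  replace (CSer c - csum c n)%C with (CSer c - csum c n - 0)%C by ring.
  apply (Cconv_le _ _ _ _ G). intros m.
  replace (csum (fun k => c (n + k)%nat) m - 0)%C with (csum (fun k => c (n + k)%nat) m) by ring.
  eapply Rle_trans. apply (Cmod_csum _ (fun k => M (n + k)%nat)). intros; apply H.
  apply (rsum_le_Series (fun k => M (n + k)%nat)). intros; apply P. apply ex_series_tail; auto.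
Qed.

Lemma Cmod_CSer c M : (forall k, Cmod (c k) <= M k) -> ex_series M -> Cmod (CSer c) <= Series M.
Proof.
  intros H E. assert (T := CSer_tail c M 0 H E). simpl in T.
  replace (CSer c - 0)%C with (CSer c) in T by ring. exact T.
Qed.

Lemma csum_plus c d n : csum (fun k => c k + d k)%C n = (csum c n + csum d n)%C.
Proof. induction n; simpl. ring. rewrite IHn. ring. Qed.

Lemma Cconv_plus c d l m : Cconv c l -> Cconv d m -> Cconv (fun k => c k + d k)%C (l + m).
Proof.
  intros H1 H2 eps He. destruct (H1 (eps/2)) as [N1 K1]. lra. destruct (H2 (eps/2)) as [N2 K2]. lra.
  exists (max N1 N2). intros n Hn. specialize (K1 n ltac:(lia)). specialize (K2 n ltac:(lia)).
  rewrite csum_plus. replace (csum c n + csum d n - (l + m))%C with ((csum c n - l) + (csum d n - m))%C by ring.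
  eapply Rle_lt_trans. apply Cmod_triangle. lra.
Qed.

Lemma Cconv_scal a c l : Cconv c l -> Cconv (fun k => a * c k)%C (a * l).
Proof.
  intros H eps He. assert (P := Cmod_ge_0 a).
  destruct (H (eps / (1 + Cmod a))) as [N K]. apply Rdiv_lt_0_compat; lra.
  exists N. intros n Hn. specialize (K n Hn). rewrite csum_mult.
  replace (a * csum c n - a * l)%C with (a * (csum c n - l))%C by ring. rewrite Cmod_mult.
  apply Rle_lt_trans with ((Cmod a) * (eps / (1 + Cmod a))). apply Rmult_le_compat_l; lra.
  apply Rmult_lt_reg_r with (1 + Cmod a). lra. unfold Rdiv. rewrite !Rmult_assoc, Rinv_l by lra. nra.
Qed.

(** Uniqueness of the derivative identifies l with the first Taylor coefficient on the circle of
    radius rho / 2; the bounds are then Cauchy's estimates, with 4 and 16 coming from that halved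
    radius and from |h| <= rho / 4. *)
Lemma deriv_bound f z rho M l : 0 < rho -> holo (disc z rho) f ->
  (forall w, disc z rho w -> Cmod (f w) <= M) -> Cderiv f z l ->
  Cmod l <= 4 * M / rho /\
  (forall h, Cmod h <= rho / 4 -> Cmod (f (z + h)%C - f z - l * h) <= 16 * M * (Cmod h * Cmod h) / (rho * rho)) /\
  l = tcoef f z (rho / 2) 1.
Proof.
  intros Hr Hf HM Hl. set (r := rho / 2). assert (Hr' : 0 < r < rho) by (unfold r; lra).
  assert (Hc : forall t, Cmod (f (z + circ r t)%C) <= M) by (intros; apply HM, circ_in; auto).
  assert (M0 : 0 <= M) by (eapply Rle_trans; [apply Cmod_ge_0|apply (Hc 0)]).
  set (A := tcoef f z r).
  assert (E0 : A 0%nat = f z).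
  { assert (T := taylor f z rho r 0 M 1 Hr' Hf). rewrite Cmod_0 in T. specialize (T ltac:(lra) Hc).
    replace (2 * M * (0 / r) ^ 1 * (r / (r - 0))) with 0 in T by (field; lra).
    replace (z + 0)%C with z in T by ring. simpl in T. fold A in T.
    destruct (Ceq_dec (A 0%nat) (f z)) as [|N]; auto. exfalso.
    apply not_eq_sym in N. apply Cminus_neq_0, Cmod_gt_0 in N.
    replace (f z - (0 + A 0%nat * 1))%C with (f z - A 0%nat)%C in T by ring. lra. }
  assert (Q : forall h, Cmod h <= r / 2 -> Cmod (f (z + h)%C - f z - A 1%nat * h) <= 4 * M * (Cmod h * Cmod h) / (r * r)).
  { intros h Hh. assert (P := Cmod_ge_0 h).
    assert (T := taylor f z rho r h M 2 Hr' Hf ltac:(lra) Hc). fold A in T. simpl csum in T.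
    replace (f (z + h) - f z - A 1%nat * h)%C with (f (z + h) - (0 + A 0%nat * 1 + A 1%nat * (h * 1)))%C
      by (rewrite E0; ring).
    eapply Rle_trans. exact T.
    replace (4 * M * (Cmod h * Cmod h) / (r * r)) with (2 * M * (Cmod h / r) ^ 2 * 2) by (field; lra).
    apply Rmult_le_compat_l. apply Rmult_le_pos. lra. apply pow2_ge_0.
    apply Rmult_le_reg_r with (r - Cmod h). lra. unfold Rdiv. rewrite Rmult_assoc, Rinv_l by lra. lra. }
  assert (E1 : l = A 1%nat).
  { apply (Cderiv_unique f z); auto. intros eps He.
    assert (R2 : 0 < r * r) by (apply Rmult_lt_0_compat; lra).
    exists (Rmin (r / 2) (eps * (r * r) / (4 * M + 1))). split.
    apply Rmin_glb_lt. lra. apply Rdiv_lt_0_compat. apply Rmult_lt_0_compat; lra. lra.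
    intros w Hw. apply Rmin_Rgt in Hw. destruct Hw as [H1 H2].
    specialize (Q (w - z)%C ltac:(lra)). replace (z + (w - z))%C with w in Q by ring.
    eapply Rle_trans. exact Q. set (x := Cmod (w - z)) in *.
    assert (X0 : 0 <= x) by apply Cmod_ge_0.
    replace (4 * M * (x * x) / (r * r)) with (4 * M * x / (r * r) * x) by (field; lra).
    apply Rmult_le_compat_r; auto.
    apply Rmult_le_reg_r with (r * r); auto. unfold Rdiv. rewrite Rmult_assoc, Rinv_l, Rmult_1_r by lra.
    apply Rmult_lt_compat_r with (r := 4 * M + 1) in H2; [|lra].
    unfold Rdiv in H2. rewrite Rmult_assoc, Rinv_l in H2 by lra. nra. }
  split.
  - rewrite E1. eapply Rle_trans. apply (tcoef_bound f z rho r M 1); auto. right. unfold r. field. lra.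
  - split; [|exact E1]. intros h Hh. rewrite E1. eapply Rle_trans. apply Q. unfold r; lra. right. unfold r. field. lra.
Qed.

Lemma disc_sub (D : C -> Prop) z rho w : (forall w, Cmod (w - z) < rho -> D w) -> Cmod (w - z) < rho / 2 ->
  forall v, disc w (rho / 2) v -> disc z rho v.
Proof. intros H Hw v Hv. unfold disc in *. assert (T := Cmod_tri_minus v z w). lra. Qed.

(* The quadratic remainders in [deriv_bound] are summable. *)
Lemma series_deriv (c c' : nat -> C -> C) z rho M : 0 < rho -> ex_series M ->
  (forall n w, disc z rho w -> Cderiv (c n) w (c' n w) /\ Ccont (c' n) w /\ Cmod (c n w) <= M n) ->
  Cderiv (fun w => CSer (fun n => c n w)) z (CSer (fun n => c' n z)) /\
  Ccont (fun w => CSer (fun n => c' n w)) z.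
Proof.
  intros Hr HM H.
  assert (Zin : disc z rho z) by (unfold disc; rewrite Cmod_self_0; lra).
  assert (M0 : forall n, 0 <= M n) by (intros n; eapply Rle_trans; [apply Cmod_ge_0|apply (H n z); auto]).
  assert (Hh : forall n, holo (disc z rho) (c n)).
  { intros n. apply (holo_intro _ _ (c' n)); intros w Hw; apply (H n w); auto. }
  assert (B1 : forall n w, Cmod (w - z) < rho / 2 -> Cmod (c' n w) <= 8 / rho * M n).
  { intros n w Hw.
    destruct (deriv_bound (c n) w (rho / 2) (M n) (c' n w)) as [K _]. lra.
    apply (holo_sub _ (disc z rho)); auto. apply (disc_sub (disc z rho)); auto.
    intros v Hv. apply (H n v). apply (disc_sub (disc z rho) z rho w); auto.
    apply H. unfold disc; lra.
    eapply Rle_trans. exact K. right. field. lra. }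
  assert (S1 : ex_series (fun n => 8 / rho * M n)) by (apply (ex_series_scal (V := R_NormedModule)); auto).
  split.
  - intros eps He. set (S := Series M).
    assert (S0 : 0 <= S) by (apply (rsum_le_Series M 0); auto).
    exists (Rmin (rho / 4) (eps * (rho * rho) / (16 * S + 1))). split.
    { apply Rmin_glb_lt. lra. apply Rdiv_lt_0_compat. repeat apply Rmult_lt_0_compat; lra. lra. }
    intros w Hw. apply Rmin_Rgt in Hw. destruct Hw as [W1 W2].
    assert (Win : disc z rho w) by (unfold disc; lra).
    set (x := Cmod (w - z)) in *. assert (X0 : 0 <= x) by apply Cmod_ge_0.
    assert (Cw : Cconv (fun n => c n w) (CSer (fun n => c n w))) by (apply (dom_conv _ M); auto; intros; apply H; auto).
    assert (Cz : Cconv (fun n => c n z) (CSer (fun n => c n z))) by (apply (dom_conv _ M); auto; intros; apply H; auto).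
    assert (Cd : Cconv (fun n => c' n z) (CSer (fun n => c' n z))).
    { apply (dom_conv _ (fun n => 8 / rho * M n)); auto. intros; apply B1. rewrite Cmod_self_0; lra. }
    assert (G : Cconv (fun n => c n w + ((- (1)) * c n z + (- (w - z)) * c' n z))%C
       (CSer (fun n => c n w) + ((- (1)) * CSer (fun n => c n z) + (- (w - z)) * CSer (fun n => c' n z)))).
    { apply Cconv_plus; auto. apply Cconv_plus; apply Cconv_scal; auto. }
    apply Rle_trans with (Series (fun n => 16 * (x * x) / (rho * rho) * M n)).
    + replace (CSer (fun n => c n w) - CSer (fun n => c n z) - CSer (fun n => c' n z) * (w - z))%C with
       (CSer (fun n => c n w) + ((- (1)) * CSer (fun n => c n z) + (- (w - z)) * CSer (fun n => c' n z)))%C by ring.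
      rewrite <- (Cconv_CSer _ _ G). apply Cmod_CSer.
      intros n. destruct (deriv_bound (c n) z rho (M n) (c' n z)) as [_ [K _]]; auto.
      intros v Hv; apply H; auto. apply H; auto.
      specialize (K (w - z)%C). fold x in K. specialize (K ltac:(lra)).
      replace (z + (w - z))%C with w in K by ring.
      replace (c n w + (- (1) * c n z + - (w - z) * c' n z))%C with (c n w - c n z - c' n z * (w - z))%C by ring.
      eapply Rle_trans. exact K. right. field. lra.
      apply (ex_series_scal (V := R_NormedModule)); auto.
    + rewrite Series_scal_l. fold S.
      replace (16 * (x * x) / (rho * rho) * S) with (16 * S * x / (rho * rho) * x) by (field; lra).
      apply Rmult_le_compat_r; auto.
      assert (R2 : 0 < rho * rho) by (apply Rmult_lt_0_compat; lra).
      apply Rmult_le_reg_r with (rho * rho); auto. unfold Rdiv. rewrite Rmult_assoc, Rinv_l, Rmult_1_r by lra.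
      apply Rmult_lt_compat_r with (r := 16 * S + 1) in W2; [|lra].
      unfold Rdiv in W2. rewrite Rmult_assoc, Rinv_l in W2 by lra. nra.
  - intros eps He.
    destruct (tail_small _ S1 (eps / 4) ltac:(lra)) as [N KN]. specialize (KN N (Nat.le_refl _)).
    assert (Cs : Ccont (fun w => csum (fun n => c' n w) N) z).
    { clear KN. induction N; simpl. apply Ccont_const.
      apply (Ccont_plus (fun w => csum (fun n => c' n w) N) (c' N)); auto. apply H; auto. }
    destruct (Cs (eps / 4) ltac:(lra)) as [d [Hd Kd]].
    exists (Rmin d (rho / 2)). split. apply Rmin_glb_lt; lra.
    intros w Hw. apply Rmin_Rgt in Hw. destruct Hw as [W1 W2].
    specialize (Kd w W1).
    assert (T1 := CSer_tail (fun n => c' n w) _ N (fun n => B1 n w W2) S1).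
    assert (T2 := CSer_tail (fun n => c' n z) _ N (fun n => B1 n z ltac:(rewrite Cmod_self_0; lra)) S1).
    set (t := Series _) in *. assert (t < eps / 4) by (eapply Rle_lt_trans; [apply Rle_abs|exact KN]).
    assert (U1 := Cmod_tri_minus (CSer (fun n => c' n w)) (CSer (fun n => c' n z)) (csum (fun n => c' n w) N)).
    assert (U2 := Cmod_tri_minus (csum (fun n => c' n w) N) (CSer (fun n => c' n z)) (csum (fun n => c' n z) N)).
    rewrite (Cmod_minus_sym (csum (fun n => c' n z) N)) in U2. lra.
Qed.

Lemma holo_series (D : C -> Prop) (c : nat -> C -> C) :
  (forall n, holo D (c n)) ->
  (forall z, D z -> exists rho M, 0 < rho /\ ex_series M /\
     forall n w, disc z rho w -> D w /\ Cmod (c n w) <= M n) ->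
  holo D (fun w => CSer (fun n => c n w)).
Proof.
  intros H1 H2.
  set (c' := fun n => epsilon (inhabits (fun z : C => z)) (fun f' => forall z, D z -> Cderiv (c n) z (f' z) /\ Ccont f' z)).
  assert (S : forall n z, D z -> Cderiv (c n) z (c' n z) /\ Ccont (c' n) z).
  { intros n. unfold c'. apply epsilon_spec. apply H1. }
  exists (fun w => CSer (fun n => c' n w)). intros z Hz.
  destruct (H2 z Hz) as (rho & M & Hr & HM & K).
  apply (series_deriv c c' z rho M); auto. intros n w Hw. destruct (K n w Hw) as [Kd Km].
  destruct (S n w Kd). auto.
Qed.

Lemma ex_series_geom_scal a q : 0 <= q < 1 -> ex_series (fun n => a * q ^ n).
Proof.
  intros H. apply (ex_series_scal (V := R_NormedModule)). apply ex_series_geom. rewrite Rabs_pos_eq; lra.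
Qed.

Lemma half_pow_to_0 B eps : 0 < eps -> 0 <= B -> exists N, forall n, (N <= n)%nat -> B * (1/2) ^ n < eps.
Proof.
  intros He HB. destruct (pow_lt_1_zero (1/2)) with (y := eps / (B + 1)) as [N H].
  rewrite Rabs_pos_eq; lra. apply Rdiv_lt_0_compat; lra.
  exists N. intros n Hn. specialize (H n Hn). rewrite Rabs_pos_eq in H by (apply pow_le; lra).
  assert (0 <= (1/2)^n) by (apply pow_le; lra).
  apply Rmult_lt_compat_r with (r := B + 1) in H; [|lra]. unfold Rdiv in H at 2.
  rewrite Rmult_assoc, Rinv_l in H by lra. nra.
Qed.

Lemma taylor_conv f s0 R0 r z : 0 < r < R0 -> holo (disc s0 R0) f -> Cmod z <= r / 2 ->
  Cconv (fun k => tcoef f s0 r k * z ^ k)%C (f (s0 + z)%C).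
Proof.
  intros Hr Hf Hz. destruct (circ_bounded f s0 R0 r Hr Hf) as [M HM].
  assert (M0 : 0 <= M) by (eapply Rle_trans; [apply Cmod_ge_0|apply (HM 0)]).
  assert (P := Cmod_ge_0 z).
  intros eps He. destruct (half_pow_to_0 (4 * M) eps He ltac:(lra)) as [N HN]. exists N. intros n Hn.
  rewrite Cmod_minus_sym. eapply Rle_lt_trans. apply (taylor f s0 R0 r z M n); auto. lra.
  eapply Rle_lt_trans; [|apply (HN n Hn)].
  assert (Q1 : (Cmod z / r) ^ n <= (1/2) ^ n).
  { apply pow_incr. split. apply Rdiv_le_0_compat; lra.
    apply Rmult_le_reg_r with r. lra. unfold Rdiv at 1. rewrite Rmult_assoc, Rinv_l; lra. }
  assert (Q2 : r / (r - Cmod z) <= 2).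
  { apply Rmult_le_reg_r with (r - Cmod z). lra. unfold Rdiv. rewrite Rmult_assoc, Rinv_l by lra. lra. }
  assert (Q0 : 0 <= (Cmod z / r) ^ n) by (apply pow_le, Rdiv_le_0_compat; lra).
  assert (Q3 : 0 <= r / (r - Cmod z)) by (apply Rdiv_le_0_compat; lra).
  replace (4 * M * (1/2)^n) with (2 * M * (1/2)^n * 2) by ring.
  apply Rmult_le_compat; auto. apply Rmult_le_pos; auto. lra. apply Rmult_le_compat_l; auto. lra.
Qed.

Definition dpow (k : nat) (x : C) : C := match k with O => 0%C | S j => (RtoC (INR (S j)) * x ^ j)%C end.

Lemma Cderiv_pow k z : Cderiv (fun w => w ^ k)%C z (dpow k z).
Proof.
  induction k. exact (Cderiv_const (RtoC 1) z).
  apply (Cderiv_eq _ _ (1 * z ^ k + z * dpow k z)%C).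
  apply (Cderiv_mult (fun w => w) (fun w => w ^ k)%C); auto. apply Cderiv_id.
  unfold dpow. destruct k. simpl. ring. rewrite (S_INR (S k)), RtoC_plus. simpl Cpow. ring.
Qed.

Lemma holo_dpow D k : holo D (dpow k).
Proof.
  destruct k. apply holo_const. unfold dpow. apply holo_mult. apply holo_const. apply holo_pow, holo_id.
Qed.

Lemma tcoef_pow_bound f s0 R0 r M k z : 0 < r < R0 -> holo (disc s0 R0) f ->
  (forall t, Cmod (f (s0 + circ r t)%C) <= M) -> Cmod z <= r / 2 ->
  Cmod (tcoef f s0 r k * z ^ k) <= 2 * M * (1/2) ^ k.
Proof.
  intros Hr Hf HM Hz. assert (T := tcoef_bound f s0 R0 r M k Hr Hf HM).
  rewrite Cmod_mult, Cmod_pow. assert (P := Cmod_ge_0 z).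
  assert (R1 : 0 < r ^ k) by (apply pow_lt; lra).
  apply Rle_trans with (2 * M / r ^ k * (r / 2) ^ k).
  apply Rmult_le_compat; auto. apply Cmod_ge_0. apply pow_le; auto. apply pow_incr; lra.
  right. unfold Rdiv. rewrite Rpow_mult_distr. replace (1 * / 2) with (/ 2) by ring. field. lra.
Qed.

(** Near each point f is its Taylor series. [series_deriv] differentiates it term by term, and the
    differentiated series is again a dominated series of holomorphic functions; the nested discs
    leave room for the Cauchy estimates. *)
Lemma holo_deriv D f f' : Copen D -> (forall z, D z -> Cderiv f z (f' z) /\ Ccont f' z) -> holo D f'.
Proof.
  intros O H. apply holo_local. intros z Hz.
  destruct (O z Hz) as [rho [Hr Hd]].
  assert (Hf : holo (disc z rho) f) by (exists f'; intros w Hw; apply H, Hd, Hw).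
  set (r := rho / 2). assert (Hr' : 0 < r < rho) by (unfold r; lra).
  destruct (circ_bounded f z rho r Hr' Hf) as [M HM].
  assert (M0 : 0 <= M) by (eapply Rle_trans; [apply Cmod_ge_0|apply (HM 0)]).
  set (A := tcoef f z r).
  set (c := fun k w => (A k * (w - z) ^ k)%C). set (c' := fun k w => (A k * dpow k (w - z))%C).
  assert (Hc : forall k w, Cderiv (c k) w (c' k w)).
  { intros k w. apply (Cderiv_eq _ _ (0 * (w - z) ^ k + A k * (dpow k (w - z) * 1))%C). 2: unfold c'; ring.
    apply (Cderiv_mult (fun _ => A k) (fun w => (w - z) ^ k)%C). apply Cderiv_const.
    apply (Cderiv_comp (fun x => x ^ k)%C (fun w => w - z)%C). 2: apply Cderiv_pow.
    apply (Cderiv_ext_loc (fun w => - z + 1 * w)%C _ _ _ 1). lra. intros; ring. apply Cderiv_affine. }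
  assert (Hc' : forall k D', holo D' (c' k)).
  { intros k D'. unfold c'. apply holo_mult. apply holo_const.
    apply (holo_comp D' (fun _ => True) (dpow k) (fun w => w - z)%C); auto.
    apply holo_minus. apply holo_id. apply holo_const. apply holo_dpow. }
  assert (Bc : forall k w, disc z (r / 2) w -> Cmod (c k w) <= 2 * M * (1/2) ^ k).
  { intros k w Hw. unfold disc in Hw. apply (tcoef_pow_bound f z rho r M k); auto. lra. }
  assert (SB : ex_series (fun k => 2 * M * (1/2) ^ k)) by (apply ex_series_geom_scal; lra).
  assert (Ef : forall w, disc z (r / 2) w -> f w = CSer (fun k => c k w)).
  { intros w Hw. symmetry. apply Cconv_CSer. unfold c, A.
    replace (f w) with (f (z + (w - z))%C) by (f_equal; ring).
    apply (taylor_conv f z rho r); auto. unfold disc in Hw; lra. }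
  exists (r / 4). split. lra.
  assert (Ef' : forall w, disc z (r / 4) w -> CSer (fun k => c' k w) = f' w).
  { intros w Hw. apply (Cderiv_unique f w).
    - apply (Cderiv_ext_loc (fun w => CSer (fun k => c k w)) f w _ (r / 4)). lra.
      intros v Hv. symmetry. apply Ef. unfold disc in *. assert (T := Cmod_tri_minus v z w). lra.
      apply (series_deriv c c' w (r/4) (fun k => 2 * M * (1/2)^k)); auto. lra.
      intros n v Hv. split; auto. split. apply (holo_cont (fun _ => True)); auto.
      apply Bc. unfold disc in *. assert (T := Cmod_tri_minus v z w). lra.
    - apply H, Hd. unfold disc, r in *. lra. }
  apply (holo_ext _ (fun w => CSer (fun k => c' k w))); auto. apply disc_open.
  apply holo_series. intros; apply Hc'.
  intros w Hw. destruct (disc_open z (r/4) w Hw) as [d [Hd1 Hd2]].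
  exists d, (fun k => 4 / (r / 4) * (2 * M * (1/2) ^ k)). split; auto. split.
  apply (ex_series_scal (V := R_NormedModule)); auto.
  intros n v Hv. split; auto. specialize (Hd2 v Hv).
  destruct (deriv_bound (c n) v (r / 4) (2 * M * (1/2) ^ n) (c' n v)) as [K _]; auto. lra.
  exists (c' n). intros u _. split; auto. apply (holo_cont (fun _ => True)); auto.
  intros u Hu. apply Bc. unfold disc in *. assert (T := Cmod_tri_minus u z v). lra.
  eapply Rle_trans. exact K. right. unfold Rdiv. ring.
Qed.

(** Induction on the index: once the lower coefficients agree, the two Taylor estimates at a small
    real h give |difference| * h^k = O(h^(k+1)). This lets bounds obtained on circles of different
    radii be applied to the same coefficients. *)
Lemma tcoef_radius f s0 R0 r1 r2 k : 0 < r1 < R0 -> 0 < r2 < R0 -> holo (disc s0 R0) f ->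
  tcoef f s0 r1 k = tcoef f s0 r2 k.
Proof.
  intros H1 H2 Hf.
  destruct (circ_bounded f s0 R0 r1 H1 Hf) as [M1 HM1]. destruct (circ_bounded f s0 R0 r2 H2 Hf) as [M2 HM2].
  assert (P1 : 0 <= M1) by (eapply Rle_trans; [apply Cmod_ge_0|apply (HM1 0)]).
  assert (P2 : 0 <= M2) by (eapply Rle_trans; [apply Cmod_ge_0|apply (HM2 0)]).
  revert k.
  assert (S : forall k j, (j < k)%nat -> tcoef f s0 r1 j = tcoef f s0 r2 j).
  { induction k; intros j Hj. lia.
    destruct (Nat.eq_dec j k) as [->|]; [|apply IHk; lia].
    destruct (Ceq_dec (tcoef f s0 r1 k) (tcoef f s0 r2 k)) as [|N]; auto. exfalso.
    apply Cminus_neq_0, Cmod_gt_0 in N. set (e := Cmod (tcoef f s0 r1 k - tcoef f s0 r2 k)) in *.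
    set (B := 4 * M1 / r1 ^ S k + 4 * M2 / r2 ^ S k).
    assert (B0 : 0 <= B).
    { unfold B. assert (0 < r1 ^ S k) by (apply pow_lt; lra). assert (0 < r2 ^ S k) by (apply pow_lt; lra).
      apply Rplus_le_le_0_compat; apply Rdiv_le_0_compat; lra. }
    set (h := Rmin (Rmin (r1/2) (r2/2)) (e / (B + 1) / 2)).
    assert (Hh : 0 < h).
    { repeat apply Rmin_glb_lt; try lra. assert (0 < e / (B + 1)) by (apply Rdiv_lt_0_compat; lra). lra. }
    assert (h <= r1 / 2 /\ h <= r2 / 2) as [L1 L2].
    { split; eapply Rle_trans; [apply Rmin_l|apply Rmin_l|apply Rmin_l|apply Rmin_r]. }
    assert (L3 : h * (B + 1) <= e / 2).
    { assert (X : h <= e / (B + 1) / 2) by apply Rmin_r.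
      apply Rmult_le_compat_r with (r := B + 1) in X; [|lra].
      replace (e / (B + 1) / 2 * (B + 1)) with (e / 2) in X by (field; lra). auto. }
    assert (Ch : Cmod (RtoC h) = h) by (rewrite Cmod_R, Rabs_pos_eq; lra).
    assert (T1 := taylor f s0 R0 r1 (RtoC h) M1 (S k) H1 Hf ltac:(rewrite Ch; lra) HM1).
    assert (T2 := taylor f s0 R0 r2 (RtoC h) M2 (S k) H2 Hf ltac:(rewrite Ch; lra) HM2).
    rewrite Ch in T1, T2. simpl csum in T1, T2.
    rewrite (csum_ext _ (fun k => tcoef f s0 r2 k * RtoC h ^ k)%C k) in T1 by (intros; rewrite IHk; auto).
    set (Sm := csum _ k) in *.
    assert (T := Cmod_tri_minus (f (s0 + RtoC h)%C - (Sm + tcoef f s0 r2 k * RtoC h ^ k)) (f (s0 + RtoC h)%C - (Sm + tcoef f s0 r1 k * RtoC h ^ k)) 0).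
    replace (f (s0 + RtoC h) - (Sm + tcoef f s0 r2 k * RtoC h ^ k) - (f (s0 + RtoC h) - (Sm + tcoef f s0 r1 k * RtoC h ^ k)))%C with
       ((tcoef f s0 r1 k - tcoef f s0 r2 k) * RtoC h ^ k)%C in T by ring.
    rewrite Cmod_mult, Cmod_pow, Ch in T. fold e in T. rewrite (Cmod_minus_sym 0) in T.
    replace (f (s0 + RtoC h) - (Sm + tcoef f s0 r2 k * RtoC h ^ k) - 0)%C with (f (s0 + RtoC h) - (Sm + tcoef f s0 r2 k * RtoC h ^ k))%C in T by ring.
    replace (f (s0 + RtoC h) - (Sm + tcoef f s0 r1 k * RtoC h ^ k) - 0)%C with (f (s0 + RtoC h) - (Sm + tcoef f s0 r1 k * RtoC h ^ k))%C in T by ring.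
    assert (Q : forall r M, 0 < r -> h <= r / 2 -> 0 <= M -> 2 * M * (h / r) ^ S k * (r / (r - h)) <= 4 * M / r ^ S k * h ^ S k).
    { intros r M Hr Hh2 HM. assert (0 < r ^ S k) by (apply pow_lt; lra).
      replace (4 * M / r ^ S k * h ^ S k) with (2 * M * (h / r) ^ S k * 2) by (unfold Rdiv; rewrite Rpow_mult_distr, pow_inv; ring).
      apply Rmult_le_compat_l. apply Rmult_le_pos. lra. apply pow_le, Rdiv_le_0_compat; lra.
      apply Rmult_le_reg_r with (r - h). lra. unfold Rdiv. rewrite Rmult_assoc, Rinv_l by lra. lra. }
    assert (Q1 := Q r1 M1 ltac:(lra) L1 P1). assert (Q2 := Q r2 M2 ltac:(lra) L2 P2).
    assert (U : e * h ^ k <= B * h ^ S k) by (unfold B; lra).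
    simpl in U. assert (HP : 0 < h ^ k) by (apply pow_lt; lra).
    assert (e <= B * h). { apply Rmult_le_reg_r with (h ^ k); auto. lra. }
    nra. }
  intros k. apply (S (Datatypes.S k)). lia.
Qed.

(** Away from a the quotient is visibly holomorphic; near a it is the Taylor series of f shifted by
    one index, whose value at a is the first coefficient. *)
Lemma holo_divide D f a : Copen D -> holo D f -> D a -> f a = 0%C ->
  exists g, holo D g /\ forall z, D z -> f z = ((z - a) * g z)%C.
Proof.
  intros O Hf Ha F0. destruct (O a Ha) as [rho [Hr Hd]].
  assert (Hf' : holo (disc a rho) f) by (apply (holo_sub _ D); auto).
  set (r := rho / 2). assert (Hr' : 0 < r < rho) by (unfold r; lra).
  destruct (circ_bounded f a rho r Hr' Hf') as [M HM].
  assert (M0 : 0 <= M) by (eapply Rle_trans; [apply Cmod_ge_0|apply (HM 0)]).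
  set (A := tcoef f a r).
  set (g := fun z => if Ceq_dec z a then A 1%nat else (f z / (z - a))%C).
  assert (G : forall z, z <> a -> g z = (f z / (z - a))%C).
  { intros z Hz. unfold g. destruct (Ceq_dec z a); tauto. }
  assert (G0 : g a = A 1%nat) by (unfold g; destruct (Ceq_dec a a); tauto).
  exists g. split.
  2:{ intros z Hz. destruct (Ceq_dec z a) as [->|N]. rewrite F0. ring.
      rewrite G by auto. field. apply Cminus_neq_0; auto. }
  apply holo_local. intros z Hz. destruct (Ceq_dec z a) as [->|N].
  - exists (r / 2). split. lra.
    set (c := fun k w => (A (S k) * (w - a) ^ k)%C).
    assert (Bc : forall k w, disc a (r/2) w -> Cmod (c k w) <= 2 * M / r * (1/2) ^ k).
    { intros k w Hw. unfold c, disc in *. rewrite Cmod_mult, Cmod_pow.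
      assert (T := tcoef_bound f a rho r M (S k) Hr' Hf' HM). fold A in T.
      assert (P := Cmod_ge_0 (w - a)%C). assert (0 < r ^ k) by (apply pow_lt; lra).
      apply Rle_trans with (2 * M / r ^ S k * (r / 2) ^ k).
      apply Rmult_le_compat; auto. apply Cmod_ge_0. apply pow_le; auto. apply pow_incr; lra.
      right. unfold Rdiv. rewrite Rpow_mult_distr. simpl. replace (1 * / 2) with (/ 2) by ring. field. lra. }
    assert (SB : ex_series (fun k => 2 * M / r * (1/2) ^ k)) by (apply ex_series_geom_scal; lra).
    apply (holo_ext _ (fun w => CSer (fun k => c k w))). apply disc_open.
    + intros w Hw. apply Cconv_CSer. destruct (Ceq_dec w a) as [->|Nw].
      * intros eps He. exists 1%nat. intros n Hn. rewrite G0.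
        replace (csum (fun k => c k a) n) with (A 1%nat). rewrite Cmod_self_0; auto.
        destruct n. lia. clear Hn. induction n. unfold c. simpl. ring.
        change (A 1%nat = csum (fun k => c k a) (S n) + c (S n) a)%C. rewrite <- IHn.
        unfold c. simpl. replace (a - a)%C with (RtoC 0) by ring. ring.
      * rewrite G by auto.
        assert (Nz : (w - a)%C <> 0%C) by (apply Cminus_neq_0; auto).
        assert (T : Cconv (fun k => A k * (w - a) ^ k)%C (f w)).
        { replace (f w) with (f (a + (w - a))%C) by (f_equal; ring).
          apply (taylor_conv f a rho r); auto. unfold disc in Hw; lra. }
        assert (A0 : A 0%nat = 0%C).
        { assert (T0 : Cconv (fun k => A k * (a - a) ^ k)%C (f a)).
          { replace (f a) with (f (a + (a - a))%C) by (f_equal; ring).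
            apply (taylor_conv f a rho r); auto. rewrite Cmod_self_0; lra. }
          rewrite F0 in T0. rewrite <- (Cconv_CSer _ _ T0). symmetry. apply Cconv_CSer.
          intros eps He. exists 1%nat. intros n Hn.
          replace (csum (fun k => A k * (a - a) ^ k)%C n) with (A 0%nat). rewrite Cmod_self_0; auto.
          destruct n. lia. clear Hn. induction n. simpl. ring.
          change (A 0%nat = csum (fun k => A k * (a - a) ^ k)%C (S n) + A (S n) * (a - a) ^ (S n))%C. rewrite <- IHn.
          simpl. replace (a - a)%C with (RtoC 0) by ring. ring. }
        replace (f w / (w - a))%C with (/ (w - a) * f w)%C by (field; auto).
        assert (T2 := Cconv_scal (/ (w - a))%C _ _ T).
        intros eps He. destruct (T2 eps He) as [N2 K]. exists N2. intros n Hn.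
        specialize (K (S n) ltac:(lia)).
        replace (csum (fun k => c k w) n) with (csum (fun k => / (w - a) * (A k * (w - a) ^ k))%C (S n)); auto.
        change (S n) with (1 + n)%nat. rewrite csum_add. simpl csum at 1. rewrite A0.
        replace (0 + / (w - a) * (0 * 1) + csum (fun k => / (w - a) * (A (1 + k)%nat * (w - a) ^ (1 + k))) n)%C
          with (csum (fun k => / (w - a) * (A (1 + k)%nat * (w - a) ^ (1 + k))) n)%C by ring.
        apply csum_ext. intros k _. unfold c. simpl. field; auto.
    + apply holo_series. intros n. unfold c. apply holo_mult. apply holo_const. apply holo_pow.
      apply holo_minus. apply holo_id. apply holo_const.
      intros w Hw. destruct (disc_open a (r/2) w Hw) as [d [Hd1 Hd2]].
      exists d, (fun k => 2 * M / r * (1/2) ^ k). split; auto.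
  - destruct (O z Hz) as [d [Hd1 Hd2]].
    assert (P : 0 < Cmod (z - a)) by (apply Cmod_gt_0, Cminus_neq_0, N).
    assert (Nw : forall w, disc z (Rmin d (Cmod (z - a))) w -> w <> a).
    { intros w Hw E. unfold disc in Hw. rewrite E, Cmod_minus_sym in Hw. apply Rmin_Rgt in Hw. lra. }
    exists (Rmin d (Cmod (z - a))). split. apply Rmin_glb_lt; lra.
    apply (holo_ext _ (fun w => f w / (w - a))%C). apply disc_open.
    intros w Hw. symmetry. apply G. apply Nw; auto.
    apply holo_div. apply (holo_sub _ D); auto. intros w Hw. apply Hd2. unfold disc in Hw. apply Rmin_Rgt in Hw. lra.
    apply holo_minus. apply holo_id. apply holo_const.
    intros w Hw. apply Cminus_neq_0. apply Nw; auto.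
Qed.

(** * Primitives, logarithms and Landau's lemma *)

Lemma CInt_swap f a b : (forall t, Rmin a b <= t <= Rmax a b -> pcont f t) ->
  CInt f a b = (- CInt f b a)%C.
Proof.
  intros H. rewrite Rmin_comm, Rmax_comm in H. destruct (pcont_ex f b a H).
  unfold CInt. apply injective_projections; simpl; symmetry;
  apply (opp_RInt_swap (V := R_CompleteNormedModule)); auto.
Qed.

Lemma CInt_point f a : CInt f a a = 0%C.
Proof. unfold CInt. rewrite !RInt_point. reflexivity. Qed.

Lemma CInt_Chasles f a b c :
  (forall t, Rmin a (Rmin b c) <= t <= Rmax a (Rmax b c) -> pcont f t) ->
  (CInt f a b + CInt f b c = CInt f a c)%C.
Proof.
  intros H.
  assert (X : forall u v, (u = a \/ u = b \/ u = c) -> (v = a \/ v = b \/ v = c) ->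
    ex_RInt (fun t => fst (f t)) u v /\ ex_RInt (fun t => snd (f t)) u v).
  { intros u v Hu Hv. apply pcont_ex. intros t Ht. apply H. revert Ht.
    unfold Rmin, Rmax. repeat destruct (Rle_dec _ _); destruct Hu as [->|[->| ->]], Hv as [->|[->| ->]]; lra. }
  unfold CInt. apply injective_projections; simpl;
  apply (RInt_Chasles (V := R_CompleteNormedModule)); apply X; auto.
Qed.

Lemma CInt_bound_abs (f : R -> C) a b M :
  (forall t, Rmin a b <= t <= Rmax a b -> pcont f t) ->
  (forall t, Rmin a b <= t <= Rmax a b -> Cmod (f t) <= M) -> Cmod (CInt f a b) <= 2 * M * Rabs (b - a).
Proof.
  intros Hc HM. destruct (Rle_dec a b) as [L|L].
  - rewrite Rmin_left, Rmax_right in * by lra. rewrite Rabs_pos_eq by lra. apply CInt_bound; auto.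
  - rewrite Rmin_right, Rmax_left in * by lra. rewrite Rabs_minus_sym, Rabs_pos_eq by lra.
    rewrite CInt_swap, Cmod_opp. apply CInt_bound; auto. lra.
    intros t. rewrite Rmin_right, Rmax_left by lra. auto.
Qed.

Lemma rect_cauchy_gen g a b c d x0 x y0 y :
  holo (rect a b c d) g -> rect a b c d (x0, y0) -> rect a b c d (x, y) ->
  (CInt (fun v => g (x, v)) y0 y - CInt (fun v => g (x0, v)) y0 y =
   - Ci * (CInt (fun u => g (u, y)) x0 x - CInt (fun u => g (u, y0)) x0 x))%C.
Proof.
  intros Hg [A0 B0] [A B]; simpl in *.
  assert (M : forall u1 u2 v1 v2, a < u1 -> u2 < b -> c < v1 -> v2 < d -> u1 <= u2 -> v1 <= v2 ->
   (CInt (fun v => g (u2, v)) v1 v2 - CInt (fun v => g (u1, v)) v1 v2 =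
   - Ci * (CInt (fun u => g (u, v2)) u1 u2 - CInt (fun u => g (u, v1)) u1 u2))%C).
  { intros u1 u2 v1 v2 H1 H2 H3 H4 H5 H6.
    apply (rect_cauchy g u1 u2 v1 v2 (Rmin (Rmin (u1 - a) (b - u2)) (Rmin (v1 - c) (d - v2)))); auto.
    repeat apply Rmin_glb_lt; lra.
    apply (holo_sub _ (rect a b c d)); auto. intros z [Z1 Z2].
    set (m := Rmin _ _) in *.
    assert (m <= u1 - a) by (eapply Rle_trans; [apply Rmin_l|apply Rmin_l]).
    assert (m <= b - u2) by (eapply Rle_trans; [apply Rmin_l|apply Rmin_r]).
    assert (m <= v1 - c) by (eapply Rle_trans; [apply Rmin_r|apply Rmin_l]).
    assert (m <= d - v2) by (eapply Rle_trans; [apply Rmin_r|apply Rmin_r]).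
    unfold rect. lra. }
  assert (Sh : forall v, c < v < d -> CInt (fun u => g (u, v)) x0 x = (- CInt (fun u => g (u, v)) x x0)%C).
  { intros v Hv. apply CInt_swap. intros t Ht. apply (pcont_comp g (fun u => (u, v))). 2: apply pcont_h.
    apply (holo_cont (rect a b c d)); auto. split; simpl; auto. unfold Rmin, Rmax in Ht. destruct (Rle_dec x0 x); lra. }
  assert (Sv : forall u, a < u < b -> CInt (fun v => g (u, v)) y0 y = (- CInt (fun v => g (u, v)) y y0)%C).
  { intros u Hu. apply CInt_swap. intros t Ht. apply (pcont_comp g (fun v => (u, v))). 2: apply pcont_v.
    apply (holo_cont (rect a b c d)); auto. split; simpl; auto. unfold Rmin, Rmax in Ht. destruct (Rle_dec y0 y); lra. }
  destruct (Rle_dec x0 x), (Rle_dec y0 y).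
  - apply M; lra.
  - rewrite (Sv x), (Sv x0) by lra.
    assert (E := M x0 x y y0 ltac:(lra) ltac:(lra) ltac:(lra) ltac:(lra) ltac:(lra) ltac:(lra)).
    replace (- CInt (fun v => g (x, v)) y y0 - - CInt (fun v => g (x0, v)) y y0)%C
      with (- (CInt (fun v => g (x, v)) y y0 - CInt (fun v => g (x0, v)) y y0))%C by ring.
    rewrite E. ring.
  - rewrite (Sh y), (Sh y0) by lra.
    assert (E := M x x0 y0 y ltac:(lra) ltac:(lra) ltac:(lra) ltac:(lra) ltac:(lra) ltac:(lra)).
    replace (CInt (fun v => g (x, v)) y0 y - CInt (fun v => g (x0, v)) y0 y)%C
      with (- (CInt (fun v => g (x0, v)) y0 y - CInt (fun v => g (x, v)) y0 y))%C by ring.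
    rewrite E. ring.
  - rewrite (Sh y), (Sh y0) by lra.
    rewrite (Sv x), (Sv x0) by lra.
    assert (E := M x x0 y y0 ltac:(lra) ltac:(lra) ltac:(lra) ltac:(lra) ltac:(lra) ltac:(lra)).
    replace (- CInt (fun v => g (x, v)) y y0 - - CInt (fun v => g (x0, v)) y y0)%C
      with (CInt (fun v => g (x0, v)) y y0 - CInt (fun v => g (x, v)) y y0)%C by ring.
    rewrite E. ring.
Qed.

(** Integral of g along a vertical and then a horizontal segment from the base point;
    [rect_cauchy_gen] shows that the opposite order gives the same value. *)
Definition prim (g : C -> C) (x0 y0 : R) (z : C) : C :=
  (CInt (fun u => g (u, snd z)) x0 (fst z) + Ci * CInt (fun v => g (x0, v)) y0 (snd z))%C.

Lemma prim_deriv g a b c d x0 y0 z : holo (rect a b c d) g -> rect a b c d (x0, y0) -> rect a b c d z ->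
  Cderiv (prim g x0 y0) z (g z).
Proof.
  intros Hg H0 Hz. destruct z as [x y].
  (* The path through the other corner: with it a vertical increment of the primitive is a single
     integral, as a horizontal one is with the definition. *)
  assert (Alt : forall u v, rect a b c d (u, v) -> prim g x0 y0 (u, v) =
     (CInt (fun w => g (w, y0)) x0 u + Ci * CInt (fun w => g (u, w)) y0 v)%C).
  { intros u v Huv. unfold prim; simpl.
    assert (E := rect_cauchy_gen g a b c d x0 u y0 v Hg H0 Huv).
    replace (CInt (fun w => g (u, w)) y0 v) with ((CInt (fun w => g (u, w)) y0 v - CInt (fun w => g (x0, w)) y0 v) + CInt (fun w => g (x0, w)) y0 v)%C by ring.
    rewrite E. set (p := CInt _ x0 u). set (q := CInt _ x0 u). set (w := CInt _ y0 v).
    apply injective_projections; simpl; ring. }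
  assert (Ph : forall u v, rect a b c d (u, v) -> pcont (fun u => g (u, v)) u).
  { intros u v Huv. apply (pcont_comp g (fun u => (u, v))). eapply holo_cont; eauto. apply pcont_h. }
  assert (Pv : forall u v, rect a b c d (u, v) -> pcont (fun v => g (u, v)) v).
  { intros u v Huv. apply (pcont_comp g (fun v => (u, v))). eapply holo_cont; eauto. apply pcont_v. }
  intros eps He.
  destruct (holo_cont _ _ _ Hg Hz (eps / 4)) as [d1 [Hd1 K1]]. lra.
  destruct (rect_open a b c d _ Hz) as [d2 [Hd2 K2]].
  exists (Rmin (d1 / 2) (d2 / 2)). split. apply Rmin_glb_lt; lra.
  intros [u v] Hw. apply Rmin_Rgt in Hw. destruct Hw as [W1 W2].
  assert (Du := Cmod_fst ((u, v) - (x, y))%C). assert (Dv := Cmod_snd ((u, v) - (x, y))%C). simpl in Du, Dv.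
  set (h := Cmod ((u, v) - (x, y))) in *.
  fold (u - x) in Du. fold (v - y) in Dv.
  assert (Huv : rect a b c d (u, v)) by (apply K2; fold h; lra).
  assert (Huy : rect a b c d (u, y)) by (destruct Huv, Hz; split; simpl in *; auto).
  destruct H0 as [X0 Y0]. destruct Hz as [Xz Yz]. destruct Huv as [Xu Yv]. simpl in *.
  assert (In : forall p q, Rmin x u <= p <= Rmax x u -> Rmin y v <= q <= Rmax y v ->
     rect a b c d (p, q) /\ Cmod (g (p, q) - g (x, y)) <= eps / 4).
  { intros p q Hp Hq. split.
    unfold Rmin, Rmax in *. destruct (Rle_dec x u), (Rle_dec y v); split; simpl; lra.
    left. apply K1. eapply Rle_lt_trans. apply Cmod_le_sum. simpl.
    assert (Rabs (p + - x) <= Rabs (u - x)).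
    { unfold Rmin, Rmax in Hp. destruct (Rle_dec x u). rewrite !Rabs_pos_eq; lra. rewrite !Rabs_left1; lra. }
    assert (Rabs (q + - y) <= Rabs (v - y)).
    { unfold Rmin, Rmax in Hq. destruct (Rle_dec y v). rewrite !Rabs_pos_eq; lra. rewrite !Rabs_left1; lra. }
    lra. }
  assert (Dh : (prim g x0 y0 (u, y) - prim g x0 y0 (x, y) = CInt (fun w => g (w, y)) x u)%C).
  { unfold prim; simpl. rewrite <- (CInt_Chasles (fun w => g (w, y)) x0 x u). ring.
    intros t Ht. apply Ph. split; simpl; auto.
    unfold Rmin, Rmax in Ht. repeat destruct (Rle_dec _ _); lra. }
  assert (Dv' : (prim g x0 y0 (u, v) - prim g x0 y0 (u, y) = Ci * CInt (fun w => g (u, w)) y v)%C).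
  { rewrite !Alt by (split; simpl; auto). rewrite <- (CInt_Chasles (fun w => g (u, w)) y0 y v). ring.
    intros t Ht. apply Pv. split; simpl; auto.
    unfold Rmin, Rmax in Ht. repeat destruct (Rle_dec _ _); lra. }
  assert (Hx : x = x) by auto.
  assert (E1 : (CInt (fun w => g (w, y)) x u = RtoC (u - x) * g (x, y) + CInt (fun w => g (w, y) + (- g (x, y))) x u)%C).
  { rewrite CInt_plus, CInt_const. ring.
    intros t Ht. apply Ph. apply In; auto. unfold Rmin, Rmax; destruct (Rle_dec y v); lra.
    intros; apply pcont_const. }
  assert (E2 : (CInt (fun w => g (u, w)) y v = RtoC (v - y) * g (x, y) + CInt (fun w => g (u, w) + (- g (x, y))) y v)%C).
  { rewrite CInt_plus, CInt_const. ring.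
    intros t Ht. apply Pv. apply In; auto. unfold Rmin, Rmax; destruct (Rle_dec x u); lra.
    intros; apply pcont_const. }
  replace (prim g x0 y0 (u, v) - prim g x0 y0 (x, y) - g (x, y) * ((u, v) - (x, y)))%C with
    (CInt (fun w => g (w, y) + (- g (x, y)))%C x u + Ci * CInt (fun w => g (u, w) + (- g (x, y)))%C y v)%C.
  2:{ replace (prim g x0 y0 (u, v) - prim g x0 y0 (x, y))%C with
       ((prim g x0 y0 (u, y) - prim g x0 y0 (x, y)) + (prim g x0 y0 (u, v) - prim g x0 y0 (u, y)))%C by ring.
      rewrite Dh, Dv', E1, E2.
      replace ((u, v) - (x, y))%C with (RtoC (u - x) + Ci * RtoC (v - y))%C
        by (apply injective_projections; simpl; ring). ring. }
  eapply Rle_trans. apply Cmod_triangle. rewrite Cmod_mult, Cmod_Ci, Rmult_1_l.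
  assert (B1 : Cmod (CInt (fun w => g (w, y) + (- g (x, y)))%C x u) <= 2 * (eps / 4) * Rabs (u - x)).
  { apply CInt_bound_abs. intros t Ht. apply pcont_plus. apply Ph. apply In; auto.
    unfold Rmin, Rmax; destruct (Rle_dec y v); lra. apply pcont_const.
    intros t Ht. apply In; auto. unfold Rmin, Rmax; destruct (Rle_dec y v); lra. }
  assert (B2 : Cmod (CInt (fun w => g (u, w) + (- g (x, y)))%C y v) <= 2 * (eps / 4) * Rabs (v - y)).
  { apply CInt_bound_abs. intros t Ht. apply pcont_plus. apply Pv. apply In; auto.
    unfold Rmin, Rmax; destruct (Rle_dec x u); lra. apply pcont_const.
    intros t Ht. apply In; auto. unfold Rmin, Rmax; destruct (Rle_dec x u); lra. }
  assert (2 * (eps / 4) * Rabs (u - x) <= 2 * (eps / 4) * h) by (apply Rmult_le_compat_l; lra).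
  assert (2 * (eps / 4) * Rabs (v - y) <= 2 * (eps / 4) * h) by (apply Rmult_le_compat_l; lra).
  lra.
Qed.

Lemma is_derive_0_const (f : R -> R) a b : (forall t, Rmin a b <= t <= Rmax a b -> is_derive f t 0) -> f a = f b.
Proof.
  intros H. destruct (Rtotal_order a b) as [L|[E|L]].
  - apply (eq_is_derive (V := R_NormedModule) f a b); auto. intros t Ht. apply H.
    rewrite Rmin_left, Rmax_right; lra.
  - now rewrite E.
  - symmetry. apply (eq_is_derive (V := R_NormedModule) f b a); auto. intros t Ht. apply H.
    rewrite Rmin_right, Rmax_left; lra.
Qed.

Lemma rect_const f a b c d z w : (forall z, rect a b c d z -> Cderiv f z 0) ->
  rect a b c d z -> rect a b c d w -> f z = f w.
Proof.
  intros H Hz Hw. destruct z as [x y], w as [u v]. destruct Hz as [X Y], Hw as [U V]. simpl in *.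
  assert (K : forall p q, a < p < b -> c < q < d -> Cderiv f (p, q) 0) by (intros; apply H; split; auto).
  transitivity (f (u, y)).
  - apply injective_projections.
    apply (is_derive_0_const (fun p => fst (f (p, y)))); intros t Ht; apply (Cderiv_h f t y 0), K; auto;
    unfold Rmin, Rmax in Ht; repeat destruct (Rle_dec _ _); lra.
    apply (is_derive_0_const (fun p => snd (f (p, y)))); intros t Ht; apply (Cderiv_h f t y 0), K; auto;
    unfold Rmin, Rmax in Ht; repeat destruct (Rle_dec _ _); lra.
  - assert (K2 : forall t, Rmin y v <= t <= Rmax y v ->
      is_derive (fun v => fst (f (u, v))) t 0 /\ is_derive (fun v => snd (f (u, v))) t 0).
    { intros t Ht. destruct (Cderiv_v f u t 0) as [A B]. apply K; auto.
      unfold Rmin, Rmax in Ht; repeat destruct (Rle_dec _ _); lra.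
      simpl in A, B. rewrite Ropp_0 in A. auto. }
    apply injective_projections.
    apply (is_derive_0_const (fun q => fst (f (u, q)))); intros; apply K2; auto.
    apply (is_derive_0_const (fun q => snd (f (u, q)))); intros; apply K2; auto.
Qed.

(** The logarithm is a primitive of W'/W, and exp(- l) W has derivative 0. A positive base value
    makes [ln] provide the constant. The last clause is what later singles out the positive square
    root on the real axis. *)
Lemma log_exists W a b c d x0 y0 w0 : holo (rect a b c d) W ->
  (forall z, rect a b c d z -> W z <> 0%C) -> rect a b c d (x0, y0) -> W (x0, y0) = RtoC w0 -> 0 < w0 ->
  exists l, holo (rect a b c d) l /\ (forall z, rect a b c d z -> Cexp (l z) = W z) /\
    l (x0, y0) = RtoC (ln w0) /\
    ((forall x, rect a b c d (x, y0) -> snd (W (x, y0)) = 0) ->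
       forall x, rect a b c d (x, y0) -> snd (l (x, y0)) = 0).
Proof.
  intros HW N H0 E0 P0. assert (O := rect_open a b c d).
  destruct HW as [W' HW'].
  assert (HW : holo (rect a b c d) W) by (exists W'; auto).
  assert (HWd : holo (rect a b c d) W') by (eapply holo_deriv; eauto).
  set (g := fun z => (W' z / W z)%C).
  assert (Hg : holo (rect a b c d) g) by (apply holo_div; auto).
  set (l := fun z => (prim g x0 y0 z + RtoC (ln w0))%C).
  assert (Hl : forall z, rect a b c d z -> Cderiv l z (g z)).
  { intros z Hz. apply (Cderiv_eq _ _ (g z + 0)%C); [|ring]. apply Cderiv_plus.
    eapply prim_deriv; eauto. apply Cderiv_const. }
  assert (L0 : l (x0, y0) = RtoC (ln w0)).
  { unfold l, prim. cbn [fst snd]. rewrite !CInt_point. ring. }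
  exists l. split; [|split; [|split]]; auto.
  - apply (holo_intro _ _ g); auto. intros; eapply holo_cont; eauto.
  - intros z Hz. assert (C : (Cexp (- l z) * W z = Cexp (- l (x0, y0)) * W (x0, y0))%C).
    { apply (rect_const (fun z => Cexp (- l z) * W z)%C a b c d); auto. intros w Hw.
      apply (Cderiv_eq _ _ (Cexp (- l w) * (- g w) * W w + Cexp (- l w) * W' w)%C).
      2:{ unfold g. field. apply N; auto. }
      apply (Cderiv_mult (fun z => Cexp (- l z)) W). 2: apply HW'; auto.
      apply (Cderiv_comp Cexp (fun z => - l z)%C). 2: apply Cderiv_Cexp.
      apply (Cderiv_ext_loc (fun z => (-1) * l z)%C _ _ _ 1). lra. intros; ring.
      apply (Cderiv_eq _ _ (0 * l w + (-1) * g w)%C); [|ring].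
      apply (Cderiv_mult (fun _ => (-1)%C) l); auto. apply Cderiv_const. }
    rewrite L0, E0, !Cexp_opp, Cexp_RtoC, exp_ln in C by auto.
    replace (/ RtoC w0 * RtoC w0)%C with (RtoC 1) in C
      by (field; intros X; apply (f_equal fst) in X; simpl in X; lra).
    replace (Cexp (l z)) with (Cexp (l z) * (/ Cexp (l z) * W z))%C by (rewrite C; ring).
    field. apply Cexp_neq_0.
  - intros R1 x Hx.
    assert (El : l (x, y0) = (CInt (fun u => g (u, y0)) x0 x + RtoC (ln w0))%C).
    { unfold l, prim. cbn [fst snd]. rewrite CInt_point. ring. }
    rewrite El. unfold CInt; simpl.
    rewrite (RInt_ext _ (fun _ => 0)). rewrite RInt_const. unfold scal; simpl; unfold mult; simpl. ring.
    intros t Ht.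
    assert (Ht2 : rect a b c d (t, y0)).
    { destruct H0 as [A B], Hx as [A' B']; simpl in *. split; simpl; auto.
      unfold Rmin, Rmax in Ht. destruct (Rle_dec x0 x); lra. }
    assert (D := proj1 (HW' _ Ht2)). apply Cderiv_h in D. destruct D as [_ D].
    assert (D0 : snd (W' (t, y0)) = 0).
    { rewrite <- (is_derive_unique _ _ _ D).
      assert (Z : is_derive (fun u => snd (W (u, y0))) t 0).
      { apply (is_derive_ext_loc (fun _ => 0)). 2: apply (is_derive_const (V := R_NormedModule)).
        destruct (O _ Ht2) as [e [He Ke]]. exists (mkposreal e He). intros u Hu.
        symmetry. apply R1. apply Ke. eapply Rle_lt_trans. apply Cmod_le_sum. simpl.
        replace (y0 + - y0) with 0 by ring. rewrite Rabs_R0, Rplus_0_r. exact Hu. }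
      apply is_derive_unique; auto. }
    unfold g, Cdiv. assert (W0 := R1 t Ht2). simpl. rewrite D0, W0. unfold Rdiv. ring.
Qed.

(** * Families of zeros and Landau's lemma *)

Fixpoint prodl (rs : list C) (w : C) : C :=
  match rs with nil => 1%C | r :: l => ((w - r) * prodl l w)%C end.

Fixpoint suml (rs : list C) (w : C) : C :=
  match rs with nil => 0%C | r :: l => (/ (w - r) + suml l w)%C end.

Lemma Cderiv_prodl rs w : (forall r, In r rs -> w <> r) ->
  Cderiv (prodl rs) w (prodl rs w * suml rs w).
Proof.
  induction rs as [|r l IH]; intros H; simpl.
  - apply (Cderiv_eq _ _ 0%C); [|ring]. apply (Cderiv_const (RtoC 1)).
  - assert (N : (w - r)%C <> 0%C) by (apply Cminus_neq_0, H; left; auto).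
    apply (Cderiv_eq _ _ (1 * prodl l w + (w - r) * (prodl l w * suml l w))%C).
    apply (Cderiv_mult (fun w => w - r)%C (prodl l)).
    apply (Cderiv_ext_loc (fun w => - r + 1 * w)%C _ _ _ 1). lra. intros; ring. apply Cderiv_affine.
    apply IH. intros; apply H; right; auto. field; auto.
Qed.

Lemma prodl_neq rs w : (forall r, In r rs -> w <> r) -> prodl rs w <> 0%C.
Proof.
  induction rs as [|r l IH]; intros H; simpl. intros X; apply (f_equal fst) in X; simpl in X; lra.
  apply Cmult_neq_0. apply Cminus_neq_0, H; left; auto. apply IH. intros; apply H; right; auto.
Qed.

Lemma prodl_root rs w : prodl rs w = 0%C -> In w rs.
Proof.
  intros E. apply NNPP. intros N. revert E. apply prodl_neq. intros r Hr ->. auto.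
Qed.

Lemma prodl_ge rs w k : 0 <= k -> (forall r, In r rs -> k <= Cmod (w - r)) -> k ^ length rs <= Cmod (prodl rs w).
Proof.
  intros K H. induction rs as [|r l IH]; simpl. rewrite Cmod_1; lra.
  rewrite Cmod_mult. apply Rmult_le_compat; auto. apply pow_le; auto. apply H; left; auto.
  apply IH. intros; apply H; right; auto.
Qed.

Lemma prodl_le rs w k : (forall r, In r rs -> Cmod (w - r) <= k) -> Cmod (prodl rs w) <= k ^ length rs.
Proof.
  intros H. induction rs as [|r l IH]; simpl. rewrite Cmod_1; lra.
  rewrite Cmod_mult. apply Rmult_le_compat; try apply Cmod_ge_0. apply H; left; auto.
  apply IH. intros; apply H; right; auto.
Qed.

Lemma fst_Cinv z : fst (/ z)%C = fst z / (fst z * fst z + snd z * snd z).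
Proof. simpl. unfold Rdiv. f_equal. f_equal. ring. Qed.

Lemma fst_Cinv_ge0 z : 0 <= fst z -> 0 <= fst (/ z)%C.
Proof.
  intros H. rewrite fst_Cinv. destruct (Req_dec (fst z * fst z + snd z * snd z) 0) as [E|N].
  (* At z = 0 the inverse takes its default value 0. *)
  rewrite E. unfold Rdiv. rewrite Rinv_0. lra.
  apply Rdiv_le_0_compat; auto. assert (0 <= fst z * fst z + snd z * snd z) by nra. lra.
Qed.

Lemma suml_ge0 rs w : (forall r, In r rs -> fst r <= fst w) -> 0 <= fst (suml rs w).
Proof.
  intros H. induction rs as [|r l IH]. simpl; lra.
  change (0 <= fst (/ (w - r))%C + fst (suml l w)).
  assert (A : 0 <= fst (/ (w - r))%C). { apply fst_Cinv_ge0. simpl. specialize (H r (or_introl eq_refl)). lra. }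
  assert (0 <= fst (suml l w)). { apply IH. intros; apply H; right; auto. } lra.
Qed.

Lemma suml_ge rs w r0 : (forall r, In r rs -> fst r <= fst w) -> In r0 rs -> fst (/ (w - r0))%C <= fst (suml rs w).
Proof.
  intros H. induction rs as [|r l IH]. intros [].
  change (In r0 (r :: l) -> fst (/ (w - r0))%C <= fst (/ (w - r))%C + fst (suml l w)).
  assert (A : 0 <= fst (/ (w - r))%C). { apply fst_Cinv_ge0. simpl. specialize (H r (or_introl eq_refl)). lra. }
  assert (B : 0 <= fst (suml l w)). { apply suml_ge0. intros; apply H; right; auto. }
  intros [->|Hi]. lra. assert (Q := IH (fun r Hr => H r (or_intror Hr)) Hi). lra.
Qed.

Lemma max_nat (P : nat -> Prop) N : P 0%nat -> (forall n, P n -> (n <= N)%nat) -> exists n, P n /\ ~ P (S n).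
Proof.
  intros H0 HN. apply NNPP. intros X.
  assert (A : forall n, P n). { induction n; auto. apply NNPP. intros Y. apply X. exists n; auto. }
  specialize (HN (S N) (A _)). lia.
Qed.

(* Landau's lemma: divide out a maximal family of zeros in the quarter disc (there are at most
   [O(M)] of them by the growth bound) and apply Borel-Caratheodory to what remains. *)
Lemma landau f s0 R0 M l : 0 < R0 -> 0 <= M -> holo (disc s0 R0) f -> f s0 <> 0%C ->
  (forall w, disc s0 R0 w -> Cmod (f w) <= exp M * Cmod (f s0)) ->
  (forall w, disc s0 R0 w -> f w = 0%C -> fst w <= fst s0) ->
  Cderiv f s0 l ->
  - (64 * (M + 2) / R0) <= fst (l / f s0)%C /\
  forall w, disc s0 (R0 / 4) w -> f w = 0%C ->
    fst (/ (s0 - w))%C - 64 * (M + 2) / R0 <= fst (l / f s0)%C.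
Proof.
  intros HR HM Hf F0 HB HZ Hl.
  assert (Sin : forall r, 0 < r -> disc s0 r s0) by (intros; unfold disc; rewrite Cmod_self_0; lra).
  assert (F0p : 0 < Cmod (f s0)) by (apply Cmod_gt_0; auto).
  set (fac := fun n => exists rs g, length rs = n /\ (forall r, In r rs -> disc s0 (R0/4) r) /\
     holo (disc s0 R0) g /\ forall w, disc s0 R0 w -> f w = (prodl rs w * g w)%C).
  (* On the circle of radius 3 R0 / 4 every linear factor is at least R0 / 2, whereas at s0 it is at
     most R0 / 4: each extracted zero gains a factor 2. The 3 is Taylor's estimate with no terms, 2
     r / (r - R0 / 4). *)
  assert (Bnd : forall rs g, (forall r, In r rs -> disc s0 (R0/4) r) ->
     holo (disc s0 R0) g -> (forall w, disc s0 R0 w -> f w = (prodl rs w * g w)%C) ->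
     forall w, disc s0 (R0 / 4) w -> Cmod (g w) * 2 ^ length rs <= 3 * exp M * Cmod (g s0)).
  { intros rs g Hrs Hg Hfg w Hw. set (n := length rs).
    set (r := 3 * R0 / 4). assert (Hr : 0 < r < R0) by (unfold r; lra).
    assert (P1 : 0 < (R0 / 2) ^ n) by (apply pow_lt; lra).
    assert (P2 : 0 < (R0 / 4) ^ n) by (apply pow_lt; lra).
    assert (G0 : Cmod (f s0) <= (R0 / 4) ^ n * Cmod (g s0)).
    { rewrite Hfg, Cmod_mult by auto. apply Rmult_le_compat_r. apply Cmod_ge_0.
      apply prodl_le. intros q Hq. rewrite Cmod_minus_sym. left. apply Hrs; auto. }
    set (B := exp M * Cmod (f s0) / (R0 / 2) ^ n).
    assert (HC : forall t, Cmod (g (s0 + circ r t)%C) <= B).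
    { intros t. assert (I := circ_in s0 R0 r Hr t). assert (Q := HB _ I). rewrite Hfg, Cmod_mult in Q by auto.
      assert (Q2 : (R0 / 2) ^ n <= Cmod (prodl rs (s0 + circ r t))).
      { apply prodl_ge. lra. intros q Hq. specialize (Hrs q Hq). unfold disc in Hrs.
        assert (T := Cmod_ge_minus (circ r t) (q - s0)). rewrite Cmod_circ in T by lra.
        replace (s0 + circ r t - q)%C with (circ r t - (q - s0))%C by ring. unfold r in T at 1. lra. }
      unfold B. apply Rmult_le_reg_r with ((R0 / 2) ^ n); auto.
      unfold Rdiv at 2. rewrite Rmult_assoc, Rinv_l, Rmult_1_r by lra.
      eapply Rle_trans; [|exact Q]. rewrite Rmult_comm. apply Rmult_le_compat_r; auto. apply Cmod_ge_0. }
    assert (B0 : 0 <= B) by (eapply Rle_trans; [apply Cmod_ge_0|apply (HC 0)]).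
    unfold disc in Hw.
    assert (T := taylor g s0 R0 r (w - s0)%C B 0 Hr Hg ltac:(unfold r; lra) HC). simpl in T.
    replace (s0 + (w - s0))%C with w in T by ring. replace (g w - 0)%C with (g w) in T by ring.
    assert (X : r / (r - Cmod (w - s0)) <= 3 / 2).
    { apply Rmult_le_reg_r with (r - Cmod (w - s0)). unfold r; lra.
      unfold Rdiv at 1. rewrite Rmult_assoc, Rinv_l by (unfold r; lra). unfold r; lra. }
    assert (T2 : Cmod (g w) <= 3 * B).
    { eapply Rle_trans. exact T. replace (3 * B) with (2 * B * 1 * (3 / 2)) by field.
      apply Rmult_le_compat_l; auto. lra. }
    assert (P3 : 0 < 2 ^ n) by (apply pow_lt; lra).
    apply Rle_trans with (3 * B * 2 ^ n). apply Rmult_le_compat_r; lra.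
    unfold B. apply Rmult_le_reg_r with ((R0 / 2) ^ n); auto.
    replace (3 * (exp M * Cmod (f s0) / (R0 / 2) ^ n) * 2 ^ n * (R0 / 2) ^ n) with (3 * exp M * 2 ^ n * Cmod (f s0)) by (field; lra).
    assert (E : (R0 / 2) ^ n = 2 ^ n * (R0 / 4) ^ n) by (rewrite <- Rpow_mult_distr; f_equal; field).
    rewrite E. assert (0 < exp M) by apply exp_pos.
    replace (3 * exp M * Cmod (g s0) * (2 ^ n * (R0 / 4) ^ n)) with (3 * exp M * 2 ^ n * ((R0 / 4) ^ n * Cmod (g s0))) by ring.
    apply Rmult_le_compat_l; auto. repeat apply Rmult_le_pos; lra. }
  assert (Gn : forall rs g, (forall w, disc s0 R0 w -> f w = (prodl rs w * g w)%C) -> g s0 <> 0%C).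
  { intros rs g Hfg E. apply F0. rewrite Hfg, E by auto. ring. }
  (* A power of 2 above 3 exp M bounds the number of zeros that can be extracted. *)
  destruct (Pow_x_infinity 2) with (b := 3 * exp M + 1) as [N HN]. rewrite Rabs_pos_eq; lra.
  destruct (max_nat fac N) as [n [(rs & g & Hlen & Hrs & Hg & Hfg) Hmax]].
  - exists nil, f. simpl. split; auto. split. intros r []. split; auto. intros; ring.
  - intros n (rs & g & Hlen & Hrs & Hg & Hfg). destruct (Nat.le_gt_cases n N); auto. exfalso.
    assert (Q := Bnd rs g Hrs Hg Hfg s0 (Sin (R0 / 4) ltac:(lra))). rewrite Hlen in Q.
    assert (0 < Cmod (g s0)) by (apply Cmod_gt_0; eapply Gn; eauto).
    assert (HNn := HN n). specialize (HNn ltac:(clear - H; lia)). clear HN. rename HNn into HN. rewrite Rabs_pos_eq in HN by (apply pow_le; lra).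
    assert (2 ^ n <= 3 * exp M). { apply Rmult_le_reg_r with (Cmod (g s0)); auto. lra. } lra.
  - assert (G0 := Gn rs g Hfg). assert (G0p : 0 < Cmod (g s0)) by (apply Cmod_gt_0; auto).
    (* A zero of g in the quarter disc could be divided out as well, against maximality. *)
    assert (Gnz : forall w, disc s0 (R0 / 4) w -> g w <> 0%C).
    { intros w Hw E. apply Hmax.
      assert (Hw' : disc s0 R0 w) by (unfold disc in *; lra).
      destruct (holo_divide (disc s0 R0) g w (disc_open _ _) Hg Hw' E) as [g1 [Hg1 Eg1]].
      exists (w :: rs), g1. simpl. split. auto. split. intros r [<-|Hr]; auto. split; auto.
      intros v Hv. rewrite Hfg, Eg1 by auto. ring. }
    assert (Gle : forall w, disc s0 (R0 / 4) w -> Cmod (g w) <= 3 * exp M * Cmod (g s0)).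
    { intros w Hw. eapply Rle_trans; [|apply (Bnd rs g); eauto].
      rewrite <- (Rmult_1_r (Cmod (g w))) at 1. apply Rmult_le_compat_l. apply Cmod_ge_0. apply pow_R1_Rle; lra. }
    (* The square of half side R0 / 8 lies in the quarter disc and contains the disc of radius a;
       logarithms are available on rectangles. *)
    set (a := R0 / 8).
    assert (Rsub : forall z, rect (fst s0 - a) (fst s0 + a) (snd s0 - a) (snd s0 + a) z -> disc s0 (R0 / 4) z).
    { intros z [Z1 Z2]. unfold disc. eapply Rle_lt_trans. apply Cmod_le_sum. simpl.
      assert (Rabs (fst z + - fst s0) < a) by (apply Rabs_def1; lra).
      assert (Rabs (snd z + - snd s0) < a) by (apply Rabs_def1; lra). unfold a in *. lra. }
    assert (Dsub : forall z, disc s0 a z -> rect (fst s0 - a) (fst s0 + a) (snd s0 - a) (snd s0 + a) z).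
    { intros z Hz. unfold disc in Hz. assert (U1 := Cmod_fst (z - s0)%C). assert (U2 := Cmod_snd (z - s0)%C).
      simpl in U1, U2. assert (U3 := Rle_lt_trans _ _ _ U1 Hz). assert (U4 := Rle_lt_trans _ _ _ U2 Hz).
      apply Rabs_def2 in U3, U4. split; lra. }
    set (G := fun z => (g z / g s0)%C).
    assert (HG : holo (disc s0 R0) G) by (apply holo_mult; auto; apply holo_const).
    destruct (log_exists G (fst s0 - a) (fst s0 + a) (snd s0 - a) (snd s0 + a) (fst s0) (snd s0) 1) as (h & Hh & Eh & h0 & _).
    { apply (holo_sub _ (disc s0 R0)); auto. intros z Hz. apply Rsub in Hz. unfold disc in *; lra. }
    { intros z Hz. unfold G. apply Cmult_neq_0. apply Gnz; auto. intros X.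
      apply (f_equal Cmod) in X. rewrite Cmod_inv, Cmod_0 in X by auto.
      assert (0 < / Cmod (g s0)) by (apply Rinv_0_lt_compat; auto). lra. }
    { split; simpl; unfold a; lra. }
    { rewrite <- surjective_pairing. unfold G. field; auto. }
    { lra. }
    rewrite <- surjective_pairing, ln_1 in h0.
    assert (Hhd : holo (disc s0 a) h) by (apply (holo_sub _ _ h Dsub); auto).
    (* The 2 absorbs the factor 3, since 3 <= exp 2. *)
    assert (Reh : forall z, disc s0 a z -> fst (h z) <= M + 2).
    { intros z Hz. assert (E := Eh z (Dsub z Hz)). apply (f_equal Cmod) in E. rewrite Cmod_Cexp in E.
      rewrite <- (ln_exp (fst (h z))), <- (ln_exp (M + 2)). rewrite E.
      assert (L : Cmod (G z) <= exp (M + 2)).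
      { unfold G. rewrite Cmod_div by auto. apply Rmult_le_reg_r with (Cmod (g s0)); auto.
        unfold Rdiv. rewrite Rmult_assoc, Rinv_l, Rmult_1_r by lra.
        eapply Rle_trans. apply Gle. unfold disc, a in *; lra.
        apply Rmult_le_compat_r. lra. rewrite exp_plus, Rmult_comm. apply Rmult_le_compat_l. left; apply exp_pos.
        assert (X := exp_ineq1 2). lra. }
      destruct L as [L|L]. left. apply ln_increasing; auto. rewrite <- E. apply exp_pos. rewrite L. lra. }
    destruct Hhd as [h' Hh']. assert (Hhd : holo (disc s0 a) h) by (exists h'; auto).
    assert (ap : 0 < a) by (unfold a; lra).
    assert (Ds0 := proj1 (Hh' s0 (Sin a ap))).
    (* Borel-Caratheodory on the circle of radius a / 2 = R0 / 16, whence the 64 of the statement.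
       [deriv_bound] gives h' as a coefficient on a smaller circle, and [tcoef_radius] moves it. *)
    assert (Cb : Cmod (h' s0) <= 4 * (M + 2) / (a / 2) ^ 1).
    { destruct (circ_bounded h s0 a (3 * a / 4) ltac:(lra) Hhd) as [K HK].
      assert (Eh1 : h' s0 = tcoef h s0 (a / 2) 1).
      { destruct (circ_bounded h s0 a (a / 2) ltac:(lra) Hhd) as [K2 HK2].
        assert (Hb2 : holo (disc s0 (a/2)) h) by (apply (holo_sub _ (disc s0 a)); auto; unfold disc; intros; lra).
        assert (Bh : exists B, forall w, disc s0 (a / 2) w -> Cmod (h w) <= B).
        { exists (2 * K * 1 * 3). intros w Hw. unfold disc in Hw.
          assert (K0 : 0 <= K) by (eapply Rle_trans; [apply Cmod_ge_0|apply (HK 0)]).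
          assert (T := taylor h s0 a (3 * a / 4) (w - s0)%C K 0 ltac:(lra) Hhd ltac:(lra) HK). simpl in T.
          replace (s0 + (w - s0))%C with w in T by ring. replace (h w - 0)%C with (h w) in T by ring.
          eapply Rle_trans. exact T. apply Rmult_le_compat_l. lra.
          apply Rmult_le_reg_r with (3 * a / 4 - Cmod (w - s0)). lra.
          unfold Rdiv at 1. rewrite Rmult_assoc, Rinv_l by lra. lra. }
        destruct Bh as [B HBh].
        destruct (deriv_bound h s0 (a/2) B (h' s0) ltac:(lra) Hb2 HBh Ds0) as (_ & _ & E).
        rewrite E. apply (tcoef_radius h s0 a); auto; lra. }
      rewrite Eh1. apply (borel_caratheodory h s0 a); auto. lra.
      intros t. rewrite h0. simpl fst. assert (Q := Reh _ (circ_in s0 a (a/2) ltac:(lra) t)). lra. }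
    destruct Hg as [g' Hg']. assert (Dg := proj1 (Hg' s0 (Sin R0 HR))).
    assert (Eg : (g' s0 = g s0 * h' s0)%C).
    { apply (Cderiv_unique g s0); auto.
      apply (Cderiv_ext_loc (fun z => g s0 * Cexp (h z))%C _ _ _ a ap).
      - intros w Hw. rewrite Eh by (apply Dsub; auto). unfold G. field; auto.
      - apply (Cderiv_eq _ _ (0 * Cexp (h s0) + g s0 * (Cexp (h s0) * h' s0))%C).
        apply (Cderiv_mult (fun _ => g s0) (fun z => Cexp (h z))). apply Cderiv_const.
        apply (Cderiv_comp Cexp h); auto. apply Cderiv_Cexp.
        rewrite h0. rewrite Cexp_0. ring. }
    assert (Nrs : forall r, In r rs -> s0 <> r).
    { intros r Hr E. apply F0. rewrite Hfg by auto.
      replace (prodl rs s0) with (RtoC 0). ring. symmetry. rewrite E. clear - Hr.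
      induction rs as [|q m IH]. destruct Hr. simpl. destruct Hr as [->|Hr]. ring. rewrite IH; auto. ring. }
    assert (Pn := prodl_neq rs s0 Nrs).
    assert (El : (l / f s0 = suml rs s0 + h' s0)%C).
    { assert (E : l = (prodl rs s0 * suml rs s0 * g s0 + prodl rs s0 * g' s0)%C).
      { apply (Cderiv_unique f s0); auto.
        apply (Cderiv_ext_loc (fun w => prodl rs w * g w)%C _ _ _ R0 HR). intros; symmetry; apply Hfg; auto.
        apply Cderiv_mult; auto. apply Cderiv_prodl; auto. }
      rewrite E, Eg, Hfg by auto. field. split; auto. }
    assert (Hre : forall r, In r rs -> fst r <= fst s0).
    { intros r Hr. assert (Hr' : disc s0 R0 r) by (specialize (Hrs r Hr); unfold disc in *; lra).
      apply HZ; auto. rewrite Hfg by auto.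
      replace (prodl rs r) with (RtoC 0). ring. symmetry. clear - Hr.
      induction rs as [|q m IH]. destruct Hr. simpl. destruct Hr as [->|Hr]. ring. rewrite IH; auto. ring. }
    assert (Hb : - (64 * (M + 2) / R0) <= fst (h' s0)).
    { assert (U := Cmod_fst (h' s0)). assert (U2 := Rle_trans _ _ _ U Cb).
      replace (4 * (M + 2) / (a / 2) ^ 1) with (64 * (M + 2) / R0) in U2 by (unfold a; simpl; field; lra).
      apply Rabs_le_between in U2. lra. }
    rewrite El. change (fst (suml rs s0 + h' s0)%C) with (fst (suml rs s0) + fst (h' s0)).
    split. assert (Q := suml_ge0 rs s0 Hre). lra.
    intros w Hw Fw.
    assert (Iw : In w rs).
    { apply prodl_root. rewrite Hfg in Fw by (unfold disc in *; lra).
      apply NNPP. intros X. apply (Cmult_neq_0 (prodl rs w) (g w)); auto. }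
    (* All the zeros lie to the left of s0, so each Re 1 / (s0 - r) is nonnegative and only the one
       at w is kept. *)
    assert (Q := suml_ge rs s0 w Hre Iw). lra.
Qed.

(** * Sums of two squares *)

Module MinusOneSquare.
Import all_boot all_algebra finfield.
Import GRing.Theory.
Local Open Scope nat_scope.

(** Write p = 4 k + 1. The polynomial X^(2k) - 1 has at most 2k < p - 1 roots, so some nonzero a has
    a^(2k) different from 1; since a^(4k) = 1 this power is -1, and a^k is the root. *)
Lemma sqrt_minus_one (p : nat) : prime.prime p -> p %% 4 = 1 -> exists x : nat, p %| x * x + 1.
Proof.
move=> pp p1.
have p_gt2 : 2 < p by case: p pp p1 => [|[|[|p]]].
have cF : #|'F_p| = p by apply: card_Fp.
set k := p %/ 4.
have pE : p = k * 4 + 1 by rewrite {1}(divn_eq p 4) p1.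
have k0 : 0 < k by case: k pE p_gt2 => // ->.
have ch : p \in [pchar 'F_p]%R by apply: pchar_Fp.
have [a a0 an1] : exists2 a : 'F_p, a != 0%R & (a ^+ (2 * k) != 1)%R.
  have: ~~ [forall a : 'F_p, (a != 0%R) ==> (a ^+ (2 * k) == 1)%R].
    apply/negP => /forallP H.
    have q0 : ('X^(2*k) - 1 : {poly 'F_p})%R != 0%R by rewrite -size_poly_eq0 size_XnsubC ?muln_gt0.
    have := @max_poly_roots _ _ [seq x <- enum 'F_p | x != 0%R] q0.
    have -> : all (root ('X^(2*k) - 1)%R) [seq x <- enum 'F_p | x != 0%R].
      apply/allP => x; rewrite mem_filter => /andP[x0 _].
      by have := H x; rewrite x0 /= rootE !hornerE subr_eq0.
    rewrite filter_uniq ?enum_uniq // => /(_ isT isT).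
    rewrite size_XnsubC ?muln_gt0 //.
    have -> : size [seq x <- enum 'F_p | x != 0%R] = p.-1.
      have -> : size [seq x <- enum 'F_p | x != 0%R] = #|predC1 (0%R : 'F_p)|.
        by rewrite size_filter enumT cardE /enum_mem size_filter; apply: eq_count => x.
      by rewrite cardC1 cF.
    by rewrite pE addn1 /= ltnS mulnC leq_pmul2r.
  by rewrite negb_forall => /existsP[a]; rewrite negb_imply => /andP[? ?]; exists a.
have aF : (a ^+ (4 * k) = 1)%R.
  have e : (a ^+ (4 * k).+1 = a)%R.
    have h : (4 * k).+1 = #|'F_p| by rewrite cF {1}pE addn1 mulnC.
    by rewrite h expf_card.
  by move: e; rewrite exprS => /(canRL (mulKf a0)); rewrite mulVf.
have am : (a ^+ (2 * k) = -1)%R.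
  have : ((a ^+ (2 * k) - 1) * (a ^+ (2 * k) + 1) = 0)%R.
    by rewrite -subr_sqr expr1n -exprM mulnAC -[2 * 2]/4 aF subrr.
  by move/eqP; rewrite mulf_eq0 subr_eq0 (negPf an1) /= addr_eq0 => /eqP.
exists (a ^+ k)%R.
rewrite (dvdn_pcharf ch) natrD natrM !natr_Zp.
by rewrite -expr2 -exprM mulnC am addNr.
Qed.

Lemma prime_of_Zprime (p : nat) : Znumtheory.prime (Z.of_nat p) -> prime.prime p.
Proof.
move=> pp; apply/primeP; have p1 := prime_ge_2 _ pp.
split; first by apply/ltP; lia.
move=> d /dvdnP[k pk].
have dp : (Z.of_nat d | Z.of_nat p)%Z by exists (Z.of_nat k); rewrite pk -multE Nat2Z.inj_mul.
have [|[|[|]]] := prime_divisors _ pp _ dp => h; apply/orP.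
- lia.
- by left; apply/eqP; lia.
- by right; apply/eqP; lia.
- lia.
Qed.

Lemma Zsqrt_minus_one (p : nat) : Znumtheory.prime (Z.of_nat p) -> (Nat.modulo p 4 = 1)%nat ->
  exists x : Z, (Z.of_nat p | x * x + 1)%Z.
Proof.
move=> pp p1.
have p1' : p %% 4 = 1.
  have e := Nat.div_mod p 4 ltac:(lia). rewrite p1 in e.
  by rewrite e plusE multE mulnC modnMDl.
have [x /dvdnP[k hk]] := sqrt_minus_one _ (prime_of_Zprime _ pp) p1'.
exists (Z.of_nat x), (Z.of_nat k).
have hk2 : (x * x + 1)%coq_nat = (k * p)%coq_nat by rewrite -multE -plusE in hk.
by rewrite -!Nat2Z.inj_mul -hk2 Nat2Z.inj_add.
Qed.
End MinusOneSquare.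

Local Open Scope Z_scope.

(* Fermat's descent on the multiplier [m]. *)
Lemma two_squares_descent (p : Z) : prime p -> forall n : nat, forall m a b, 1 <= m -> m < p ->
  (Z.to_nat m <= n)%nat -> m * p = a * a + b * b -> exists c d, p = c * c + d * d.
Proof.
  intros Pp. assert (P2 := prime_ge_2 p Pp).
  induction n; intros m a b M1 M2 Mn E. lia.
  destruct (Z.eq_dec m 1) as [->|N1]. exists a, b; lia.
  assert (Red : forall t, exists c k, t = c + k * m /\ 2 * Z.abs c <= m).
  { intros t. assert (H := Z.mod_pos_bound t m ltac:(lia)). assert (H2 := Z.div_mod t m ltac:(lia)).
    destruct (Z_le_gt_dec (2 * (t mod m)) m).
    - exists (t mod m), (t / m). split. lia. lia.
    - exists (t mod m - m), (t / m + 1). split. lia. lia. }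
  destruct (Red a) as (c & k & Ea & Hc). destruct (Red b) as (d & l & Eb & Hd).
  (* The new multiplier: r = (c^2 + d^2) / m, written without division. Least absolute residues give
     4 c^2, 4 d^2 <= m^2, hence r < m. *)
  set (r := p - 2 * (c * k + d * l) - (k * k + l * l) * m).
  assert (Er : m * r = c * c + d * d).
  { unfold r. subst a b. nia. }
  assert (Ep : p = r + 2 * (c * k + d * l) + (k * k + l * l) * m) by (unfold r; ring). clearbody r.
  assert (R0 : 0 <= r) by nia.
  assert (Rm : r < m).
  { assert (4 * (c * c) <= m * m) by nia. assert (4 * (d * d) <= m * m) by nia. nia. }
  (* If r = 0 then c = d = 0 and m divides p with 1 < m < p. *)
  destruct (Z.eq_dec r 0) as [Z0|NZ].
  - exfalso. assert (c = 0) by nia. assert (d = 0) by nia. subst c d.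
    assert (Dm : (m | p)). { exists (k * k + l * l). lia. }
    destruct (prime_divisors p Pp m Dm) as [|[|[|]]]; lia.
  (* Brahmagupta's identity for (c^2 + d^2) (a^2 + b^2), divided by m^2: these are (a c + b d) / m
     and (a d - b c) / m. *)
  - apply (IHn r (r + k * c + l * d) (k * d - l * c)); try lia.
    transitivity (r * (r + 2 * (k * c + l * d)) + (k * k + l * l) * (c * c + d * d)); [|ring].
    rewrite <- Er. rewrite Ep at 1. ring.
Qed.

(** Least absolute residues of a and b modulo p keep the divisibility and make the multiplier at
    most p / 2, which starts the descent; p not dividing a keeps it positive. *)
Lemma prime_dvd_sum_squares (p a b : Z) : prime p -> 2 < p -> (p | a * a + b * b) -> ~ (p | a) ->
  exists c d, p = c * c + d * d.
Proof.
  intros Pp P2 H Na.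
  assert (Red : forall t, exists c k, t = c + k * p /\ 2 * Z.abs c <= p).
  { intros t. assert (H0 := Z.mod_pos_bound t p ltac:(lia)). assert (H2 := Z.div_mod t p ltac:(lia)).
    destruct (Z_le_gt_dec (2 * (t mod p)) p).
    - exists (t mod p), (t / p). split. lia. lia.
    - exists (t mod p - p), (t / p + 1). split. lia. lia. }
  destruct (Red a) as (c & k & Ea & Hc). destruct (Red b) as (d & l & Eb & Hd).
  destruct H as [m Hm].
  set (q := m - 2 * (c * k + d * l) - (k * k + l * l) * p).
  assert (Eq : q * p = c * c + d * d) by (unfold q; subst a b; nia). clearbody q.
  assert (c <> 0). { intros ->. apply Na. exists k. lia. }
  assert (4 * (c * c) <= p * p) by nia. assert (4 * (d * d) <= p * p) by nia.
  apply (two_squares_descent p Pp (Z.to_nat q) q c d); try nia.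
Qed.

Lemma prime_1_two_squares (p : nat) : prime (Z.of_nat p) -> (p mod 4 = 1)%nat ->
  exists c d, Z.of_nat p = c * c + d * d.
Proof.
  intros Pp H. destruct (MinusOneSquare.Zsqrt_minus_one p Pp H) as [x Hx].
  assert (P2 := prime_ge_2 _ Pp).
  assert (Z.of_nat p <> 2). { intros E. assert (p = 2%nat) by lia. subst p. simpl in H. lia. }
  apply (prime_dvd_sum_squares (Z.of_nat p) 1 x); auto. lia.
  replace (1 * 1 + x * x) with (x * x + 1) by ring. auto.
  intros Hk. apply Z.divide_pos_le in Hk; lia.
Qed.

Lemma sum_squares_mod4 (n : nat) c d : Z.of_nat n = c * c + d * d -> (n mod 4 <> 3)%nat.
Proof.
  intros E H.
  assert (S : forall t, exists k, t * t = 4 * k \/ t * t = 4 * k + 1).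
  { intros t. destruct (Zeven_odd_dec t) as [Ht|Ht].
    apply Zeven_ex in Ht. destruct Ht as [m ->]. exists (m * m). lia.
    apply Zodd_ex in Ht. destruct Ht as [m ->]. exists (m * m + m). lia. }
  destruct (S c) as [k Hk], (S d) as [l Hl].
  assert (E2 := Nat.div_mod n 4 ltac:(lia)). lia.
Qed.

(** Otherwise the descent would write p itself as a sum of two squares, which is impossible modulo
    4. *)
Lemma prime_3_dvd (p : nat) a b : prime (Z.of_nat p) -> (p mod 4 = 3)%nat ->
  (Z.of_nat p | a * a + b * b) -> (Z.of_nat p | a) /\ (Z.of_nat p | b).
Proof.
  intros Pp H D. assert (P2 := prime_ge_2 _ Pp).
  assert (Z.of_nat p <> 2). { intros E. assert (p = 2%nat) by lia. subst p. simpl in H. lia. }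
  assert (Q : forall u v, (Z.of_nat p | u * u + v * v) -> (Z.of_nat p | u)).
  { intros u v Duv. destruct (Zdivide_dec (Z.of_nat p) u) as [|N]; auto. exfalso.
    destruct (prime_dvd_sum_squares (Z.of_nat p) u v Pp ltac:(lia) Duv N) as (c & d & E).
    apply (sum_squares_mod4 p c d E). auto. }
  split. apply (Q a b D). apply (Q b a). rewrite Z.add_comm. auto.
Qed.

Lemma inE_iff n : inE n <-> exists a b, Z.of_nat n = a * a + b * b.
Proof. unfold inE. split; intros (a & b & H); exists a, b; rewrite H; ring. Qed.

(** This and the next three lemmas are all that the Euler product takes from arithmetic: membership
    is unchanged by a factor 2, p = 1 mod 4 or p^2 with p = 3 mod 4, and a prime 3 mod 4 never
    divides a member exactly once. *)
Lemma inE_double n : inE (2 * n) <-> inE n.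
Proof.
  rewrite !inE_iff. split; intros (a & b & H).
  - assert (E : exists k, a + b = 2 * k).
    { destruct (Zeven_odd_dec (a + b)) as [He|Ho]. apply Zeven_ex in He; auto.
      exfalso. apply Zodd_ex in Ho. destruct Ho as [k Hk]. assert (b = 2 * k + 1 - a) by lia. subst b. nia. }
    destruct E as [k Hk]. exists k, (a - k). assert (b = 2 * k - a) by lia. subst b. nia.
  - exists (a + b), (a - b). nia.
Qed.

Lemma inE_prime_1 p n : prime (Z.of_nat p) -> (p mod 4 = 1)%nat -> (inE (p * n) <-> inE n).
Proof.
  intros Pp Hp. destruct (prime_1_two_squares p Pp Hp) as (c & d & Ep).
  assert (P2 := prime_ge_2 _ Pp).
  rewrite !inE_iff, Nat2Z.inj_mul. set (q := Z.of_nat p) in *. set (N := Z.of_nat n).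
  split; intros (a & b & H).
  (* Here d' stands for d or - d: p divides (a c - b d) (a c + b d), and the sign is chosen so that
     p divides the first factor. Brahmagupta's identity then makes p divide the companion form
     too. *)
  - assert (Main : forall d', d' * d' = d * d -> (q | a * c - b * d') -> exists u v, N = u * u + v * v).
    { intros d' Ed [u Hu].
      assert (X : (a * d' + b * c) * (a * d' + b * c) = q * (q * (N - u * u))).
      { transitivity ((a * a + b * b) * (c * c + d' * d') - (a * c - b * d') * (a * c - b * d')). ring.
        rewrite Ed, <- Ep, <- H, Hu. ring. }
      assert (D : (q | a * d' + b * c)).
      { destruct (prime_mult q Pp (a * d' + b * c) (a * d' + b * c)); auto.
        rewrite X. exists (q * (N - u * u)). ring. }
      destruct D as [v Hv]. exists u, v. rewrite Hv in X.
      assert (v * v = N - u * u). { apply (Z.mul_reg_l _ _ (q * q)). nia. transitivity (v * q * (v * q)). ring. rewrite X. ring. }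
      lia. }
    assert (D : (q | (a * c - b * d) * (a * c - b * - d))).
    { exists (a * a - N * (d * d)).
      transitivity (a * a * (c * c + d * d) - (a * a + b * b) * (d * d)). ring. rewrite <- Ep, <- H. ring. }
    destruct (prime_mult q Pp _ _ D) as [D1|D1].
    apply (Main d); auto. apply (Main (- d)); auto. ring.
  - exists (a * c - b * d), (a * d + b * c). rewrite Ep, H. ring.
Qed.

Lemma inE_prime_3 p n : prime (Z.of_nat p) -> (p mod 4 = 3)%nat -> inE (p * n) -> Nat.divide p n.
Proof.
  intros Pp Hp. rewrite inE_iff, Nat2Z.inj_mul. intros (a & b & H). assert (P2 := prime_ge_2 _ Pp).
  destruct (prime_3_dvd p a b Pp Hp) as [[u Hu] [v Hv]]. rewrite <- H. exists (Z.of_nat n). ring.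
  subst a b. assert (E : Z.of_nat n = (u * u + v * v) * Z.of_nat p).
  { apply (Z.mul_reg_l _ _ (Z.of_nat p)). lia. rewrite H. ring. }
  exists (Z.to_nat (u * u + v * v)). nia.
Qed.

Lemma inE_prime_3_sq p n : prime (Z.of_nat p) -> (p mod 4 = 3)%nat -> (inE (p * p * n) <-> inE n).
Proof.
  intros Pp Hp. assert (P2 := prime_ge_2 _ Pp). rewrite !inE_iff, !Nat2Z.inj_mul. split; intros (a & b & H).
  - destruct (prime_3_dvd p a b Pp Hp) as [[u Hu] [v Hv]]. rewrite <- H. exists (Z.of_nat p * Z.of_nat n). ring.
    exists u, v. subst a b. apply (Z.mul_reg_l _ _ (Z.of_nat p * Z.of_nat p)). nia.
    rewrite H. ring.
  - exists (Z.of_nat p * a), (Z.of_nat p * b). rewrite H. ring.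
Qed.
Close Scope Z_scope.

(** * Dirichlet series and Euler products *)

Lemma cpow_Cexp n s : cpow_neg n s = Cexp (- (RtoC (ln (INR n)) * s)).
Proof.
  unfold cpow_neg, Cexp. destruct s as [a b]. apply injective_projections; simpl.
  - replace (- (ln (INR n) * a - 0 * b)) with (- a * ln (INR n)) by ring.
    replace (- (ln (INR n) * b + 0 * a)) with (- (b * ln (INR n))) by ring. rewrite cos_neg. auto.
  - replace (- (ln (INR n) * a - 0 * b)) with (- a * ln (INR n)) by ring.
    replace (- (ln (INR n) * b + 0 * a)) with (- (b * ln (INR n))) by ring. rewrite sin_neg. ring.
Qed.

Lemma Cmod_cpow n s : Cmod (cpow_neg n s) = Rpower (INR n) (- fst s).
Proof.
  rewrite cpow_Cexp, Cmod_Cexp. unfold Rpower. f_equal. destruct s; simpl. ring.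
Qed.

Lemma cpow_mult n m s : (1 <= n)%nat -> (1 <= m)%nat -> cpow_neg (n * m) s = (cpow_neg n s * cpow_neg m s)%C.
Proof.
  intros Hn Hm. rewrite !cpow_Cexp, <- Cexp_plus. f_equal.
  rewrite mult_INR, ln_mult, RtoC_plus by (apply lt_0_INR; lia). ring.
Qed.

Lemma cpow_1 s : cpow_neg 1 s = 1%C.
Proof.
  rewrite cpow_Cexp. simpl INR. rewrite ln_1. replace (- (RtoC 0 * s))%C with (RtoC 0) by ring. apply Cexp_0.
Qed.

Lemma cpow_real n x : cpow_neg n (RtoC x) = RtoC (Rpower (INR n) (- x)).
Proof.
  rewrite cpow_Cexp, <- RtoC_mult, <- RtoC_opp, Cexp_RtoC. f_equal. unfold Rpower. f_equal. ring.
Qed.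

Lemma Cderiv_cpow n s : Cderiv (cpow_neg n) s (- RtoC (ln (INR n)) * cpow_neg n s).
Proof.
  apply (Cderiv_ext_loc (fun s => Cexp (- (RtoC (ln (INR n)) * s))) _ _ _ 1). lra.
  intros; symmetry; apply cpow_Cexp.
  rewrite cpow_Cexp.
  apply (Cderiv_eq _ _ (Cexp (- (RtoC (ln (INR n)) * s)) * - RtoC (ln (INR n)))%C); [|ring].
  apply (Cderiv_comp Cexp (fun s => - (RtoC (ln (INR n)) * s))%C). 2: apply Cderiv_Cexp.
  apply (Cderiv_ext_loc (fun s => 0 + (- RtoC (ln (INR n))) * s)%C _ _ _ 1). lra. intros; ring. apply Cderiv_affine.
Qed.

Lemma holo_cpow D n : holo D (cpow_neg n).
Proof.
  apply (holo_intro _ _ (fun s => - RtoC (ln (INR n)) * cpow_neg n s)%C); intros z _.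
  apply Cderiv_cpow. apply Ccont_mult. apply Ccont_const. eapply Cderiv_cont, Cderiv_cpow.
Qed.

Lemma INR_S_ge1 k : 1 <= INR (S k).
Proof. rewrite S_INR. generalize (pos_INR k). lra. Qed.

Lemma Rpower_pos x y : 0 < Rpower x y.
Proof. apply exp_pos. Qed.

Lemma exp_mono x y : x <= y -> exp x <= exp y.
Proof. intros [H|H]. left; apply exp_increasing; auto. rewrite H; lra. Qed.

Lemma ln_ge_0 x : 1 <= x -> 0 <= ln x.
Proof. intros [H|H]. rewrite <- ln_1. left; apply ln_increasing; lra. rewrite <- H, ln_1; lra. Qed.

Lemma Rpower_le1 x y z : 1 <= x -> y <= z -> Rpower x y <= Rpower x z.
Proof.
  intros Hx Hyz. apply exp_mono. apply Rmult_le_compat_r; auto. apply ln_ge_0; auto.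
Qed.

(** The mean value theorem for x^-d between consecutive integers; its telescoping sum bounds zeta(1
    + d) by 1 + 1/d. *)
Lemma Rpower_neg_telescope d k : 0 < d ->
  d * Rpower (INR (S (S k))) (- (1 + d)) <= Rpower (INR (S k)) (- d) - Rpower (INR (S (S k))) (- d).
Proof.
  intros Hd. set (a := INR (S k)). assert (Ha : 1 <= a) by apply INR_S_ge1.
  replace (INR (S (S k))) with (a + 1) by (unfold a; rewrite (S_INR (S k)); auto).
  destruct (MVT_gen (fun x => Rpower x (- d)) a (a + 1) (fun x => - d * Rpower x (- d - 1))) as [c [Hc Ec]].
  - intros x Hx. rewrite Rmin_left, Rmax_right in Hx by lra.
    apply is_derive_Reals. apply derivable_pt_lim_power. lra.
  - intros x Hx. rewrite Rmin_left, Rmax_right in Hx by lra.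
    apply derivable_continuous_pt. exists (- d * Rpower x (- d - 1)). apply derivable_pt_lim_power. lra.
  - rewrite Rmin_left, Rmax_right in Hc by lra.
    assert (Q : Rpower (a + 1) (- (1 + d)) <= Rpower c (- d - 1)).
    { replace (- d - 1) with (- (1 + d)) by ring. rewrite !Rpower_Ropp.
      apply Rinv_le_contravar. apply Rpower_pos. apply Rle_Rpower_l; lra. }
    assert (d * Rpower (a + 1) (- (1 + d)) <= d * Rpower c (- d - 1)) by (apply Rmult_le_compat_l; lra).
    lra.
Qed.

Lemma ex_series_nonneg_bounded (a : nat -> R) B : (forall k, 0 <= a k) -> (forall n, rsum a n <= B) ->
  ex_series a /\ Series a <= B.
Proof.
  intros P H.
  assert (Inc : forall n, rsum a (S n) <= rsum a (S (S n))) by (intros n; simpl; specialize (P (S n)); lra).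
  destruct (ex_finite_lim_seq_incr (fun n => rsum a (S n)) B Inc (fun n => H (S n))) as [l Hl].
  assert (Is : is_series a l).
  { change (is_lim_seq (sum_n a) l). eapply is_lim_seq_ext; [|exact Hl]. intros n. symmetry. apply rsum_sum_n. }
  split. exists l; auto. rewrite (is_series_unique _ _ Is).
  apply (is_lim_seq_le (fun n => rsum a (S n)) (fun _ => B) l B); auto. apply is_lim_seq_const.
Qed.

Lemma zeta_bound x : 1 < x -> ex_series (fun k => Rpower (INR (S k)) (- x)) /\
  Series (fun k => Rpower (INR (S k)) (- x)) <= 1 + / (x - 1).
Proof.
  intros Hx. apply ex_series_nonneg_bounded. intros; left; apply Rpower_pos.
  intros n. destruct n. simpl. assert (0 < / (x - 1)) by (apply Rinv_0_lt_compat; lra). lra.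
  assert (H : rsum (fun k => Rpower (INR (S k)) (- x)) (S n) <= 1 + / (x - 1) * (1 - Rpower (INR (S n)) (- (x - 1)))).
  { induction n.
    - simpl. unfold Rpower. rewrite ln_1, !Rmult_0_r, exp_0. lra.
    - change (rsum (fun k => Rpower (INR (S k)) (- x)) (S n) + Rpower (INR (S (S n))) (- x) <=
        1 + / (x - 1) * (1 - Rpower (INR (S (S n))) (- (x - 1)))).
      assert (T := Rpower_neg_telescope (x - 1) n ltac:(lra)).
      replace (- (1 + (x - 1))) with (- x) in T by ring.
      apply Rmult_le_compat_l with (r := / (x - 1)) in T; [|left; apply Rinv_0_lt_compat; lra].
      rewrite <- Rmult_assoc, Rinv_l, Rmult_1_l in T by lra. lra. }
  assert (0 < / (x - 1)) by (apply Rinv_0_lt_compat; lra).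
  assert (P := Rpower_pos (INR (S n)) (- (x - 1))).
  assert (0 <= / (x - 1) * Rpower (INR (S n)) (- (x - 1))) by (apply Rmult_le_pos; lra). lra.
Qed.

Definition Dser (a : nat -> R) (s : C) : C := CSer (fun k => RtoC (a (S k)) * cpow_neg (S k) s)%C.

Definition bounded1 (a : nat -> R) := forall n, Rabs (a n) <= 1.

Lemma Dser_term a s x k : bounded1 a -> x <= fst s ->
  Cmod (RtoC (a (S k)) * cpow_neg (S k) s) <= Rpower (INR (S k)) (- x).
Proof.
  intros Ha Hx. rewrite Cmod_mult, Cmod_R, Cmod_cpow. rewrite <- (Rmult_1_l (Rpower _ (- x))).
  apply Rmult_le_compat; auto. apply Rabs_pos. left; apply Rpower_pos.
  apply Rpower_le1. apply INR_S_ge1. lra.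
Qed.

Lemma Dser_conv a s : bounded1 a -> 1 < fst s -> Cconv (fun k => RtoC (a (S k)) * cpow_neg (S k) s)%C (Dser a s).
Proof.
  intros Ha Hs. apply (dom_conv _ (fun k => Rpower (INR (S k)) (- fst s))).
  intros k. apply Dser_term; auto. lra. apply zeta_bound; auto.
Qed.

Lemma Dser_bound a s : bounded1 a -> 1 < fst s -> Cmod (Dser a s) <= 1 + / (fst s - 1).
Proof.
  intros Ha Hs. destruct (zeta_bound (fst s) Hs) as [E B].
  eapply Rle_trans; [|exact B]. apply Cmod_CSer; auto. intros k. apply Dser_term; auto. lra.
Qed.

Lemma holo_Dser a : bounded1 a -> holo (fun s => 1 < fst s) (Dser a).
Proof.
  intros Ha. apply (holo_series (fun s => 1 < fst s) (fun k s => RtoC (a (S k)) * cpow_neg (S k) s)%C).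
  - intros n. apply holo_mult. apply holo_const. apply holo_cpow.
  - intros z Hz. exists ((fst z - 1) / 2), (fun k => Rpower (INR (S k)) (- ((fst z + 1) / 2))).
    split. lra. split. apply zeta_bound. lra.
    intros n w Hw. unfold disc in Hw. assert (T := Cmod_fst (w - z)%C). simpl in T.
    assert (T2 := Rle_lt_trans _ _ _ T Hw). apply Rabs_def2 in T2.
    split. lra. apply Dser_term; auto. lra.
Qed.

Lemma Cconv_unique c l m : Cconv c l -> Cconv c m -> l = m.
Proof. intros H1 H2. rewrite <- (Cconv_CSer _ _ H1). apply Cconv_CSer; auto. Qed.

Lemma Cseq_unique (u : nat -> C) l m (g : nat -> nat) :
  (forall eps, 0 < eps -> exists N, forall n, (N <= n)%nat -> Cmod (u n - l) < eps) ->
  (forall eps, 0 < eps -> exists N, forall n, (N <= n)%nat -> Cmod (u (g n) - m) < eps) ->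
  (forall n, (n <= g n)%nat) -> l = m.
Proof.
  intros H1 H2 Hg. destruct (Ceq_dec l m) as [|N]; auto. exfalso.
  apply Cminus_neq_0, Cmod_gt_0 in N.
  destruct (H1 (Cmod (l - m) / 2)) as [N1 K1]. lra. destruct (H2 (Cmod (l - m) / 2)) as [N2 K2]. lra.
  set (n := max N1 N2). specialize (K2 n ltac:(lia)). specialize (K1 (g n)). specialize (Hg n).
  specialize (K1 ltac:(lia)). assert (T := Cmod_tri_minus l m (u (g n))). rewrite (Cmod_minus_sym l (u (g n))) in T. lra.
Qed.

Definition dvdb (q n : nat) : bool := Nat.eqb (n mod q) 0.

Lemma dvdb_spec q n : (1 <= q)%nat -> dvdb q n = true <-> Nat.divide q n.
Proof.
  intros Hq. unfold dvdb. rewrite Nat.eqb_eq. apply Nat.Lcm0.mod_divide.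
Qed.

Lemma csum_multiples (c : nat -> C) q N : (1 <= q)%nat ->
  csum (fun k => if dvdb q (S k) then c (S k) else 0%C) (N * q) = csum (fun j => c (q * S j)%nat) N.
Proof.
  intros Hq. induction N. auto.
  replace (S N * q)%nat with (N * q + q)%nat by lia. rewrite csum_add, IHN. simpl csum at 3. f_equal.
  destruct q as [|q]. lia. simpl csum. rewrite (csum_ext _ (fun _ => 0%C)).
  - assert (Z : forall n, csum (fun _ => 0%C) n = 0%C) by (induction n; simpl; [auto|rewrite IHn; ring]).
    rewrite Z. replace (S (N * S q + q)) with (S q * S N)%nat by lia.
    replace (dvdb (S q) (S q * S N)) with true. ring.
    symmetry. apply dvdb_spec. lia. exists (S N). lia.
  - intros k Hk. destruct (dvdb (S q) (S (N * S q + k))) eqn:E; auto. exfalso.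
    apply dvdb_spec in E; [|lia]. destruct E as [m Hm]. assert (N < m)%nat by nia. assert (S N <= m)%nat by lia. assert (S N * S q <= m * S q)%nat by (apply Nat.mul_le_mono_r; auto). lia.
Qed.

(** Multiplication by 1 - w q^-s subtracts the terms at multiples of q. By the last hypothesis a
    vanishes at the other multiples of p, so all multiples of p disappear. Separating p from q
    covers the square factor q = p^2 of primes 3 mod 4. *)
Lemma Dser_step a p q w s : bounded1 a -> 1 < fst s -> (1 <= p)%nat -> (1 <= q)%nat -> Nat.divide p q ->
  (forall n, (1 <= n)%nat -> a (q * n)%nat = w * a n) ->
  (forall n, (1 <= n)%nat -> Nat.divide p n -> ~ Nat.divide q n -> a n = 0) ->
  (Dser a s * (1 - RtoC w * cpow_neg q s) = Dser (fun n => if dvdb p n then 0 else a n)%R s)%C.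
Proof.
  intros Ha Hs Hp Hq Dpq H1 H2.
  set (c := fun n => (RtoC (a n) * cpow_neg n s)%C).
  assert (B1 : bounded1 (fun n => if dvdb q n then a n else 0)).
  { intros n. destruct (dvdb q n). apply Ha. rewrite Rabs_R0; lra. }
  assert (B2 : bounded1 (fun n => if dvdb p n then 0 else a n)).
  { intros n. destruct (dvdb p n). rewrite Rabs_R0; lra. apply Ha. }
  (* Partial sums over multiples of q up to N q match partial sums up to N of the original series;
     comparison along this subsequence identifies the limits. *)
  assert (E1 : Dser (fun n => if dvdb q n then a n else 0) s = (RtoC w * cpow_neg q s * Dser a s)%C).
  { apply (Cseq_unique (csum (fun k => RtoC (if dvdb q (S k) then a (S k) else 0) * cpow_neg (S k) s)%C) _ _ (fun N => (N * q)%nat)).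
    - apply (Dser_conv (fun n => if dvdb q n then a n else 0)); auto.
    - intros eps He. destruct (Cconv_scal (RtoC w * cpow_neg q s)%C _ _ (Dser_conv a s Ha Hs) eps He) as [N K].
      exists N. intros n Hn. specialize (K n Hn).
      replace (csum (fun k => RtoC (if dvdb q (S k) then a (S k) else 0) * cpow_neg (S k) s)%C (n * q)) with
        (csum (fun k => RtoC w * cpow_neg q s * (RtoC (a (S k)) * cpow_neg (S k) s))%C n); auto.
      rewrite (csum_ext (fun k => RtoC (if dvdb q (S k) then a (S k) else 0) * cpow_neg (S k) s)%C
         (fun k => if dvdb q (S k) then c (S k) else 0%C)).
      2:{ intros k _. unfold c. destruct (dvdb q (S k)); ring. }
      rewrite csum_multiples by auto. apply csum_ext. intros k _. unfold c.
      rewrite H1, cpow_mult, RtoC_mult by lia. ring.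
    - intros n. nia. }
  replace (Dser a s * (1 - RtoC w * cpow_neg q s))%C with (Dser a s + (-1) * (RtoC w * cpow_neg q s * Dser a s))%C by ring.
  rewrite <- E1. symmetry. apply (Cconv_unique (fun k => RtoC (if dvdb p (S k) then 0 else a (S k)) * cpow_neg (S k) s)%C).
  apply (Dser_conv (fun n => if dvdb p n then 0 else a n)); auto.
  assert (G := Cconv_plus _ _ _ _ (Dser_conv a s Ha Hs) (Cconv_scal (-1)%C _ _ (Dser_conv (fun n => if dvdb q n then a n else 0) s B1 Hs))).
  intros eps He. destruct (G eps He) as [N K]. exists N. intros n Hn. specialize (K n Hn).
  rewrite (csum_ext _ (fun k => RtoC (if dvdb p (S k) then 0 else a (S k)) * cpow_neg (S k) s)%C) in K; auto.
  intros k _. destruct (dvdb q (S k)) eqn:Eq.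
  - assert (Ep : dvdb p (S k) = true).
    { apply dvdb_spec; auto. apply dvdb_spec in Eq; auto. eapply Nat.divide_trans; eauto. }
    rewrite Ep. ring.
  - destruct (dvdb p (S k)) eqn:Ep; [|ring].
    rewrite (H2 (S k)); try lia. ring. apply dvdb_spec; auto.
    intros D. apply dvdb_spec in D; auto. congruence.
Qed.

(** * Sieving and Euler products *)

Fixpoint sieved (a : nat -> R) (N : nat) : nat -> R :=
  match N with
  | O => a
  | S k => if prime_dec (Z.of_nat k) then fun n => if dvdb k n then 0 else sieved a k n else sieved a k
  end.

Fixpoint eprod (f : nat -> C) (N : nat) : C :=
  match N with
  | O => 1%C
  | S k => (eprod f k * (if prime_dec (Z.of_nat k) then f k else 1))%C
  end.

Lemma sieved_bounded a N : bounded1 a -> bounded1 (sieved a N).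
Proof.
  intros Ha. induction N; simpl; auto. destruct (prime_dec (Z.of_nat N)); auto.
  intros n. destruct (dvdb N n); auto. rewrite Rabs_R0; lra.
Qed.

Lemma sieved_zero a N p n : prime (Z.of_nat p) -> (p < N)%nat -> Nat.divide p n -> sieved a N n = 0.
Proof.
  intros Pp Hp Hd. assert (P2 := prime_ge_2 _ Pp).
  induction N; simpl. lia. destruct (Nat.eq_dec p N) as [->|].
  - destruct (prime_dec (Z.of_nat N)); [|tauto].
    replace (dvdb N n) with true; auto. symmetry. apply dvdb_spec; auto. lia.
  - destruct (prime_dec (Z.of_nat N)); [destruct (dvdb N n); auto|]; apply IHN; lia.
Qed.

Lemma sieved_cases a N n : sieved a N n = a n \/ sieved a N n = 0.
Proof.
  induction N; simpl; auto. destruct (prime_dec (Z.of_nat N)); auto. destruct (dvdb N n); auto.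
Qed.

Lemma nat_prime_dvd_mult p q n : prime (Z.of_nat p) -> Nat.divide p (q * n) -> Nat.divide p q \/ Nat.divide p n.
Proof.
  intros Pp H. assert (D : (Z.of_nat p | Z.of_nat q * Z.of_nat n)%Z).
  { rewrite <- Nat2Z.inj_mul. destruct H as [k Hk]. exists (Z.of_nat k). rewrite Hk. lia. }
  destruct (prime_mult _ Pp _ _ D) as [[k Hk]|[k Hk]]; assert (P2 := prime_ge_2 _ Pp); [left|right];
  exists (Z.to_nat k); nia.
Qed.

Lemma nat_prime_dvd_prime p r : prime (Z.of_nat p) -> prime (Z.of_nat r) -> Nat.divide p r -> p = r.
Proof.
  intros Pp Pr [k Hk]. assert (P2 := prime_ge_2 _ Pp). assert (P3 := prime_ge_2 _ Pr).
  assert (D : (Z.of_nat p | Z.of_nat r)%Z) by (exists (Z.of_nat k); lia).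
  destruct (prime_divisors _ Pr _ D) as [|[|[|]]]; lia.
Qed.

Lemma sieved_mult a N p q w n : prime (Z.of_nat p) -> (q = p \/ q = (p * p)%nat) -> (N <= p)%nat ->
  a (q * n)%nat = w * a n -> sieved a N (q * n)%nat = w * sieved a N n.
Proof.
  intros Pp Hq Hp Ha. assert (P2 := prime_ge_2 _ Pp).
  induction N; simpl; auto. destruct (prime_dec (Z.of_nat N)) as [PN|]; [|apply IHN; lia].
  assert (P3 := prime_ge_2 _ PN).
  replace (dvdb N (q * n)) with (dvdb N n). destruct (dvdb N n). ring. apply IHN; lia.
  apply Bool.eq_iff_eq_true. rewrite !dvdb_spec by lia. split.
  - intros H. apply Nat.divide_mul_r; auto.
  - intros H. destruct (nat_prime_dvd_mult N q n PN H) as [D|D]; auto. exfalso.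
    assert (N = p); [|lia]. destruct Hq as [->| ->]. apply nat_prime_dvd_prime; auto.
    destruct (nat_prime_dvd_mult N p p PN D); apply nat_prime_dvd_prime; auto.
Qed.

Lemma prime_divisor n : (2 <= n)%nat -> exists p, prime (Z.of_nat p) /\ Nat.divide p n /\ (p <= n)%nat.
Proof.
  induction n as [n IH] using (well_founded_induction Wf_nat.lt_wf). intros Hn.
  destruct (prime_dec (Z.of_nat n)) as [Pn|Nn].
  - exists n. split; auto. split; auto. apply Nat.divide_refl.
  - destruct (not_prime_divide (Z.of_nat n) ltac:(lia) Nn) as [d [Hd Dd]].
    assert (E : Z.of_nat (Z.to_nat d) = d) by lia.
    destruct (IH (Z.to_nat d)) as (p & Pp & Dp & Lp); try lia.
    exists p. split; auto. split; [|lia]. eapply Nat.divide_trans; eauto.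
    destruct Dd as [k Hk]. exists (Z.to_nat k). nia.
Qed.

(** The local factor at p is 1 / (1 - w p * (q p)^-s). One record serves zeta, L(s, chi_4), the
    series of E and the product over primes 3 mod 4. *)
Record euler_data (a : nat -> R) (q : nat -> nat) (w : nat -> R) : Prop := {
  ed_bound : bounded1 a;
  ed_one : a 1%nat = 1;
  ed_q : forall p, prime (Z.of_nat p) -> q p = p \/ q p = (p * p)%nat;
  ed_mult : forall p n, prime (Z.of_nat p) -> (1 <= n)%nat -> a (q p * n)%nat = w p * a n;
  ed_zero : forall p n, prime (Z.of_nat p) -> (1 <= n)%nat -> Nat.divide p n -> ~ Nat.divide (q p) n -> a n = 0
}.

Lemma euler_sieve a q w s N : euler_data a q w -> 1 < fst s ->
  (Dser a s * eprod (fun p => 1 - RtoC (w p) * cpow_neg (q p) s)%C N = Dser (sieved a N) s)%C.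
Proof.
  intros [Hb H1 Hq Hm Hz] Hs. induction N; simpl. ring.
  rewrite Cmult_assoc, IHN. destruct (prime_dec (Z.of_nat N)) as [PN|]; [|ring].
  assert (P2 := prime_ge_2 _ PN).
  apply (Dser_step (sieved a N) N (q N) (w N)); auto. apply sieved_bounded; auto. lia.
  destruct (Hq N PN) as [->| ->]; nia.
  destruct (Hq N PN) as [->| ->]. apply Nat.divide_refl. exists N; lia.
  - intros n Hn. apply (sieved_mult a N N); auto.
  - intros n Hn D1 D2. destruct (sieved_cases a N n) as [->| ->]; auto. eapply Hz; eauto.
Qed.

(** Sieving by the primes below N leaves only n = 1 and terms with n >= N, and the latter are a tail
    of an absolutely convergent series. Stating it as series times finite product tending to 1 also
    gives nonvanishing, without infinite products. *)
Lemma euler_limit a q w s : euler_data a q w -> 1 < fst s -> forall eps, 0 < eps ->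
  exists N0, forall N, (N0 <= N)%nat ->
    Cmod (Dser a s * eprod (fun p => 1 - RtoC (w p) * cpow_neg (q p) s)%C N - 1) < eps.
Proof.
  intros Ed Hs eps He. assert (Hb := ed_bound _ _ _ Ed). assert (H1 := ed_one _ _ _ Ed).
  destruct (zeta_bound (fst s) Hs) as [E _].
  destruct (tail_small _ E eps He) as [N0 K]. exists (max 2 (S N0)). intros N HN.
  rewrite (euler_sieve a q w s N Ed Hs).
  assert (S1 : csum (fun k => RtoC (sieved a N (S k)) * cpow_neg (S k) s)%C (N - 1) = 1%C).
  { destruct N as [|[|N]]; try lia. replace (S (S N) - 1)%nat with (S N) by lia.
    assert (One : sieved a (S (S N)) 1 = 1).
    { rewrite <- H1. generalize (S (S N)). induction n; simpl; auto.
      destruct (prime_dec (Z.of_nat n)) as [Pn|]; auto. assert (P2 := prime_ge_2 _ Pn).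
      destruct (dvdb n 1) eqn:D; auto. apply dvdb_spec in D; [|lia]. apply Nat.divide_1_r in D. lia. }
    assert (Zr : forall k, (1 <= k)%nat -> (k < S N)%nat -> sieved a (S (S N)) (S k) = 0).
    { intros k K1 K2. destruct (prime_divisor (S k) ltac:(lia)) as (p & Pp & Dp & Lp).
      apply (sieved_zero a _ p); auto. lia. }
    set (A := sieved a (S (S N))) in *.
    change (S N) with (1 + N)%nat. rewrite csum_add. simpl csum at 1. rewrite One, cpow_1.
    rewrite (csum_ext _ (fun _ => 0%C)).
    assert (Z : forall n, csum (fun _ => 0%C) n = 0%C) by (induction n; simpl; [auto|rewrite IHn; ring]).
    rewrite Z. ring.
    intros k Hk. rewrite Zr by lia. ring. }
  rewrite <- S1. eapply Rle_lt_trans.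
  apply (CSer_tail _ (fun k => Rpower (INR (S k)) (- fst s)) (N - 1)).
  intros k. apply Dser_term. apply sieved_bounded; auto. lra. auto.
  eapply Rle_lt_trans. apply Rle_abs. apply (K (N - 1)%nat). lia.
Qed.

Definition one (n : nat) : R := 1.

Definition g3 (n : nat) : R :=
  if excluded_middle_informative (forall p, prime (Z.of_nat p) -> Nat.divide p n -> (p mod 4 = 3)%nat)
  then 1 else 0.

Lemma euler_one : euler_data one (fun p => p) one.
Proof.
  split; unfold one; intros; auto. intros n. rewrite Rabs_R1; lra. ring. tauto.
Qed.

Lemma chi4_mult n m : chi4 (n * m) = chi4 n * chi4 m.
Proof.
  assert (A : forall n, (n mod 4 = 0)%nat /\ chi4 n = 0 \/ (n mod 4 = 1)%nat /\ chi4 n = 1 \/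
     (n mod 4 = 2)%nat /\ chi4 n = 0 \/ (n mod 4 = 3)%nat /\ chi4 n = -1).
  { intros k. assert (H4 := Nat.div_mod k 4 ltac:(lia)). assert (H2 := Nat.div_mod k 2 ltac:(lia)).
    assert (L4 := Nat.mod_upper_bound k 4 ltac:(lia)). assert (L2 := Nat.mod_upper_bound k 2 ltac:(lia)).
    unfold chi4. destruct (Nat.eqb_spec (k mod 2) 0), (Nat.eqb_spec (k mod 4) 1); try lia;
    assert (X : (k mod 4 = 0 \/ k mod 4 = 1 \/ k mod 4 = 2 \/ k mod 4 = 3)%nat) by lia;
    destruct X as [X|[X|[X|X]]]; auto; lia. }
  assert (M : ((n * m) mod 4 = ((n mod 4) * (m mod 4)) mod 4)%nat) by apply Nat.Div0.mul_mod.
  destruct (A n) as [[E1 ->]|[[E1 ->]|[[E1 ->]|[E1 ->]]]];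
  destruct (A m) as [[E2 ->]|[[E2 ->]|[[E2 ->]|[E2 ->]]]];
  rewrite E1, E2 in M;
  destruct (A (n * m)%nat) as [[E3 ->]|[[E3 ->]|[[E3 ->]|[E3 ->]]]]; try lra; rewrite E3 in M; discriminate M.
Qed.

Lemma chi4_bounded : bounded1 chi4.
Proof.
  intros n. unfold chi4. destruct (Nat.eqb (n mod 2) 0). rewrite Rabs_R0; lra.
  destruct (Nat.eqb (n mod 4) 1). rewrite Rabs_R1; lra. rewrite Rabs_left; lra.
Qed.

Lemma euler_chi4 : euler_data chi4 (fun p => p) chi4.
Proof.
  split; auto. apply chi4_bounded. intros; apply chi4_mult. tauto.
Qed.

Definition qE (p : nat) : nat := if Nat.eqb (p mod 4) 3 then (p * p)%nat else p.

Lemma prime_cases p : prime (Z.of_nat p) -> p = 2%nat \/ (p mod 4 = 1)%nat \/ (p mod 4 = 3)%nat.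
Proof.
  intros Pp. assert (P2 := prime_ge_2 _ Pp).
  assert (H4 := Nat.div_mod p 4 ltac:(lia)). assert (L4 := Nat.mod_upper_bound p 4 ltac:(lia)).
  assert (X : (p mod 4 = 0 \/ p mod 4 = 1 \/ p mod 4 = 2 \/ p mod 4 = 3)%nat) by lia.
  destruct X as [X|[X|[X|X]]]; auto; left.
  - assert (D : (2 | Z.of_nat p)%Z) by (exists (2 * Z.of_nat (p / 4))%Z; lia).
    destruct (prime_divisors _ Pp _ D) as [|[|[|]]]; lia.
  - assert (D : (2 | Z.of_nat p)%Z) by (exists (2 * Z.of_nat (p / 4) + 1)%Z; lia).
    destruct (prime_divisors _ Pp _ D) as [|[|[|]]]; lia.
Qed.

Lemma indE_iff n m : (inE n <-> inE m) -> indE n = indE m.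
Proof.
  intros H. unfold indE. destruct (excluded_middle_informative (inE n)), (excluded_middle_informative (inE m)); tauto.
Qed.

Lemma indE_bounded : bounded1 indE.
Proof.
  intros n. unfold indE. destruct (excluded_middle_informative _); [rewrite Rabs_R1|rewrite Rabs_R0]; lra.
Qed.

Lemma euler_indE : euler_data indE qE one.
Proof.
  split.
  - apply indE_bounded.
  - unfold indE. destruct (excluded_middle_informative _) as [|N]; auto. exfalso. apply N.
    exists 1%Z, 0%Z. reflexivity.
  - intros p _. unfold qE. destruct (Nat.eqb _ _); auto.
  - intros p n Pp Hn. unfold one. rewrite Rmult_1_l. apply indE_iff. unfold qE.
    destruct (prime_cases p Pp) as [->|[H|H]].
    + apply inE_double.
    + rewrite H. simpl. apply inE_prime_1; auto.
    + rewrite H. simpl. apply inE_prime_3_sq; auto.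
  - intros p n Pp Hn D ND. unfold qE in ND. destruct (Nat.eqb_spec (p mod 4) 3) as [E|]; [|tauto].
    unfold indE. destruct (excluded_middle_informative (inE n)) as [I|]; auto. exfalso.
    destruct D as [k Hk]. rewrite Hk, Nat.mul_comm in I. apply inE_prime_3 in I; auto.
    apply ND. destruct I as [j Hj]. exists j. rewrite Hk, Hj. ring.
Qed.

Definition w3 (p : nat) : R := if Nat.eqb (p mod 4) 3 then 1 else 0.

Lemma euler_g3 : euler_data g3 (fun p => p) w3.
Proof.
  split; auto.
  - intros n. unfold g3. destruct (excluded_middle_informative _); [rewrite Rabs_R1|rewrite Rabs_R0]; lra.
  - unfold g3. destruct (excluded_middle_informative _) as [|N]; auto. exfalso. apply N.
    intros p Pp D. apply Nat.divide_1_r in D. subst p. exfalso. apply (not_prime_1 Pp).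
  - intros p n Pp Hn. unfold w3, g3.
    destruct (excluded_middle_informative _) as [A|A], (excluded_middle_informative _) as [B|B];
      destruct (Nat.eqb_spec (p mod 4) 3) as [E|E]; try ring; exfalso.
    + apply E. apply A; auto. exists n. lia.
    + apply B. intros r Pr D. apply A; auto. apply Nat.divide_mul_r; auto.
    + apply B. intros r Pr D. apply A; auto. apply Nat.divide_mul_r; auto.
    + apply A. intros r Pr D. destruct (nat_prime_dvd_mult r p n Pr D) as [D'|D'].
      rewrite (nat_prime_dvd_prime r p Pr Pp D'); auto. auto.
  - tauto.
Qed.

Definition zetaD := Dser one.
Definition LD := Dser chi4.
Definition FD := Dser indE.
(** The product of (1 - p^-2s)^-1 over primes p = 3 mod 4, encoded as a Dirichlet series at 2 s so
    that holomorphy, bounds and nonvanishing for Re s > 1/2 are inherited. *)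
Definition H3 (s : C) : C := Dser g3 (2 * s)%C.

(* Euler factor of [1 / (zeta L)] at p: [(1 - v)^m] with [v = p^-s] or [p^-2s], see [factor_form]. *)
Definition fZ (s : C) (p : nat) : C :=
  ((1 - RtoC (one p) * cpow_neg p s) * (1 - RtoC (chi4 p) * cpow_neg p s))%C.

Lemma eprod_mult f g N : eprod (fun p => f p * g p)%C N = (eprod f N * eprod g N)%C.
Proof. induction N; simpl. ring. rewrite IHN. destruct (prime_dec _); ring. Qed.

Definition Cseq (u : nat -> C) (l : C) :=
  forall eps, 0 < eps -> exists N, forall n, (N <= n)%nat -> Cmod (u n - l) < eps.

Lemma Cseq_mult u v l m : Cseq u l -> Cseq v m -> Cseq (fun n => u n * v n)%C (l * m)%C.
Proof.
  intros H1 H2 eps He. set (A := Cmod l + Cmod m + 1).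
  assert (F0 := Cmod_ge_0 l). assert (G0 := Cmod_ge_0 m). assert (HA : 1 <= A) by (unfold A; lra).
  set (e := Rmin 1 (eps / (2 * A))).
  assert (E1 : 0 < e) by (apply Rmin_glb_lt; [lra|apply Rdiv_lt_0_compat; lra]).
  destruct (H1 e E1) as [N1 K1]. destruct (H2 e E1) as [N2 K2]. exists (max N1 N2). intros n Hn.
  specialize (K1 n ltac:(lia)). specialize (K2 n ltac:(lia)).
  replace (u n * v n - l * m)%C with ((u n - l) * (v n - m) + (u n - l) * m + l * (v n - m))%C by ring.
  eapply Rle_lt_trans. apply Cmod_triangle. eapply Rle_lt_trans. apply Rplus_le_compat_r, Cmod_triangle.
  rewrite !Cmod_mult.
  assert (X1 : e <= 1) by apply Rmin_l. assert (X2 : e <= eps / (2 * A)) by apply Rmin_r.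
  assert (X3 : e * A <= eps / 2).
  { apply Rmult_le_compat_r with (r := A) in X2; [|lra].
    replace (eps / (2 * A) * A) with (eps / 2) in X2 by (field; lra). lra. }
  assert (P1 := Cmod_ge_0 (u n - l)). assert (P2 := Cmod_ge_0 (v n - m)).
  assert (Cmod (u n - l) * Cmod (v n - m) <= e * 1) by (apply Rmult_le_compat; lra).
  assert (Cmod (u n - l) * Cmod m <= e * Cmod m) by (apply Rmult_le_compat_r; lra).
  assert (Cmod l * Cmod (v n - m) <= Cmod l * e) by (apply Rmult_le_compat_l; lra).
  unfold A in X3. lra.
Qed.

Lemma Cseq_const c : Cseq (fun _ => c) c.
Proof. intros eps He. exists 0%nat. intros n _. rewrite Cmod_self_0; auto. Qed.

Lemma Cseq_lim_unique u v l m : Cseq u l -> Cseq v m ->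
  (exists N, forall n, (N <= n)%nat -> u n = v n) -> l = m.
Proof.
  intros H1 H2 [N0 E]. apply (Cseq_unique u l m (fun n => n + N0)%nat); auto; [|lia].
  intros eps He. destruct (H2 eps He) as [N K]. exists N. intros n Hn. rewrite E by lia. apply K. lia.
Qed.

Lemma euler_Z s : 1 < fst s -> Cseq (fun N => zetaD s * LD s * eprod (fZ s) N)%C 1%C.
Proof.
  intros Hs. replace (RtoC 1) with (RtoC 1 * RtoC 1)%C by ring.
  intros eps He.
  destruct (Cseq_mult _ _ _ _ (euler_limit _ _ _ s euler_one Hs) (euler_limit _ _ _ s euler_chi4 Hs) eps He) as [N K].
  exists N. intros n Hn. specialize (K n Hn). unfold fZ. rewrite eprod_mult.
  replace (zetaD s * LD s * (eprod (fun p => 1 - RtoC (one p) * cpow_neg p s) n * eprod (fun p => 1 - RtoC (chi4 p) * cpow_neg p s) n))%C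
    with (Dser one s * eprod (fun p => 1 - RtoC (one p) * cpow_neg p s) n * (Dser chi4 s * eprod (fun p => 1 - RtoC (chi4 p) * cpow_neg p s) n))%C
    by (unfold zetaD, LD; ring). exact K.
Qed.

Lemma cpow_sq p s : (1 <= p)%nat -> cpow_neg (p * p) s = (cpow_neg p s * cpow_neg p s)%C.
Proof. intros. apply cpow_mult; auto. Qed.

Lemma cpow_double p s : cpow_neg p (2 * s) = (cpow_neg p s * cpow_neg p s)%C.
Proof. rewrite !cpow_Cexp, <- Cexp_plus. f_equal. ring. Qed.

Lemma chi4_p p : (p mod 4 = 1)%nat -> chi4 p = 1.
Proof.
  intros H. assert (H4 := Nat.div_mod p 4 ltac:(lia)). assert (H2 := Nat.div_mod p 2 ltac:(lia)).
  assert (L2 := Nat.mod_upper_bound p 2 ltac:(lia)).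
  unfold chi4. destruct (Nat.eqb_spec (p mod 2) 0). lia. rewrite H. auto.
Qed.

Lemma chi4_m p : (p mod 4 = 3)%nat -> chi4 p = -1.
Proof.
  intros H. assert (H4 := Nat.div_mod p 4 ltac:(lia)). assert (H2 := Nat.div_mod p 2 ltac:(lia)).
  assert (L2 := Nat.mod_upper_bound p 2 ltac:(lia)).
  unfold chi4. destruct (Nat.eqb_spec (p mod 2) 0). lia. rewrite H. auto.
Qed.

(** With v = p^-s, the squared factor of F is (1 - v)^2 for p = 1 mod 4, which is that of zeta L,
    and (1 - v^2)^2 for p = 3 mod 4, which is (1 - v) (1 + v) from zeta L times 1 - v^2 from H3. *)
Lemma FD_square s : 1 < fst s -> (FD s * FD s * (1 - cpow_neg 2 s) = zetaD s * LD s * H3 s)%C.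
Proof.
  intros Hs.
  set (eF := eprod (fun p => 1 - RtoC (one p) * cpow_neg (qE p) s)%C).
  set (eH := eprod (fun p => 1 - RtoC (w3 p) * cpow_neg p (2 * s))%C).
  assert (LF : Cseq (fun N => FD s * eF N)%C 1%C) by exact (euler_limit _ _ _ s euler_indE Hs).
  assert (LH : Cseq (fun N => H3 s * eH N)%C 1%C).
  { refine (euler_limit _ _ _ (2 * s)%C euler_g3 _). simpl. lra. }
  assert (LZ := euler_Z s Hs).
  (* From N = 3 on the prime 2 is included; it is the one prime where the factors disagree, by 1 -
     2^-s. *)
  assert (Id : forall N, (3 <= N)%nat -> (eF N * eF N = eprod (fZ s) N * eH N * (1 - cpow_neg 2 s))%C).
  { assert (St : forall N, prime (Z.of_nat N) -> N <> 2%nat ->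
      ((1 - RtoC (one N) * cpow_neg (qE N) s) * (1 - RtoC (one N) * cpow_neg (qE N) s) =
       fZ s N * (1 - RtoC (w3 N) * cpow_neg N (2 * s)))%C).
    { intros N PN N2. unfold fZ, qE, w3, one. assert (P2 := prime_ge_2 _ PN).
      destruct (prime_cases N PN) as [|[E|E]]. tauto.
      - rewrite chi4_p by auto. rewrite E. simpl. ring.
      - rewrite chi4_m by auto. rewrite E. simpl Nat.eqb. cbv iota. rewrite cpow_sq, cpow_double by lia. ring. }
    induction N; intros HN. lia.
    destruct (Nat.eq_dec N 2) as [->|].
    - unfold eF, eH, fZ. simpl eprod.
      destruct (prime_dec (Z.of_nat 0)) as [P|]. exfalso; apply (not_prime_0 P).
      destruct (prime_dec (Z.of_nat 1)) as [P|]. exfalso; apply (not_prime_1 P).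
      destruct (prime_dec 2) as [P|P]. 2: exfalso; apply P, prime_2.
      change (chi4 2) with 0. change (qE 2) with 2%nat. change (w3 2) with 0. change (one 2) with 1. ring.
    - unfold eF, eH in *. simpl eprod. specialize (IHN ltac:(lia)).
      destruct (prime_dec (Z.of_nat N)) as [PN|].
      + set (x := eprod _ N) in *. set (y := eprod _ N) in *. set (z := eprod _ N) in *.
        set (u := (1 - RtoC (one N) * cpow_neg (qE N) s)%C) in *.
        replace (x * u * (x * u))%C with (x * x * (u * u))%C by ring. rewrite IHN. unfold u. rewrite St by auto. ring.
      + replace (eprod (fun p => 1 - RtoC (one p) * cpow_neg (qE p) s) N * 1 * (eprod (fun p => 1 - RtoC (one p) * cpow_neg (qE p) s) N * 1))%C
         with (eprod (fun p => 1 - RtoC (one p) * cpow_neg (qE p) s) N * eprod (fun p => 1 - RtoC (one p) * cpow_neg (qE p) s) N)%C by ring.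
        rewrite IHN. ring. }
  (* Each side is multiplied by the other side's products, which tend to 1, so that no limit of a
     quotient occurs. *)
  apply (Cseq_lim_unique
    (fun N => FD s * FD s * (1 - cpow_neg 2 s) * (zetaD s * LD s * eprod (fZ s) N * (H3 s * eH N)))%C
    (fun N => zetaD s * LD s * H3 s * (FD s * eF N * (FD s * eF N)))%C).
  - replace (FD s * FD s * (1 - cpow_neg 2 s))%C with (FD s * FD s * (1 - cpow_neg 2 s) * (1 * 1))%C at 1 by ring.
    apply (Cseq_mult (fun _ => FD s * FD s * (1 - cpow_neg 2 s))%C). apply Cseq_const.
    apply (Cseq_mult _ _ _ _ LZ LH).
  - replace (zetaD s * LD s * H3 s)%C with (zetaD s * LD s * H3 s * (1 * 1))%C at 1 by ring.
    apply (Cseq_mult (fun _ => zetaD s * LD s * H3 s)%C). apply Cseq_const.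
    apply (Cseq_mult _ _ _ _ LF LF).
  - exists 3%nat. intros N HN.
    replace (FD s * eF N * (FD s * eF N))%C with (FD s * FD s * (eF N * eF N))%C by ring.
    rewrite Id by auto. ring.
Qed.

Lemma euler_limit_neq a (e : nat -> C) : Cseq (fun N => a * e N)%C 1%C -> a <> 0%C.
Proof.
  intros H E. destruct (H (1/2)) as [N K]. lra. specialize (K N (Nat.le_refl _)). rewrite E in K.
  replace (0 * e N - 1)%C with (- (1))%C in K by ring. rewrite Cmod_m1 in K. lra.
Qed.

Lemma Z_neq_0 s : 1 < fst s -> (zetaD s * LD s)%C <> 0%C.
Proof. intros Hs. eapply euler_limit_neq. apply euler_Z; auto. Qed.

Lemma H3_neq_0 s : 1/2 < fst s -> H3 s <> 0%C.
Proof.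
  intros Hs. eapply euler_limit_neq. refine (euler_limit _ _ _ (2 * s)%C euler_g3 _). simpl. lra.
Qed.

Lemma holo_H3 : holo (fun s => 1/2 < fst s) H3.
Proof.
  unfold H3. apply (holo_comp _ (fun s => 1 < fst s) (Dser g3) (fun s => 2 * s)%C).
  apply holo_mult. apply holo_const. apply holo_id. intros z Hz. simpl. lra.
  apply holo_Dser. apply (ed_bound _ _ _ euler_g3).
Qed.

Lemma H3_bound s : 1/2 < fst s -> Cmod (H3 s) <= 1 + / (2 * fst s - 1).
Proof.
  intros Hs. unfold H3. eapply Rle_trans. apply Dser_bound. apply (ed_bound _ _ _ euler_g3). simpl; lra.
  right. f_equal. f_equal. simpl. ring.
Qed.

(** * Analytic continuation *)

Definition xpow (c : C) (x : R) : C := Cexp (c * RtoC (ln x)).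

Lemma xpow_deriv c x : 0 < x ->
  is_derive (fun u => fst (xpow c u)) x (fst (c * xpow (c - 1) x)%C) /\
  is_derive (fun u => snd (xpow c u)) x (snd (c * xpow (c - 1) x)%C).
Proof.
  intros Hx.
  assert (K : Cderiv (fun y => Cexp (c * y)) (RtoC (ln x)) (Cexp (c * RtoC (ln x)) * c)).
  { apply (Cderiv_comp Cexp (fun y => c * y)%C). 2: apply Cderiv_Cexp.
    apply (Cderiv_ext_loc (fun x => 0 + c * x)%C _ _ _ 1). lra. intros; ring. apply Cderiv_affine. }
  apply Cderiv_restrict in K. destruct K as [K1 K2].
  assert (L : is_derive ln x (/ x)) by (apply is_derive_Reals, derivable_pt_lim_ln; auto).
  assert (E : (c * xpow (c - 1) x = RtoC (/ x) * (Cexp (c * RtoC (ln x)) * c))%C).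
  { unfold xpow. replace ((c - 1) * RtoC (ln x))%C with (c * RtoC (ln x) + - RtoC (ln x))%C by ring.
    rewrite Cexp_plus, Cexp_opp, Cexp_RtoC, exp_ln by auto. rewrite RtoC_inv. ring. lra. }
  rewrite E.
  split.
  - assert (D := is_derive_comp (fun y => fst (Cexp (c * RtoC y))) ln x _ _ K1 L).
    unfold scal in D; simpl in D; unfold mult in D; simpl in D.
    replace (fst (RtoC (/ x) * (Cexp (c * RtoC (ln x)) * c))%C) with (/ x * fst (Cexp (c * RtoC (ln x)) * c)%C); auto.
    simpl. ring.
  - assert (D := is_derive_comp (fun y => snd (Cexp (c * RtoC y))) ln x _ _ K2 L).
    unfold scal in D; simpl in D; unfold mult in D; simpl in D.
    replace (snd (RtoC (/ x) * (Cexp (c * RtoC (ln x)) * c))%C) with (/ x * snd (Cexp (c * RtoC (ln x)) * c)%C); auto.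
    simpl. ring.
Qed.

Lemma cmvt (F F' : R -> C) a b M : a <= b ->
  (forall x, a <= x <= b -> is_derive (fun u => fst (F u)) x (fst (F' x)) /\
     is_derive (fun u => snd (F u)) x (snd (F' x)) /\ Cmod (F' x) <= M) ->
  Cmod (F b - F a) <= 2 * M * (b - a).
Proof.
  intros AB H.
  assert (G : forall (p : R -> R) (p' : R -> R), (forall x, a <= x <= b -> is_derive p x (p' x) /\ Rabs (p' x) <= M) ->
     Rabs (p b - p a) <= M * (b - a)).
  { intros p p' Hp. destruct (MVT_gen p a b p') as [c [Hc E]].
    - rewrite Rmin_left, Rmax_right by lra. intros; apply Hp; lra.
    - rewrite Rmin_left, Rmax_right by lra. intros x Hx. apply continuity_pt_filterlim.
      apply (ex_derive_continuous (V := R_NormedModule)). exists (p' x). apply Hp; lra.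
    - rewrite Rmin_left, Rmax_right in Hc by lra. rewrite E, Rabs_mult, (Rabs_pos_eq (b - a)) by lra.
      apply Rmult_le_compat_r. lra. apply Hp; auto. }
  eapply Rle_trans. apply Cmod_le_sum. simpl.
  assert (G1 := G (fun u => fst (F u)) (fun u => fst (F' u))).
  assert (G2 := G (fun u => snd (F u)) (fun u => snd (F' u))).
  unfold Rminus in G1, G2. simpl in G1, G2.
  assert (Rabs (fst (F b) + - fst (F a)) <= M * (b + - a)).
  { apply G1. intros x Hx. destruct (H x Hx) as (A & B & C). split; auto. eapply Rle_trans. apply Cmod_fst. auto. }
  assert (Rabs (snd (F b) + - snd (F a)) <= M * (b + - a)).
  { apply G2. intros x Hx. destruct (H x Hx) as (A & B & C). split; auto. eapply Rle_trans. apply Cmod_snd. auto. }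
  lra.
Qed.

Lemma Cmod_xpow c x : Cmod (xpow c x) = Rpower x (fst c).
Proof. unfold xpow. rewrite Cmod_Cexp. unfold Rpower. f_equal. destruct c; simpl. ring. Qed.

Lemma Rpower_anti a b y : 0 < a <= b -> y <= 0 -> Rpower b y <= Rpower a y.
Proof.
  intros H Hy. replace y with (- - y) by ring. rewrite (Rpower_Ropp b), (Rpower_Ropp a).
  apply Rinv_le_contravar. apply Rpower_pos. apply Rle_Rpower_l; lra.
Qed.

Lemma xpow_diff c a b : 0 < a <= b -> fst c <= 1 ->
  Cmod (xpow c b - xpow c a) <= 2 * (Cmod c * Rpower a (fst c - 1)) * (b - a).
Proof.
  intros Hab Hc. apply (cmvt (xpow c) (fun x => c * xpow (c - 1) x)%C). lra.
  intros x Hx. destruct (xpow_deriv c x) as [A B]. lra. split; auto. split; auto.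
  rewrite Cmod_mult, Cmod_xpow. apply Rmult_le_compat_l. apply Cmod_ge_0.
  replace (fst (c - 1)%C) with (fst c - 1) by (simpl; ring). apply Rpower_anti; lra.
Qed.

Lemma xpow_cpow s n : xpow (- s) (INR n) = cpow_neg n s.
Proof. rewrite cpow_Cexp. unfold xpow. f_equal. ring. Qed.

Lemma xpow_1_cpow s n : (1 <= n)%nat -> xpow (1 - s) (INR n) = (RtoC (INR n) * cpow_neg n s)%C.
Proof.
  intros H. rewrite cpow_Cexp. unfold xpow.
  replace ((1 - s) * RtoC (ln (INR n)))%C with (RtoC (ln (INR n)) + - (RtoC (ln (INR n)) * s))%C by ring.
  rewrite Cexp_plus, Cexp_RtoC, exp_ln; auto. apply lt_0_INR; lia.
Qed.

(* [zterm k] is the second-order Taylor remainder of [x^(1-s)] on [k+1, k+2]. *)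
Definition zterm (k : nat) (s : C) : C :=
  ((s - 1) * cpow_neg (S k) s - RtoC (INR (S k)) * cpow_neg (S k) s + RtoC (INR (S (S k))) * cpow_neg (S (S k)) s)%C.

(** This is (s - 1) zeta(s), continued to Re s > 0 and regular at 1. The leading 1 is the boundary
    term x^(1-s) at x = 1 of the telescoping in [zterm_sum]. *)
Definition Z1 (s : C) : C := (1 + CSer (fun k => zterm k s))%C.

Lemma zterm_bound k s : 0 <= fst s ->
  Cmod (zterm k s) <= 4 * Cmod (s - 1) * Cmod s * Rpower (INR (S k)) (- (fst s + 1)).
Proof.
  intros Hs. set (a := INR (S k)). assert (Ha : 1 <= a) by apply INR_S_ge1.
  assert (Eb : INR (S (S k)) = a + 1) by (unfold a; rewrite (S_INR (S k)); auto).
  (* F is x^(1-s) minus its linear part at a, so that [zterm] is the increment F(a + 1) - F(a). Two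
     mean value estimates produce the factors |s - 1| and |s| and lower the exponent to - Re s -
     1. *)
  set (F := fun x => (xpow (1 - s) x + - ((1 - s) * xpow (- s) a) * RtoC x)%C).
  set (F' := fun x => ((1 - s) * (xpow (- s) x - xpow (- s) a))%C).
  assert (E : zterm k s = (F (a + 1)%R - F a)%C).
  { unfold zterm, F. rewrite <- Eb. unfold a. rewrite !xpow_1_cpow, xpow_cpow by lia.
    rewrite (S_INR (S k)), RtoC_plus. ring. }
  rewrite E.
  eapply Rle_trans. apply (cmvt F F' a (a + 1) (Cmod (s - 1) * (2 * (Cmod s * Rpower a (- (fst s + 1)))))). lra.
  - intros x Hx. destruct (xpow_deriv (1 - s)%C x ltac:(lra)) as [D1 D2].
    replace (1 - s - 1)%C with (- s)%C in D1, D2 by ring.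
    assert (Lin : forall k0 : R, is_derive (fun u => k0 * u) x k0).
    { intros k0. auto_derive; auto. ring. }
    set (q := (- ((1 - s) * xpow (- s) a))%C) in *.
    split; [|split].
    + apply (is_derive_ext (fun u => fst (xpow (1 - s) u) + fst q * u)).
      intros u; unfold F; fold q; simpl; ring.
      replace (fst (F' x)) with (fst ((1 - s) * xpow (- s) x)%C + fst q) by (unfold F', q; simpl; ring).
      apply (is_derive_plus (V := R_NormedModule)); auto.
    + apply (is_derive_ext (fun u => snd (xpow (1 - s) u) + snd q * u)).
      intros u; unfold F; fold q; simpl; ring.
      replace (snd (F' x)) with (snd ((1 - s) * xpow (- s) x)%C + snd q) by (unfold F', q; simpl; ring).
      apply (is_derive_plus (V := R_NormedModule)); auto.
    + unfold F'. rewrite Cmod_mult, (Cmod_minus_sym 1 s). apply Rmult_le_compat_l. apply Cmod_ge_0.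
      assert (D := xpow_diff (- s)%C a x ltac:(lra)). simpl fst in D. specialize (D ltac:(lra)).
      rewrite Cmod_opp in D. replace (- fst s - 1) with (- (fst s + 1)) in D by ring.
      eapply Rle_trans. exact D. rewrite <- (Rmult_1_r (2 * (Cmod s * Rpower a (- (fst s + 1))))) at 2.
      apply Rmult_le_compat_l. 2: lra.
      assert (P1 := Cmod_ge_0 s). assert (P2 := Rpower_pos a (- (fst s + 1))).
      assert (0 <= Cmod s * Rpower a (- (fst s + 1))) by (apply Rmult_le_pos; lra). lra.
  - right. ring.
Qed.

Lemma cpow_to_0 s : 0 < fst s -> forall eps, 0 < eps -> exists N, forall n, (N <= n)%nat -> Cmod (cpow_neg n s) < eps.
Proof.
  intros Hs eps He.
  destruct (INR_unbounded (Rpower eps (- / fst s))) as [N HN]. exists (S N). intros n Hn.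
  rewrite Cmod_cpow. assert (Pn : Rpower eps (- / fst s) < INR n).
  { eapply Rlt_le_trans. exact HN. apply le_INR; lia. }
  assert (P0 := Rpower_pos eps (- / fst s)).
  replace eps with (Rpower (Rpower eps (- / fst s)) (- fst s)).
  2:{ rewrite Rpower_mult. replace (- / fst s * - fst s) with 1 by (field; lra). apply Rpower_1; auto. }
  set (t := Rpower eps (- / fst s)) in *. clearbody t. rewrite !Rpower_Ropp.
  apply Rinv_lt_contravar. apply Rmult_lt_0_compat; apply Rpower_pos.
  apply Rlt_Rpower_l; [lra|split; lra].
Qed.

Lemma zterm_sum s N : (1 + csum (fun k => zterm k s) N = (s - 1) * csum (fun k => cpow_neg (S k) s) N + xpow (1 - s) (INR (S N)))%C.
Proof.
  induction N.
  - simpl csum. unfold xpow. simpl INR. rewrite ln_1. replace ((1 - s) * RtoC 0)%C with (RtoC 0) by ring. rewrite Cexp_0. ring.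
  - change (csum (fun k => zterm k s) (S N)) with (csum (fun k => zterm k s) N + zterm N s)%C.
    change (csum (fun k => cpow_neg (S k) s) (S N)) with (csum (fun k => cpow_neg (S k) s) N + cpow_neg (S N) s)%C.
    replace (1 + (csum (fun k => zterm k s) N + zterm N s))%C with (1 + csum (fun k => zterm k s) N + zterm N s)%C by ring.
    rewrite IHN. unfold zterm. rewrite !xpow_1_cpow by lia. ring.
Qed.

Lemma zser_dom s x : 0 < x <= fst s -> forall B, Cmod (s - 1) * Cmod s <= B ->
  (forall k, Cmod (zterm k s) <= 4 * B * Rpower (INR (S k)) (- (x + 1))).
Proof.
  intros Hx B HB k. eapply Rle_trans. apply zterm_bound. lra.
  assert (P := Rpower_pos (INR (S k)) (- (fst s + 1))).
  assert (Q : Rpower (INR (S k)) (- (fst s + 1)) <= Rpower (INR (S k)) (- (x + 1))).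
  { apply Rpower_le1. apply INR_S_ge1. lra. }
  assert (0 <= Cmod (s - 1) * Cmod s) by (apply Rmult_le_pos; apply Cmod_ge_0).
  rewrite (Rmult_assoc 4). apply Rmult_le_compat; lra.
Qed.

Lemma ex_series_zeta_scal B x : 0 < x -> ex_series (fun k => B * Rpower (INR (S k)) (- (x + 1))).
Proof. intros Hx. apply (ex_series_scal (V := R_NormedModule)). apply zeta_bound. lra. Qed.

Lemma Z1_conv s : 0 < fst s -> Cconv (fun k => zterm k s) (CSer (fun k => zterm k s)).
Proof.
  intros Hs. apply (dom_conv _ (fun k => 4 * (Cmod (s - 1) * Cmod s) * Rpower (INR (S k)) (- (fst s + 1)))).
  apply zser_dom; lra. apply ex_series_zeta_scal; auto.
Qed.

(** Pairing the terms of opposite sign of L(s, chi_4) gives a series that converges absolutely for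
    Re s > 0. *)
Definition lterm (k : nat) (s : C) : C := (cpow_neg (4 * k + 1) s - cpow_neg (4 * k + 3) s)%C.
Definition Lc (s : C) : C := CSer (fun k => lterm k s).

Lemma lterm_bound k s : 0 <= fst s -> Cmod (lterm k s) <= 4 * Cmod s * Rpower (INR (S k)) (- (fst s + 1)).
Proof.
  intros Hs. unfold lterm. rewrite <- !xpow_cpow. rewrite Cmod_minus_sym.
  assert (L1 : INR (S k) <= INR (4 * k + 1)) by (apply le_INR; lia).
  assert (L0 := INR_S_ge1 k).
  assert (L2 : INR (4 * k + 3) = INR (4 * k + 1) + 2).
  { replace (4 * k + 3)%nat with ((4 * k + 1) + 2)%nat by lia. rewrite plus_INR. simpl. ring. }
  assert (D := xpow_diff (- s)%C (INR (4 * k + 1)) (INR (4 * k + 3)) ltac:(lra)). simpl fst in D. specialize (D ltac:(lra)).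
  eapply Rle_trans. exact D. rewrite L2, Cmod_opp. replace (- fst s - 1) with (- (fst s + 1)) by ring.
  replace (INR (4 * k + 1) + 2 - INR (4 * k + 1)) with 2 by ring.
  assert (Q : Rpower (INR (4 * k + 1)) (- (fst s + 1)) <= Rpower (INR (S k)) (- (fst s + 1))).
  { apply Rpower_anti; lra. }
  assert (P := Cmod_ge_0 s).
  assert (Cmod s * Rpower (INR (4 * k + 1)) (- (fst s + 1)) <= Cmod s * Rpower (INR (S k)) (- (fst s + 1))) by (apply Rmult_le_compat_l; auto).
  lra.
Qed.

Lemma lser_dom s x : 0 < x <= fst s -> forall B, Cmod s <= B ->
  (forall k, Cmod (lterm k s) <= 4 * B * Rpower (INR (S k)) (- (x + 1))).
Proof.
  intros Hx B HB k. eapply Rle_trans. apply lterm_bound. lra.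
  assert (P := Rpower_pos (INR (S k)) (- (fst s + 1))).
  assert (Q : Rpower (INR (S k)) (- (fst s + 1)) <= Rpower (INR (S k)) (- (x + 1))).
  { apply Rpower_le1. apply INR_S_ge1. lra. }
  assert (0 <= Cmod s) by apply Cmod_ge_0. apply Rmult_le_compat; lra.
Qed.

Lemma Lc_conv s : 0 < fst s -> Cconv (fun k => lterm k s) (Lc s).
Proof.
  intros Hs. apply (dom_conv _ (fun k => 4 * (Cmod s) * Rpower (INR (S k)) (- (fst s + 1)))).
  apply lser_dom; lra. apply ex_series_zeta_scal; auto.
Qed.

Lemma local_dom z : 0 < fst z -> forall w, disc z (Rmin 1 (fst z / 2)) w -> 0 < fst w /\ fst z / 2 <= fst w /\
  Cmod w <= Cmod z + 1 /\ Cmod (w - 1) <= Cmod z + 2.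
Proof.
  intros Hz w Hw. unfold disc in Hw. apply Rmin_Rgt in Hw. destruct Hw as [A B].
  assert (T := Cmod_fst (w - z)%C). simpl in T. assert (T2 := Rle_lt_trans _ _ _ T B). apply Rabs_def2 in T2.
  assert (U : Cmod w <= Cmod z + 1).
  { assert (X := Cmod_triangle (w - z) z). replace (w - z + z)%C with w in X by ring. lra. }
  split. lra. split. lra. split; auto.
  assert (X := Cmod_minus_le w 1). rewrite Cmod_1 in X. lra.
Qed.

Lemma holo_Z1 : holo (fun s => 0 < fst s) Z1.
Proof.
  unfold Z1. apply holo_plus. apply holo_const. apply (holo_series (fun s => 0 < fst s) zterm).
  - intros n. unfold zterm. repeat first [apply holo_minus | apply holo_plus | apply holo_mult | apply holo_cpow | apply holo_const | apply holo_id].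
  - intros z Hz. exists (Rmin 1 (fst z / 2)), (fun k => 4 * ((Cmod z + 2) * (Cmod z + 1)) * Rpower (INR (S k)) (- (fst z / 2 + 1))).
    split. apply Rmin_glb_lt; lra. split. apply ex_series_zeta_scal. lra.
    intros n w Hw. destruct (local_dom z Hz w Hw) as (A & B & C1 & C2). split; auto.
    apply zser_dom. lra. apply Rmult_le_compat; auto; apply Cmod_ge_0.
Qed.

Lemma holo_Lc : holo (fun s => 0 < fst s) Lc.
Proof.
  unfold Lc. apply (holo_series (fun s => 0 < fst s) lterm).
  - intros n. unfold lterm. apply holo_minus; apply holo_cpow.
  - intros z Hz. exists (Rmin 1 (fst z / 2)), (fun k => 4 * (Cmod z + 1) * Rpower (INR (S k)) (- (fst z / 2 + 1))).
    split. apply Rmin_glb_lt; lra. split. apply ex_series_zeta_scal. lra.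
    intros n w Hw. destruct (local_dom z Hz w Hw) as (A & B & C1 & C2). split; auto.
    apply lser_dom. lra. auto.
Qed.

(** The exponent 1/4 leaves a margin: polynomial bounds on Re s >= 1/4 cover every disc and
    rectangle used later, which stay in Re s >= 1/2. *)
Lemma zeta_5 : Series (fun k => Rpower (INR (S k)) (- (1/4 + 1))) <= 5.
Proof.
  destruct (zeta_bound (1/4 + 1) ltac:(lra)) as [_ B]. eapply Rle_trans. exact B. lra.
Qed.

Lemma Z1_bound s : 1/4 <= fst s -> Cmod (Z1 s) <= 21 * (1 + Cmod s) ^ 2.
Proof.
  intros Hs. unfold Z1. eapply Rle_trans. apply Cmod_triangle. rewrite Cmod_1.
  assert (P := Cmod_ge_0 s). assert (X := Cmod_minus_le s 1). rewrite Cmod_1 in X.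
  assert (Y : Cmod (s - 1) * Cmod s <= (1 + Cmod s) * Cmod s) by (apply Rmult_le_compat_r; lra).
  assert (B : Cmod (CSer (fun k => zterm k s)) <= Series (fun k => 4 * ((1 + Cmod s) * Cmod s) * Rpower (INR (S k)) (- (1/4 + 1)))).
  { apply Cmod_CSer. apply zser_dom; lra. apply ex_series_zeta_scal; lra. }
  rewrite Series_scal_l in B. assert (Z5 := zeta_5). set (S5 := Series _) in *.
  assert (Q : 0 <= (1 + Cmod s) * Cmod s) by (apply Rmult_le_pos; lra).
  assert (4 * ((1 + Cmod s) * Cmod s) * S5 <= 4 * ((1 + Cmod s) * Cmod s) * 5) by (apply Rmult_le_compat_l; lra).
  nra.
Qed.

Lemma Lc_bound s : 1/4 <= fst s -> Cmod (Lc s) <= 20 * (1 + Cmod s).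
Proof.
  intros Hs. assert (P := Cmod_ge_0 s).
  assert (B : Cmod (Lc s) <= Series (fun k => 4 * (Cmod s) * Rpower (INR (S k)) (- (1/4 + 1)))).
  { apply Cmod_CSer. apply lser_dom; lra. apply ex_series_zeta_scal; lra. }
  rewrite Series_scal_l in B. assert (Z5 := zeta_5). set (S5 := Series _) in *.
  assert (4 * (Cmod s) * S5 <= 4 * Cmod s * 5) by (apply Rmult_le_compat_l; lra). lra.
Qed.

(** The function (s - 1) zeta(s) L(s, chi_4), regular at 1; all statements on zeros and growth are
    made for it. *)
Definition W (s : C) : C := (Z1 s * Lc s)%C.

Lemma holo_W : holo (fun s => 0 < fst s) W.
Proof. apply holo_mult. apply holo_Z1. apply holo_Lc. Qed.

Lemma W_bound s : 1/4 <= fst s -> Cmod (W s) <= 420 * (1 + Cmod s) ^ 3.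
Proof.
  intros Hs. unfold W. rewrite Cmod_mult. replace (420 * (1 + Cmod s) ^ 3) with (21 * (1 + Cmod s) ^ 2 * (20 * (1 + Cmod s))) by ring.
  apply Rmult_le_compat; try apply Cmod_ge_0. apply Z1_bound; auto. apply Lc_bound; auto.
Qed.

Lemma Cseq_plus u v l m : Cseq u l -> Cseq v m -> Cseq (fun n => u n + v n)%C (l + m)%C.
Proof.
  intros H1 H2 eps He. destruct (H1 (eps/2)) as [N1 K1]. lra. destruct (H2 (eps/2)) as [N2 K2]. lra.
  exists (max N1 N2). intros n Hn. specialize (K1 n ltac:(lia)). specialize (K2 n ltac:(lia)).
  replace (u n + v n - (l + m))%C with ((u n - l) + (v n - m))%C by ring.
  eapply Rle_lt_trans. apply Cmod_triangle. lra.
Qed.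

Lemma Cseq_sub u l (g : nat -> nat) : Cseq u l -> (forall n, (n <= g n)%nat) -> Cseq (fun n => u (g n)) l.
Proof.
  intros H Hg eps He. destruct (H eps He) as [N K]. exists N. intros n Hn. apply K. specialize (Hg n). lia.
Qed.

Lemma Cseq_ext u v l : (forall n, u n = v n) -> Cseq u l -> Cseq v l.
Proof. intros E H eps He. destruct (H eps He) as [N K]. exists N. intros n Hn. rewrite <- E. auto. Qed.

Lemma Z1_zeta s : 1 < fst s -> Z1 s = ((s - 1) * zetaD s)%C.
Proof.
  intros Hs. apply (Cseq_lim_unique (fun N => 1 + csum (fun k => zterm k s) N)%C
    (fun N => (s - 1) * csum (fun k => cpow_neg (S k) s) N + xpow (1 - s) (INR (S N)))%C).
  - unfold Z1. apply Cseq_plus. apply Cseq_const. apply Z1_conv. lra.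
  - replace ((s - 1) * zetaD s)%C with ((s - 1) * zetaD s + 0)%C by ring. apply Cseq_plus.
    apply Cseq_mult. apply Cseq_const.
    + assert (D := Dser_conv one s (ed_bound _ _ _ euler_one) Hs).
      apply (Cseq_ext (csum (fun k => RtoC (one (S k)) * cpow_neg (S k) s)%C)); auto.
      intros n. apply csum_ext. intros k _. unfold one. ring.
    + intros eps He. destruct (cpow_to_0 (s - 1)%C ltac:(simpl; lra) eps He) as [N K]. exists N. intros n Hn.
      replace (xpow (1 - s) (INR (S n)) - 0)%C with (cpow_neg (S n) (s - 1)). apply K; lia.
      rewrite <- xpow_cpow. replace (- (s - 1))%C with (1 - s)%C by ring. ring.
  - exists 0%nat. intros. apply zterm_sum.
Qed.

Lemma csum_blocks (c : nat -> C) m N : csum c (N * m) = csum (fun j => csum (fun i => c (j * m + i)%nat) m) N.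
Proof.
  induction N; simpl. auto. rewrite Nat.add_comm, csum_add, IHN. auto.
Qed.

(** An incomplete block has fewer than m terms, all small. This links the conditionally convergent
    series of the definitions with their absolutely convergent regroupings. *)
Lemma blocks_conv (c : nat -> C) m l : (1 <= m)%nat ->
  Cseq (fun N => csum c (N * m)) l -> Cseq c 0%C -> Cconv c l.
Proof.
  intros Hm H1 H2 eps He.
  assert (Im : 1 <= INR m) by (change 1 with (INR 1); apply le_INR; auto).
  destruct (H1 (eps / 2)) as [N1 K1]. lra. destruct (H2 (eps / (4 * INR m))) as [N2 K2]. apply Rdiv_lt_0_compat; lra.
  exists ((N1 + N2 + 1) * m)%nat. intros n Hn.
  assert (E := Nat.div_mod n m ltac:(lia)). assert (L := Nat.mod_upper_bound n m ltac:(lia)).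
  set (q := (n / m)%nat) in *. set (r := (n mod m)%nat) in *.
  assert (Q : (N1 + N2 + 1 <= q)%nat) by nia.
  rewrite E, Nat.mul_comm, csum_add.
  replace (csum c (q * m) + csum (fun k => c (q * m + k)%nat) r - l)%C with ((csum c (q * m) - l) + csum (fun k => c (q * m + k)%nat) r)%C by ring.
  eapply Rle_lt_trans. apply Cmod_triangle.
  assert (B : Cmod (csum (fun k => c (q * m + k)%nat) r) <= rsum (fun _ => eps / (4 * INR m)) r).
  { apply Cmod_csum. intros k Hk. left. replace (c (q * m + k)%nat) with (c (q * m + k)%nat - 0)%C by ring. apply K2. nia. }
  assert (Rs : forall n, rsum (fun _ => eps / (4 * INR m)) n = INR n * (eps / (4 * INR m))).
  { intros j. induction j. simpl; ring. rewrite S_INR. simpl rsum. rewrite IHj. ring. }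
  rewrite Rs in B.
  assert (INR r * (eps / (4 * INR m)) <= INR m * (eps / (4 * INR m))).
  { apply Rmult_le_compat_r. left; apply Rdiv_lt_0_compat; lra. apply le_INR; lia. }
  replace (INR m * (eps / (4 * INR m))) with (eps / 4) in H by (field; lra).
  specialize (K1 q ltac:(lia)). lra.
Qed.

Lemma cdirichlet_CSer a s : cdirichlet a s = CSer (fun k => RtoC (a (S k)) * cpow_neg (S k) s)%C.
Proof. unfold cdirichlet, CSer. f_equal; apply Series_ext; intros k; simpl; ring. Qed.

Lemma term_to_0 a s : bounded1 a -> 0 < fst s -> Cseq (fun k => RtoC (a (S k)) * cpow_neg (S k) s)%C 0%C.
Proof.
  intros Ha Hs eps He. destruct (cpow_to_0 s Hs eps He) as [N K]. exists N. intros n Hn.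
  replace (RtoC (a (S n)) * cpow_neg (S n) s - 0)%C with (RtoC (a (S n)) * cpow_neg (S n) s)%C by ring.
  rewrite Cmod_mult, Cmod_R. specialize (K (S n) ltac:(lia)). assert (Q := Ha (S n)).
  assert (P := Cmod_ge_0 (cpow_neg (S n) s)).
  eapply Rle_lt_trans; [|exact K]. rewrite <- (Rmult_1_l (Cmod _)) at 2. apply Rmult_le_compat_r; auto.
Qed.

Lemma L4_conv s : 0 < fst s -> Cconv (fun k => RtoC (chi4 (S k)) * cpow_neg (S k) s)%C (Lc s).
Proof.
  intros Hs. apply (blocks_conv _ 4). lia.
  - apply (Cseq_ext (csum (fun k => lterm k s))). 2: apply Lc_conv; auto.
    intros n. rewrite csum_blocks. apply csum_ext. intros j _. simpl csum.
    assert (C1 : chi4 (S (j * 4 + 0)) = 1).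
    { apply chi4_p. replace (S (j * 4 + 0)) with (1 + j * 4)%nat by lia. rewrite Nat.Div0.mod_add. auto. }
    assert (C3 : chi4 (S (j * 4 + 2)) = -1).
    { apply chi4_m. replace (S (j * 4 + 2)) with (3 + j * 4)%nat by lia. rewrite Nat.Div0.mod_add. auto. }
    assert (Ev : forall n, (n mod 2 = 0)%nat -> chi4 n = 0) by (intros k Hk; unfold chi4; rewrite Hk; auto).
    assert (C2 : chi4 (S (j * 4 + 1)) = 0).
    { apply Ev. replace (S (j * 4 + 1)) with (0 + (2 * j + 1) * 2)%nat by lia. rewrite Nat.Div0.mod_add. auto. }
    assert (C4 : chi4 (S (j * 4 + 3)) = 0).
    { apply Ev. replace (S (j * 4 + 3)) with (0 + (2 * j + 2) * 2)%nat by lia. rewrite Nat.Div0.mod_add. auto. }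
    rewrite C1, C2, C3, C4. unfold lterm.
    replace (4 * j + 1)%nat with (S (j * 4 + 0)) by lia. replace (4 * j + 3)%nat with (S (j * 4 + 2)) by lia. ring.
  - apply term_to_0; auto. apply chi4_bounded.
Qed.

Lemma L4_C_eq s : 0 < fst s -> L4_C s = Lc s.
Proof. intros Hs. unfold L4_C. rewrite cdirichlet_CSer. apply Cconv_CSer. apply L4_conv; auto. Qed.

Lemma LD_eq s : 1 < fst s -> LD s = Lc s.
Proof. intros Hs. unfold LD, Dser. apply Cconv_CSer, L4_conv. lra. Qed.

Lemma W_Z s : 1 < fst s -> W s = ((s - 1) * (zetaD s * LD s))%C.
Proof. intros Hs. unfold W. rewrite Z1_zeta, LD_eq by auto. ring. Qed.

(** * The eta series and zeta *)

Definition etaterm (k : nat) (s : C) : C := (cpow_neg (2 * k + 1) s - cpow_neg (2 * k + 2) s)%C.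

Lemma eta_partial s N : csum (fun k => etaterm k s) N =
  (csum (fun k => cpow_neg (S k) s) (2 * N) - 2 * cpow_neg 2 s * csum (fun k => cpow_neg (S k) s) N)%C.
Proof.
  assert (cS : forall c n, csum c (S n) = (csum c n + c n)%C) by reflexivity.
  induction N. simpl. ring.
  replace (2 * S N)%nat with (S (S (2 * N))) by lia. rewrite !cS, IHN. unfold etaterm.
  replace (2 * N + 2)%nat with (2 * S N)%nat by lia. replace (S (S (2 * N))) with (2 * S N)%nat by lia.
  rewrite (cpow_mult 2 (S N)) by lia. replace (2 * N + 1)%nat with (S (2 * N)) by lia. ring.
Qed.

(** A partial sum of eta is S(2N) - 2 * 2^-s * S(N) for the partial sums S of zeta. Written through
    [zterm_sum], the growing boundary terms leave the difference of x^(1-s) at 2N + 2 and 2N + 1,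
    which tends to 0 for Re s > 0. *)
Lemma eta_Z1 (s : C) : 0 < fst s -> s <> RtoC 1 -> Cseq (csum (fun k => etaterm k s)) ((1 - 2 * cpow_neg 2 s) * Z1 s / (s - 1))%C.
Proof.
  intros Hs N1. assert (Nz : (s - 1)%C <> 0%C) by (apply Cminus_neq_0; auto).
  set (P := fun N => (1 + csum (fun k => zterm k s) N)%C).
  assert (LP : Cseq P (Z1 s)) by (apply Cseq_plus; [apply Cseq_const|apply Z1_conv; auto]).
  assert (E : forall N, csum (fun k => etaterm k s) N =
    (/ (s - 1) * (P (2 * N)%nat + ((- (2 * cpow_neg 2 s)) * P N + (xpow (1 - s) (INR (2 * S N)) - xpow (1 - s) (INR (S (2 * N)))))))%C).
  { intros N. rewrite eta_partial. unfold P. rewrite !zterm_sum.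
    rewrite (xpow_1_cpow s (2 * S N)), (xpow_1_cpow s (S N)) by lia. rewrite (cpow_mult 2 (S N)) by lia.
    rewrite mult_INR, RtoC_mult. replace (INR 2) with 2 by (simpl; ring). field. auto. }
  apply (Cseq_ext _ _ _ (fun n => eq_sym (E n))).
  replace ((1 - 2 * cpow_neg 2 s) * Z1 s / (s - 1))%C with (/ (s - 1) * (Z1 s + ((- (2 * cpow_neg 2 s)) * Z1 s + 0)))%C by (field; auto).
  apply Cseq_mult. apply Cseq_const. apply Cseq_plus. apply (Cseq_sub P _ (fun N => (2 * N)%nat)); auto. intros; lia.
  apply Cseq_plus. apply Cseq_mult. apply Cseq_const. auto.
  intros eps He. assert (Pc := Cmod_ge_0 (1 - s)).
  destruct (cpow_to_0 s Hs (eps / (2 * Cmod (1 - s) + 1))) as [N K]. apply Rdiv_lt_0_compat; lra.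
  exists N. intros n Hn. specialize (K (S (2 * n)) ltac:(lia)).
  replace (xpow (1 - s) (INR (2 * S n)) - xpow (1 - s) (INR (S (2 * n))) - 0)%C with (xpow (1 - s) (INR (2 * S n)) - xpow (1 - s) (INR (S (2 * n))))%C by ring.
  assert (E2 : INR (2 * S n) = INR (S (2 * n)) + 1) by (replace (2 * S n)%nat with (S (S (2 * n))) by lia; apply S_INR).
  assert (L := INR_S_ge1 (2 * n)).
  assert (D := xpow_diff (1 - s)%C (INR (S (2 * n))) (INR (2 * S n)) ltac:(lra)). simpl fst in D. specialize (D ltac:(lra)).
  eapply Rle_lt_trans. exact D. rewrite E2. replace (INR (S (2 * n)) + 1 - INR (S (2 * n))) with 1 by ring.
  replace (1 + - fst s - 1) with (- fst s) by ring. rewrite Cmod_cpow in K.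
  set (y := Rpower _ _) in *. assert (0 < y) by apply Rpower_pos.
  apply Rmult_lt_compat_r with (r := 2 * Cmod (1 - s) + 1) in K; [|lra].
  unfold Rdiv in K. rewrite Rmult_assoc, Rinv_l in K by lra. nra.
Qed.

Lemma eta_conv (s : C) : 0 < fst s -> s <> RtoC 1 ->
  Cconv (fun k => RtoC ((-1) ^ (S (S k))) * cpow_neg (S k) s)%C ((1 - 2 * cpow_neg 2 s) * Z1 s / (s - 1))%C.
Proof.
  intros Hs N1. apply (blocks_conv _ 2). lia.
  - apply (Cseq_ext (csum (fun k => etaterm k s))). 2: apply eta_Z1; auto.
    intros n. rewrite csum_blocks. apply csum_ext. intros j _. cbn [csum]. unfold etaterm.
    replace (2 * j + 1)%nat with (S (j * 2 + 0)) by lia. replace (2 * j + 2)%nat with (S (j * 2 + 1)) by lia.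
    replace ((-1) ^ S (S (j * 2 + 0))) with 1. replace ((-1) ^ S (S (j * 2 + 1))) with (-1). ring.
    replace (S (S (j * 2 + 1))) with (S (2 * (j + 1))) by lia. rewrite pow_1_odd. auto.
    replace (S (S (j * 2 + 0))) with (2 * (j + 1))%nat by lia. rewrite pow_1_even. auto.
  - apply (term_to_0 (fun n => (-1) ^ S n)); auto. intros n. rewrite pow_1_abs. lra.
Qed.

Lemma eta_C_eq (s : C) : 0 < fst s -> s <> RtoC 1 -> eta_C s = ((1 - 2 * cpow_neg 2 s) * Z1 s / (s - 1))%C.
Proof. intros Hs N1. unfold eta_C. rewrite cdirichlet_CSer. apply Cconv_CSer. apply eta_conv; auto. Qed.

Lemma eta_factor_neq s : 0 < fst s -> fst s <> 1 -> (1 - 2 * cpow_neg 2 s)%C <> 0%C.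
Proof.
  intros Hs N1 E. assert (E2 : (2 * cpow_neg 2 s = 1)%C).
  { replace (2 * cpow_neg 2 s)%C with (1 - (1 - 2 * cpow_neg 2 s))%C by ring. rewrite E. ring. }
  apply (f_equal Cmod) in E2. rewrite Cmod_mult, Cmod_R, Cmod_cpow, Cmod_1, Rabs_pos_eq in E2 by lra.
  simpl (INR 2) in E2.
  assert (E3 : Rpower 2 (1 - fst s) = Rpower 2 0).
  { unfold Rminus. rewrite Rpower_plus, Rpower_1, Rpower_O by lra. exact E2. }
  destruct (Rtotal_order (1 - fst s) 0) as [L|[L|L]]. assert (Q := Rpower_lt 2 _ _ ltac:(lra) L). lra. lra.
  assert (Q := Rpower_lt 2 _ _ ltac:(lra) L). lra.
Qed.

(** The factor 1 - 2^(1-s) cancels where it is nonzero; its zeros lie on Re s = 1, outside the strip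
    where the Riemann Hypothesis is formulated. *)
Lemma zeta_C_eq s : 0 < fst s -> fst s <> 1 -> zeta_C s = (Z1 s / (s - 1))%C.
Proof.
  intros Hs N1. assert (Ns : s <> RtoC 1) by (intros E; apply N1; rewrite E; auto).
  unfold zeta_C. rewrite eta_C_eq by auto. assert (X := eta_factor_neq s Hs N1).
  field. split. apply Cminus_neq_0; auto. auto.
Qed.

(** * The zero-free region *)

(** The common shape reduces the 3-4-1 inequality and the lower bound for zeta L to a single factor
    1 - exp(- lam s) with real lam. *)
Lemma factor_form p : prime (Z.of_nat p) -> exists lam m, 0 < lam /\
  forall s, fZ s p = ((1 - Cexp (- (RtoC lam * s))) ^ m)%C.
Proof.
  intros Pp. assert (P2 := prime_ge_2 _ Pp).
  assert (Lp : 0 < ln (INR p)).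
  { rewrite <- ln_1. apply ln_increasing. lra. change 1 with (INR 1). apply lt_INR. lia. }
  unfold fZ, one. destruct (prime_cases p Pp) as [->|[E|E]].
  - exists (ln (INR 2)), 1%nat. split; auto. intros s. change (chi4 2) with 0. rewrite cpow_Cexp. cbn [Cpow]. ring.
  - exists (ln (INR p)), 2%nat. split; auto. intros s. rewrite chi4_p, cpow_Cexp by auto. cbn [Cpow]. ring.
  - exists (2 * ln (INR p)), 1%nat. split. lra. intros s. rewrite chi4_m, cpow_Cexp by auto.
    replace (- (RtoC (2 * ln (INR p)) * s))%C with (- (RtoC (ln (INR p)) * s) + - (RtoC (ln (INR p)) * s))%C
      by (rewrite RtoC_mult; ring).
    rewrite Cexp_plus. cbn [Cpow]. ring.
Qed.

(** For one factor, |1 - v| (1 - r) <= (1 + r) (1 - r) <= 1 with r = |v|. In the limit this bounds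
    |zeta L| from below by the inverse of its value at the real point Re s. *)
Lemma Cmod_eprod_le1 s N : 0 < fst s -> Cmod (eprod (fZ s) N) * Cmod (eprod (fZ (RtoC (fst s))) N) <= 1.
Proof.
  intros Hs. induction N; simpl. rewrite Cmod_1; lra.
  destruct (prime_dec (Z.of_nat N)) as [PN|]; [|rewrite !Cmult_1_r; auto].
  destruct (factor_form N PN) as (lam & m & Hl & E). rewrite !E, !Cmod_mult, !Cmod_pow.
  set (v := Cexp (- (RtoC lam * s))). set (r := exp (- (lam * fst s))).
  assert (Hr : 0 < r < 1).
  { unfold r. split. apply exp_pos. rewrite <- exp_0. apply exp_increasing.
    assert (0 < lam * fst s) by (apply Rmult_lt_0_compat; auto). lra. }
  assert (V : Cmod v = r).
  { unfold v, r. rewrite Cmod_Cexp. f_equal. simpl. ring. }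
  assert (V0 : Cexp (- (RtoC lam * RtoC (fst s))) = RtoC r).
  { rewrite <- RtoC_mult, <- RtoC_opp, Cexp_RtoC. auto. }
  rewrite V0. replace (1 - RtoC r)%C with (RtoC (1 - r)) by (rewrite RtoC_minus; auto).
  rewrite Cmod_R, Rabs_pos_eq by lra.
  assert (A := Cmod_minus_le 1 v). rewrite Cmod_1, V in A.
  assert (B : Cmod (1 - v) * (1 - r) <= 1).
  { apply Rle_trans with ((1 + r) * (1 - r)). apply Rmult_le_compat_r; lra. nra. }
  set (x := Cmod (eprod (fZ s) N)) in *. set (y := Cmod (eprod (fZ (RtoC (fst s))) N)) in *.
  assert (X : 0 <= x) by apply Cmod_ge_0. assert (Y : 0 <= y) by apply Cmod_ge_0.
  replace (x * Cmod (1 - v) ^ m * (y * (1 - r) ^ m)) with (x * y * (Cmod (1 - v) * (1 - r)) ^ m) by (rewrite Rpow_mult_distr; ring).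
  assert (0 <= Cmod (1 - v) * (1 - r)) by (apply Rmult_le_pos; [apply Cmod_ge_0|lra]).
  assert (C1 : (Cmod (1 - v) * (1 - r)) ^ m <= 1). { apply Rle_trans with (1 ^ m). apply pow_incr; split; auto. rewrite pow1; lra. }
  assert (0 <= (Cmod (1 - v) * (1 - r)) ^ m) by (apply pow_le; auto).
  apply Rle_trans with (1 * 1); [|lra]. apply Rmult_le_compat; auto. apply Rmult_le_pos; auto.
Qed.

Definition ZZ (s : C) : C := (zetaD s * LD s)%C.

Lemma Cseq_mod u l : Cseq u l -> is_lim_seq (fun n => Cmod (u n)) (Cmod l).
Proof.
  intros H. apply is_lim_seq_spec. intros eps. destruct (H eps (cond_pos eps)) as [N K]. exists N. intros n Hn.
  specialize (K n Hn). apply Rabs_def1.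
  assert (T := Cmod_ge_minus (u n) l). lra. assert (T := Cmod_ge_minus l (u n)). rewrite Cmod_minus_sym in T. lra.
Qed.

Lemma ZZ_lower s : 1 < fst s -> 1 <= Cmod (ZZ s) * Cmod (ZZ (RtoC (fst s))).
Proof.
  intros Hs.
  assert (L1 := Cseq_mod _ _ (euler_Z s Hs)).
  assert (L2 := Cseq_mod _ _ (euler_Z (RtoC (fst s)) Hs)).
  rewrite Cmod_1 in L1, L2. assert (L := is_lim_seq_mult' _ _ _ _ L1 L2). rewrite Rmult_1_r in L.
  apply (is_lim_seq_le _ (fun _ => Cmod (ZZ s) * Cmod (ZZ (RtoC (fst s)))) 1 (Cmod (ZZ s) * Cmod (ZZ (RtoC (fst s)))) ) in L; auto.
  - intros n. fold (ZZ s). fold (ZZ (RtoC (fst s))). rewrite (Cmod_mult (ZZ s)), (Cmod_mult (ZZ (RtoC (fst s)))).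
    assert (Q := Cmod_eprod_le1 s n ltac:(lra)).
    set (a := Cmod (ZZ s)). set (b := Cmod (ZZ (RtoC (fst s)))). set (x := Cmod (eprod (fZ s) n)) in *. set (y := Cmod (eprod (fZ (RtoC (fst s))) n)) in *.
    replace (a * x * (b * y)) with (a * b * (x * y)) by ring. apply Rle_trans with (a * b * 1); [|right; unfold a, b; ring].
    apply Rmult_le_compat_l; auto. apply Rmult_le_pos; apply Cmod_ge_0.
  - apply is_lim_seq_const.
Qed.

Lemma ZZ_upper s : 1 < fst s -> Cmod (ZZ s) <= (1 + / (fst s - 1)) ^ 2.
Proof.
  intros Hs. unfold ZZ. rewrite Cmod_mult. simpl. rewrite Rmult_1_r.
  apply Rmult_le_compat; try apply Cmod_ge_0; apply Dser_bound; auto. apply (ed_bound _ _ _ euler_one). apply chi4_bounded.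
Qed.

(* Bernstein expansion on [0,1] x [-1,1] of the numerator of
   [3/(1-r) + 4 (c-r)/(1-2rc+r^2) + (c2-r)/(1-2r c2+r^2)], where [c2 = 2c^2-1]. *)
Lemma three_four_one_num r c : 0 <= r <= 1 -> -1 <= c <= 1 ->
  0 <= 3 * (1 - 2*r*c + r^2) * (1 - 2*r*(2*c^2-1) + r^2) + 4 * (c - r) * (1 - r) * (1 - 2*r*(2*c^2-1) + r^2)
   + ((2*c^2-1) - r) * (1 - r) * (1 - 2*r*c + r^2).
Proof.
  intros Hr Hc.
  pose (q := 1 - r). pose (u := (1 + c) / 2). pose (z := (1 - c) / 2).
  replace (3 * (1 - 2*r*c + r^2) * (1 - 2*r*(2*c^2-1) + r^2) + 4 * (c - r) * (1 - r) * (1 - 2*r*(2*c^2-1) + r^2)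
   + ((2*c^2-1) - r) * (1 - r) * (1 - 2*r*c + r^2)) with
   (8 * q^4 * u^2 * z + 8 * q^4 * u^3 + r * q^3 * z * (8 * (z - 5/2 * u)^2 + 62 * u^2) + 16 * r^2 * q^2 * z^3
    + 16 * r^2 * q^2 * u * z^2 + 128 * r^2 * q^2 * u^2 * z + 224 * r^3 * q * u * z^2 + 192 * r^4 * u * z^2)
   by (unfold q, u, z; field).
  assert (0 <= q) by (unfold q; lra). assert (0 <= u) by (unfold u; lra). assert (0 <= z) by (unfold z; lra).
  assert (0 <= r) by lra.
  assert (0 <= 8 * (z - 5/2 * u)^2 + 62 * u^2) by (assert (A := pow2_ge_0 (z - 5/2 * u)); assert (B := pow2_ge_0 u); lra).
  set (K := 8 * (z - 5/2 * u)^2 + 62 * u^2) in *. clearbody K q u z.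
  repeat apply Rplus_le_le_0_compat; repeat (apply Rmult_le_pos || apply pow_le); lra.
Qed.

(** The polynomial is the squared 3-4-1 product of |1 - r exp(i theta)| with c = cos theta; its
    derivative in r is -2 (1 - r)^5 (1 - 2 r c + r^2)^3 times the numerator shown to be
    nonnegative. *)
Lemma three_four_one_mono c r1 r2 : -1 <= c <= 1 -> 0 <= r1 <= r2 -> r2 <= 1 ->
  (1 - r2)^6 * (1 - 2*r2*c + r2^2)^4 * (1 - 2*r2*(2*c^2-1) + r2^2) <=
  (1 - r1)^6 * (1 - 2*r1*c + r1^2)^4 * (1 - 2*r1*(2*c^2-1) + r1^2).
Proof.
  intros Hc H1 H2.
  set (B := fun r => (1 - r)^6 * (1 - 2*r*c + r^2)^4 * (1 - 2*r*(2*c^2-1) + r^2)).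
  set (N := fun r => 3 * (1 - 2*r*c + r^2) * (1 - 2*r*(2*c^2-1) + r^2) + 4 * (c - r) * (1 - r) * (1 - 2*r*(2*c^2-1) + r^2)
   + ((2*c^2-1) - r) * (1 - r) * (1 - 2*r*c + r^2)).
  assert (D : forall r, is_derive B r (-2 * (1 - r)^5 * (1 - 2*r*c + r^2)^3 * N r)).
  { intros r. unfold B, N. auto_derive; auto. ring. }
  destruct (MVT_gen B r1 r2 (fun r => -2 * (1 - r)^5 * (1 - 2*r*c + r^2)^3 * N r)) as [x [Hx E]].
  - intros; apply D.
  - intros x _. apply continuity_pt_filterlim. apply (ex_derive_continuous (V := R_NormedModule)). eexists; apply D.
  - rewrite Rmin_left, Rmax_right in Hx by lra. fold (B r1) (B r2).
    assert (P : 0 <= (1 - x)^5 * (1 - 2*x*c + x^2)^3 * N x).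
    { apply Rmult_le_pos. apply Rmult_le_pos; apply pow_le. lra. nra. apply three_four_one_num; lra. }
    assert (0 <= (1 - x)^5 * (1 - 2*x*c + x^2)^3 * N x * (r2 - r1)) by (apply Rmult_le_pos; lra).
    replace (-2 * (1 - x)^5 * (1 - 2*x*c + x^2)^3 * N x * (r2 - r1)) with (-2 * ((1 - x)^5 * (1 - 2*x*c + x^2)^3 * N x * (r2 - r1))) in E by ring. lra.
Qed.

Definition tfo (f : C -> C) (t x : R) : R := Cmod (f (x, 0)) ^ 3 * Cmod (f (x, t)) ^ 4 * Cmod (f (x, 2 * t)).

Lemma tfo_mult f g t x : tfo (fun s => f s * g s)%C t x = tfo f t x * tfo g t x.
Proof. unfold tfo. rewrite !Cmod_mult, !Rpow_mult_distr. ring. Qed.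

Lemma tfo_nonneg f t x : 0 <= tfo f t x.
Proof. unfold tfo. apply Rmult_le_pos; [apply Rmult_le_pos; apply pow_le|]; apply Cmod_ge_0. Qed.

Lemma tfo_factor lam t x1 x2 : 0 < lam -> 0 < x1 <= x2 ->
  tfo (fun s => 1 - Cexp (- (RtoC lam * s)))%C t x1 <= tfo (fun s => 1 - Cexp (- (RtoC lam * s)))%C t x2.
Proof.
  intros Hl Hx. set (c := cos (lam * t)).
  assert (Hc : -1 <= c <= 1) by (unfold c; generalize (COS_bound (lam * t)); lra).
  assert (S : forall x y, Cmod (1 - Cexp (- (RtoC lam * (x, y)))) ^ 2 = 1 - 2 * exp (- (lam * x)) * cos (lam * y) + exp (- (lam * x)) ^ 2).
  { intros x y. replace (- (RtoC lam * (x, y)))%C with ((- (lam * x), - (lam * y)) : C)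
      by (apply injective_projections; simpl; ring).
    rewrite Cmod2_alt. unfold Cexp, Re, Im; simpl. rewrite cos_neg, sin_neg.
    set (r := exp _). assert (T := sin2_cos2 (lam * y)). unfold Rsqr in T.
    replace (sin (lam * y) * sin (lam * y)) with (1 - cos (lam * y) * cos (lam * y)) in T by lra.
    assert (T2 : sin (lam * y) * sin (lam * y) = 1 - cos (lam * y) * cos (lam * y)) by (generalize (sin2_cos2 (lam * y)); unfold Rsqr; lra).
    nra. }
  (* Squaring turns the moduli into polynomials in r = exp(- lam x) and c = cos(lam t); the double
     angle becomes 2 c^2 - 1. *)
  assert (SQ : forall x, tfo (fun s => 1 - Cexp (- (RtoC lam * s)))%C t x ^ 2 =
     (1 - exp (- (lam * x)))^6 * (1 - 2 * exp (- (lam * x)) * c + exp (- (lam * x)) ^2)^4 * (1 - 2 * exp (- (lam * x)) * (2*c^2-1) + exp (- (lam * x))^2)).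
  { intros x. unfold tfo.
    set (A := Cmod (1 - Cexp (- (RtoC lam * (x, 0))))). set (B := Cmod (1 - Cexp (- (RtoC lam * (x, t))))).
    set (D := Cmod (1 - Cexp (- (RtoC lam * (x, 2 * t))))).
    replace ((A ^ 3 * B ^ 4 * D) ^ 2) with ((A ^ 2) ^ 3 * (B ^ 2) ^ 4 * D ^ 2) by ring.
    unfold A, B, D. rewrite !S. rewrite Rmult_0_r, cos_0. fold c.
    replace (lam * (2 * t)) with (2 * (lam * t)) by ring. rewrite cos_2a_cos. fold c.
    set (r := exp _). replace (1 - 2 * r * 1 + r ^ 2) with ((1 - r) ^ 2) by ring. ring. }
  assert (E1 : forall x, 0 < x -> 0 < exp (- (lam * x)) <= 1).
  { intros x Px. split. apply exp_pos. rewrite <- exp_0. apply exp_mono.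
    assert (0 < lam * x) by (apply Rmult_lt_0_compat; auto). lra. }
  assert (P1 := E1 x1 ltac:(lra)). assert (P2 := E1 x2 ltac:(lra)).
  assert (L : exp (- (lam * x2)) <= exp (- (lam * x1))) by (apply exp_mono; nra).
  assert (Q := three_four_one_mono c _ _ Hc (conj (Rlt_le _ _ (proj1 P2)) L) (proj2 P1)).
  rewrite <- !SQ in Q. apply Rsqr_incr_0; try apply tfo_nonneg. unfold Rsqr. simpl in Q. lra.
Qed.

Lemma tfo_ext f g t x : (forall s, f s = g s) -> tfo f t x = tfo g t x.
Proof. intros H. unfold tfo. rewrite !H. auto. Qed.

Lemma tfo_pow f m t x : tfo (fun s => f s ^ m)%C t x = tfo f t x ^ m.
Proof.
  induction m; simpl. unfold tfo. rewrite !Cmod_1, !pow1. ring.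
  rewrite (tfo_mult f (fun s => f s ^ m)%C), IHm. auto.
Qed.

Lemma tfo_eprod N t x1 x2 : 0 < x1 <= x2 -> tfo (fun s => eprod (fZ s) N) t x1 <= tfo (fun s => eprod (fZ s) N) t x2.
Proof.
  intros Hx. induction N; simpl. unfold tfo; rewrite !Cmod_1; lra.
  destruct (prime_dec (Z.of_nat N)) as [PN|].
  - destruct (factor_form N PN) as (lam & m & Hl & E).
    rewrite (tfo_mult (fun s => eprod (fZ s) N) (fun s => fZ s N) t x1), (tfo_mult (fun s => eprod (fZ s) N) (fun s => fZ s N) t x2).
    apply Rmult_le_compat; try apply tfo_nonneg; auto.
    rewrite (tfo_ext (fun s => fZ s N) _ t x1 E), (tfo_ext (fun s => fZ s N) _ t x2 E), !tfo_pow.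
    apply pow_incr. split. apply tfo_nonneg. apply tfo_factor; auto.
  - rewrite !(tfo_ext (fun s => eprod (fZ s) N * 1)%C (fun s => eprod (fZ s) N)) by (intros; ring). auto.
Qed.

(** The finite products are inverse Euler products, hence increase in x, and their product with
    [tfo ZZ] tends to 1; the limit therefore decreases. *)
Lemma tfo_ZZ t x1 x2 : 1 < x1 <= x2 -> tfo ZZ t x2 <= tfo ZZ t x1.
Proof.
  intros Hx.
  assert (L : forall x, 1 < x -> is_lim_seq (fun N => tfo ZZ t x * tfo (fun s => eprod (fZ s) N) t x) 1).
  { intros x Px.
    assert (M : forall y, is_lim_seq (fun N => Cmod (ZZ (x, y)) * Cmod (eprod (fZ (x, y)) N)) 1).
    { intros y. assert (Q := Cseq_mod _ _ (euler_Z (x, y) Px)). rewrite Cmod_1 in Q.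
      eapply is_lim_seq_ext; [|exact Q]. intros n. simpl. rewrite <- Cmod_mult. auto. }
    assert (Pw : forall (u : nat -> R) k, is_lim_seq u 1 -> is_lim_seq (fun n => u n ^ k) 1).
    { intros u k Hu. induction k. apply is_lim_seq_const.
      assert (Q := is_lim_seq_mult' _ _ _ _ Hu IHk). rewrite Rmult_1_r in Q. exact Q. }
    assert (R := is_lim_seq_mult' _ _ _ _ (is_lim_seq_mult' _ _ _ _ (Pw _ 3%nat (M 0)) (Pw _ 4%nat (M t))) (M (2 * t))).
    rewrite !Rmult_1_r in R.
    eapply is_lim_seq_ext; [|exact R]. intros n. unfold tfo. rewrite !Rpow_mult_distr. ring. }
  assert (L1 := L x1 ltac:(lra)). assert (L2 := L x2 ltac:(lra)).
  assert (R1 := is_lim_seq_mult' _ _ _ _ (is_lim_seq_const (tfo ZZ t x2)) L1). rewrite Rmult_1_r in R1.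
  assert (R2 := is_lim_seq_mult' _ _ _ _ (is_lim_seq_const (tfo ZZ t x1)) L2). rewrite Rmult_1_r in R2.
  refine (is_lim_seq_le _ _ (tfo ZZ t x2) (tfo ZZ t x1) _ R1 R2).
  intros n. assert (Q := tfo_eprod n t x1 x2 ltac:(lra)).
  assert (P1 := tfo_nonneg ZZ t x1). assert (P2 := tfo_nonneg ZZ t x2).
  assert (0 <= tfo ZZ t x1 * tfo ZZ t x2) by (apply Rmult_le_pos; auto). nra.
Qed.

(** Written as half the logarithm of |f|^2, which is differentiable by components. It converts
    monotonicity of moduli into an inequality for real parts of logarithmic derivatives. *)
Lemma ln_Cmod_derive f x y l : Cderiv f (x, y) l -> f (x, y) <> 0%C ->
  is_derive (fun u => ln (Cmod (f (u, y)))) x (fst (l / f (x, y))%C).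
Proof.
  intros D N. apply Cderiv_h in D. destruct D as [D1 D2].
  set (g := fun u => fst (f (u, y)) * fst (f (u, y)) + snd (f (u, y)) * snd (f (u, y))).
  assert (Hg : forall u, g u = Cmod (f (u, y)) * Cmod (f (u, y))) by (intros; unfold g; rewrite Cmod_sq; auto).
  assert (P : 0 < Cmod (f (x, y))) by (apply Cmod_gt_0; auto).
  assert (Pg : 0 < g x) by (rewrite Hg; apply Rmult_lt_0_compat; auto).
  set (a := fst (f (x, y))) in *. set (b := snd (f (x, y))) in *.
  assert (Dg : is_derive g x (2 * (a * fst l + b * snd l))).
  { unfold g. replace (2 * (a * fst l + b * snd l)) with ((fst l * a + a * fst l) + (snd l * b + b * snd l)) by ring.
    apply (is_derive_plus (V := R_NormedModule)).
    apply (is_derive_mult (K := R_AbsRing) (fun u => fst (f (u, y))) (fun u => fst (f (u, y)))); auto. intros; apply Rmult_comm.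
    apply (is_derive_mult (K := R_AbsRing) (fun u => snd (f (u, y))) (fun u => snd (f (u, y)))); auto. intros; apply Rmult_comm. }
  assert (Dl : is_derive (fun u => / 2 * ln (g u)) x (/ 2 * (2 * (a * fst l + b * snd l) * / g x))).
  { apply (is_derive_scal (fun u => ln (g u))).
    apply (is_derive_comp ln g); auto. apply is_derive_Reals, derivable_pt_lim_ln; auto. }
  replace (fst (l / f (x, y))%C) with (/ 2 * (2 * (a * fst l + b * snd l) * / g x)).
  2:{ unfold g. fold a b. unfold Cdiv, Cinv. fold a b. simpl. field. unfold g in Pg. fold a b in Pg. nra. }
  assert (Fin : forall u : R, 0 < g u -> / 2 * ln (g u) = ln (Cmod (f (u, y)))).
  { intros u Hu. rewrite Hg in *.
    assert (Pu : 0 < Cmod (f (u, y))) by (destruct (Cmod_ge_0 (f (u, y))) as [Z|Z]; auto; rewrite <- Z in Hu; lra).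
    rewrite ln_mult by auto. field. }
  apply (is_derive_ext_loc (fun u => / 2 * ln (g u))); auto.
  assert (Cg : continuous g x) by (apply (ex_derive_continuous (V := R_NormedModule)); eexists; exact Dg).
  apply continuity_pt_filterlim in Cg. assert (L := proj1 (continuity_pt_locally _ _) Cg (mkposreal _ Pg)).
  destruct L as [e Ke]. exists e. intros u Hu. specialize (Ke u Hu). simpl in Ke. apply Rabs_def2 in Ke.
  apply Fin. lra.
Qed.

Lemma derive_nonincr f x l e : 0 < e -> is_derive f x l -> (forall y, x < y < x + e -> f y <= f x) -> l <= 0.
Proof.
  intros He D H. apply is_derive_Reals in D. apply Rnot_lt_le. intros P.
  destruct (D (l / 2)) as [d K]. lra.
  set (h := Rmin (d / 2) (e / 2)). assert (Hd := cond_pos d).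
  assert (0 < h) by (apply Rmin_glb_lt; lra). assert (h <= d / 2) by apply Rmin_l. assert (h <= e / 2) by apply Rmin_r.
  specialize (K h ltac:(lra)). rewrite Rabs_pos_eq in K by lra. specialize (K ltac:(lra)).
  specialize (H (x + h) ltac:(lra)). apply Rabs_def2 in K.
  assert ((f (x + h) - f x) / h <= 0).
  { unfold Rdiv. assert (0 < / h) by (apply Rinv_0_lt_compat; auto). nra. }
  lra.
Qed.

Lemma holo_ZZ : holo (fun s => 1 < fst s) ZZ.
Proof. apply holo_mult; apply holo_Dser. apply (ed_bound _ _ _ euler_one). apply chi4_bounded. Qed.

Lemma three_four_one Z' t x : (forall s, 1 < fst s -> Cderiv ZZ s (Z' s)) -> 1 < x ->
  3 * fst (Z' (x, 0) / ZZ (x, 0))%C + 4 * fst (Z' (x, t) / ZZ (x, t))%C + fst (Z' (x, (2 * t)%R) / ZZ (x, (2 * t)%R))%C <= 0.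
Proof.
  intros D Hx.
  assert (N : forall u y, 1 < u -> ZZ (u, y) <> 0%C) by (intros u y Hu; exact (Z_neq_0 (u, y) Hu)).
  apply (derive_nonincr (fun u => 3 * ln (Cmod (ZZ (u, 0))) + 4 * ln (Cmod (ZZ (u, t))) + ln (Cmod (ZZ (u, 2 * t)))) x _ 1). lra.
  - apply (is_derive_plus (V := R_NormedModule)). apply (is_derive_plus (V := R_NormedModule)).
    apply (is_derive_scal (fun u => ln (Cmod (ZZ (u, 0))))). apply ln_Cmod_derive; auto.
    apply (is_derive_scal (fun u => ln (Cmod (ZZ (u, t))))). apply ln_Cmod_derive; auto.
    apply ln_Cmod_derive; auto.
  - intros y Hy.
    assert (Q := tfo_ZZ t x y ltac:(lra)). unfold tfo in Q.
    assert (P : forall u v, 1 < u -> 0 < Cmod (ZZ (u, v))) by (intros; apply Cmod_gt_0; auto).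
    assert (LL : forall u, 1 < u -> 3 * ln (Cmod (ZZ (u, 0))) + 4 * ln (Cmod (ZZ (u, t))) + ln (Cmod (ZZ (u, 2 * t))) =
       ln (Cmod (ZZ (u, 0)) ^ 3 * Cmod (ZZ (u, t)) ^ 4 * Cmod (ZZ (u, 2 * t)))).
    { intros u Hu. assert (A := P u 0 Hu). assert (B := P u t Hu). assert (C := P u (2 * t) Hu).
      assert (A3 : 0 < Cmod (ZZ (u, 0)) ^ 3) by (apply pow_lt; auto).
      assert (B4 : 0 < Cmod (ZZ (u, t)) ^ 4) by (apply pow_lt; auto).
      rewrite ln_mult, ln_mult, !ln_pow; auto. simpl. ring. apply Rmult_lt_0_compat; auto. }
    rewrite !LL by lra.
    assert (0 < Cmod (ZZ (y, 0)) ^ 3 * Cmod (ZZ (y, t)) ^ 4 * Cmod (ZZ (y, 2 * t))).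
    { apply Rmult_lt_0_compat. apply Rmult_lt_0_compat; apply pow_lt; apply P; lra. apply P; lra. }
    destruct Q as [Q|Q]. left. apply ln_increasing; auto. rewrite Q. lra.
Qed.

Lemma Cseries_real_pos (c : nat -> C) (r : nat -> R) l : (forall k, c k = RtoC (r k)) -> (forall k, 0 < r k) ->
  Cconv c l -> 0 < fst l /\ snd l = 0.
Proof.
  intros E P H. apply Cconv_series in H. destruct H as [H1 H2].
  assert (H1' : is_series r (fst l)).
  { eapply is_series_ext; [|exact H1]. intros n. simpl. rewrite E. auto. }
  split.
  - rewrite <- (is_series_unique _ _ H1').
    apply Rlt_le_trans with (rsum r 1). simpl. specialize (P 0%nat). lra.
    apply rsum_le_Series. intros; left; auto. exists (fst l); auto.
  - rewrite <- (is_series_unique _ _ H2). rewrite (Series_ext _ (fun _ => 0 * 0)).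
    rewrite Series_scal_l. ring. intros n. rewrite E. simpl. ring.
Qed.

(** For chi_4 the paired series has positive terms, so L has no real zeros at all; in particular
    L(1) is nonzero without an analytic argument. *)
Lemma Lc_pos x : 0 < x -> 0 < fst (Lc (RtoC x)) /\ snd (Lc (RtoC x)) = 0.
Proof.
  intros Hx. apply (Cseries_real_pos (fun k => lterm k (RtoC x)) (fun k => Rpower (INR (4 * k + 1)) (- x) - Rpower (INR (4 * k + 3)) (- x))).
  - intros k. unfold lterm. rewrite !cpow_real, RtoC_minus. auto.
  - intros k. assert (Q : Rpower (INR (4 * k + 3)) (- x) < Rpower (INR (4 * k + 1)) (- x)).
    { rewrite !Rpower_Ropp. apply Rinv_lt_contravar. apply Rmult_lt_0_compat; apply Rpower_pos.
      apply Rlt_Rpower_l; auto. split. apply lt_0_INR; lia. apply lt_INR; lia. }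
    lra.
  - apply Lc_conv. auto.
Qed.

Lemma Z1_1 : Z1 1 = 1%C.
Proof.
  unfold Z1. replace (CSer (fun k => zterm k 1)) with (RtoC 0). ring.
  symmetry. apply Cconv_CSer. intros eps He. exists 0%nat. intros n _.
  replace (csum (fun k => zterm k 1) n) with (RtoC 0). rewrite Cmod_self_0; auto.
  induction n. auto. simpl. rewrite <- IHn. unfold zterm. rewrite <- !xpow_1_cpow by lia.
  unfold xpow. replace (1 - 1)%C with (RtoC 0) by ring.
  replace (RtoC 0 * RtoC (ln (INR (S n))))%C with (RtoC 0) by ring.
  replace (RtoC 0 * RtoC (ln (INR (S (S n)))))%C with (RtoC 0) by ring. ring.
Qed.

Lemma W_1_neq : W 1 <> 0%C.
Proof.
  unfold W. rewrite Z1_1, Cmult_1_l. intros E. apply (f_equal fst) in E. change (fst (Lc (RtoC 1)) = 0) in E.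
  destruct (Lc_pos 1 ltac:(lra)) as [P _]. lra.
Qed.

Lemma W_neq_right s : 1 < fst s -> W s <> 0%C.
Proof.
  intros Hs. rewrite W_Z by auto. apply Cmult_neq_0. 2: apply Z_neq_0; auto.
  intros E. apply (f_equal fst) in E. simpl in E. lra.
Qed.

(** With u = Re s - 1: |s - 1| >= u, and [ZZ_lower] with ZZ(1 + u) <= (1 + 1/u)^2 <= 4 / u^2 gives
    |ZZ(s)| >= u^2 / 4. *)
Lemma W_lower s : 1 < fst s <= 2 -> (fst s - 1) ^ 3 / 4 <= Cmod (W s).
Proof.
  intros Hs. rewrite W_Z by lra. rewrite Cmod_mult. fold (ZZ s).
  assert (A := ZZ_lower s ltac:(lra)). assert (B := ZZ_upper (RtoC (fst s)) ltac:(simpl; lra)).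
  simpl fst in B. set (u := fst s - 1) in *. assert (Hu : 0 < u <= 1) by (unfold u; lra).
  assert (C : u <= Cmod (s - 1)).
  { eapply Rle_trans; [|apply Cmod_fst]. simpl. unfold u. fold (fst s - 1). apply Rle_abs. }
  set (z := Cmod (ZZ s)) in *. set (y := Cmod (ZZ (RtoC (fst s)))) in *.
  assert (Z0 : 0 <= z) by apply Cmod_ge_0. assert (Y0 : 0 <= y) by apply Cmod_ge_0.
  assert (Yb : y <= 4 / (u * u)).
  { eapply Rle_trans. exact B. apply Rmult_le_reg_r with (u * u). apply Rmult_lt_0_compat; lra.
    replace (4 / (u * u) * (u * u)) with 4 by (field; lra).
    replace ((1 + / u) ^ 2 * (u * u)) with ((u + 1) * (u + 1)) by (field; lra). nra. }
  assert (Zb : u * u / 4 <= z).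
  { apply Rmult_le_reg_r with (4 / (u * u)). apply Rdiv_lt_0_compat. lra. apply Rmult_lt_0_compat; lra.
    replace (u * u / 4 * (4 / (u * u))) with 1 by (field; lra).
    eapply Rle_trans. exact A. apply Rmult_le_compat_l; auto. }
  replace (u ^ 3 / 4) with (u * (u * u / 4)) by (unfold Rdiv; ring).
  apply Rmult_le_compat; auto. lra. assert (0 <= u * u) by (apply Rmult_le_pos; lra). lra.
Qed.

(** Continuity of W and W'/W at 1. The disc disposes of zeros with small ordinate, and A controls
    the term of height 0 in the 3-4-1 inequality once the pole has been split off. *)
Lemma near_one (W' : C -> C) : (forall s, 0 < fst s -> Cderiv W s (W' s) /\ Ccont W' s) ->
  exists d A, 0 < d <= 1/8 /\ 0 <= A /\ (forall s, Cmod (s - 1) < 2 * d -> W s <> 0%C) /\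
    forall x, 1 < x < 1 + d -> Rabs (fst (W' (RtoC x) / W (RtoC x))%C) <= A.
Proof.
  intros H. assert (P1 : 0 < fst (RtoC 1)) by (simpl; lra).
  destruct (H (RtoC 1) P1) as [D1 C1]. assert (CW := Cderiv_cont _ _ _ D1).
  assert (N1 := W_1_neq). assert (P : 0 < Cmod (W 1)) by (apply Cmod_gt_0; auto).
  destruct (CW (Cmod (W 1)) P) as [d1 [Hd1 K1]].
  assert (CQ : Ccont (fun s => W' s * / W s)%C (RtoC 1)).
  { apply Ccont_mult; auto. apply Ccont_inv; auto. }
  destruct (CQ 1 ltac:(lra)) as [d2 [Hd2 K2]].
  set (d := Rmin (1/8) (Rmin (d1 / 2) (d2 / 2))).
  assert (Dp : 0 < d) by (repeat apply Rmin_glb_lt; lra).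
  assert (d <= 1/8) by apply Rmin_l.
  assert (d <= d1 / 2) by (eapply Rle_trans; [apply Rmin_r|apply Rmin_l]).
  assert (d <= d2 / 2) by (eapply Rle_trans; [apply Rmin_r|apply Rmin_r]).
  exists d, (Cmod (W' (RtoC 1) * / W 1) + 1). split. lra. split. generalize (Cmod_ge_0 (W' (RtoC 1) * / W 1)); lra. split.
  - intros s Hs E. specialize (K1 s ltac:(lra)). rewrite E in K1.
    replace (0 - W 1)%C with (- W 1)%C in K1 by ring. rewrite Cmod_opp in K1. lra.
  - intros x Hx. eapply Rle_trans. apply Cmod_fst. specialize (K2 (RtoC x)).
    assert (E : Cmod (RtoC x - 1) < d2).
    { rewrite <- RtoC_minus, Cmod_R, Rabs_pos_eq; lra. }
    specialize (K2 E). assert (T := Cmod_ge_minus (W' (RtoC x) * / W (RtoC x)) (W' (RtoC 1) * / W 1)).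
    unfold Cdiv. lra.
Qed.

(** Radius 1/2 keeps the disc in Re s > 1/2 and gives a quarter disc of radius 1/8 and 64 / (1/2) =
    128. The condition on M compares the growth bound with [W_lower] at the centre. *)
Lemma W_landau (W' : C -> C) x y M : (forall s, 0 < fst s -> Cderiv W s (W' s) /\ Ccont W' s) ->
  1 < x <= 2 -> 0 <= M -> 420 * (4 + Rabs y) ^ 3 <= exp M * ((x - 1) ^ 3 / 4) ->
  - (128 * (M + 2)) <= fst (W' (x, y) / W (x, y))%C /\
  forall w, Cmod (w - (x, y)) < 1/8 -> W w = 0%C ->
    fst (/ ((x, y) - w))%C - 128 * (M + 2) <= fst (W' (x, y) / W (x, y))%C.
Proof.
  intros HW Hx HM HB.
  assert (R2 : forall w, disc (x, y) (1/2) w -> 1/2 < fst w /\ Cmod w <= 3 + Rabs y).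
  { intros w Hw. unfold disc in Hw. assert (T := Cmod_fst (w - (x, y))%C). simpl in T.
    assert (T2 := Rle_lt_trans _ _ _ T Hw). apply Rabs_def2 in T2. split. lra.
    assert (U := Cmod_triangle (w - (x, y)) (x, y)). replace (w - (x, y) + (x, y))%C with w in U by ring.
    assert (V := Cmod_le_sum (x, y)). simpl in V. rewrite (Rabs_pos_eq x) in V by lra. lra. }
  destruct (landau W (x, y) (1/2) M (W' (x, y))) as [A B]; auto.
  - lra.
  - apply (holo_sub _ (fun s => 0 < fst s)). 2: apply holo_W. intros w Hw. apply R2 in Hw. lra.
  - apply W_neq_right. simpl; lra.
  - intros w Hw. destruct (R2 w Hw) as [Q1 Q2].
    eapply Rle_trans. apply W_bound. lra.
    apply Rle_trans with (420 * (4 + Rabs y) ^ 3).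
    apply Rmult_le_compat_l. lra. apply pow_incr. assert (Z := Cmod_ge_0 w). lra.
    eapply Rle_trans. exact HB. apply Rmult_le_compat_l. left; apply exp_pos. apply (W_lower (x, y)). simpl; lra.
  - intros w Hw E. apply Rnot_lt_le. simpl. intros L. revert E. apply W_neq_right. lra.
  - apply HW. simpl; lra.
  - replace (64 * (M + 2) / (1/2)) with (128 * (M + 2)) in A, B by field. split; auto.
    intros w Hw E. apply B; auto. unfold disc. lra.
Qed.

Lemma ln_le_self x : 0 < x -> ln x <= x.
Proof. intros H. assert (A := exp_ineq1_le (ln x)). rewrite exp_ln in A by auto. lra. Qed.

Lemma ln_nat_bound (x : R) k : 0 < x -> x <= 2 ^ k -> ln x <= INR k.
Proof.
  intros Hx H. rewrite <- (ln_exp (INR k)).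
  assert (Q : 2 ^ k <= exp (INR k)).
  { clear. induction k. simpl. rewrite exp_0; lra. rewrite S_INR, exp_plus. simpl.
    assert (A := exp_ineq1 1 ltac:(lra)). assert (0 < 2 ^ k) by (apply pow_lt; lra). nra. }
  destruct (Rle_lt_or_eq_dec x (exp (INR k)) ltac:(lra)) as [L|L]. left. apply ln_increasing; auto. rewrite L; lra.
Qed.

Lemma ln_ge_1 T : 3 <= T -> 1 <= ln T.
Proof.
  intros H. rewrite <- (ln_exp 1). assert (E := exp_le_3).
  destruct (Rle_lt_or_eq_dec (exp 1) T ltac:(lra)) as [L|L]. left. apply ln_increasing; auto. apply exp_pos. rewrite L; lra.
Qed.

Lemma zero_free : exists c, 0 < c <= 1/8 /\
  forall T s, 3 <= T -> Rabs (snd s) <= T -> 1 - c / ln T <= fst s -> W s <> 0%C.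
Proof.
  destruct holo_W as [W' HW].
  destruct (near_one W' HW) as (d & A & Hd & HA & N1 & BA).
  destruct holo_ZZ as [Z' HZ].
  assert (DZ : forall s, 1 < fst s -> Cderiv ZZ s (Z' s)) by (intros; apply HZ; auto).
  assert (LD : forall s, 1 < fst s -> (Z' s / ZZ s)%C = (W' s / W s - / (s - 1))%C).
  { intros s Hs. assert (NZ : ZZ s <> 0%C) by exact (Z_neq_0 s Hs).
    assert (Ns : (s - 1)%C <> 0%C) by (intros E; apply (f_equal fst) in E; simpl in E; lra).
    assert (E : W' s = (1 * ZZ s + (s - 1) * Z' s)%C).
    { apply (Cderiv_unique W s). apply HW. lra.
      apply (Cderiv_ext_loc (fun s => (s - 1) * ZZ s)%C _ _ _ (fst s - 1)). lra.
      - intros w Hw. symmetry. apply W_Z. assert (T := Cmod_fst (w - s)%C). simpl in T.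
        assert (T2 := Rle_lt_trans _ _ _ T Hw). apply Rabs_def2 in T2. lra.
      - apply (Cderiv_mult (fun s => s - 1)%C ZZ); auto.
        apply (Cderiv_ext_loc (fun w => - (1) + 1 * w)%C _ _ _ 1). lra. intros; ring. apply Cderiv_affine. }
    rewrite E, W_Z by auto. fold (ZZ s). field. auto. }
  (* With c = a / 7 a zero too close to the line Re s = 1 would contribute at least 4 / (a + c) = 7
     / (2 a) against the 3 / a of the pole, a surplus b^2 / 2 in units of log T. As a = b^-2,
     log(1/a) is at most 2 b, so all the rest is at most K1 + 3840 b, and b = 8000 + 2 K1 is too
     large for that. The 640 = 5 * 128 comes from Landau's lemma at the two heights, and 16640 = 640
     * 26. *)
  set (K1 := 3 * A + 5 / d + 16640). set (b := 8000 + 2 * K1). set (a := / (b * b)). set (c := a / 7).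
  assert (Hd5 : 0 < 5 / d) by (apply Rdiv_lt_0_compat; lra).
  assert (Hb : 8000 < b) by (unfold b, K1; lra).
  assert (Ha : 0 < a) by (unfold a; apply Rinv_0_lt_compat; nra).
  assert (Ha1 : a <= / b).
  { unfold a. apply Rinv_le_contravar. lra. nra. }
  assert (Hbd : 10 <= b * d).
  { assert (10 / d <= b) by (unfold b, K1; lra). replace 10 with (10 / d * d) by (field; lra). apply Rmult_le_compat_r; lra. }
  assert (Ha2 : a <= d / 10).
  { eapply Rle_trans. exact Ha1. apply Rmult_le_reg_r with b. lra. rewrite Rinv_l by lra. lra. }
  assert (Ha3 : a <= 1/80) by lra.
  assert (Hc : 0 < c) by (unfold c; lra).
  exists c. split. unfold c; lra.
  intros T s HT Ht Hs E.
  set (L := ln T) in *. assert (HL : 1 <= L) by (apply ln_ge_1; auto).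
  assert (cL : c / L <= c). { apply Rmult_le_reg_r with L. lra. unfold Rdiv. rewrite Rmult_assoc, Rinv_l by lra. nra. }
  assert (aL : a / L <= a). { apply Rmult_le_reg_r with L. lra. unfold Rdiv. rewrite Rmult_assoc, Rinv_l by lra. nra. }
  assert (aLp : 0 < a / L) by (apply Rdiv_lt_0_compat; lra).
  assert (cLp : 0 < c / L) by (apply Rdiv_lt_0_compat; lra).
  assert (S1 : fst s <= 1). { apply Rnot_lt_le. intros X. revert E. apply W_neq_right; auto. }
  (* At small ordinates the pole terms at heights g and 2 g would not be bounded, so these zeros are
     excluded by [near_one]; otherwise each such term is at most 1 / d. *)
  destruct (Rlt_or_le (Rabs (snd s)) d) as [Sm|Bg].
  - apply (N1 s); auto. eapply Rle_lt_trans. apply Cmod_le_sum. simpl.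
    rewrite Ropp_0, Rplus_0_r. rewrite Rabs_left1 by lra. unfold c in *. lra.
  - set (g := snd s) in *. set (x := 1 + a / L).
    assert (Hx : 1 < x <= 2) by (unfold x; lra).
    (* Chosen to make the hypothesis of [W_landau] an identity at |y| = 2 T, which covers both
       heights; 1680 = 4 * 420. *)
    set (M := ln (1680 * (4 + 2 * T) ^ 3 / (x - 1) ^ 3)).
    assert (X3 : 0 < (x - 1) ^ 3) by (apply pow_lt; lra).
    assert (T3 : 0 < (4 + 2 * T) ^ 3) by (apply pow_lt; lra).
    assert (EM : exp M = 1680 * (4 + 2 * T) ^ 3 / (x - 1) ^ 3).
    { unfold M. apply exp_ln. apply Rdiv_lt_0_compat; lra. }
    assert (M0 : 0 <= M).
    { unfold M. apply ln_ge_0. apply Rmult_le_reg_r with ((x - 1) ^ 3); auto.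
      unfold Rdiv. rewrite Rmult_assoc, Rinv_l by lra.
      assert ((x - 1) ^ 3 <= 1 ^ 3) by (apply pow_incr; lra).
      assert (1 ^ 3 <= (4 + 2 * T) ^ 3) by (apply pow_incr; lra). lra. }
    assert (HB : forall y, Rabs y <= 2 * T -> 420 * (4 + Rabs y) ^ 3 <= exp M * ((x - 1) ^ 3 / 4)).
    { intros y Hy. rewrite EM. replace (1680 * (4 + 2 * T) ^ 3 / (x - 1) ^ 3 * ((x - 1) ^ 3 / 4)) with (420 * (4 + 2 * T) ^ 3) by (field; lra).
      apply Rmult_le_compat_l. lra. apply pow_incr. generalize (Rabs_pos y); lra. }
    assert (MB : M <= 24 * L + 6 * b).
    { unfold M, Rdiv. rewrite ln_mult; [|apply Rmult_lt_0_compat; lra|apply Rinv_0_lt_compat; auto].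
      rewrite ln_mult by (auto; lra). rewrite ln_Rinv by auto. rewrite !ln_pow by lra.
      assert (Q1 : ln 1680 <= INR 11) by (apply ln_nat_bound; simpl; lra).
      assert (Q2 : ln (4 + 2 * T) <= 2 + L).
      { apply Rle_trans with (ln (4 * T)). destruct (Rle_lt_or_eq_dec (4 + 2 * T) (4 * T) ltac:(lra)) as [Y|Y].
        left; apply ln_increasing; lra. rewrite Y; lra.
        rewrite ln_mult by lra. assert (ln 4 <= INR 2) by (apply ln_nat_bound; simpl; lra). simpl in H. unfold L. lra. }
      assert (Q3 : - ln (x - 1) <= L + 2 * b).
      { unfold x. replace (1 + a / L - 1) with (a * / L) by (unfold Rdiv; ring).
        rewrite ln_mult by (auto; apply Rinv_0_lt_compat; lra). rewrite ln_Rinv by lra.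
        unfold a. rewrite ln_Rinv by nra. rewrite ln_mult by lra.
        assert (Y1 := ln_le_self L ltac:(lra)). assert (Y2 := ln_le_self b ltac:(lra)). lra. }
      simpl INR in *. lra. }
    assert (N2 : forall y, d <= Rabs y -> fst (/ ((x, y) - 1))%C <= 1 / d).
    { intros y Hy. eapply Rle_trans. apply Rle_abs. eapply Rle_trans. apply Cmod_fst.
      assert (Q : d <= Cmod ((x, y) - 1)).
      { eapply Rle_trans. exact Hy. eapply Rle_trans; [|apply Cmod_snd]. simpl. rewrite Ropp_0, Rplus_0_r. lra. }
      rewrite Cmod_inv by (apply Cmod_gt_0; lra). unfold Rdiv. rewrite Rmult_1_l. apply Rinv_le_contravar; lra. }
    assert (G2 : Rabs (2 * g) = 2 * Rabs g) by (rewrite Rabs_mult, (Rabs_pos_eq 2); lra).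
    destruct (W_landau W' x g M HW Hx M0 (HB g ltac:(lra))) as [_ A1].
    destruct (W_landau W' x (2 * g) M HW Hx M0 (HB (2 * g) ltac:(lra))) as [A2 _].
    assert (Es : ((x, g) - s = RtoC (x - fst s))%C).
    { unfold g. destruct s as [s1 s2]. apply injective_projections; simpl; ring. }
    assert (Dx : 0 < x - fst s) by lra.
    assert (Dx2 : x - fst s <= (a + c) / L) by (unfold x; unfold Rdiv in *; lra).
    assert (Dx3 : (a + c) / L <= a + c).
    { unfold Rdiv in *. lra. }
    specialize (A1 s). rewrite Cmod_minus_sym, Es, Cmod_R, Rabs_pos_eq in A1 by lra.
    specialize (A1 ltac:(unfold c in *; lra) E).
    assert (F1 : fst (/ RtoC (x - fst s))%C = / (x - fst s)).
    { rewrite <- RtoC_inv by lra. auto. }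
    rewrite F1 in A1.
    assert (TF := three_four_one Z' g x DZ ltac:(lra)).
    rewrite !LD in TF by (simpl; lra).
    change (fst (W' (x, 0) / W (x, 0) - / ((x, 0) - 1))%C) with (fst (W' (x, 0) / W (x, 0))%C - fst (/ ((x, 0) - 1))%C) in TF.
    change (fst (W' (x, g) / W (x, g) - / ((x, g) - 1))%C) with (fst (W' (x, g) / W (x, g))%C - fst (/ ((x, g) - 1))%C) in TF.
    change (fst (W' (x, (2 * g)%R) / W (x, (2 * g)%R) - / ((x, (2 * g)%R) - 1))%C) with (fst (W' (x, (2 * g)%R) / W (x, (2 * g)%R))%C - fst (/ ((x, (2 * g)%R) - 1))%C) in TF.
    assert (B0 := BA x ltac:(unfold x; lra)). change (RtoC x) with ((x, 0) : C) in B0. apply Rabs_le_between in B0.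
    assert (F0 : fst (/ ((x, 0) - 1))%C = L / a).
    { replace ((x, 0) - 1)%C with (RtoC (x - 1)) by (apply injective_projections; simpl; ring).
      rewrite <- RtoC_inv by lra. simpl. unfold x. field. lra. }
    rewrite F0 in TF.
    assert (G1 := N2 g ltac:(lra)). assert (G3 := N2 (2 * g) ltac:(lra)).
    (* The 3-4-1 inequality rearranged: the pole at height 0 gives 3 L / a, the zero gives 4 / (x -
       Re s), and the pole terms at the other two heights add up to 5 / d. *)
    assert (Key : 4 / (x - fst s) <= 3 * (L / a) + 3 * A + 5 / d + 640 * (M + 2)) by (unfold Rdiv in *; lra).
    assert (Low : 4 * L / (a + c) <= 4 / (x - fst s)).
    { replace (4 * L / (a + c)) with (4 * / ((a + c) / L)) by (field; lra). unfold Rdiv at 2.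
      apply Rmult_le_compat_l. lra. apply Rinv_le_contravar; lra. }
    replace (4 * L / (a + c)) with (7/2 * (L * (b * b))) in Low.
    2:{ unfold c, a. field. lra. }
    replace (L / a) with (L * (b * b)) in Key by (unfold a; field; lra).
    assert (Fin : 1/2 * (L * (b * b)) <= 3 * A + 5 / d + 640 * (24 * L + 6 * b + 2)) by lra.
    assert (Fin2 : 3 * A + 5 / d + 640 * (24 * L + 6 * b + 2) <= L * (K1 + 3840 * b)).
    { unfold K1. assert (0 <= (L - 1) * (3 * A + 5 / d + 1280 + 3840 * b)) by (apply Rmult_le_pos; lra). nra. }
    assert (Fin3 : 1/2 * (b * b) <= K1 + 3840 * b).
    { apply Rmult_le_reg_l with L. lra. lra. }
    assert (K1p : 0 < K1) by (unfold K1; lra).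
    assert (1/2 * (b * b) = 4000 * b + K1 * b) by (unfold b; field).
    assert (K1 * 8000 <= K1 * b) by (apply Rmult_le_compat_l; lra). lra.
Qed.

(** * Growth under the Riemann Hypothesis *)

(** The hypotheses speak of the open strip 0 < Re s < 1 only. The line Re s = 1 is covered by
    [zero_free], and Re s > 1 by the Euler product. *)
Lemma W_neq_RH s : RH_zeta -> RH_L4 -> 1/2 < fst s -> W s <> 0%C.
Proof.
  intros RZ RL Hs E. destruct (Rtotal_order (fst s) 1) as [L|[L|L]].
  - destruct (Ceq_dec (Z1 s) 0) as [EZ|NZ].
    + assert (A : zeta_C (fst s, snd s) = 0%C).
      { rewrite <- surjective_pairing, zeta_C_eq by lra. rewrite EZ. unfold Cdiv. ring. }
      apply RZ in A; lra.
    + destruct (Ceq_dec (Lc s) 0) as [EL|NL].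
      * assert (A : L4_C (fst s, snd s) = 0%C) by (rewrite <- surjective_pairing, L4_C_eq by lra; auto).
        apply RL in A; lra.
      * apply (Cmult_neq_0 _ _ NZ NL). exact E.
  - destruct zero_free as (c & Hc & ZF).
    apply (ZF (3 + Rabs (snd s)) s); auto; generalize (Rabs_pos (snd s)); try lra. intros P.
    assert (Q := ln_ge_1 (3 + Rabs (snd s)) ltac:(lra)).
    assert (0 < c / ln (3 + Rabs (snd s))) by (apply Rdiv_lt_0_compat; lra). lra.
  - revert E. apply W_neq_right; auto.
Qed.

Lemma tcoef_0 f s0 R0 r : 0 < r < R0 -> holo (disc s0 R0) f -> tcoef f s0 r 0 = f s0.
Proof.
  intros Hr Hf. destruct (circ_bounded f s0 R0 r Hr Hf) as [M HM].
  assert (T := taylor f s0 R0 r 0 M 1 Hr Hf). rewrite Cmod_0 in T. specialize (T ltac:(lra) HM).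
  replace (2 * M * (0 / r) ^ 1 * (r / (r - 0))) with 0 in T by (field; lra).
  replace (s0 + 0)%C with s0 in T by ring. simpl in T.
  destruct (Ceq_dec (tcoef f s0 r 0) (f s0)) as [|N]; auto. exfalso.
  apply not_eq_sym in N. apply Cminus_neq_0, Cmod_gt_0 in N.
  replace (f s0 - (0 + tcoef f s0 r 0 * 1))%C with (f s0 - tcoef f s0 r 0)%C in T by ring. lra.
Qed.

(* Interpolation (three circles) on Taylor coefficients: the first [K0] of them are controlled
   by the small disc, the others by the large one. *)
Lemma taylor_interpolate h s0 R0 r0 r1 rho B M K0 z : 0 < r0 < R0 -> 0 < r1 < R0 -> 0 <= rho < r1 ->
  0 <= M -> holo (disc s0 R0) h -> h s0 = 0%C ->
  (forall t, fst (h (s0 + circ r0 t)%C) <= B) -> (forall t, fst (h (s0 + circ r1 t)%C) <= M) ->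
  Cmod z <= rho ->
  Cmod (h (s0 + z)%C) <= rsum (fun k => 4 * B / r0 ^ k * rho ^ k) (S K0) + 4 * M * (rho / r1) ^ S K0 / (1 - rho / r1).
Proof.
  intros H0 H1 Hrho HM Hh Hz0 HB0 HB1 Hz.
  set (A := tcoef h s0 r1). set (q := rho / r1).
  assert (Hq : 0 <= q < 1).
  { unfold q. split. apply Rdiv_le_0_compat; lra. apply Rmult_lt_reg_r with r1. lra.
    unfold Rdiv. rewrite Rmult_assoc, Rinv_l; lra. }
  assert (P := Cmod_ge_0 z).
  (* A negative B would make the Borel-Caratheodory bound for the first coefficient negative. *)
  assert (B0 : 0 <= B).
  { apply Rnot_lt_le. intros X. assert (Q := borel_caratheodory h s0 R0 r0 B 1 H0 Hh ltac:(lia)).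
    rewrite Hz0 in Q. simpl fst in Q. assert (Q2 : Cmod (tcoef h s0 r0 1) <= 4 * B / r0 ^ 1).
    { apply Q. intros t. specialize (HB0 t). lra. }
    assert (Z := Cmod_ge_0 (tcoef h s0 r0 1)).
    assert (4 * B / r0 ^ 1 < 0). { simpl. rewrite Rmult_1_r. unfold Rdiv. assert (0 < / r0) by (apply Rinv_0_lt_compat; lra). nra. }
    lra. }
  assert (C0 : forall k, Cmod (A k * z ^ k) <= 4 * B / r0 ^ k * rho ^ k).
  { intros k. rewrite Cmod_mult, Cmod_pow.
    apply Rmult_le_compat; try apply Cmod_ge_0. apply pow_le; auto.
    2: apply pow_incr; lra.
    destruct k.
    - unfold A. rewrite (tcoef_0 h s0 R0), Hz0, Cmod_0 by auto. simpl. lra.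
    - unfold A. rewrite (tcoef_radius h s0 R0 r1 r0) by auto.
      apply (borel_caratheodory h s0 R0); auto. lia. intros t. rewrite Hz0. simpl. specialize (HB0 t). lra. }
  assert (C1 : forall k, (1 <= k)%nat -> Cmod (A k * z ^ k) <= 4 * M * q ^ k).
  { intros k Hk. rewrite Cmod_mult, Cmod_pow.
    assert (R1 : 0 < r1 ^ k) by (apply pow_lt; lra).
    replace (4 * M * q ^ k) with (4 * M / r1 ^ k * rho ^ k) by (unfold q, Rdiv; rewrite Rpow_mult_distr, pow_inv; ring).
    apply Rmult_le_compat; try apply Cmod_ge_0. apply pow_le; auto.
    apply (borel_caratheodory h s0 R0); auto. intros t. rewrite Hz0. simpl. specialize (HB1 t). lra.
    apply pow_incr; lra. }
  set (S0 := rsum (fun k => 4 * B / r0 ^ k * rho ^ k) (S K0)).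
  assert (Part : forall j, Cmod (csum (fun k => A k * z ^ k)%C (S K0 + j)) <= S0 + 4 * M * q ^ S K0 * (1 - q ^ j) / (1 - q)).
  { induction j.
    - rewrite Nat.add_0_r. replace (S0 + 4 * M * q ^ S K0 * (1 - q ^ 0) / (1 - q)) with S0 by (simpl; field; lra).
      apply Cmod_csum. intros; auto.
    - rewrite Nat.add_succ_r.
      change (csum (fun k => A k * z ^ k)%C (S (S K0 + j))) with (csum (fun k => A k * z ^ k)%C (S K0 + j) + A (S K0 + j)%nat * z ^ (S K0 + j))%C.
      eapply Rle_trans. apply Cmod_triangle.
      assert (Q := C1 (S K0 + j)%nat ltac:(lia)).
      replace (S0 + 4 * M * q ^ S K0 * (1 - q ^ S j) / (1 - q)) with
        (S0 + 4 * M * q ^ S K0 * (1 - q ^ j) / (1 - q) + 4 * M * (q ^ (S K0 + j))).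
      lra. rewrite pow_add. simpl. field. lra. }
  set (Lim := S0 + 4 * M * q ^ S K0 / (1 - q)).
  assert (Part2 : forall j, Cmod (csum (fun k => A k * z ^ k)%C (S K0 + j)) <= Lim).
  { intros j. eapply Rle_trans. apply Part. unfold Lim. apply Rplus_le_compat_l.
    unfold Rdiv. apply Rmult_le_compat_r. left. apply Rinv_0_lt_compat; lra.
    assert (0 <= q ^ j) by (apply pow_le; lra). assert (0 <= q ^ S K0) by (apply pow_le; lra).
    assert (0 <= 4 * M * q ^ S K0) by (apply Rmult_le_pos; auto; lra).
    assert (0 <= 4 * M * q ^ S K0 * q ^ j) by (apply Rmult_le_pos; auto). lra. }
  destruct (circ_bounded h s0 R0 r1 H1 Hh) as [M' HM'].
  assert (M0 : 0 <= M') by (eapply Rle_trans; [apply Cmod_ge_0|apply (HM' 0)]).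
  apply le_epsilon. intros eps He.
  set (D := 2 * M' * (r1 / (r1 - Cmod z))).
  assert (D0 : 0 <= D). { unfold D. apply Rmult_le_pos. lra. apply Rdiv_le_0_compat; lra. }
  destruct (pow_lt_1_zero q) with (y := eps / (D + 1)) as [N HN]. rewrite Rabs_pos_eq; lra. apply Rdiv_lt_0_compat; lra.
  specialize (HN (S K0 + N)%nat ltac:(lia)). rewrite Rabs_pos_eq in HN by (apply pow_le; lra).
  assert (T := taylor h s0 R0 r1 z M' (S K0 + N) H1 Hh ltac:(lra) HM'). fold A in T.
  assert (Z1 : (Cmod z / r1) ^ (S K0 + N) <= q ^ (S K0 + N)).
  { apply pow_incr. split. apply Rdiv_le_0_compat; lra. unfold q, Rdiv. apply Rmult_le_compat_r.
    left; apply Rinv_0_lt_compat; lra. lra. }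
  set (y := q ^ (S K0 + N)) in *. set (y' := (Cmod z / r1) ^ (S K0 + N)) in *.
  assert (Y0 : 0 <= y') by (apply pow_le, Rdiv_le_0_compat; lra).
  assert (T2 : 2 * M' * y' * (r1 / (r1 - Cmod z)) <= eps).
  { replace (2 * M' * y' * (r1 / (r1 - Cmod z))) with (D * y') by (unfold D; ring).
    apply Rmult_lt_compat_r with (r := D + 1) in HN; [|lra]. unfold Rdiv in HN.
    rewrite Rmult_assoc, Rinv_l in HN by lra. nra. }
  assert (U := Cmod_triangle (h (s0 + z)%C - csum (fun k => A k * z ^ k)%C (S K0 + N)) (csum (fun k => A k * z ^ k)%C (S K0 + N))).
  replace (h (s0 + z) - csum (fun k => A k * z ^ k) (S K0 + N) + csum (fun k => A k * z ^ k) (S K0 + N))%C with (h (s0 + z)%C) in U by ring.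
  specialize (Part2 N). lra.
Qed.

Lemma W_growth_RH d eta : RH_zeta -> RH_L4 -> 0 < d < 1/2 -> 0 < eta ->
  exists K, 0 < K /\ forall x t, 1/2 + d <= x <= 2 -> 3 <= Rabs t ->
    Cmod (W (x, t)) <= K * Cmod ((x, t) - 1) * Rpower (6 + Rabs t) eta.
Proof.
  intros RZ RL Hd Heta.
  (* Around the centre 2 + it, radius rho reaches Re s = 1/2 + d, and r1 lies strictly between rho
     and the largest radius 3/2 that stays in Re s > 1/2. *)
  set (rho := 3/2 - d). set (r1 := 3/2 - d / 2). set (q := rho / r1).
  assert (Hr1 : 0 < r1 < 3/2) by (unfold r1; lra). assert (Hrho : 0 <= rho < r1) by (unfold rho, r1; lra).
  assert (Hq : 0 <= q < 1).
  { unfold q. split. apply Rdiv_le_0_compat; lra. apply Rmult_lt_reg_r with r1. lra.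
    unfold Rdiv. rewrite Rmult_assoc, Rinv_l; lra. }
  (* The tail 4 M q^(K0+1) / (1 - q) becomes at most (eta / 3) M; as M is about 3 log|t|, this is
     the exponent eta. *)
  destruct (pow_lt_eps q (eta / 12 * (1 - q)) Hq) as [K0 HK0].
  { apply Rmult_lt_0_compat; lra. }
  assert (HK1 : q ^ S K0 <= eta / 12 * (1 - q)).
  { simpl. assert (0 <= q ^ K0) by (apply pow_le; lra). nra. }
  set (B := rsum (fun k => 4 * 6 / (1/4) ^ k * rho ^ k) (S K0)).
  exists (4 * 9 * exp B * exp (eta / 3 * ln 1680)). split.
  { repeat apply Rmult_lt_0_compat; try apply exp_pos; lra. }
  intros x t Hx Ht. set (s0 := (2, t) : C).
  (* 1680 = 4 * 420: the cubic bound for W, divided by the value at the centre, which is at least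
     1/4. *)
  set (M := ln (1680 * (6 + Rabs t) ^ 3)).
  assert (T3 : 0 < (6 + Rabs t) ^ 3) by (apply pow_lt; lra).
  assert (T1 : 1 <= (6 + Rabs t) ^ 3) by (apply pow_R1_Rle; lra).
  assert (M0 : 0 <= M) by (apply ln_ge_0; lra).
  set (rc := rect (1/2) (7/2) (t - 3/2) (t + 3/2)).
  assert (Rc : forall w, rc w -> 1/2 < fst w /\ 1 <= Cmod (w - 1) /\ Cmod w <= 5 + Rabs t).
  { intros w [W1 W2]. split. lra.
    assert (Q : Rabs t - 3/2 <= Rabs (snd w) <= Rabs t + 3/2).
    { unfold Rabs in *. destruct (Rcase_abs t), (Rcase_abs (snd w)); lra. }
    split.
    eapply Rle_trans; [|apply Cmod_snd]. simpl. rewrite Ropp_0, Rplus_0_r. lra.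
    eapply Rle_trans. apply Cmod_le_sum. rewrite (Rabs_pos_eq (fst w)) by lra. lra. }
  assert (Nw : forall w, rc w -> (w - 1)%C <> 0%C).
  { intros w Hw. apply Rc in Hw. apply Cmod_gt_0. lra. }
  set (Zt := fun w => (W w / (w - 1))%C).
  assert (HZt : holo rc Zt).
  { apply holo_div. apply (holo_sub _ (fun s => 0 < fst s)). intros w Hw. apply Rc in Hw. lra. apply holo_W.
    apply holo_minus. apply holo_id. apply holo_const. apply Nw. }
  assert (NZt : forall w, rc w -> Zt w <> 0%C).
  { intros w Hw E. apply (W_neq_RH w RZ RL). apply Rc in Hw. lra.
    replace (W w) with (Zt w * (w - 1))%C. rewrite E. ring. unfold Zt. field. apply Nw; auto. }
  assert (Hs0 : rc s0) by (unfold s0; split; simpl; lra).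
  assert (EZ : forall w, rc w -> 1 < fst w -> Zt w = ZZ w).
  { intros w Hw H1. unfold Zt. rewrite W_Z by auto. fold (ZZ w). field. apply Nw; auto. }
  assert (NZ0 := NZt s0 Hs0).
  assert (L0 : 1/4 <= Cmod (Zt s0)).
  { rewrite EZ by (auto; unfold s0; simpl; lra).
    assert (Q := ZZ_lower s0 ltac:(unfold s0; simpl; lra)).
    assert (Q2 := ZZ_upper (RtoC (fst s0)) ltac:(unfold s0; simpl; lra)). simpl fst in Q2.
    replace ((1 + / (2 - 1)) ^ 2) with 4 in Q2 by field.
    change (fst s0) with 2 in Q. assert (Z := Cmod_ge_0 (ZZ s0)).
    set (a := Cmod (ZZ s0)) in *. set (b := Cmod (ZZ (RtoC 2))) in *.
    assert (a * b <= a * 4) by (apply Rmult_le_compat_l; auto). lra. }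
  assert (U0 : Cmod (Zt s0) <= 9).
  { rewrite EZ by (auto; unfold s0; simpl; lra). eapply Rle_trans. apply ZZ_upper. unfold s0; simpl; lra.
    unfold s0; simpl fst. replace (2 - 1) with 1 by ring. rewrite Rinv_1. lra. }
  set (V := fun w => (Zt w / Zt s0)%C).
  assert (HV : holo rc V) by (apply holo_mult; auto; apply holo_const).
  assert (Vmod : forall w, rc w -> Cmod (V w) <= 4 * Cmod (Zt w)).
  { intros w Hw. unfold V. rewrite Cmod_div by auto. rewrite Rmult_comm. apply Rmult_le_compat_l. apply Cmod_ge_0.
    replace 4 with (/ (1/4)) by field. apply Rinv_le_contravar; lra. }
  destruct (log_exists V (1/2) (7/2) (t - 3/2) (t + 3/2) 2 t 1) as (h & Hh & Eh & h0 & _); auto.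
  { intros w Hw. unfold V. apply Cmult_neq_0. apply NZt; auto. intros X.
    apply (f_equal Cmod) in X. rewrite Cmod_inv, Cmod_0 in X by auto.
    assert (0 < / Cmod (Zt s0)) by (apply Rinv_0_lt_compat; lra). lra. }
  { unfold V. fold s0. field. auto. }
  { lra. }
  fold s0 in h0. rewrite ln_1 in h0. fold rc in Hh, Eh.
  assert (Dr : forall w, disc s0 (3/2) w -> rc w).
  { intros w Hw. unfold disc in Hw. assert (A1 := Cmod_fst (w - s0)%C). assert (A2 := Cmod_snd (w - s0)%C).
    unfold s0 in A1, A2. simpl in A1, A2. fold s0 in A1, A2.
    assert (A3 := Rle_lt_trans _ _ _ A1 Hw). assert (A4 := Rle_lt_trans _ _ _ A2 Hw).
    apply Rabs_def2 in A3, A4. split; lra. }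
  assert (Reh : forall w Y, rc w -> 0 < Y -> Cmod (V w) <= Y -> fst (h w) <= ln Y).
  { intros w Y Hw HY HVY. assert (E := Eh w Hw). apply (f_equal Cmod) in E. rewrite Cmod_Cexp in E.
    rewrite <- (ln_exp (fst (h w))), E. assert (Pw := exp_pos (fst (h w))). rewrite E in Pw.
    destruct HVY as [L|L]. left. apply ln_increasing; auto. rewrite L; lra. }
  assert (BM : forall w, rc w -> fst (h w) <= M).
  { intros w Hw. apply Reh; auto. lra. eapply Rle_trans. apply Vmod; auto.
    destruct (Rc w Hw) as (Q1 & Q2 & Q3). unfold Zt. rewrite Cmod_div by (apply Nw; auto).
    assert (Q4 := W_bound w ltac:(lra)).
    assert (Q5 : (1 + Cmod w) ^ 3 <= (6 + Rabs t) ^ 3) by (apply pow_incr; generalize (Cmod_ge_0 w); lra).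
    assert (Q6 : Cmod (W w) / Cmod (w - 1) <= Cmod (W w)).
    { apply Rmult_le_reg_r with (Cmod (w - 1)). lra. unfold Rdiv. rewrite Rmult_assoc, Rinv_l by lra.
      generalize (Cmod_ge_0 (W w)); nra. }
    lra. }
  (* On the small circle Re s >= 7/4, so |ZZ| <= 3^2 whatever t is; then ln(4 * 9) <= 6 because 36
     <= 2^6. *)
  assert (B6 : forall u, fst (h (s0 + circ (1/4) u)%C) <= 6).
  { intros u. set (w := (s0 + circ (1/4) u)%C).
    assert (Hw : Cmod (w - s0) = 1/4).
    { unfold w. replace (s0 + circ (1/4) u - s0)%C with (circ (1/4) u) by ring. apply Cmod_circ. lra. }
    assert (Rw : rc w) by (apply Dr; unfold disc; lra).
    assert (Fw : 7/4 <= fst w).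
    { assert (A1 : Rabs (fst w - 2) <= Cmod (w - s0)) by exact (Cmod_fst (w - s0)%C).
      rewrite Hw in A1. apply Rabs_le_between in A1. lra. }
    apply Rle_trans with (ln 36).
    2:{ assert (Q := ln_nat_bound 36 6 ltac:(lra) ltac:(simpl; lra)). simpl in Q. lra. }
    apply Reh; auto. lra. eapply Rle_trans. apply Vmod; auto. rewrite EZ by (auto; lra).
    assert (Q := ZZ_upper w ltac:(lra)).
    assert (I : / (fst w - 1) <= 4/3) by (replace (4/3) with (/ (3/4)) by field; apply Rinv_le_contravar; lra).
    assert (I0 : 0 < / (fst w - 1)) by (apply Rinv_0_lt_compat; lra).
    assert ((1 + / (fst w - 1)) ^ 2 <= 3 ^ 2) by (apply pow_incr; lra). lra. }
  assert (Hhd : holo (disc s0 (3/2)) h) by (apply (holo_sub _ rc); auto).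
  assert (Zm : Cmod (RtoC (x - 2)) <= rho) by (rewrite Cmod_R, Rabs_left1 by lra; unfold rho; lra).
  assert (TI := taylor_interpolate h s0 (3/2) (1/4) r1 rho 6 M K0 (RtoC (x - 2)) ltac:(lra) Hr1 Hrho M0 Hhd h0 B6
     (fun u => BM _ (Dr _ (circ_in s0 (3/2) r1 Hr1 u))) Zm).
  fold B in TI. fold q in TI.
  assert (Es : (s0 + RtoC (x - 2) = (x, t))%C) by (unfold s0; apply injective_projections; simpl; ring).
  rewrite Es in TI.
  assert (TI2 : Cmod (h (x, t)) <= B + eta / 3 * M).
  { eapply Rle_trans. exact TI. apply Rplus_le_compat_l.
    apply Rmult_le_reg_r with (1 - q). lra. unfold Rdiv at 1. rewrite Rmult_assoc, Rinv_l by lra. nra. }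
  assert (Rxt : rc (x, t)) by (split; simpl; lra).
  assert (Fh : fst (h (x, t)) <= B + eta / 3 * M).
  { eapply Rle_trans. apply Rle_abs. eapply Rle_trans. apply Cmod_fst. auto. }
  assert (EV : Cmod (V (x, t)) <= exp B * (exp (eta / 3 * ln 1680) * Rpower (6 + Rabs t) eta)).
  { rewrite <- Eh by auto. rewrite Cmod_Cexp. eapply Rle_trans. apply exp_mono. exact Fh.
    rewrite exp_plus. apply Rmult_le_compat_l. left; apply exp_pos.
    unfold M. rewrite ln_mult, ln_pow by lra. unfold Rpower. rewrite <- exp_plus. right. f_equal. simpl. field. }
  assert (EW : W (x, t) = (V (x, t) * Zt s0 * ((x, t) - 1))%C).
  { unfold V, Zt at 1. field. split; auto. }
  rewrite EW, !Cmod_mult. set (cc := Cmod ((x, t) - 1)).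
  assert (C0 : 0 <= cc) by apply Cmod_ge_0.
  assert (P1 := exp_pos B). assert (P2 := exp_pos (eta / 3 * ln 1680)). assert (P3 := Rpower_pos (6 + Rabs t) eta).
  replace (4 * 9 * exp B * exp (eta / 3 * ln 1680) * cc * Rpower (6 + Rabs t) eta) with
    (exp B * (exp (eta / 3 * ln 1680) * Rpower (6 + Rabs t) eta) * 36 * cc) by ring.
  apply Rmult_le_compat_r; auto. apply Rmult_le_compat; try apply Cmod_ge_0; auto. lra.
Qed.

(** * Perron's formula *)

(** The kernel y^s / (s (s + 1)), whose integral over a vertical line is max(0, 1 - 1/y) up to a
    constant; it converges absolutely. *)
Definition pker (y : R) (s : C) : C := (xpow s y / (s * (s + 1)))%C.

Lemma holo_xpow D (g : C -> C) y : holo D g -> holo D (fun s => xpow (g s) y).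
Proof. intros H. unfold xpow. apply holo_Cexp. apply holo_mult; auto. apply holo_const. Qed.

Lemma holo_pker (D : C -> Prop) y : (forall s, D s -> s <> 0%C /\ (s + 1)%C <> 0%C) -> holo D (pker y).
Proof.
  intros H. unfold pker. apply holo_div. apply holo_xpow, holo_id. apply holo_mult. apply holo_id.
  apply holo_plus. apply holo_id. apply holo_const. intros s Hs. destruct (H s Hs). apply Cmult_neq_0; auto.
Qed.

Lemma Cmod_pker y s k m : 0 < k -> 0 < m -> k <= Cmod s -> m <= Cmod (s + 1) -> Cmod (pker y s) <= Rpower y (fst s) / (k * m).
Proof.
  intros Hk Hm H1 H2. unfold pker.
  rewrite Cmod_div by (apply Cmult_neq_0; apply Cmod_gt_0; lra). rewrite Cmod_mult, Cmod_xpow.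
  apply Rmult_le_compat_l. left; apply Rpower_pos. apply Rinv_le_contravar. apply Rmult_lt_0_compat; auto.
  apply Rmult_le_compat; lra.
Qed.

Lemma xpow_real x y : xpow (RtoC x) y = RtoC (Rpower y x).
Proof. unfold xpow. rewrite <- RtoC_mult, Cexp_RtoC. auto. Qed.

Lemma snd_RtoC_div a b : b <> 0 -> snd (RtoC a / RtoC b)%C = 0.
Proof. intros H. rewrite <- RtoC_div by auto. auto. Qed.

Lemma pker_real y x : 0 < x -> snd (pker y (RtoC x)) = 0.
Proof.
  intros H. unfold pker. rewrite xpow_real, <- RtoC_plus, <- RtoC_mult. apply snd_RtoC_div.
  assert (0 < x * (x + 1)) by (apply Rmult_lt_0_compat; lra). lra.
Qed.

(** A function real on the lower side contributes only an imaginary amount there after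
    multiplication by i, so for real parts that side drops out and the upper half of a line
    suffices. *)
Lemma rect_cauchy_re f l1 l2 T d : 0 < d -> l1 <= l2 -> 0 <= T ->
  holo (rect (l1 - d) (l2 + d) (0 - d) (T + d)) f -> (forall u, l1 < u < l2 -> snd (f (u, 0)) = 0) ->
  fst (CInt (fun v => f (l1, v)) 0 T) = fst (CInt (fun v => f (l2, v)) 0 T) - snd (CInt (fun u => f (u, T)) l1 l2).
Proof.
  intros Hd L HT Hf H0.
  assert (E := rect_cauchy f l1 l2 0 T d Hd L HT Hf). apply (f_equal fst) in E.
  assert (Z : snd (CInt (fun u => f (u, 0)) l1 l2) = 0).
  { unfold CInt; simpl. rewrite (RInt_ext _ (fun _ => 0)). rewrite RInt_const. unfold scal; simpl; unfold mult; simpl; ring.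
    intros u. rewrite Rmin_left, Rmax_right by lra. apply H0. }
  simpl in E. simpl in Z. rewrite Z in E. simpl. lra.
Qed.

Lemma pker_cont_v y x T : 0 < x -> forall t, 0 <= t <= T -> pcont (fun v => pker y (x, v)) t.
Proof.
  intros Hx t _. apply (pcont_comp (pker y) (fun v => (x, v))). 2: apply pcont_v.
  apply (holo_cont (fun s => 0 < fst s)). 2: simpl; auto. apply holo_pker. intros s Hs.
  split; intros E; apply (f_equal fst) in E; simpl in E; lra.
Qed.

(** By conjugation this is half of the integral over the segment from - T to T, so its limit is PI
    max(0, 1 - 1/y) with no factor 2 or i. *)
Definition perron (c y T : R) : R := fst (CInt (fun t => pker y (c, t)) 0 T).

(** For y <= 1 the line is moved right to Re s = c + T, where |y^s| has not grown; the new side and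
    the top each cost 2 y^c / T. *)
Lemma perron_small c y T : 1 <= c <= 2 -> 0 < y <= 1 -> 1 <= T -> Rabs (perron c y T) <= 4 * Rpower y c / T.
Proof.
  intros Hc Hy HT. unfold perron. set (B := c + T).
  assert (Hp : holo (rect (c - 1/2) (B + 1/2) (0 - 1/2) (T + 1/2)) (pker y)).
  { apply holo_pker. intros s [S1 S2]. split; intros E; apply (f_equal fst) in E; simpl in E; lra. }
  rewrite (rect_cauchy_re (pker y) c B T (1/2)); auto; try lra; try (unfold B; lra).
  2:{ intros u Hu. apply (pker_real y u). lra. }
  assert (Pc := Rpower_pos y c).
  assert (Mono : forall u, c <= u -> Rpower y u <= Rpower y c).
  { intros u Hu. unfold Rpower. apply exp_mono. assert (ln y <= 0).
    { rewrite <- ln_1. destruct (proj2 Hy) as [L|L]. left; apply ln_increasing; lra. rewrite L; lra. } nra. }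
  assert (X1 : Cmod (CInt (fun v => pker y (B, v)) 0 T) <= 2 * (Rpower y c / (T * T)) * (T - 0)).
  { apply CInt_bound. lra. apply pker_cont_v. unfold B; lra.
    intros t Ht. eapply Rle_trans. apply (Cmod_pker y (B, t) T T); try lra.
    eapply Rle_trans; [|apply Cmod_fst]. simpl. unfold B. rewrite Rabs_pos_eq; lra.
    eapply Rle_trans; [|apply Cmod_fst]. simpl. unfold B. rewrite Rabs_pos_eq; lra.
    apply Rmult_le_compat_r. left; apply Rinv_0_lt_compat; nra. apply Mono. simpl. unfold B; lra. }
  assert (X2 : Cmod (CInt (fun u => pker y (u, T)) c B) <= 2 * (Rpower y c / (T * T)) * (B - c)).
  { apply CInt_bound. unfold B; lra.
    intros u Hu. apply (pcont_comp (pker y) (fun u => (u, T))). 2: apply pcont_h.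
    apply (holo_cont _ _ _ Hp). split; simpl; lra.
    intros u Hu. eapply Rle_trans. apply (Cmod_pker y (u, T) T T); try lra.
    eapply Rle_trans; [|apply Cmod_snd]. simpl. rewrite Rabs_pos_eq; lra.
    eapply Rle_trans; [|apply Cmod_snd]. simpl. rewrite Rplus_0_r, Rabs_pos_eq; lra.
    apply Rmult_le_compat_r. left; apply Rinv_0_lt_compat; nra. apply Mono. simpl; lra. }
  assert (Y1 := Rle_trans _ _ _ (Cmod_fst _) X1). assert (Y2 := Rle_trans _ _ _ (Cmod_snd _) X2).
  replace (2 * (Rpower y c / (T * T)) * (T - 0)) with (2 * Rpower y c / T) in Y1 by (field; lra).
  replace (2 * (Rpower y c / (T * T)) * (B - c)) with (2 * Rpower y c / T) in Y2 by (unfold B; field; lra).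
  replace (4 * Rpower y c / T) with (2 * Rpower y c / T + 2 * Rpower y c / T) by (field; lra).
  eapply Rle_trans. apply Rabs_triang. rewrite Rabs_Ropp. lra.
Qed.

Lemma RInt_inv_re x T : x <> 0 -> 0 <= T -> fst (CInt (fun t => / ((x, t) : C))%C 0 T) = atan (T / x).
Proof.
  intros Hx HT. rewrite CInt_fst.
  rewrite (RInt_ext _ (fun t => / x * / (1 + (t / x) ^ 2))).
  2:{ intros t _. rewrite fst_Cinv. simpl. field. split; auto. nra. }
  apply is_RInt_unique.
  replace (atan (T / x)) with (atan (T / x) - atan (0 / x)).
  2:{ unfold Rdiv. rewrite Rmult_0_l, atan_0. ring. }
  apply (is_RInt_derive (fun t => atan (t / x)) (fun t => / x * / (1 + (t / x) ^ 2))).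
  - intros t _. auto_derive; auto. unfold Rdiv, Rsqr. field. split; auto. nra.
  - intros t _. apply (continuous_mult (K := R_AbsRing) (fun _ => / x)). apply continuous_const.
    apply (ex_derive_continuous (V := R_NormedModule)). auto_derive. assert (0 <= (t / x) ^ 2) by apply pow2_ge_0. unfold Rdiv in *. lra.
Qed.

Lemma atan_near x : 0 < x -> Rabs (atan x - PI / 2) <= / x.
Proof.
  intros Hx. assert (I := atan_inv x Hx). assert (Pi : 0 < / x) by (apply Rinv_0_lt_compat; auto).
  replace (atan x - PI / 2) with (- atan (/ x)) by lra. rewrite Rabs_Ropp.
  assert (A0 : 0 < atan (/ x)) by (rewrite <- atan_0; apply atan_increasing; auto).
  rewrite Rabs_pos_eq by lra.
  destruct (MVT_gen atan 0 (/ x) (fun t => / (1 + t ^ 2))) as [z [Hz E]].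
  - intros t _. apply is_derive_Reals. apply derivable_pt_lim_atan.
  - intros t _. apply derivable_continuous_pt. apply derivable_pt_atan.
  - rewrite atan_0, Rminus_0_r in E. rewrite E.
    assert (0 <= z ^ 2) by apply pow2_ge_0.
    assert (/ (1 + z ^ 2) <= 1) by (rewrite <- Rinv_1; apply Rinv_le_contravar; lra). nra.
Qed.

(** Let phi be the entire function (y^s - 1) / s. Then g(s) = phi(s) - phi(s + 1) / y equals the
    kernel without its poles, [pker] - 1/s + 1 / (y (s + 1)). The line is moved to Re s = - 1 - c,
    the mirror image of c under s -> - 1 - s, which fixes s (s + 1): there the kernel reproduces the
    Perron integral for 1/y <= 1. The subtracted fractions integrate to arctangents close to PI / 2,
    which supply the main term. *)
Lemma perron_large c y T : 1 <= c <= 2 -> 1 <= y -> 1 <= T ->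
  Rabs (perron c y T - PI * (1 - / y)) <= 60 * Rpower y c / T.
Proof.
  intros Hc Hy HT.
  assert (Oall : Copen (fun _ => True)) by (intros z _; exists 1; split; [lra|auto]).
  destruct (holo_divide (fun _ => True) (fun s => xpow s y - 1)%C 0 Oall) as [phi [Hphi Ephi]]; auto.
  { apply holo_minus. apply holo_xpow, holo_id. apply holo_const. }
  { unfold xpow. replace (0 * RtoC (ln y))%C with (RtoC 0) by ring. rewrite Cexp_0. ring. }
  set (g := fun s => (phi s - RtoC (/ y) * phi (s + 1))%C).
  assert (Hg : forall D, holo D g).
  { intros D. unfold g. apply holo_minus. apply (holo_sub _ (fun _ => True)); auto.
    apply holo_mult. apply holo_const. apply (holo_comp D (fun _ => True) phi (fun s => s + 1)%C); auto.
    apply holo_plus. apply holo_id. apply holo_const. }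
  assert (Ep : forall s : C, s <> RtoC 0 -> phi s = (xpow s y / s - / s)%C).
  { intros s Hs. assert (E := Ephi s I). replace (s - 0)%C with s in E by ring.
    replace (phi s) with (/ s * (s * phi s))%C by (field; auto). rewrite <- E. field; auto. }
  assert (Ypow : forall s, xpow (s + 1) y = (RtoC y * xpow s y)%C).
  { intros s. unfold xpow. replace ((s + 1) * RtoC (ln y))%C with (RtoC (ln y) + s * RtoC (ln y))%C by ring.
    rewrite Cexp_plus, Cexp_RtoC, exp_ln; auto. lra. }
  assert (Yn : RtoC y <> 0%C) by (intros E; apply (f_equal fst) in E; simpl in E; lra).
  assert (Eg : forall s : C, s <> RtoC 0 -> (s + 1)%C <> RtoC 0 -> g s = (pker y s - / s + RtoC (/ y) * / (s + 1))%C).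
  { intros s S0 S1. unfold g. rewrite !Ep by auto. rewrite Ypow. unfold pker. rewrite RtoC_inv by lra. field. auto. }
  (* Away from 0 phi is a quotient of real numbers on the axis; at 0 its reality follows by
     continuity. *)
  assert (Real : forall u, snd (g (u, 0)) = 0).
  { assert (R1 : forall u, u <> 0 -> snd (phi (RtoC u)) = 0).
    { intros u Hu. rewrite Ep by (intros E; apply (f_equal fst) in E; simpl in E; lra).
      rewrite xpow_real, <- RtoC_div, <- RtoC_inv, <- RtoC_minus by auto. auto. }
    assert (R2 : forall u, snd (phi (RtoC u)) = 0).
    { intros u. destruct (Req_dec u 0) as [->|]; auto.
      destruct (Req_dec (snd (phi (RtoC 0))) 0) as [|N]; auto. exfalso.
      assert (Cp := holo_cont _ _ _ Hphi I : Ccont phi (RtoC 0)).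
      destruct (Cp (Rabs (snd (phi (RtoC 0))))) as [d [Hd K]]. apply Rabs_pos_lt; auto.
      specialize (K (RtoC (d / 2))). rewrite <- RtoC_minus, Cmod_R, Rminus_0_r, Rabs_pos_eq in K by lra.
      specialize (K ltac:(lra)). assert (Q := Cmod_snd (phi (RtoC (d / 2)) - phi (RtoC 0))%C).
      simpl in Q. rewrite R1 in Q by lra. rewrite Rplus_0_l, Rabs_Ropp in Q. simpl in K. lra. }
    intros u. unfold g. assert (A := R2 u). assert (B := R2 (u + 1)).
    replace ((u, 0) + 1)%C with (RtoC (u + 1)) by (apply injective_projections; simpl; ring).
    change ((u, 0) : C) with (RtoC u). simpl. rewrite A, B. ring. }
  assert (Bnd : forall s : C, 1 <= Rabs (snd s) -> s <> RtoC 0 /\ (s + 1)%C <> RtoC 0).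
  { intros s Hs. split; intros E; apply (f_equal snd) in E; simpl in E; [|rewrite Rplus_0_r in E]; rewrite E, Rabs_R0 in Hs; lra. }
  assert (RC := rect_cauchy_re g (- 1 - c) c T 1 ltac:(lra) ltac:(lra) ltac:(lra) (Hg _) (fun u _ => Real u)).
  assert (Inv : forall x b, x <> 0 -> forall t, pcont (fun t => RtoC b * / ((x, t) : C))%C t).
  { intros x b Hx t. apply pcont_mult. apply pcont_const. apply (pcont_comp Cinv (fun t => (x, t))). 2: apply pcont_v.
    eapply Cderiv_cont, Cderiv_inv. intros E; apply (f_equal fst) in E; simpl in E; lra. }
  assert (Pk : forall x, x <> 0 -> x <> -1 -> forall t, pcont (fun t => pker y (x, t)) t).
  { intros x X0 X1 t. apply (pcont_comp (pker y) (fun t => (x, t))). 2: apply pcont_v.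
    apply (holo_cont (fun s => fst s <> 0 /\ fst s <> -1)); simpl; auto. apply holo_pker. intros s [S0 S1].
    split; intros E; apply (f_equal fst) in E; simpl in E; lra. }
  assert (Line : forall x, x <> 0 -> x <> -1 -> fst (CInt (fun t => g (x, t)) 0 T) =
     fst (CInt (fun t => pker y (x, t)) 0 T) - atan (T / x) + / y * atan (T / (x + 1))).
  { intros x X0 X1.
    rewrite (CInt_ext _ (fun t => pker y (x, t) + (RtoC (-1) * / ((x, t) : C) + RtoC (/ y) * / (((x + 1)%R, t) : C)))%C).
    2:{ intros t _. rewrite Eg.
        replace ((x, t) + 1)%C with (((x + 1)%R, t) : C) by (apply injective_projections; simpl; ring). ring.
        intros E; apply (f_equal fst) in E; simpl in E; lra. intros E; apply (f_equal fst) in E; simpl in E; lra. }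
    assert (I1 := Inv x (-1) X0). assert (I2 := Inv (x + 1) (/ y) ltac:(lra)). assert (I3 := Pk x X0 X1).
    rewrite CInt_plus; [|auto|intros; apply pcont_plus; auto]. rewrite CInt_plus; auto.
    assert (J : forall z b, z <> 0 -> fst (CInt (fun t => RtoC b * / ((z, t) : C))%C 0 T) = b * atan (T / z)).
    { intros z b Hz. rewrite <- (RInt_inv_re z T) by lra. rewrite CInt_scal. simpl. ring.
      intros t _. apply (pcont_comp Cinv (fun t => (z, t))). 2: apply pcont_v.
      eapply Cderiv_cont, Cderiv_inv. intros E; apply (f_equal fst) in E; simpl in E; lra. }
    assert (J1 := J x (-1) X0). assert (J2 := J (x + 1) (/ y) ltac:(lra)).
    set (q1 := CInt (fun t => RtoC (-1) * / ((x, t) : C))%C 0 T) in *.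
    set (q2 := CInt (fun t => RtoC (/ y) * / (((x + 1)%R, t) : C))%C 0 T) in *.
    set (q3 := CInt (fun t => pker y (x, t)) 0 T).
    change (fst (q3 + (q1 + q2))%C) with (fst q3 + (fst q1 + fst q2)). rewrite J1, J2. ring. }
  rewrite !Line in RC by lra. fold (perron c y T) in RC.
  (* The symmetry s -> - 1 - conj(s) maps the new line to the old one and replaces y by 1/y. *)
  assert (Refl : fst (CInt (fun t => pker y (- 1 - c, t)) 0 T) = / y * perron c (/ y) T).
  { unfold perron.
    rewrite (CInt_ext _ (fun t => RtoC (/ y) * Cconj (pker (/ y) (c, t)))%C).
    - rewrite CInt_scal, <- Cconj_CInt. simpl. ring.
      intros t. rewrite Rmin_left, Rmax_right by lra. apply pker_cont_v; lra.
      intros t. rewrite Rmin_left, Rmax_right by lra. intros. apply pcont_conj. apply (pker_cont_v _ _ T); lra.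
    - intros t _. unfold pker.
      assert (Cn : ((c, t) * ((c, t) + 1))%C <> 0%C).
      { apply Cmult_neq_0; intros E; apply (f_equal fst) in E; simpl in E; lra. }
      rewrite Cdiv_conj by auto. rewrite !Cmult_conj, Cplus_conj.
      assert (X : (xpow ((- 1 - c)%R, t) y = RtoC (/ y) * Cconj (xpow (c, t) (/ y)))%C).
      { unfold xpow. rewrite Cconj_Cexp, ln_Rinv by lra.
        rewrite <- (exp_ln (/ y)) by (apply Rinv_0_lt_compat; lra). rewrite ln_Rinv by lra.
        rewrite <- Cexp_RtoC, <- Cexp_plus. f_equal. apply injective_projections; simpl; ring. }
      rewrite X.
      replace (((- 1 - c)%R, t) * (((- 1 - c)%R, t) + 1))%C with (Cconj (c, t) * (Cconj (c, t) + Cconj 1))%C.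
      unfold Cdiv. ring. apply injective_projections; simpl; ring. }
  rewrite Refl in RC.
  assert (Yi : 0 < / y <= 1). { split. apply Rinv_0_lt_compat; lra. rewrite <- Rinv_1. apply Rinv_le_contravar; lra. }
  assert (PS := perron_small c (/ y) T Hc Yi HT).
  assert (Py : 1 <= Rpower y c). { rewrite <- (Rpower_O y) by lra. apply Rpower_le1; lra. }
  assert (Py' : Rpower (/ y) c <= 1).
  { unfold Rpower. rewrite ln_Rinv by lra. rewrite <- exp_0. apply exp_mono.
    assert (0 <= ln y) by (apply ln_ge_0; lra). nra. }
  assert (IT : 0 < / T) by (apply Rinv_0_lt_compat; lra).
  assert (Top : Cmod (CInt (fun u => g (u, T)) (-1 - c) c) <= 2 * (3 * Rpower y c / T) * (c - (-1 - c))).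
  { apply CInt_bound. lra.
    intros u _. apply (pcont_comp g (fun u => (u, T))). 2: apply pcont_h. apply (holo_cont (fun _ => True)); auto.
    intros u Hu. destruct (Bnd (u, T)) as [B1 B2]. simpl. rewrite Rabs_pos_eq; lra.
    rewrite Eg by auto.
    assert (M1 : T <= Cmod (u, T)). { eapply Rle_trans; [|apply Cmod_snd]. simpl. rewrite Rabs_pos_eq; lra. }
    assert (M2 : T <= Cmod ((u, T) + 1)). { eapply Rle_trans; [|apply Cmod_snd]. simpl. rewrite Rplus_0_r, Rabs_pos_eq; lra. }
    eapply Rle_trans. apply Cmod_triangle. eapply Rle_trans. apply Rplus_le_compat_r. apply Cmod_minus_le.
    rewrite Cmod_mult, Cmod_R, !Cmod_inv, (Rabs_pos_eq (/ y)) by (auto; lra).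
    assert (E1 : Cmod (pker y (u, T)) <= Rpower y c * / T).
    { eapply Rle_trans. apply (Cmod_pker y (u, T) T 1); try lra. simpl fst. unfold Rdiv. rewrite Rmult_1_r.
      apply Rmult_le_compat_r. lra. apply Rpower_le1; lra. }
    assert (E2 : / Cmod (u, T) <= / T) by (apply Rinv_le_contravar; lra).
    assert (E3 : / Cmod ((u, T) + 1) <= / T) by (apply Rinv_le_contravar; lra).
    assert (E4 : / y * / Cmod ((u, T) + 1) <= 1 * / T).
    { apply Rmult_le_compat; try lra. left. apply Rinv_0_lt_compat. lra. }
    replace (3 * Rpower y c / T) with (Rpower y c * / T + Rpower y c * / T + Rpower y c * / T) by (unfold Rdiv; ring).
    assert (1 * / T <= Rpower y c * / T) by (apply Rmult_le_compat_r; lra). lra. }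
  assert (Top2 := Rle_trans _ _ _ (Cmod_snd _) Top).
  assert (Top3 : 2 * (3 * Rpower y c / T) * (c - (-1 - c)) <= 30 * (Rpower y c / T)).
  { assert (0 <= Rpower y c / T) by (apply Rdiv_le_0_compat; lra).
    replace (2 * (3 * Rpower y c / T) * (c - (-1 - c))) with (6 * (Rpower y c / T) * (2 * c + 1)) by (field; lra). nra. }
  assert (At1 := atan_near (T / c) ltac:(apply Rdiv_lt_0_compat; lra)).
  assert (At2 := atan_near (T / (c + 1)) ltac:(apply Rdiv_lt_0_compat; lra)).
  replace (T / (- 1 - c)) with (- (T / (c + 1))) in RC by (field; lra).
  replace (T / (- 1 - c + 1)) with (- (T / c)) in RC by (field; lra).
  rewrite !atan_opp in RC.
  set (a1 := atan (T / c)) in *. set (a2 := atan (T / (c + 1))) in *.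
  replace (/ (T / c)) with (c / T) in At1 by (field; lra). replace (/ (T / (c + 1))) with ((c + 1) / T) in At2 by (field; lra).
  set (tp := snd (CInt (fun u => g (u, T)) (-1 - c) c)) in *. set (P1 := perron c y T) in *. set (P2 := perron c (/ y) T) in *.
  (* All four arctangents are counted from PI / 2, so that only their small deviations remain. *)
  assert (E : P1 - PI * (1 - / y) = (1 - / y) * ((a1 - PI / 2) + (a2 - PI / 2)) + / y * P2 + tp) by lra.
  rewrite E.
  assert (B1 : Rabs ((1 - / y) * (a1 - PI / 2 + (a2 - PI / 2))) <= 1 * (c / T + (c + 1) / T)).
  { rewrite Rabs_mult. apply Rmult_le_compat; try apply Rabs_pos. rewrite Rabs_pos_eq; lra.
    eapply Rle_trans. apply Rabs_triang. lra. }
  assert (B2 : Rabs (/ y * P2) <= 1 * (4 * 1 / T)).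
  { rewrite Rabs_mult, (Rabs_pos_eq (/ y)) by lra. apply Rmult_le_compat; try apply Rabs_pos; try lra.
    eapply Rle_trans. exact PS. unfold Rdiv. apply Rmult_le_compat_r; lra. }
  eapply Rle_trans. apply Rabs_triang. eapply Rle_trans. apply Rplus_le_compat_r, Rabs_triang.
  replace (60 * Rpower y c / T) with (60 * (Rpower y c / T)) by (unfold Rdiv; ring).
  assert (U : / T <= Rpower y c / T) by (unfold Rdiv; nra).
  unfold Rdiv in *. nra.
Qed.

Lemma perron_formula c y T : 1 <= c <= 2 -> 0 < y -> 1 <= T ->
  Rabs (perron c y T - PI * Rmax 0 (1 - / y)) <= 60 * Rpower y c / T.
Proof.
  intros Hc Hy HT. assert (P := Rpower_pos y c). assert (Ti : 0 < / T) by (apply Rinv_0_lt_compat; lra).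
  destruct (Rle_dec y 1) as [L|L].
  - assert (1 <= / y) by (rewrite <- Rinv_1; apply Rinv_le_contravar; lra).
    rewrite Rmax_left by lra. rewrite Rmult_0_r, Rminus_0_r. eapply Rle_trans. apply perron_small; auto; lra.
    unfold Rdiv. apply Rmult_le_compat_r; lra.
  - assert (/ y <= 1) by (rewrite <- Rinv_1; apply Rinv_le_contravar; lra).
    rewrite Rmax_right by lra. apply perron_large; auto; lra.
Qed.

(** The transform of the averaging weight [smooth x h]; as h -> 0 it tends to x^s / s. *)
Definition Kh (x h : R) (s : C) : C := ((xpow (s + 1) (x + h) - xpow (s + 1) x) / (RtoC h * (s * (s + 1))))%C.

Lemma holo_Kh (D : C -> Prop) x h : 0 < h -> (forall s, D s -> 0 < fst s) -> holo D (Kh x h).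
Proof.
  intros Hh HD. unfold Kh.
  assert (S1 : holo D (fun s => s + 1)%C) by (apply holo_plus; [apply holo_id|apply holo_const]).
  apply holo_div. apply holo_minus; apply holo_xpow; auto.
  apply holo_mult. apply holo_const. apply holo_mult; auto. apply holo_id.
  intros s Hs. specialize (HD s Hs). apply Cmult_neq_0; [|apply Cmult_neq_0]; intros E; apply (f_equal fst) in E; simpl in E; lra.
Qed.

Lemma pcont_Kh x h c t : 0 < h -> 0 < c -> pcont (fun v => Kh x h (c, v)) t.
Proof.
  intros Hh Hc. apply (pcont_comp (Kh x h) (fun v => (c, v))). 2: apply pcont_v.
  apply (holo_cont (fun s => 0 < fst s)). apply holo_Kh; auto. simpl; auto.
Qed.

Lemma xpow_scale n (s : C) X : (1 <= n)%nat -> 0 < X ->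
  (cpow_neg n s * xpow (s + 1) X = RtoC X * xpow s (X / INR n))%C.
Proof.
  intros Hn HX. assert (Pn : 0 < INR n) by (apply lt_0_INR; lia). rewrite <- xpow_cpow. unfold xpow.
  replace (RtoC X) with (Cexp (RtoC (ln X))) by (rewrite Cexp_RtoC, exp_ln; auto).
  rewrite <- !Cexp_plus. f_equal. unfold Rdiv. rewrite ln_mult, ln_Rinv by (auto; apply Rinv_0_lt_compat; auto).
  rewrite RtoC_plus, RtoC_opp. ring.
Qed.

Lemma Kh_term n (s : C) x h : (1 <= n)%nat -> 0 < x -> 0 < h -> 0 < fst s ->
  (cpow_neg n s * Kh x h s = RtoC ((x + h) / h) * pker ((x + h) / INR n) s + RtoC (- x / h) * pker (x / INR n) s)%C.
Proof.
  intros Hn Hx Hh Hs. unfold Kh, pker.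
  assert (N0 : s <> RtoC 0) by (intros E; apply (f_equal fst) in E; simpl in E; lra).
  assert (N1 : (s + 1)%C <> RtoC 0) by (intros E; apply (f_equal fst) in E; simpl in E; lra).
  assert (N2 : RtoC h <> RtoC 0) by (intros E; apply (f_equal fst) in E; simpl in E; lra).
  assert (E1 := xpow_scale n s (x + h) Hn ltac:(lra)). assert (E2 := xpow_scale n s x Hn Hx).
  rewrite !RtoC_div, RtoC_opp by lra.
  transitivity ((cpow_neg n s * xpow (s + 1) (x + h) - cpow_neg n s * xpow (s + 1) x) / (RtoC h * (s * (s + 1))))%C.
  field; auto. rewrite E1, E2. field; auto.
Qed.

(** Closed form of the mean over y in [x, x + h] of the indicator of n <= y: 1 up to x, then linear,
    0 from x + h on. *)
Definition smooth (x h : R) (n : nat) : R := (Rmax 0 (x + h - INR n) - Rmax 0 (x - INR n)) / h.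

(** The two Perron integrals at (x + h) / n and x / n combine linearly; the error carries n^-c and
    can be summed over n as soon as c > 1. *)
Lemma perron_term n c x h T : (1 <= n)%nat -> 0 < x -> 0 < h -> 1 <= c <= 2 -> 1 <= T ->
  Rabs (fst (CInt (fun t => cpow_neg n (c, t) * Kh x h (c, t)) 0 T)%C - PI * smooth x h n) <=
  120 * Rpower (x + h) (c + 1) / (h * T) * Rpower (INR n) (- c).
Proof.
  intros Hn Hx Hh Hc HT. assert (Pn : 0 < INR n) by (apply lt_0_INR; lia).
  assert (Pi := PI_RGT_0).
  rewrite (CInt_ext _ (fun t => RtoC ((x + h) / h) * pker ((x + h) / INR n) (c, t) + RtoC (- x / h) * pker (x / INR n) (c, t))%C).
  2:{ intros t _. apply Kh_term; auto. simpl; lra. }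
  assert (Pc : forall y t, pcont (fun t => pker y (c, t)) t).
  { intros y t. destruct (Rle_dec 0 t). apply (pker_cont_v y c t); lra.
    apply (pcont_comp (pker y) (fun v => (c, v))). 2: apply pcont_v.
    apply (holo_cont (fun s => 0 < fst s)). 2: simpl; lra. apply holo_pker. intros s Hs.
    split; intros E; apply (f_equal fst) in E; simpl in E; lra. }
  rewrite CInt_plus by (intros; apply pcont_mult; auto; apply pcont_const).
  rewrite !CInt_scal by auto.
  assert (F : forall b y, fst (RtoC b * CInt (fun t => pker y (c, t)) 0 T)%C = b * perron c y T) by (intros; unfold perron; simpl; ring).
  match goal with |- context [fst (?a + ?b)%C] => change (fst (a + b)%C) with (fst a + fst b) end. rewrite !F.
  assert (M : forall X, 0 < X -> Rmax 0 (X - INR n) = X * Rmax 0 (1 - / (X / INR n))).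
  { intros X HX. replace (1 - / (X / INR n)) with (/ X * (X - INR n)) by (field; lra).
    assert (0 < / X) by (apply Rinv_0_lt_compat; auto). unfold Rmax. destruct (Rle_dec 0 (X - INR n)), (Rle_dec 0 (/ X * (X - INR n))); try nra. field; lra. }
  unfold smooth. rewrite !M by lra.
  assert (A1 := perron_formula c ((x + h) / INR n) T Hc ltac:(apply Rdiv_lt_0_compat; lra) HT).
  assert (A2 := perron_formula c (x / INR n) T Hc ltac:(apply Rdiv_lt_0_compat; lra) HT).
  set (p1 := perron c ((x + h) / INR n) T) in *. set (p2 := perron c (x / INR n) T) in *.
  set (m1 := Rmax 0 (1 - / ((x + h) / INR n))) in *. set (m2 := Rmax 0 (1 - / (x / INR n))) in *.
  replace ((x + h) / h * p1 + - x / h * p2 - PI * (((x + h) * m1 - x * m2) / h)) with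
    ((x + h) / h * (p1 - PI * m1) + - (x / h * (p2 - PI * m2))) by (field; lra).
  assert (D : forall X, 0 < X -> X <= x + h -> Rpower (X / INR n) c <= Rpower (x + h) c * Rpower (INR n) (- c)).
  { intros X HX L. unfold Rdiv.
    unfold Rpower. rewrite <- exp_plus. apply exp_mono. rewrite ln_mult, ln_Rinv by (auto; apply Rinv_0_lt_compat; auto).
    assert (ln X <= ln (x + h)) by (destruct L as [L|L]; [left; apply ln_increasing; auto|rewrite L; lra]). nra. }
  assert (D1 := D (x + h) ltac:(lra) ltac:(lra)). assert (D2 := D x ltac:(lra) ltac:(lra)).
  rewrite Rpower_plus, Rpower_1 by lra.
  set (Q := Rpower (x + h) c * Rpower (INR n) (- c)) in *.
  replace (120 * (Rpower (x + h) c * (x + h)) / (h * T) * Rpower (INR n) (- c)) with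
     ((x + h) / h * (60 * Q / T) + (x + h) / h * (60 * Q / T)) by (unfold Q; field; lra).
  assert (Ti : 0 < / T) by (apply Rinv_0_lt_compat; lra). assert (Hi : 0 < / h) by (apply Rinv_0_lt_compat; lra).
  assert (U : forall p r, Rabs p <= 60 * r / T -> r <= Q -> Rabs p <= 60 * Q / T).
  { intros p r H1 H2. eapply Rle_trans. exact H1. unfold Rdiv. apply Rmult_le_compat_r; lra. }
  eapply Rle_trans. apply Rabs_triang. rewrite Rabs_Ropp, !Rabs_mult.
  assert (0 < (x + h) / h) by (apply Rdiv_lt_0_compat; lra). assert (0 < x / h) by (apply Rdiv_lt_0_compat; lra).
  rewrite (Rabs_pos_eq ((x + h) / h)), (Rabs_pos_eq (x / h)) by lra.
  apply Rplus_le_compat; apply Rmult_le_compat; try apply Rabs_pos; try lra.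
  apply (U _ _ A1 D1). unfold Rdiv; apply Rmult_le_compat_r; lra. apply (U _ _ A2 D2).
Qed.

Lemma Int_part_nat x : 0 <= x -> INR (Z.to_nat (Int_part x)) <= x < INR (Z.to_nat (Int_part x)) + 1.
Proof.
  intros Hx. destruct (base_Int_part x) as [A B].
  assert (0 <= Int_part x)%Z. { assert (-1 < Int_part x)%Z. apply lt_IZR. lra. lia. }
  rewrite INR_IZR_INZ, Z2Nat.id by auto. lra.
Qed.

Lemma rsum_seq f m : fold_right Rplus 0 (map f (seq 1 m)) = rsum (fun k => f (S k)) m.
Proof.
  assert (G0 : forall l z, fold_right Rplus z l = fold_right Rplus 0 l + z).
  { induction l; intros z; simpl. ring. rewrite IHl. ring. }
  induction m; simpl. auto. change (f 1%nat :: map f (seq 2 m)) with (map f (seq 1 (S m))).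
  change (f 1%nat + fold_right Rplus 0 (map f (seq 2 m))) with (fold_right Rplus 0 (map f (seq 1 (S m)))).
  rewrite seq_S, map_app, fold_right_app. simpl. rewrite G0, IHm. ring.
Qed.

Lemma smooth_bounds x h n : 0 < h -> 0 <= smooth x h n <= 1 /\ (INR n <= x -> smooth x h n = 1) /\ (x + h <= INR n -> smooth x h n = 0).
Proof.
  intros Hh. assert (Hi : 0 < / h) by (apply Rinv_0_lt_compat; lra). assert (E : h * / h = 1) by (apply Rinv_r; lra).
  unfold smooth, Rdiv, Rmax. destruct (Rle_dec 0 (x + h - INR n)), (Rle_dec 0 (x - INR n)); repeat split; try nra; intros; try lra.
Qed.

(** Only integers strictly between x and x + h have a weight differing from the sharp cutoff, and
    there are at most h + 1 of them. *)
Lemma rsum_smooth_countE x h N : 0 <= x -> 0 < h -> x + h <= INR N ->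
  Rabs (rsum (fun k => indE (S k) * smooth x h (S k)) N - countE x) <= h + 1.
Proof.
  intros Hx Hh HN. unfold countE. rewrite rsum_seq.
  destruct (Int_part_nat x Hx) as [A B]. set (m := Z.to_nat (Int_part x)) in *.
  assert (I01 : forall k, 0 <= indE k <= 1) by (intros; unfold indE; destruct excluded_middle_informative; lra).
  assert (E1 : forall n, (n <= m)%nat -> rsum (fun k => indE (S k) * smooth x h (S k)) n = rsum (fun k => indE (S k)) n).
  { induction n; intros Hn; cbn [rsum]. auto. rewrite IHn by lia. destruct (smooth_bounds x h (S n) Hh) as [_ [S1 _]].
    rewrite S1. ring. apply Rle_trans with (INR m); auto. apply le_INR; auto. }
  assert (E2 : forall j, 0 <= rsum (fun k => indE (S k) * smooth x h (S k)) (m + j) - rsum (fun k => indE (S k)) m <= Rmin (INR j) (h + 1)).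
  { induction j.
    - rewrite Nat.add_0_r, E1 by lia. simpl INR. split. lra. apply Rmin_glb; lra.
    - rewrite Nat.add_succ_r. cbn [rsum]. rewrite S_INR.
      destruct (smooth_bounds x h (S (m + j)) Hh) as [S0 [S1 S2]]. specialize (I01 (S (m + j))).
      assert (R1 := Rmin_l (INR j) (h + 1)). assert (R2 := Rmin_r (INR j) (h + 1)).
      assert (0 <= indE (S (m + j)) * smooth x h (S (m + j)) <= 1) by nra.
      destruct (Rle_dec (x + h) (INR (S (m + j)))) as [L|L].
      + rewrite (S2 L), Rmult_0_r. split. lra. apply Rmin_glb; lra.
      + split. lra. rewrite S_INR, plus_INR in L. apply Rmin_glb; lra. }
  assert (Nm : (m <= N)%nat). { apply INR_le. lra. }
  replace N with (m + (N - m))%nat by lia. specialize (E2 (N - m)%nat). assert (R2 := Rmin_r (INR (N - m)) (h + 1)).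
  rewrite Rabs_pos_eq; lra.
Qed.

Lemma rsum_abs_le a b n : (forall k, (k < n)%nat -> Rabs (a k) <= b k) -> Rabs (rsum a n) <= rsum b n.
Proof.
  induction n; intros H; cbn [rsum]. rewrite Rabs_R0; lra.
  eapply Rle_trans. apply Rabs_triang. apply Rplus_le_compat. apply IHn. intros; apply H; lia. apply H; lia.
Qed.
Lemma rsum_scal c a n : rsum (fun k => c * a k) n = c * rsum a n.
Proof. induction n; cbn [rsum]. ring. rewrite IHn. ring. Qed.
Lemma rsum_minus a b n : rsum (fun k => a k - b k) n = rsum a n - rsum b n.
Proof. induction n; cbn [rsum]. ring. rewrite IHn. ring. Qed.
Lemma rsum_ext a b n : (forall k, a k = b k) -> rsum a n = rsum b n.
Proof. intros H. induction n; cbn [rsum]. ring. rewrite IHn, H. ring. Qed.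

(** On a segment of finite height the Dirichlet series converges uniformly, so it is cut at some N
    depending on T and eps, beyond x + h; the finite sum is integrated term by term and eps is then
    let go to 0. *)
Lemma perron_countE x h c T : 1 <= x -> 0 < h -> 1 < c <= 2 -> 1 <= T ->
  Rabs (PI * countE x - fst (CInt (fun t => FD (c, t) * Kh x h (c, t))%C 0 T)) <=
  PI * (h + 1) + 120 * Rpower (x + h) (c + 1) / (h * T) * (1 + / (c - 1)).
Proof.
  intros Hx Hh Hc HT. assert (Pi := PI_RGT_0).
  apply Rle_plus_epsilon. intros eps He.
  destruct (zeta_bound c ltac:(lra)) as [Zs Zb].
  assert (Kb : exists M, 0 < M /\ forall t, 0 <= t <= T -> Cmod (Kh x h (c, t)) <= M).
  { exists (2 * Rpower (x + h) (c + 1) / h). split. apply Rdiv_lt_0_compat; auto. assert (Q := Rpower_pos (x + h) (c + 1)); lra.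
    intros t _. unfold Kh. assert (A1 : 1 <= Cmod (c, t)). { eapply Rle_trans; [|apply Cmod_fst]. simpl. rewrite Rabs_pos_eq; lra. }
    assert (A2 : 1 <= Cmod ((c, t) + 1)). { eapply Rle_trans; [|apply Cmod_fst]. simpl. rewrite Rabs_pos_eq; lra. }
    rewrite Cmod_div. rewrite !Cmod_mult, Cmod_R, (Rabs_pos_eq h) by lra.
    unfold Rdiv. apply Rmult_le_compat. apply Cmod_ge_0. left; apply Rinv_0_lt_compat. apply Rmult_lt_0_compat; nra.
    eapply Rle_trans. apply Cmod_minus_le. rewrite !Cmod_xpow. simpl fst.
    assert (Rpower x (c + 1) <= Rpower (x + h) (c + 1)) by (apply Rle_Rpower_l; lra). lra.
    assert (A3 : 1 <= Cmod (c, t) * Cmod ((c, t) + 1)) by nra.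
    apply Rinv_le_contravar. lra. rewrite <- (Rmult_1_r h) at 1. apply Rmult_le_compat_l; lra.
    apply Cmult_neq_0; [|apply Cmult_neq_0]; intros E; apply (f_equal fst) in E; simpl in E; lra. }
  destruct Kb as [M [HM Kb]].
  destruct (tail_small _ Zs (eps / (2 * M * T)) ltac:(apply Rdiv_lt_0_compat; nra)) as [N0 HN0].
  destruct (nfloor_ex (x + h) ltac:(lra)) as [N1 HN1]. set (N := Nat.max N0 (S N1)).
  specialize (HN0 N ltac:(lia)).
  assert (HN : x + h <= INR N). { apply Rle_trans with (INR (S N1)). rewrite S_INR; lra. apply le_INR; lia. }
  set (term := fun k t => (RtoC (indE (S k)) * cpow_neg (S k) (c, t))%C).
  assert (Pcp : forall k t, pcont (fun t => cpow_neg (S k) (c, t)) t).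
  { intros k t. apply (pcont_comp (cpow_neg (S k)) (fun v => (c, v))). 2: apply pcont_v.
    apply (holo_cont (fun _ => True)); auto. apply holo_cpow. }
  assert (PK : forall t, pcont (fun t => Kh x h (c, t)) t) by (intros; apply pcont_Kh; lra).
  assert (PT : forall k t, pcont (fun t => cpow_neg (S k) (c, t) * Kh x h (c, t))%C t) by (intros; apply pcont_mult; auto).
  assert (Pterm : forall k t, pcont (term k) t) by (intros; unfold term; apply pcont_mult; [apply pcont_const|auto]).
  assert (PF : forall t, pcont (fun t => FD (c, t)) t).
  { intros t. apply (pcont_comp FD (fun v => (c, v))). 2: apply pcont_v.
    apply (holo_cont (fun s => 1 < fst s)). apply (holo_Dser _ indE_bounded). simpl; lra. }
  assert (Pcs : forall t, pcont (fun t => csum (fun k => term k t) N) t) by (intros; apply pcont_csum; auto).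
  assert (PD : forall t, pcont (fun t => FD (c, t) - csum (fun k => term k t) N)%C t).
  { intros t. unfold Cminus. apply pcont_plus; auto.
    destruct (Pcs t) as [Q1 Q2]. split; simpl; apply (continuous_opp (V := R_NormedModule)); auto. }
  assert (Tail : Cmod (CInt (fun t => (FD (c, t) - csum (fun k => term k t) N) * Kh x h (c, t))%C 0 T) <= eps).
  { eapply Rle_trans. apply (CInt_bound _ 0 T (eps / (2 * M * T) * M)). lra.
    intros; apply pcont_mult; auto.
    intros t Ht. rewrite Cmod_mult. apply Rmult_le_compat; try apply Cmod_ge_0; auto.
    left. eapply Rle_lt_trans; [|exact HN0]. eapply Rle_trans; [|apply Rle_abs].
    unfold FD, Dser. apply (CSer_tail (fun k => term k t) (fun k => Rpower (INR (S k)) (- c)) N); auto.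
    intros k. apply Dser_term. apply indE_bounded. simpl; lra.
    right. field. lra. }
  rewrite (CInt_ext _ (fun t => (FD (c, t) - csum (fun k => term k t) N) * Kh x h (c, t) +
     csum (fun k => RtoC (indE (S k)) * (cpow_neg (S k) (c, t) * Kh x h (c, t))) N)%C).
  2:{ intros t _. rewrite (csum_ext (fun k => RtoC (indE (S k)) * (cpow_neg (S k) (c, t) * Kh x h (c, t)))%C (fun k => Kh x h (c, t) * term k t)%C).
      rewrite csum_mult. ring. intros; unfold term; ring. }
  rewrite CInt_plus. 2: intros; apply pcont_mult; auto.
  2: intros; apply pcont_csum; intros; apply pcont_mult; auto; apply pcont_const.
  rewrite (CInt_csum (fun k t => RtoC (indE (S k)) * (cpow_neg (S k) (c, t) * Kh x h (c, t)))%C).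
  2: intros; apply pcont_mult; auto; apply pcont_const.
  set (E0 := CInt (fun t => (FD (c, t) - csum (fun k => term k t) N) * Kh x h (c, t))%C 0 T) in *.
  clearbody E0. set (I := fun k => CInt (fun t => cpow_neg (S k) (c, t) * Kh x h (c, t))%C 0 T).
  rewrite (csum_ext _ (fun k => RtoC (indE (S k)) * I k)%C).
  2:{ intros k _. unfold I. apply CInt_scal. auto. }
  rewrite csum_rsum. simpl fst.
  rewrite (rsum_ext _ (fun k => indE (S k) * fst (I k))) by (intros; simpl; ring).
  assert (Bd : Rabs (rsum (fun k => indE (S k) * fst (I k)) N - PI * rsum (fun k => indE (S k) * smooth x h (S k)) N)
     <= 120 * Rpower (x + h) (c + 1) / (h * T) * (1 + / (c - 1))).
  { rewrite <- rsum_scal, <- rsum_minus.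
    eapply Rle_trans. apply (rsum_abs_le _ (fun k => 120 * Rpower (x + h) (c + 1) / (h * T) * Rpower (INR (S k)) (- c))).
    intros k _. replace (indE (S k) * fst (I k) - PI * (indE (S k) * smooth x h (S k))) with (indE (S k) * (fst (I k) - PI * smooth x h (S k))) by ring.
    rewrite Rabs_mult. assert (B1 := indE_bounded (S k)).
    assert (B2 := perron_term (S k) c x h T ltac:(lia) ltac:(lra) Hh ltac:(lra) HT). fold (I k) in B2.
    rewrite <- (Rmult_1_l (120 * _ / _ * _)). apply Rmult_le_compat; try apply Rabs_pos; auto.
    rewrite rsum_scal. apply Rmult_le_compat_l.
    left. apply Rdiv_lt_0_compat. assert (Q := Rpower_pos (x + h) (c + 1)); lra. nra.
    eapply Rle_trans; [|exact Zb]. apply rsum_le_Series; auto. intros; left; apply Rpower_pos. }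
  assert (Cn := rsum_smooth_countE x h N ltac:(lra) Hh HN).
  set (S1 := rsum (fun k => indE (S k) * fst (I k)) N) in *. set (S2 := rsum (fun k => indE (S k) * smooth x h (S k)) N) in *.
  assert (T2 := Rle_trans _ _ _ (Cmod_fst _) Tail).
  replace (PI * countE x - (fst E0 + S1)) with (- (PI * (S2 - countE x)) + - (S1 - PI * S2) + - fst E0) by ring.
  eapply Rle_trans. apply Rabs_triang. rewrite Rabs_Ropp. apply Rplus_le_compat; auto.
  eapply Rle_trans. apply Rabs_triang. rewrite !Rabs_Ropp. apply Rplus_le_compat; auto.
  rewrite Rabs_mult, (Rabs_pos_eq PI) by lra. apply Rmult_le_compat_l; lra.
Qed.

(** * The contour around the branch point *)

(** Two bounds with complementary use: this one decays like 1/|s|^2 but pays 1/h and serves on the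
    top side; the next one has no 1/h, being a mean value estimate, and serves on the left side. *)
Lemma Kh_bound_sq x h s : 0 < x -> 0 < h -> 0 < fst s ->
  Cmod (Kh x h s) <= 2 * Rpower (x + h) (fst s + 1) / (h * (Cmod s * Cmod s)).
Proof.
  intros Hx Hh Hs. unfold Kh.
  assert (N0 : s <> RtoC 0) by (intros E; apply (f_equal fst) in E; simpl in E; lra).
  assert (N1 : (s + 1)%C <> RtoC 0) by (intros E; apply (f_equal fst) in E; simpl in E; lra).
  assert (N2 : RtoC h <> RtoC 0) by (intros E; apply (f_equal fst) in E; simpl in E; lra).
  assert (P0 := proj1 (Cmod_gt_0 s) N0).
  assert (M : Cmod s <= Cmod (s + 1)).
  { apply Rsqr_incr_0_var; [|apply Cmod_ge_0]. unfold Rsqr. rewrite !Cmod_sq. simpl. nra. }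
  rewrite Cmod_div by (repeat apply Cmult_neq_0; auto). rewrite !Cmod_mult, Cmod_R, (Rabs_pos_eq h) by lra.
  unfold Rdiv. apply Rmult_le_compat. apply Cmod_ge_0. left; apply Rinv_0_lt_compat. apply Rmult_lt_0_compat; nra.
  eapply Rle_trans. apply Cmod_minus_le. rewrite !Cmod_xpow. simpl fst.
  assert (Rpower x (fst s + 1) <= Rpower (x + h) (fst s + 1)) by (apply Rle_Rpower_l; lra). lra.
  apply Rinv_le_contravar. apply Rmult_lt_0_compat; nra. apply Rmult_le_compat_l. lra. apply Rmult_le_compat_l; lra.
Qed.

Lemma Kh_bound x h s : 0 < x -> 0 < h -> 0 < fst s ->
  Cmod (Kh x h s) <= 2 * Rpower (x + h) (fst s) / Cmod s.
Proof.
  intros Hx Hh Hs. unfold Kh.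
  assert (N0 : s <> RtoC 0) by (intros E; apply (f_equal fst) in E; simpl in E; lra).
  assert (N1 : (s + 1)%C <> RtoC 0) by (intros E; apply (f_equal fst) in E; simpl in E; lra).
  assert (N2 : RtoC h <> RtoC 0) by (intros E; apply (f_equal fst) in E; simpl in E; lra).
  assert (P0 := proj1 (Cmod_gt_0 s) N0). assert (P1 := proj1 (Cmod_gt_0 _) N1).
  assert (M := cmvt (xpow (s + 1)) (fun u => (s + 1) * xpow ((s + 1) - 1) u)%C x (x + h) (Cmod (s + 1) * Rpower (x + h) (fst s)) ltac:(lra)).
  rewrite Cmod_div by (repeat apply Cmult_neq_0; auto). rewrite !Cmod_mult, Cmod_R, (Rabs_pos_eq h) by lra.
  eapply Rle_trans. apply Rmult_le_compat_r. left; apply Rinv_0_lt_compat. apply Rmult_lt_0_compat; nra.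
  apply M.
  - intros u Hu. destruct (xpow_deriv (s + 1) u ltac:(lra)) as [D1 D2]. split; [exact D1|split; [exact D2|]].
    rewrite Cmod_mult, Cmod_xpow. apply Rmult_le_compat_l. lra.
    replace (fst (s + 1 - 1)%C) with (fst s) by (simpl; ring). apply Rle_Rpower_l; lra.
  - right. replace (x + h - x) with h by ring. field. lra.
Qed.

Lemma Kh_real x h u : 0 < x -> 0 < h -> 0 < u -> Kh x h (RtoC u) = RtoC ((Rpower (x + h) (u + 1) - Rpower x (u + 1)) / (h * (u * (u + 1)))).
Proof.
  intros Hx Hh Hu. assert (0 < h * (u * (u + 1))) by (apply Rmult_lt_0_compat; [|apply Rmult_lt_0_compat]; lra).
  unfold Kh. rewrite <- RtoC_plus, !xpow_real, <- RtoC_minus, <- !RtoC_mult, <- RtoC_div by lra. auto.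
Qed.

Lemma Rpower_mvt a b u : 0 < a < b -> exists z, a <= z <= b /\ Rpower b u - Rpower a u = u * Rpower z (u - 1) * (b - a).
Proof.
  intros H. destruct (MVT_gen (fun v => Rpower v u) a b (fun v => u * Rpower v (u - 1))) as [z [Hz E]].
  - intros v. rewrite Rmin_left, Rmax_right by lra. intros Hv. apply is_derive_Reals. apply derivable_pt_lim_power. lra.
  - intros v. rewrite Rmin_left, Rmax_right by lra. intros Hv. apply derivable_continuous_pt. eexists. apply derivable_pt_lim_power. lra.
  - rewrite Rmin_left, Rmax_right in Hz by lra. exists z. split; auto.
Qed.

(** One mean value replaces the kernel by z^u / u for some z in [x, x + h]; a second one bounds z^u
    - x^u by u h, and the factor u cancels the denominator. *)
Lemma Kh_approx x h u : 1 <= x -> 0 < h -> 0 < u <= 1 -> Rabs (fst (Kh x h (RtoC u)) - Rpower x u / u) <= h.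
Proof.
  intros Hx Hh Hu. rewrite Kh_real by lra. simpl fst.
  destruct (Rpower_mvt x (x + h) (u + 1) ltac:(lra)) as [z [Hz E]]. rewrite E.
  replace ((u + 1) * Rpower z (u + 1 - 1) * (x + h - x) / (h * (u * (u + 1))) - Rpower x u / u) with ((Rpower z u - Rpower x u) / u).
  2:{ replace (u + 1 - 1) with u by ring. field. lra. }
  destruct (Req_dec z x) as [->|N].
  - unfold Rdiv. rewrite Rminus_diag, Rmult_0_l, Rabs_R0. lra.
  - destruct (Rpower_mvt x z u ltac:(lra)) as [y [Hy E2]]. rewrite E2.
    replace (u * Rpower y (u - 1) * (z - x) / u) with (Rpower y (u - 1) * (z - x)) by (field; lra).
    assert (P := Rpower_pos y (u - 1)).
    assert (Rpower y (u - 1) <= 1). { apply Rle_trans with (Rpower y 0). apply Rpower_le1; lra. right; apply Rpower_O; lra. }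
    rewrite Rabs_pos_eq; nra.
Qed.

(* The square root with values in the closed first quadrant; a right inverse of squaring on the closed upper half-plane. *)
Definition csqrt (z : C) : C := (sqrt ((Cmod z + fst z) / 2), sqrt ((Cmod z - fst z) / 2)).

Lemma Cmod_fst_bounds z : 0 <= Cmod z + fst z /\ 0 <= Cmod z - fst z.
Proof. assert (H := Cmod_fst z). unfold Rabs in H. destruct Rcase_abs; lra. Qed.

Lemma csqrt_sq z : 0 <= snd z -> (csqrt z * csqrt z)%C = z.
Proof.
  intros H. destruct (Cmod_fst_bounds z) as [A B]. unfold csqrt. apply injective_projections; simpl.
  - rewrite !sqrt_def by lra. field.
  - rewrite Rmult_comm. rewrite <- sqrt_mult by lra.
    replace ((Cmod z - fst z) / 2 * ((Cmod z + fst z) / 2)) with ((snd z / 2) * (snd z / 2)).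
    rewrite sqrt_square by lra. lra. assert (Q := Cmod_sq z). lra.
Qed.

Lemma csqrt_neq_0 z : 0 <= snd z -> z <> RtoC 0 -> csqrt z <> RtoC 0.
Proof. intros H N E. apply N. rewrite <- (csqrt_sq z H), E. apply Cmult_0_l. Qed.

Lemma sqrt_diff_le u v : 0 <= u -> 0 <= v -> Rabs (sqrt u - sqrt v) <= sqrt (Rabs (u - v)).
Proof.
  assert (G0 : forall u v, 0 <= v -> v <= u -> Rabs (sqrt u - sqrt v) <= sqrt (Rabs (u - v))).
  { intros a b Hb L. assert (S := sqrt_le_1 b a Hb ltac:(lra) L). rewrite !Rabs_pos_eq by lra.
    assert (P1 := sqrt_pos b). assert (P2 := sqrt_pos a). assert (P3 := sqrt_pos (a - b)).
    assert (E1 := sqrt_def a ltac:(lra)). assert (E2 := sqrt_def b Hb). assert (E3 := sqrt_def (a - b) ltac:(lra)).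
    apply Rsqr_incr_0_var; auto. unfold Rsqr. nra. }
  intros Hu Hv. destruct (Rle_dec v u) as [L|L]. auto. rewrite (Rabs_minus_sym (sqrt u)), (Rabs_minus_sym u). apply G0; lra.
Qed.

(** The formula for [csqrt] is continuous on the whole plane, although it inverts squaring only for
    Im z >= 0; this gives limits on the real axis and at the branch point. *)
Lemma csqrt_holder z w : Cmod (csqrt w - csqrt z) <= 2 * sqrt (Cmod (w - z)).
Proof.
  assert (F := Cmod_fst (w - z)%C). simpl in F.
  assert (M : Rabs (Cmod w - Cmod z) <= Cmod (w - z)).
  { apply Rabs_le. assert (A := Cmod_ge_minus w z). assert (B := Cmod_ge_minus z w). rewrite Cmod_minus_sym in B. lra. }
  destruct (Cmod_fst_bounds z) as [A B]. destruct (Cmod_fst_bounds w) as [A' B'].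
  eapply Rle_trans. apply Cmod_le_sum. unfold csqrt. simpl.
  assert (forall p q, Rabs p <= Cmod (w - z) -> Rabs q <= Cmod (w - z) -> sqrt (Rabs ((p + q) / 2)) <= sqrt (Cmod (w - z))).
  { intros p q Hp Hq. apply sqrt_le_1. apply Rabs_pos. apply Cmod_ge_0. unfold Rdiv. rewrite Rabs_mult, (Rabs_pos_eq (/ 2)) by lra.
    assert (T := Rabs_triang p q). lra. }
  assert (X1 := sqrt_diff_le ((Cmod w + fst w) / 2) ((Cmod z + fst z) / 2) ltac:(lra) ltac:(lra)).
  assert (X2 := sqrt_diff_le ((Cmod w - fst w) / 2) ((Cmod z - fst z) / 2) ltac:(lra) ltac:(lra)).
  assert (Y1 := H (Cmod w - Cmod z) (fst w + - fst z) M F).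
  assert (Y2 := H (Cmod w - Cmod z) (- (fst w + - fst z)) M ltac:(rewrite Rabs_Ropp; auto)).
  replace ((Cmod w - Cmod z + (fst w + - fst z)) / 2) with ((Cmod w + fst w) / 2 - (Cmod z + fst z) / 2) in Y1 by field.
  replace ((Cmod w - Cmod z + - (fst w + - fst z)) / 2) with ((Cmod w - fst w) / 2 - (Cmod z - fst z) / 2) in Y2 by field.
  unfold Rminus in *. lra.
Qed.

Lemma Ccont_csqrt z : Ccont csqrt z.
Proof.
  intros eps He. exists (eps / 2 * (eps / 2)). split. nra. intros w Hw.
  eapply Rle_lt_trans. apply csqrt_holder. assert (sqrt (Cmod (w - z)) < eps / 2); [|lra].
  rewrite <- (sqrt_square (eps / 2)) by lra. apply sqrt_lt_1; auto. apply Cmod_ge_0. nra.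
Qed.

(** Caratheodory's form of differentiability: a difference quotient that extends continuously to
    z. *)
Lemma Cderiv_quotient f g z d : 0 < d -> (forall w, Cmod (w - z) < d -> (f w - f z = g w * (w - z))%C) -> Ccont g z ->
  Cderiv f z (g z).
Proof.
  intros Hd E Hg eps He. destruct (Hg eps He) as [d' [Hd' K]]. exists (Rmin d d'). split. apply Rmin_pos; auto.
  intros w Hw. assert (R1 := Rmin_l d d'). assert (R2 := Rmin_r d d'). rewrite E by lra.
  replace (g w * (w - z) - g z * (w - z))%C with ((g w - g z) * (w - z))%C by ring. rewrite Cmod_mult.
  apply Rmult_le_compat_r. apply Cmod_ge_0. left; apply K; lra.
Qed.

Lemma csqrt_sum_neq w z : 0 < snd z -> (csqrt w + csqrt z)%C <> RtoC 0.
Proof.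
  intros H E. apply (f_equal fst) in E. simpl in E. assert (P := sqrt_pos ((Cmod w + fst w) / 2)).
  destruct (Cmod_fst_bounds z) as [A B]. assert (Q := Cmod_sq z).
  assert (0 < sqrt ((Cmod z + fst z) / 2)); [|lra]. apply sqrt_lt_R0. nra.
Qed.

Lemma Cderiv_csqrt z : 0 < snd z -> Cderiv csqrt z (/ (csqrt z + csqrt z))%C.
Proof.
  intros H. apply (Cderiv_quotient csqrt (fun w => / (csqrt w + csqrt z))%C z (snd z)); auto.
  - intros w Hw. assert (P : 0 <= snd w). { assert (Q := Cmod_snd (w - z)%C). simpl in Q. apply Rabs_le_between in Q. lra. }
    assert (N := csqrt_sum_neq w z H).
    transitivity (/ (csqrt w + csqrt z) * (csqrt w * csqrt w - csqrt z * csqrt z))%C. field. auto.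
    rewrite !csqrt_sq by lra. auto.
  - apply Ccont_inv. apply Ccont_plus. apply Ccont_csqrt. apply Ccont_const. apply csqrt_sum_neq; auto.
Qed.

Lemma holo_csqrt : holo (fun z => 0 < snd z) csqrt.
Proof.
  apply (holo_intro _ _ (fun z => / (csqrt z + csqrt z))%C). intros z H; apply Cderiv_csqrt; auto.
  intros z H. apply Ccont_inv. apply Ccont_plus; apply Ccont_csqrt. apply csqrt_sum_neq; auto.
Qed.

Lemma csqrt_pos_real u : 0 <= u -> csqrt (RtoC u) = RtoC (sqrt u).
Proof.
  intros H. unfold csqrt. rewrite Cmod_R, Rabs_pos_eq by auto. simpl. apply injective_projections; simpl.
  f_equal; lra. replace ((u - u) / 2) with 0 by field. apply sqrt_0.
Qed.

Lemma csqrt_neg_real u : 0 <= u -> csqrt (RtoC (- u)) = (0, sqrt u).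
Proof.
  intros H. unfold csqrt. rewrite Cmod_R, Rabs_Ropp, Rabs_pos_eq by auto. simpl. apply injective_projections; simpl.
  replace ((u + - u) / 2) with 0 by field. apply sqrt_0. f_equal; lra.
Qed.

(** The integral of psi(u) / sqrt(1 - u) over [a, 1] after the substitution u = 1 - v^2, which
    removes the singularity at 1. *)
Definition Jint (psi : R -> R) (a : R) : R := RInt (fun v => 2 * psi (1 - v * v)) 0 (sqrt (1 - a)).

Lemma Jint_cont (psi : R -> R) a : a < 1 -> (forall u, a <= u <= 1 -> continuous psi u) ->
  forall v, 0 <= v <= sqrt (1 - a) -> continuous (fun v => 2 * psi (1 - v * v)) v.
Proof.
  intros Ha Hp v Hv. assert (E := sqrt_def (1 - a) ltac:(lra)).
  apply (continuous_mult (K := R_AbsRing) (fun _ => 2)). apply continuous_const.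
  apply (continuous_comp (fun v => 1 - v * v) psi).
  apply (ex_derive_continuous (V := R_NormedModule)). auto_derive; auto. apply Hp. nra.
Qed.

Lemma Jint_ex (psi : R -> R) a b c : a < 1 -> (forall u, a <= u <= 1 -> continuous psi u) ->
  0 <= b <= sqrt (1 - a) -> 0 <= c <= sqrt (1 - a) -> ex_RInt (fun v => 2 * psi (1 - v * v)) b c.
Proof.
  intros Ha Hp Hb Hc. apply (ex_RInt_continuous (V := R_CompleteNormedModule)). intros v Hv. apply (Jint_cont psi a); auto.
  unfold Rmin, Rmax in Hv. destruct (Rle_dec b c); lra.
Qed.

(** On [a, b] with b < 1 the substitution is regular; what is missing from [Jint] is the integral
    over [0, sqrt(1 - b)], which is at most a constant times sqrt(1 - b). *)
Lemma Jint_improper (psi : R -> R) a : a < 1 -> (forall u, a <= u <= 1 -> continuous psi u) ->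
  is_RInt_gen (fun u => psi u / sqrt (1 - u)) (at_point a) (at_left 1) (Jint psi a).
Proof.
  intros Ha Hp. set (f := fun v => 2 * psi (1 - v * v)). set (V := sqrt (1 - a)).
  assert (PV : 0 < V) by (apply sqrt_lt_R0; lra).
  assert (Fc : forall v, 0 <= v <= V -> continuous f v) by (apply Jint_cont; auto).
  assert (Fb : exists M, 0 < M /\ forall v, 0 <= v <= V -> Rabs (f v) <= M).
  { destruct (continuity_ab_maj (fun v => Rabs (f v)) 0 V ltac:(lra)) as [v0 [H0 _]].
    - intros v Hv. apply continuity_pt_filterlim. apply (continuous_comp f Rabs). apply Fc; auto. apply continuous_Rabs.
    - exists (Rabs (f v0) + 1). assert (P := Rabs_pos (f v0)). split. lra. intros v Hv. specialize (H0 v Hv). lra. }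
  destruct Fb as [M [HM Fb]].
  assert (Main : forall b, a < b < 1 -> is_RInt (fun u => psi u / sqrt (1 - u)) a b (RInt f (sqrt (1 - b)) V)).
  { intros b Hb.
    assert (Q := is_RInt_comp f (fun u => sqrt (1 - u)) (fun u => - / (2 * sqrt (1 - u))) a b).
    assert (Sb : 0 <= sqrt (1 - b) <= V). { split. apply sqrt_pos. apply sqrt_le_1; lra. }
    replace (RInt f (sqrt (1 - b)) V) with (- RInt f (sqrt (1 - a)) (sqrt (1 - b))).
    2:{ apply (opp_RInt_swap (V := R_CompleteNormedModule)). apply (Jint_ex psi a); auto; fold V; lra. }
    assert (Eq : forall u : R, a < u < b -> - (- / (2 * sqrt (1 - u)) * f (sqrt (1 - u))) = psi u / sqrt (1 - u)).
    { intros u Hu. unfold f. rewrite sqrt_def by lra.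
      replace (1 - (1 - u)) with u by ring. assert (0 < sqrt (1 - u)) by (apply sqrt_lt_R0; lra). field. lra. }
    apply (is_RInt_ext (fun y => - (- / (2 * sqrt (1 - y)) * f (sqrt (1 - y))))).
    - intros u. rewrite Rmin_left, Rmax_right by lra. apply Eq.
    - apply (is_RInt_opp (V := R_NormedModule)). apply Q.
      + intros u. rewrite Rmin_left, Rmax_right by lra. intros Hu. apply Fc. split. apply sqrt_pos. apply sqrt_le_1; lra.
      + intros u. rewrite Rmin_left, Rmax_right by lra. intros Hu. assert (0 < sqrt (1 - u)) by (apply sqrt_lt_R0; lra). split.
        auto_derive. lra. unfold Rminus in *. field. lra.
        apply (ex_derive_continuous (V := R_NormedModule)). auto_derive. unfold Rminus in *. split; [lra|]. split; [|auto]. intros E0; lra. }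
  apply filterlimi_locally. intros eps.
  apply (Filter_prod _ _ _ (fun t => t = a) (fun b => a < b < 1 /\ sqrt (1 - b) < eps / M)).
  - reflexivity.
  - assert (Pe := cond_pos eps). assert (P0 : 0 < eps / M) by (apply Rdiv_lt_0_compat; auto).
    assert (P1 : 0 < Rmin (1 - a) (eps / M * (eps / M))) by (apply Rmin_pos; nra).
    exists (mkposreal _ P1). intros b Hb Lb. unfold ball in Hb; simpl in Hb; unfold AbsRing_ball, abs, minus, plus, opp in Hb; simpl in Hb.
    apply Rabs_lt_between in Hb. assert (R1 := Rmin_l (1 - a) (eps / M * (eps / M))). assert (R2 := Rmin_r (1 - a) (eps / M * (eps / M))).
    split. lra. rewrite <- (sqrt_square (eps / M)) by lra. apply sqrt_lt_1; lra.
  - intros t b -> [Hb Lb]. exists (RInt f (sqrt (1 - b)) V). split. apply (Main b); auto.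
    assert (Sb : 0 <= sqrt (1 - b) <= V). { split. apply sqrt_pos. apply sqrt_le_1; lra. }
    unfold Jint. fold f. fold V.
    assert (X1 : ex_RInt f 0 (sqrt (1 - b))) by (apply (Jint_ex psi a); auto; fold V; lra).
    assert (X2 : ex_RInt f (sqrt (1 - b)) V) by (apply (Jint_ex psi a); auto; fold V; lra).
    assert (Ch := RInt_Chasles (V := R_CompleteNormedModule) f 0 (sqrt (1 - b)) V X1 X2).
    change (RInt f 0 (sqrt (1 - b)) + RInt f (sqrt (1 - b)) V = RInt f 0 V) in Ch. rewrite <- Ch.
    unfold ball; simpl; unfold AbsRing_ball, abs, minus, plus, opp; simpl.
    replace (RInt f (sqrt (1 - b)) V + - (RInt f 0 (sqrt (1 - b)) + RInt f (sqrt (1 - b)) V)) with (- RInt f 0 (sqrt (1 - b))) by ring.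
    rewrite Rabs_Ropp. eapply Rle_lt_trans. apply (abs_RInt_le_const f 0 (sqrt (1 - b)) M). lra.
    auto. intros; apply Fb; lra.
    rewrite Rminus_0_r. replace (pos eps) with (eps / M * M) by (field; lra). apply Rmult_lt_compat_r; auto.
Qed.

Lemma RInt_slit (f : R -> R) a : a < 1 -> (forall u, a <= u <= 1 -> continuous f u) ->
  RInt (fun u => sqrt (1 - u) * f u) a 1 = RInt (fun v => 2 * v * v * f (1 - v * v)) 0 (sqrt (1 - a)).
Proof.
  intros Ha Hf. set (V := sqrt (1 - a)). assert (PV : 0 < V) by (apply sqrt_lt_R0; lra).
  assert (EV : V * V = 1 - a) by (apply sqrt_def; lra).
  assert (Q := RInt_comp (V := R_CompleteNormedModule) (fun u => sqrt (1 - u) * f u) (fun v => 1 - v * v) (fun v => - (2 * v)) 0 V).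
  simpl in Q. replace (1 - V * V) with a in Q by lra. replace (1 - 0 * 0) with 1 in Q by ring.
  assert (Cs : forall u, a <= u <= 1 -> continuous (fun u => sqrt (1 - u) * f u) u).
  { intros u Hu. apply (continuous_mult (K := R_AbsRing) (fun u => sqrt (1 - u)) f); auto.
    apply (continuous_comp (fun u => 1 - u) sqrt). apply (ex_derive_continuous (V := R_NormedModule)). auto_derive; auto.
    apply continuous_sqrt. }
  assert (Sw := opp_RInt_swap (V := R_CompleteNormedModule) (fun u => sqrt (1 - u) * f u) 1 a).
  rewrite <- Sw.
  2:{ apply (ex_RInt_continuous (V := R_CompleteNormedModule)). intros u. rewrite Rmin_right, Rmax_left by lra. apply Cs. }
  rewrite <- Q.
  - rewrite <- (RInt_opp (V := R_CompleteNormedModule)).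
    apply RInt_ext. intros v. rewrite Rmin_left, Rmax_right by lra. intros Hv.
    unfold scal, opp; simpl; unfold mult; simpl. replace (1 - (1 - v * v)) with (v * v) by ring. rewrite sqrt_square by lra. ring.
    apply (ex_RInt_continuous (V := R_CompleteNormedModule)). intros v. rewrite Rmin_left, Rmax_right by lra. intros Hv.
    apply (continuous_mult (K := R_AbsRing) (fun v => - (2 * v)) (fun v => sqrt (1 - (1 - v * v)) * f (1 - v * v))).
    apply (ex_derive_continuous (V := R_NormedModule)). auto_derive; auto.
    apply (continuous_comp (fun v => 1 - v * v) (fun u => sqrt (1 - u) * f u)).
    apply (ex_derive_continuous (V := R_NormedModule)). auto_derive; auto. apply Cs. nra.
  - intros v. rewrite Rmin_left, Rmax_right by lra. intros Hv. apply Cs. nra.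
  - intros v _. split. auto_derive; auto. ring. apply (ex_derive_continuous (V := R_NormedModule)). auto_derive; auto.
Qed.

Lemma CInt_unif (f : C -> C) a b y0 : a <= b -> (forall u, a <= u <= b -> Ccont f (u, y0)) -> forall eps, 0 < eps ->
  exists d, 0 < d /\ forall y u, Rabs (y - y0) <= d -> a <= u <= b -> Cmod (f (u, y) - f (u, y0)) <= eps.
Proof.
  intros L Hf eps He. assert (H2 : 0 < eps / 2) by lra.
  destruct (uniform_continuity_2d_1d (fun u v => fst (f (u, v))) a b y0 (fun u Hu => proj1 (Ccont_2d f u y0 (Hf u Hu))) (mkposreal _ H2)) as [d1 K1].
  destruct (uniform_continuity_2d_1d (fun u v => snd (f (u, v))) a b y0 (fun u Hu => proj2 (Ccont_2d f u y0 (Hf u Hu))) (mkposreal _ H2)) as [d2 K2].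
  assert (P1 := cond_pos d1). assert (P2 := cond_pos d2). simpl in K1, K2.
  exists (Rmin d1 d2). split. apply Rmin_pos; auto. intros y u Hy Hu.
  assert (R1 := Rmin_l d1 d2). assert (R2 := Rmin_r d1 d2). apply Rabs_le_between in Hy.
  assert (Z : Rabs (u - u) = 0) by (rewrite Rminus_diag; apply Rabs_R0).
  specialize (K1 u y0 u y Hu ltac:(lra) Hu ltac:(lra) ltac:(lra)). specialize (K2 u y0 u y Hu ltac:(lra) Hu ltac:(lra) ltac:(lra)).
  eapply Rle_trans. apply Cmod_le_sum. simpl. unfold Rminus in *. lra.
Qed.

Lemma small_zero X : (forall eps, 0 < eps -> Rabs X <= eps) -> X = 0.
Proof.
  intros H. destruct (Req_dec X 0) as [|N]; auto. assert (P := Rabs_pos_lt X N). specialize (H (Rabs X / 2) ltac:(lra)). lra.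
Qed.

Lemma CInt_initial (f : R -> C) T : 0 < T -> (forall t, 0 <= t <= T -> pcont f t) -> forall eps, 0 < eps ->
  exists d, 0 < d < T /\ forall y, 0 < y <= d -> Cmod (CInt f 0 T - CInt f y T) <= eps.
Proof.
  intros HT Hf eps He. destruct (pcont_eps f 0 (Hf 0 ltac:(lra)) 1 ltac:(lra)) as [d [Hd K]].
  set (M := Cmod (f 0) + 1). assert (PM : 0 < M) by (assert (Q := Cmod_ge_0 (f 0)); unfold M; lra).
  assert (P0 : 0 < eps / (2 * M)) by (apply Rdiv_lt_0_compat; lra).
  exists (Rmin (Rmin (d / 2) (T / 2)) (eps / (2 * M))).
  assert (R1 := Rmin_l (Rmin (d / 2) (T / 2)) (eps / (2 * M))). assert (R2 := Rmin_r (Rmin (d / 2) (T / 2)) (eps / (2 * M))).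
  assert (R3 := Rmin_l (d / 2) (T / 2)). assert (R4 := Rmin_r (d / 2) (T / 2)).
  split. split. repeat apply Rmin_pos; lra. lra.
  intros y Hy. rewrite <- (CInt_Chasles f 0 y T).
  2:{ intros t. rewrite (Rmin_left y T), (Rmax_right y T), Rmin_left, Rmax_right by lra. auto. }
  replace (CInt f 0 y + CInt f y T - CInt f y T)%C with (CInt f 0 y) by ring.
  eapply Rle_trans. apply (CInt_bound f 0 y M). lra. intros; apply Hf; lra.
  intros t Ht. specialize (K t ltac:(rewrite Rminus_0_r, Rabs_pos_eq; lra)).
  replace (f t) with ((f t - f 0%R) + f 0%R)%C by ring. eapply Rle_trans. apply Cmod_triangle. unfold M; lra.
  replace eps with (2 * M * (eps / (2 * M))) by (field; lra). apply Rmult_le_compat_l; lra.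
Qed.

Lemma pcont_Ccont_h f u y : Ccont f (u, y) -> pcont (fun u => f (u, y)) u.
Proof. intros H. apply (pcont_comp f (fun u => (u, y))); auto. apply pcont_h. Qed.
Lemma pcont_Ccont_v f x v : Ccont f (x, v) -> pcont (fun v => f (x, v)) v.
Proof. intros H. apply (pcont_comp f (fun v => (x, v))); auto. apply pcont_v. Qed.

Lemma CInt_ftc_h (F f : C -> C) a b y : a <= b -> (forall u, a <= u <= b -> Cderiv F (u, y) (f (u, y))) ->
  (forall u, a <= u <= b -> Ccont f (u, y)) -> CInt (fun u => f (u, y)) a b = (F (b, y) - F (a, y))%C.
Proof.
  intros L H1 H2. unfold CInt. apply injective_projections; simpl; apply is_RInt_unique.
  - apply (is_RInt_derive (fun u => fst (F (u, y))) (fun u => fst (f (u, y)))); intros u; rewrite Rmin_left, Rmax_right by lra; intros Hu.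
    apply (Cderiv_h F u y _ (H1 u Hu)). apply (Ccont_h f u y (H2 u Hu)).
  - apply (is_RInt_derive (fun u => snd (F (u, y))) (fun u => snd (f (u, y)))); intros u; rewrite Rmin_left, Rmax_right by lra; intros Hu.
    apply (Cderiv_h F u y _ (H1 u Hu)). apply (Ccont_h f u y (H2 u Hu)).
Qed.

(* Cauchy's theorem on [a,c] x [0,T] for Psi(s)/sqrt(s-1), whose branch point 1 lies on the lower side.  Writing
   Psi(s) = Psi(1) + (s-1) Psi2(s) separates an explicitly integrable singularity from a function continuous up to the boundary. *)
Lemma slit_contour Psi a c T d : 0 < d -> a < 1 < c -> 0 < T ->
  holo (rect (a - d) (c + d) (- d) (T + d)) Psi -> (forall u, a - d < u < c + d -> snd (Psi (u, 0)) = 0) ->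
  fst (CInt (fun t => Psi (c, t) / csqrt ((c, t) - 1))%C 0 T) =
  fst (CInt (fun t => Psi (a, t) / csqrt ((a, t) - 1))%C 0 T) + snd (CInt (fun u => Psi (u, T) / csqrt ((u, T) - 1))%C a c)
  + Jint (fun u => fst (Psi (u, 0))) a.
Proof.
  intros Hd Hac HT HP Hreal. set (D := rect (a - d) (c + d) (- d) (T + d)) in *.
  set (q := fun s : C => csqrt (s - 1)). set (Phi := fun s => (Psi s / q s)%C).
  change (fst (CInt (fun t => Phi (c, t)) 0 T) = fst (CInt (fun t => Phi (a, t)) 0 T) + snd (CInt (fun u => Phi (u, T)) a c) + Jint (fun u => fst (Psi (u, 0))) a).
  assert (OD : Copen D) by apply rect_open.
  assert (D1 : D (RtoC 1)) by (unfold D; split; simpl; lra).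
  destruct (holo_divide D (fun s => Psi s - Psi (RtoC 1))%C (RtoC 1) OD) as [P2 [HP2 E2]]; auto.
  { apply holo_minus; auto. apply holo_const. } { ring. }
  assert (Cq : forall s, Ccont q s).
  { intros s. unfold q. apply (Ccont_comp csqrt (fun s => s - 1)%C). apply Ccont_plus. apply Ccont_id. apply Ccont_const. apply Ccont_csqrt. }
  assert (qn : forall s, 0 <= snd s -> s <> RtoC 1 -> q s <> RtoC 0).
  { intros s S1 S2. unfold q. apply csqrt_neq_0. simpl; lra. apply Cminus_neq_0; auto. }
  assert (qsq : forall s, 0 <= snd s -> (q s * q s)%C = (s - 1)%C).
  { intros s S1. unfold q. apply csqrt_sq. simpl; lra. }
  assert (CPhi : forall s, D s -> 0 <= snd s -> s <> RtoC 1 -> Ccont Phi s).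
  { intros s S0 S1 S2. unfold Phi, Cdiv. apply Ccont_mult. apply (holo_cont D); auto. apply Ccont_inv; auto. }
  set (f := fun s => (q s * P2 s)%C).
  assert (Cf : forall s, D s -> Ccont f s).
  { intros s S0. unfold f. apply Ccont_mult; auto. apply (holo_cont D); auto. }
  assert (Nx : forall x t, x <> 1 -> (x, t) <> RtoC 1) by (intros x t Hx E; apply (f_equal fst) in E; simpl in E; lra).
  assert (Ny : forall x t, t <> 0 -> (x, t) <> RtoC 1) by (intros x t Hx E; apply (f_equal snd) in E; simpl in E; lra).
  assert (Side : forall x, (x = a \/ x = c) -> forall t, 0 <= t <= T -> pcont (fun t => Phi (x, t)) t).
  { intros x Hx t Ht. apply pcont_Ccont_v. apply CPhi. unfold D; split; simpl; lra. simpl; lra. apply Nx; lra. }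
  (* The limit as y -> 0 of the integral over the lower side at height y; the first term integrates
     Psi(1) / q exactly, 2 q being a primitive of 1 / q. *)
  set (L0 := (RtoC 2 * Psi (RtoC 1) * (q (c, 0) - q (a, 0)) + CInt (fun u => f (u, 0)) a c)%C).
  assert (Main : fst (CInt (fun t => Phi (c, t)) 0 T) - fst (CInt (fun t => Phi (a, t)) 0 T) - snd (CInt (fun u => Phi (u, T)) a c) + snd L0 = 0).
  { apply small_zero. intros eps He.
    destruct (CInt_initial (fun t => Phi (c, t)) T HT (Side c ltac:(auto)) (eps / 4) ltac:(lra)) as [d1 [Hd1 K1]].
    destruct (CInt_initial (fun t => Phi (a, t)) T HT (Side a ltac:(auto)) (eps / 4) ltac:(lra)) as [d2 [Hd2 K2]].
    destruct (CInt_unif f a c 0 ltac:(lra)) with (eps := eps / (8 * (c - a))) as [d3 [Hd3 K3]].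
    { intros u Hu. apply Cf. unfold D; split; simpl; lra. } { apply Rdiv_lt_0_compat; lra. }
    set (Bc := Cmod (RtoC 2 * Psi (RtoC 1))). assert (PB := Cmod_ge_0 (RtoC 2 * Psi (RtoC 1)) : 0 <= Bc).
    assert (P0 : 0 < eps / (8 * (Bc + 1))) by (apply Rdiv_lt_0_compat; lra).
    destruct (Cq (c, 0) _ P0) as [d4 [Hd4 K4]]. destruct (Cq (a, 0) _ P0) as [d5 [Hd5 K5]].
    set (y := Rmin (Rmin (Rmin d1 d2) (Rmin (d3 / 2) (d / 2))) (Rmin (d4 / 2) (d5 / 2))).
    assert (Hy : 0 < y /\ y <= d1 /\ y <= d2 /\ y < d3 /\ y < d4 /\ y < d5 /\ y < d).
    { unfold y. assert (X : forall p r, Rmin p r <= p /\ Rmin p r <= r) by (intros; split; [apply Rmin_l|apply Rmin_r]).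
      assert (X1 := X (Rmin (Rmin d1 d2) (Rmin (d3 / 2) (d / 2))) (Rmin (d4 / 2) (d5 / 2))).
      assert (X2 := X (Rmin d1 d2) (Rmin (d3 / 2) (d / 2))). assert (X3 := X d1 d2). assert (X4 := X (d3 / 2) (d / 2)). assert (X5 := X (d4 / 2) (d5 / 2)).
      split. repeat apply Rmin_pos; lra. lra. }
    clearbody y. destruct Hy as [y0 [y1 [y2 [y3 [y4 [y5 y6]]]]]].
    assert (HPhi : holo (rect (a - y / 2) (c + y / 2) (y - y / 2) (T + y / 2)) Phi).
    { unfold Phi. apply holo_div.
      - apply (holo_sub _ D); auto. intros s [S1 S2]. unfold D; split; lra.
      - unfold q. apply (holo_comp _ (fun z => 0 < snd z) csqrt (fun s => s - 1)%C).
        apply holo_minus. apply holo_id. apply holo_const. intros s [S1 S2]. simpl. lra. apply holo_csqrt.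
      - intros s [S1 S2]. apply qn. lra. intros ->. simpl in S2. lra. }
    assert (RC := rect_cauchy Phi a c y T (y / 2) ltac:(lra) ltac:(lra) ltac:(lra) HPhi).
    (* With q^2 = s - 1 the decomposition of Psi reads Psi / q = Psi(1) / q + q P2, and 1 / q is
       written as 2 / (q + q) to match the derivative of [csqrt]. *)
    assert (Bot : CInt (fun u => Phi (u, y)) a c = (RtoC 2 * Psi (RtoC 1) * (q (c, y) - q (a, y)) + CInt (fun u => f (u, y)) a c)%C).
    { rewrite (CInt_ext _ (fun u => RtoC 2 * Psi (RtoC 1) * / (q (u, y) + q (u, y)) + f (u, y))%C).
      2:{ intros u. rewrite Rmin_left, Rmax_right by lra. intros Hu. unfold Phi, f.
          assert (Qn := qn (u, y) ltac:(simpl; lra) (Ny u y ltac:(lra))).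
          assert (Qs := qsq (u, y) ltac:(simpl; lra)).
          assert (Du : D (u, y)) by (unfold D; split; simpl; lra). assert (E := E2 _ Du).
          replace (Psi (u, y)) with (Psi (RtoC 1) + (Psi (u, y) - Psi (RtoC 1)))%C by ring. rewrite E, <- Qs.
          field. split; auto. replace (q (u, y) + q (u, y))%C with (RtoC 2 * q (u, y))%C by ring.
          apply Cmult_neq_0; auto. intros E0; apply (f_equal fst) in E0; simpl in E0; lra. }
      assert (Sn : forall s, 0 < snd s -> (q s + q s)%C <> RtoC 0) by (intros; unfold q; apply csqrt_sum_neq; simpl; lra).
      assert (Ci : forall u, Ccont (fun s => / (q s + q s))%C (u, y)).
      { intros u. apply Ccont_inv. apply Ccont_plus; auto. apply Sn. simpl; auto. }
      rewrite CInt_plus. f_equal.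
      2:{ intros u _. apply pcont_mult. apply pcont_const. apply (pcont_Ccont_h (fun s => / (q s + q s))%C). auto. }
      2:{ intros u. rewrite Rmin_left, Rmax_right by lra. intros Hu. apply pcont_Ccont_h, Cf. unfold D; split; simpl; lra. }
      rewrite CInt_scal by (intros u _; apply (pcont_Ccont_h (fun s => / (q s + q s))%C); auto).
      f_equal. apply (CInt_ftc_h q (fun s => / (q s + q s))%C). lra. 2: auto.
      intros u Hu. unfold q. apply (Cderiv_eq _ _ (/ (csqrt ((u, y) - 1) + csqrt ((u, y) - 1)) * 1)%C); [|ring].
      apply (Cderiv_comp csqrt (fun s => s - 1)%C).
      apply (Cderiv_eq _ _ (1 + 0)%C); [|ring]. apply (Cderiv_plus (fun s => s) (fun _ => (- (1))%C)). apply Cderiv_id. apply Cderiv_const.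
      apply Cderiv_csqrt. simpl; lra. }
    rewrite Bot in RC.
    set (C0 := CInt (fun t => Phi (c, t)) 0 T) in *. set (A0 := CInt (fun t => Phi (a, t)) 0 T) in *. set (Tp := CInt (fun u => Phi (u, T)) a c) in *.
    specialize (K1 y ltac:(lra)). specialize (K2 y ltac:(lra)).
    set (C1 := CInt (fun v => Phi (c, v)) y T) in *. set (A1 := CInt (fun v => Phi (a, v)) y T) in *.
    set (L1 := (RtoC 2 * Psi (RtoC 1) * (q (c, y) - q (a, y)) + CInt (fun u => f (u, y)) a c)%C) in *.
    assert (KL : Cmod (L0 - L1) <= eps / 2).
    { unfold L0, L1. assert (Em1 : RtoC (-1) = (- RtoC 1)%C) by (apply injective_projections; simpl; ring).
      assert (I1 : Cmod (CInt (fun u => f (u, 0)) a c - CInt (fun u => f (u, y)) a c) <= eps / 4).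
      { replace (CInt (fun u => f (u, 0)) a c - CInt (fun u => f (u, y)) a c)%C with (CInt (fun u => f (u, 0) + (RtoC (-1)) * f (u, y))%C a c).
        - eapply Rle_trans. apply (CInt_bound _ a c (eps / (8 * (c - a)))). lra.
          + intros u Hu. apply pcont_plus; [|apply pcont_mult; [apply pcont_const|]]; apply pcont_Ccont_h, Cf; unfold D; split; simpl; lra.
          + intros u Hu. replace (f (u, 0) + RtoC (-1) * f (u, y))%C with (f (u, 0) - f (u, y))%C by (rewrite Em1; ring).
            rewrite Cmod_minus_sym. apply K3; auto. rewrite Rminus_0_r, Rabs_pos_eq; lra.
          + right. field. lra.
        - assert (Y : forall v, -d < v < T + d -> forall t, Rmin a c <= t <= Rmax a c -> pcont (fun u => f (u, v)) t).
          { intros v Hv t. rewrite Rmin_left, Rmax_right by lra. intros Ht. apply pcont_Ccont_h, Cf. unfold D; split; simpl; lra. }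
          rewrite CInt_plus, CInt_scal. rewrite Em1; ring. apply Y; lra. apply Y; lra.
          intros t Ht. apply pcont_mult. apply pcont_const. apply (Y y); auto; lra. }
      assert (N4 : Cmod ((c, y) - (c, 0)) < d4). { replace ((c, y) - (c, 0))%C with ((0, y) : C) by (apply injective_projections; simpl; ring). eapply Rle_lt_trans. apply Cmod_le_sum. simpl. rewrite Rabs_R0, Rabs_pos_eq; lra. }
      assert (N5 : Cmod ((a, y) - (a, 0)) < d5). { replace ((a, y) - (a, 0))%C with ((0, y) : C) by (apply injective_projections; simpl; ring). eapply Rle_lt_trans. apply Cmod_le_sum. simpl. rewrite Rabs_R0, Rabs_pos_eq; lra. }
      specialize (K4 _ N4). specialize (K5 _ N5).
      set (i0 := CInt (fun u => f (u, 0)) a c) in *. set (i1 := CInt (fun u => f (u, y)) a c) in *.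
      replace (2 * Psi (RtoC 1) * (q (c, 0) - q (a, 0)) + i0 - (2 * Psi (RtoC 1) * (q (c, y) - q (a, y)) + i1))%C with
        ((i0 - i1) + (2 * Psi (RtoC 1)) * ((q (a, y) - q (a, 0)) - (q (c, y) - q (c, 0))))%C by ring.
      eapply Rle_trans. apply Cmod_triangle. rewrite Cmod_mult. fold Bc.
      assert (Bc * Cmod (q (a, y) - q (a, 0) - (q (c, y) - q (c, 0))) <= Bc * (2 * (eps / (8 * (Bc + 1))))).
      { apply Rmult_le_compat_l; auto. eapply Rle_trans. apply Cmod_minus_le. lra. }
      assert (Bc * (2 * (eps / (8 * (Bc + 1)))) <= eps / 4).
      { apply Rle_trans with ((Bc + 1) * (2 * (eps / (8 * (Bc + 1))))). apply Rmult_le_compat_r; lra. right; field; lra. }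
      lra. }
    clearbody L0 L1 C0 A0 C1 A1 Tp. apply (f_equal fst) in RC. simpl in RC.
    assert (Q1 := Rle_trans _ _ _ (Cmod_fst _) K1). assert (Q2 := Rle_trans _ _ _ (Cmod_fst _) K2). assert (Q3 := Rle_trans _ _ _ (Cmod_snd _) KL).
    simpl in Q1, Q2, Q3. apply Rabs_le_between in Q1, Q2, Q3. apply Rabs_le. lra. }
  (* On [1, c] everything is real and drops out of the imaginary part. On [a, 1] q = i sqrt(1 - u),
     and u = 1 - v^2 brings both integrals to the variable v, where Psi(1) and P2 recombine into
     Psi. *)
  assert (J : snd L0 = - Jint (fun u => fst (Psi (u, 0))) a).
  { set (V := sqrt (1 - a)). assert (PV : 0 < V) by (apply sqrt_lt_R0; lra). assert (EV : V * V = 1 - a) by (apply sqrt_def; lra).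
    assert (Qc : forall u, 1 <= u -> q (u, 0) = RtoC (sqrt (u - 1))).
    { intros u Hu. unfold q. replace ((u, 0) - 1)%C with (RtoC (u - 1)) by (apply injective_projections; simpl; ring). apply csqrt_pos_real. lra. }
    assert (Qa : forall u, u <= 1 -> q (u, 0) = (0, sqrt (1 - u))).
    { intros u Hu. unfold q. replace ((u, 0) - 1)%C with (RtoC (- (1 - u))) by (apply injective_projections; simpl; ring). apply csqrt_neg_real. lra. }
    assert (R1 : snd (Psi (RtoC 1)) = 0) by (apply Hreal; lra).
    assert (E20 : forall u, a - d < u < c + d -> fst (Psi (u, 0)) - fst (Psi (RtoC 1)) = (u - 1) * fst (P2 (u, 0)) /\ (u <> 1 -> snd (P2 (u, 0)) = 0)).
    { intros u Hu. assert (Du : D (u, 0)) by (unfold D; split; simpl; lra). assert (E := E2 _ Du). split.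
      - apply (f_equal fst) in E. simpl in E. simpl. lra.
      - intros N. apply (f_equal snd) in E. simpl in E. rewrite (Hreal u Hu) in E. simpl in R1. rewrite R1 in E.
        apply Rmult_eq_reg_l with (u - 1); lra. }
    assert (Pf : forall u, a <= u <= c -> pcont (fun u => f (u, 0)) u).
    { intros u Hu. apply pcont_Ccont_h, Cf. unfold D; split; simpl; lra. }
    assert (S1 : snd (CInt (fun u => f (u, 0)) 1 c) = 0).
    { change (RInt (fun u => snd (f (u, 0))) 1 c = 0). rewrite (RInt_ext _ (fun _ => 0)). rewrite RInt_const. unfold scal; simpl; unfold mult; simpl; ring.
      intros u. rewrite Rmin_left, Rmax_right by lra. intros Hu. unfold f. rewrite Qc by lra. destruct (E20 u ltac:(lra)) as [_ Z]. simpl. rewrite Z by lra. ring. }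
    assert (S2 : snd (CInt (fun u => f (u, 0)) a 1) = RInt (fun u => sqrt (1 - u) * fst (P2 (u, 0))) a 1).
    { change (RInt (fun u => snd (f (u, 0))) a 1 = RInt (fun u => sqrt (1 - u) * fst (P2 (u, 0))) a 1). apply RInt_ext. intros u. rewrite Rmin_left, Rmax_right by lra. intros Hu. unfold f. rewrite Qa by lra. simpl. ring. }
    assert (CP2 : forall u, a <= u <= 1 -> continuous (fun u => fst (P2 (u, 0))) u).
    { intros u Hu. apply (Ccont_h P2). apply (holo_cont D); auto. unfold D; split; simpl; lra. }
    rewrite RInt_slit in S2 by (auto; lra). fold V in S2.
    assert (Jv : Jint (fun u => fst (Psi (u, 0))) a = 2 * fst (Psi (RtoC 1)) * V - RInt (fun v => 2 * v * v * fst (P2 (1 - v * v, 0))) 0 V).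
    { unfold Jint. fold V.
      assert (X : ex_RInt (fun v => 2 * v * v * fst (P2 (1 - v * v, 0))) 0 V).
      { apply (ex_RInt_continuous (V := R_CompleteNormedModule)). intros v. rewrite Rmin_left, Rmax_right by lra. intros Hv.
        apply (continuous_mult (K := R_AbsRing) (fun v => 2 * v * v) (fun v => fst (P2 (1 - v * v, 0)))).
        apply (ex_derive_continuous (V := R_NormedModule)). auto_derive; auto.
        apply (continuous_comp (fun v => 1 - v * v) (fun u => fst (P2 (u, 0)))).
        apply (ex_derive_continuous (V := R_NormedModule)). auto_derive; auto. apply CP2. nra. }
      rewrite (RInt_ext _ (fun v => minus (2 * fst (Psi (RtoC 1))) (2 * v * v * fst (P2 (1 - v * v, 0))))).
      - rewrite (RInt_minus (V := R_CompleteNormedModule)); auto. rewrite RInt_const. unfold minus, plus, opp, scal; simpl; unfold mult; simpl. ring.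
        apply ex_RInt_const.
      - intros v. rewrite Rmin_left, Rmax_right by lra. intros Hv. destruct (E20 (1 - v * v)) as [E _]. nra.
        unfold minus, plus, opp; simpl. simpl in E. nra. }
    unfold L0. rewrite <- (CInt_Chasles (fun u => f (u, 0)) a 1 c).
    2:{ intros u. rewrite (Rmin_left 1 c), (Rmax_right 1 c), Rmin_left, Rmax_right by lra. auto. }
    rewrite Qc, Qa by lra. fold V.
    set (i1 := CInt (fun u => f (u, 0)) a 1) in *. set (i2 := CInt (fun u => f (u, 0)) 1 c) in *. clearbody i1 i2.
    simpl. simpl in R1, Jv. rewrite R1, Jv, S1, S2. ring. }
  lra.
Qed.

(** * The function G *)

Lemma Dser_real a u : (forall n, 0 <= a n) -> bounded1 a -> 1 < u ->
  0 <= fst (Dser a (RtoC u)) /\ snd (Dser a (RtoC u)) = 0.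
Proof.
  intros Ha Hb Hu. assert (Cv := Dser_conv a (RtoC u) Hb Hu). apply Cconv_series in Cv. destruct Cv as [C1 C2].
  assert (E : forall k, (RtoC (a (S k)) * cpow_neg (S k) (RtoC u))%C = RtoC (a (S k) * Rpower (INR (S k)) (- u))).
  { intros k. rewrite cpow_real, <- RtoC_mult. auto. }
  split.
  - rewrite <- (is_series_unique _ _ C1).
    assert (N : forall k, 0 <= fst (RtoC (a (S k)) * cpow_neg (S k) (RtoC u))%C).
    { intros k. rewrite E. simpl fst. apply Rmult_le_pos; auto. left; apply Rpower_pos. }
    apply Rle_trans with (rsum (fun k => fst (RtoC (a (S k)) * cpow_neg (S k) (RtoC u))%C) 0). simpl; lra.
    apply rsum_le_Series; auto. eexists; exact C1.
  - rewrite <- (is_series_unique _ _ C2). rewrite (Series_ext _ (fun _ => 0 * 0)). rewrite Series_scal_l. ring.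
    intros k. rewrite E. simpl. ring.
Qed.

Lemma two_neg_half : Rpower 2 (- (1/2)) <= 3/4.
Proof.
  rewrite Rpower_Ropp. replace (1/2) with (/ 2) by field. rewrite Rpower_sqrt by lra.
  assert (4/3 <= sqrt 2). { rewrite <- (sqrt_square (4/3)) by lra. apply sqrt_le_1; lra. }
  replace (3/4) with (/ (4/3)) by field. apply Rinv_le_contravar; lra.
Qed.

Lemma Cmod_one_minus_two s : 1/2 <= fst s -> 1/4 <= Cmod (1 - cpow_neg 2 s).
Proof.
  intros Hs. eapply Rle_trans; [|apply Cmod_ge_minus]. rewrite Cmod_1, Cmod_cpow.
  assert (Q := two_neg_half). assert (Rpower (INR 2) (- fst s) <= Rpower 2 (- (1/2))).
  { replace (INR 2) with 2 by (simpl; ring). apply Rpower_le1; lra. } lra.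
Qed.

Lemma one_minus_two_neq s : 1/2 <= fst s -> (1 - cpow_neg 2 s)%C <> RtoC 0.
Proof. intros Hs E. assert (Q := Cmod_one_minus_two s Hs). rewrite E, Cmod_0 in Q. lra. Qed.

(* The square of G, continued to the half-plane Re s > 1/2. *)
Definition W2 (s : C) : C := (W s * H3 s / (1 - cpow_neg 2 s))%C.

Lemma holo_W2 : holo (fun s => 1/2 < fst s) W2.
Proof.
  unfold W2. apply holo_div. apply holo_mult. apply (holo_sub _ (fun s => 0 < fst s)). intros; lra. apply holo_W. apply holo_H3.
  apply holo_minus. apply holo_const. apply holo_cpow. intros s Hs. apply one_minus_two_neq. lra.
Qed.

Lemma W2_neq s : 1/2 < fst s -> W s <> RtoC 0 -> W2 s <> RtoC 0.
Proof.
  intros Hs Hw. unfold W2, Cdiv. apply Cmult_neq_0. apply Cmult_neq_0; auto. exact (H3_neq_0 s Hs).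
  assert (N := one_minus_two_neq s ltac:(lra)). intros E. apply C1_nz.
  rewrite <- (Cinv_r _ N), E. apply Cmult_0_r.
Qed.

Lemma W2_bound s : 1/2 < fst s -> Cmod (W2 s) <= 4 * (1 + / (2 * fst s - 1)) * Cmod (W s).
Proof.
  intros Hs. unfold W2. rewrite Cmod_div by (apply one_minus_two_neq; lra). rewrite Cmod_mult.
  assert (A := H3_bound s Hs). assert (B := Cmod_one_minus_two s ltac:(lra)).
  assert (I : / Cmod (1 - cpow_neg 2 s) <= 4). { replace 4 with (/ (1/4)) by field. apply Rinv_le_contravar; lra. }
  assert (P1 := Cmod_ge_0 (W s)). assert (P2 := Cmod_ge_0 (H3 s)).
  assert (P3 : 0 < / Cmod (1 - cpow_neg 2 s)) by (apply Rinv_0_lt_compat; lra).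
  replace (4 * (1 + / (2 * fst s - 1)) * Cmod (W s)) with (Cmod (W s) * (1 + / (2 * fst s - 1)) * 4) by ring.
  unfold Rdiv. apply Rmult_le_compat; try lra. apply Rmult_le_pos; auto. apply Rmult_le_compat_l; auto.
Qed.

Lemma W2_FD s : 1 < fst s -> W2 s = (FD s * FD s * (s - 1))%C.
Proof.
  intros Hs. assert (E := FD_square s Hs). assert (N := one_minus_two_neq s ltac:(lra)).
  unfold W2. rewrite (W_Z s Hs).
  transitivity ((s - 1) * (zetaD s * LD s * H3 s) / (1 - cpow_neg 2 s))%C. unfold Cdiv; ring.
  rewrite <- E. field. auto.
Qed.

(** The paired eta series is positive on the real axis, and (1 - 2^(1-u)) / (u - 1) is positive on
    both sides of 1, so (u - 1) zeta(u) is positive too. *)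
Lemma Z1_pos u : 0 < u -> 0 < fst (Z1 (RtoC u)) /\ snd (Z1 (RtoC u)) = 0.
Proof.
  intros Hu. destruct (Req_dec u 1) as [->|N1]. rewrite Z1_1. simpl. lra.
  assert (Nc : RtoC u <> RtoC 1) by (intros E; apply (f_equal fst) in E; simpl in E; lra).
  assert (Cv := eta_Z1 (RtoC u) Hu Nc). change (Cconv (fun k => etaterm k (RtoC u)) ((1 - 2 * cpow_neg 2 (RtoC u)) * Z1 (RtoC u) / (RtoC u - 1))%C) in Cv.
  assert (SP := fun A B => Cseries_real_pos _ (fun k => Rpower (INR (2 * k + 1)) (- u) - Rpower (INR (2 * k + 2)) (- u)) _ A B Cv).
  destruct SP as [P0 P1].
  - intros k. unfold etaterm. rewrite !cpow_real, <- RtoC_minus. auto.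
  - intros k. assert (0 < INR (2 * k + 1)) by (apply lt_0_INR; lia). assert (INR (2 * k + 1) < INR (2 * k + 2)) by (apply lt_INR; lia).
    assert (ln (INR (2 * k + 1)) < ln (INR (2 * k + 2))) by (apply ln_increasing; auto).
    unfold Rpower. assert (exp (- u * ln (INR (2 * k + 2))) < exp (- u * ln (INR (2 * k + 1)))) by (apply exp_increasing; nra). lra.
  - set (k := (1 - 2 * Rpower 2 (- u)) / (u - 1)).
    assert (E : ((1 - 2 * cpow_neg 2 (RtoC u)) * Z1 (RtoC u) / (RtoC u - 1))%C = (RtoC k * Z1 (RtoC u))%C).
    { unfold k. rewrite cpow_real. replace (INR 2) with 2 by (simpl; ring).
      rewrite RtoC_div, !RtoC_minus, RtoC_mult by lra. unfold Cdiv. ring. }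
    rewrite E in P0, P1. simpl in P0, P1.
    assert (Pk : 0 < k).
    { unfold k. assert (E2 : 2 * Rpower 2 (- u) = Rpower 2 (1 - u)).
      { unfold Rminus. rewrite Rpower_plus, Rpower_1 by lra. auto. }
      rewrite E2. destruct (Rlt_dec u 1).
      - assert (1 < Rpower 2 (1 - u)). { rewrite <- (Rpower_O 2) at 1 by lra. apply Rpower_lt; lra. }
        replace ((1 - Rpower 2 (1 - u)) / (u - 1)) with ((Rpower 2 (1 - u) - 1) / (1 - u)) by (field; lra). apply Rdiv_lt_0_compat; lra.
      - assert (Rpower 2 (1 - u) < 1). { apply Rlt_le_trans with (Rpower 2 0). apply Rpower_lt; lra. rewrite Rpower_O; lra. }
        apply Rdiv_lt_0_compat; lra. }
    split. apply Rmult_lt_reg_l with k; simpl in *; lra. apply Rmult_eq_reg_l with k; simpl in *; lra.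
Qed.

Lemma H3_pos u : 1/2 < u -> 0 < fst (H3 (RtoC u)) /\ snd (H3 (RtoC u)) = 0.
Proof.
  intros Hu. assert (N := H3_neq_0 (RtoC u) Hu). unfold H3 in *. rewrite <- RtoC_mult in *.
  destruct (Dser_real g3 (2 * u)) as [A B].
  intros n; unfold g3; destruct excluded_middle_informative; lra.
  intros n; unfold g3; destruct excluded_middle_informative; rewrite ?Rabs_R0, ?Rabs_R1; lra. lra.
  split; auto. destruct A as [A|A]; auto. exfalso. apply N. apply injective_projections; simpl; auto.
Qed.

Lemma real_C z : snd z = 0 -> z = RtoC (fst z).
Proof. intros H. apply injective_projections; auto. Qed.

Definition den2 (u : R) : R := 1 - Rpower 2 (- u).

Lemma W2_real u : 1/2 < u ->
  W2 (RtoC u) = RtoC (fst (Z1 (RtoC u)) * fst (Lc (RtoC u)) * fst (H3 (RtoC u)) / den2 u) /\ 0 < den2 u.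
Proof.
  intros Hu. destruct (Z1_pos u ltac:(lra)) as [_ A]. destruct (Lc_pos u ltac:(lra)) as [_ B]. destruct (H3_pos u Hu) as [_ D].
  assert (P : 0 < den2 u).
  { unfold den2. assert (Q := two_neg_half). assert (Rpower 2 (- u) <= Rpower 2 (- (1/2))) by (apply Rpower_le1; lra). lra. }
  split; auto. unfold W2, W. rewrite (real_C _ A), (real_C _ B), (real_C _ D) at 1. rewrite cpow_real.
  replace (INR 2) with 2 by (simpl; ring). rewrite <- !RtoC_mult, <- RtoC_minus, <- RtoC_div. auto. unfold den2 in P. lra.
Qed.

Lemma W2_pos u : 1/2 < u -> 0 < fst (W2 (RtoC u)) /\ snd (W2 (RtoC u)) = 0.
Proof.
  intros Hu. destruct (W2_real u Hu) as [E P]. rewrite E. simpl. split; auto.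
  destruct (Z1_pos u ltac:(lra)) as [A _]. destruct (Lc_pos u ltac:(lra)) as [B _]. destruct (H3_pos u Hu) as [D _].
  apply Rdiv_lt_0_compat; auto. repeat apply Rmult_lt_0_compat; auto.
Qed.

(** Factor by factor the partial products are inverse square roots of the finite products attached
    to [g3] at 2 u, which tend to 1 / H3(u). *)
Lemma prod3_inf_eq u : 1/2 < u -> prod3_inf u = sqrt (fst (H3 (RtoC u))).
Proof.
  intros Hu. set (e := fun N => eprod (fun p => 1 - RtoC (w3 p) * cpow_neg p (RtoC (2 * u)))%C N).
  assert (Ek : forall k, prime (Z.of_nat k) -> (k mod 4 = 3)%nat -> 0 < 1 - Rpower (INR k) (- 2 * u)).
  { intros k Pk _. destruct Pk as [L _]. assert (1 < INR k) by (change 1 with (INR 1); apply lt_INR; lia).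
    assert (Rpower (INR k) (- 2 * u) < 1); [|lra]. apply Rlt_le_trans with (Rpower (INR k) 0). apply Rpower_lt; lra. rewrite Rpower_O; lra. }
  assert (Inv : forall N, snd (e N) = 0 /\ 0 < fst (e N) /\ prod3 u N = / sqrt (fst (e N))).
  { induction N as [|N [I1 [I2 I3]]].
    - unfold e; simpl. rewrite sqrt_1, Rinv_1. lra.
    - unfold e in *. cbn [eprod prod3]. set (E := eprod _ N) in *. destruct (prime_dec (Z.of_nat N)) as [Pr|].
      2:{ rewrite Cmult_1_r, Rmult_1_r. auto. }
      unfold w3. destruct (Nat.eqb_spec (N mod 4) 3) as [M|M].
      + specialize (Ek N Pr M). rewrite cpow_real. replace (- (2 * u)) with (- 2 * u) by ring.
        assert (X : (E * (1 - RtoC 1 * RtoC (Rpower (INR N) (- 2 * u))))%C = RtoC (fst E * (1 - Rpower (INR N) (- 2 * u)))).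
        { rewrite (real_C E I1) at 1. rewrite <- RtoC_mult, <- RtoC_minus, <- RtoC_mult. f_equal. ring. }
        rewrite X. simpl fst. split; auto. split. apply Rmult_lt_0_compat; auto.
        rewrite I3, sqrt_mult by lra. assert (P1 := sqrt_lt_R0 _ I2). assert (P2 := sqrt_lt_R0 _ Ek). field. lra.
      + replace (E * (1 - RtoC 0 * cpow_neg N (RtoC (2 * u))))%C with E by ring. rewrite Rmult_1_r. auto. }
  destruct (H3_pos u Hu) as [Hp Hs]. set (H := fst (H3 (RtoC u))) in *.
  assert (Lim : is_lim_seq (fun N => fst (e N)) (/ H)).
  { apply is_lim_seq_spec. intros eps. assert (Pe := cond_pos eps).
    destruct (euler_limit g3 (fun p => p) w3 (RtoC (2 * u)) euler_g3 ltac:(simpl; lra) (eps * H) ltac:(nra)) as [N0 HN]. exists N0. intros N L.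
    specialize (HN N L). fold (e N) in HN. assert (EH : Dser g3 (RtoC (2 * u)) = RtoC H).
    { unfold H. rewrite <- (real_C _ Hs). unfold H3. rewrite RtoC_mult. auto. }
    rewrite EH in HN. assert (Q := Rle_lt_trans _ _ _ (Cmod_fst _) HN). simpl in Q.
    replace (H * fst (e N) - 0 * snd (e N) + - (1)) with (H * (fst (e N) - / H)) in Q by (field; lra).
    rewrite Rabs_mult, (Rabs_pos_eq H) in Q by lra. apply Rmult_lt_reg_l with H; lra. }
  assert (Lim2 : is_lim_seq (prod3 u) (sqrt H)).
  { apply (is_lim_seq_ext (fun N => / sqrt (fst (e N)))). intros N. symmetry; apply Inv.
    replace (Finite (sqrt H)) with (Rbar_inv (Finite (sqrt (/ H)))).
    2:{ simpl. f_equal. rewrite sqrt_inv. apply Rinv_inv. }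
    apply is_lim_seq_inv. apply (is_lim_seq_continuous sqrt (fun N => fst (e N)) (/ H)); auto.
    apply continuity_pt_filterlim. apply continuous_sqrt.
    intros E. injection E. assert (P := sqrt_lt_R0 (/ H) (Rinv_0_lt_compat _ Hp)). lra. }
  unfold prod3_inf. rewrite (is_lim_seq_unique _ _ Lim2). auto.
Qed.

(** The function G on the real axis as a single square root, a form in which continuity and bounds
    can be read off. *)
Definition GR (u : R) : R := sqrt (fst (W2 (RtoC u))).

Lemma G_eq u : 1/2 < u <= 1 -> G u = GR u.
Proof.
  intros Hu. destruct (W2_real u ltac:(lra)) as [E P].
  destruct (Z1_pos u ltac:(lra)) as [A A']. destruct (Lc_pos u ltac:(lra)) as [B _]. destruct (H3_pos u ltac:(lra)) as [D _].
  unfold GR. rewrite E. clear E.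
  match goal with |- _ = sqrt (fst (RtoC ?x)) => change (fst (RtoC x)) with x end.
  assert (Zt : zeta_times u = fst (Z1 (RtoC u))).
  { unfold zeta_times. destruct (Req_EM_T u 1) as [->|N]. rewrite Z1_1; auto.
    change ((u, 0) : C) with (RtoC u). rewrite (zeta_C_eq (RtoC u)) by (simpl; lra).
    rewrite (real_C _ A') at 1. rewrite <- RtoC_minus, <- RtoC_div by lra. simpl. field. lra. }
  assert (Lt : L4 u = fst (Lc (RtoC u))).
  { unfold L4. change ((u, 0) : C) with (RtoC u). rewrite (L4_C_eq (RtoC u)) by (simpl; lra). auto. }
  unfold G. rewrite Zt, Lt, prod3_inf_eq by lra. fold (den2 u).
  generalize dependent (fst (Z1 (RtoC u))). intros z A _. generalize dependent (fst (Lc (RtoC u))). intros l B _.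
  generalize dependent (fst (H3 (RtoC u))). intros k D. assert (AB := Rmult_lt_0_compat _ _ A B).
  rewrite sqrt_div_alt by auto. rewrite (sqrt_mult (z * l)) by lra. rewrite (sqrt_mult z) by lra.
  assert (Q := sqrt_lt_R0 _ P). field. lra.
Qed.

Lemma GR_cont u : 1/2 < u -> continuous GR u.
Proof.
  intros Hu. unfold GR. apply (continuous_comp (fun u => fst (W2 (RtoC u))) sqrt).
  apply (Ccont_h W2 u 0). apply (holo_cont (fun s => 1/2 < fst s)). apply holo_W2. simpl; auto. apply continuous_sqrt.
Qed.

Lemma GR_bound d u : 0 < d -> 1/2 + d <= u <= 1 -> 0 <= GR u <= 48384 * (1 + / d).
Proof.
  intros Hd Hu. split. apply sqrt_pos.
  assert (B := W2_bound (RtoC u) ltac:(simpl; lra)). assert (Wb := W_bound (RtoC u) ltac:(simpl; lra)). rewrite Cmod_R, Rabs_pos_eq in Wb by lra.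
  assert (F := Cmod_fst (W2 (RtoC u))). assert (F2 := Rle_abs (fst (W2 (RtoC u)))).
  assert (I : 0 < / (2 * fst (RtoC u) - 1) <= / d). { simpl. split. apply Rinv_0_lt_compat; lra. apply Rinv_le_contravar; lra. }
  assert (Id : 0 < / d) by (apply Rinv_0_lt_compat; auto).
  assert (P3 : (1 + u) ^ 3 <= 8) by (simpl; nra).
  (* 13440 = 4 * 420 * 2^3, from [W2_bound] and [W_bound] with u <= 1. Only finiteness of the bound
     on [GR] matters, so its root is estimated generously. *)
  assert (fst (W2 (RtoC u)) <= 13440 * (1 + / d)).
  { apply Rle_trans with (4 * (1 + / (2 * fst (RtoC u) - 1)) * Cmod (W (RtoC u))). lra.
    replace (13440 * (1 + / d)) with (4 * (1 + / d) * 3360) by ring.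
    apply Rmult_le_compat; try lra. apply Cmod_ge_0. }
  destruct (W2_pos u ltac:(lra)) as [P _].
  unfold GR. apply Rle_trans with (sqrt ((48384 * (1 + / d)) * (48384 * (1 + / d)))).
  apply sqrt_le_1; try nra. rewrite sqrt_square; lra.
Qed.

(** Half the logarithm of W2, real on the axis, gives the root g. To compare it with F, consider F *
    sqrt(s - 1) / g on a vertical segment: its square is 1, it is continuous, and it is nonnegative
    at the real end, so it is 1 throughout. *)
Lemma analytic_root a T : 1/2 <= a < 1 -> 0 < T -> (forall s, rect a 3 (- T) T s -> W s <> RtoC 0) ->
  exists g, holo (rect a 3 (- T) T) g /\ (forall s, rect a 3 (- T) T s -> (g s * g s)%C = W2 s) /\
    (forall u, a < u < 3 -> g (RtoC u) = RtoC (GR u)) /\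
    (forall c t, 1 < c < 3 -> 0 <= t < T -> FD (c, t) = (g (c, t) / csqrt ((c, t) - 1))%C).
Proof.
  intros Ha HT HW. set (D := rect a 3 (- T) T) in *.
  destruct (W2_pos 2 ltac:(lra)) as [P2 S2].
  destruct (log_exists W2 a 3 (- T) T 2 0 (fst (W2 (RtoC 2)))) as [l [Hl [El [_ Rl]]]]; auto.
  - apply (holo_sub _ (fun s => 1/2 < fst s)). intros s [S _]. lra. apply holo_W2.
  - intros s Hs. apply W2_neq. destruct Hs; lra. apply HW; auto.
  - split; simpl; lra.
  - apply real_C; auto.
  - fold D in Hl, El. set (g := fun s => Cexp (RtoC (/2) * l s)).
    assert (Hg : holo D g) by (unfold g; apply holo_Cexp; apply holo_mult; [apply holo_const|auto]).
    assert (Sq : forall s, D s -> (g s * g s)%C = W2 s).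
    { intros s Hs. unfold g. rewrite <- Cexp_plus, <- El by auto. f_equal.
      apply injective_projections; simpl; field. }
    assert (Rg : forall u, a < u < 3 -> g (RtoC u) = RtoC (GR u)).
    { intros u Hu. assert (Du : D (u, 0)) by (unfold D; split; simpl; lra).
      assert (Z : snd (l (u, 0)) = 0). { apply Rl. intros v [Hv _]. simpl in Hv. apply (W2_pos v). lra. exact Du. }
      unfold g, GR. change (RtoC u) with ((u, 0) : C). rewrite <- (El _ Du). rewrite (real_C _ Z), <- RtoC_mult, !Cexp_RtoC. simpl fst. f_equal.
      rewrite <- (sqrt_square (exp (/ 2 * fst (l (u, 0))))) by (left; apply exp_pos). f_equal. rewrite <- exp_plus. f_equal. field. }
    exists g. split; [auto|split; [auto|split; [auto|]]].
    intros c t Hc Ht.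
    set (q := fun v => csqrt ((c, v) - 1)). set (r := fun v => (FD (c, v) * q v / g (c, v))%C).
    assert (gn : forall s, g s <> RtoC 0) by (intros; apply Cexp_neq_0).
    assert (qn : forall v, 0 <= v -> q v <> RtoC 0).
    { intros v Hv. unfold q. apply csqrt_neq_0. simpl; lra. intros E; apply (f_equal fst) in E; simpl in E; lra. }
    assert (R2 : forall v, 0 <= v <= t -> (r v * r v)%C = RtoC 1).
    { intros v Hv. assert (Dv : D (c, v)) by (unfold D; split; simpl; lra). unfold r.
      assert (Qs : (q v * q v)%C = ((c, v) - 1)%C) by (apply csqrt_sq; simpl; lra).
      assert (X := W2_FD (c, v) ltac:(simpl; lra)). rewrite <- Qs, <- (Sq _ Dv) in X. assert (N := gn (c, v)).
      transitivity ((FD (c, v) * FD (c, v) * (q v * q v)) / (g (c, v) * g (c, v)))%C. field; auto. rewrite <- X. field; auto. }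
    assert (Rc : forall v, 0 <= v <= t -> pcont r v).
    { intros v Hv. unfold r, q. set (m := fun s => (FD s * csqrt (s - 1) / g s)%C).
      refine (pcont_Ccont_v m c v _). unfold m, Cdiv. apply Ccont_mult. apply Ccont_mult.
      apply (holo_cont (fun s => 1 < fst s)). apply (holo_Dser _ indE_bounded). simpl; lra.
      apply (Ccont_comp csqrt (fun s => s - 1)%C). apply Ccont_plus. apply Ccont_id. apply Ccont_const. apply Ccont_csqrt.
      apply Ccont_inv; auto. apply (holo_cont D); auto. unfold D; split; simpl; lra. }
    assert (R1 : forall v, 0 <= v <= t -> snd (r v) = 0 /\ (fst (r v) = 1 \/ fst (r v) = -1)).
    { intros v Hv. assert (X := R2 v Hv). destruct (r v) as [p w]. injection X as X1 X2. simpl.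
      assert (Z : p * w = 0) by lra. apply Rmult_integral in Z. destruct Z as [Z|Z]; [exfalso; rewrite Z in X1; nra|]. split; auto. rewrite Z in X1.
      assert (Z2 : (p - 1) * (p + 1) = 0) by lra. apply Rmult_integral in Z2. destruct Z2; [left|right]; lra. }
    (* At the real point F has nonnegative coefficients and g is a positive root, which rules out
       -1. *)
    assert (R0 : fst (r 0) = 1).
    { destruct (R1 0 ltac:(lra)) as [_ [|E]]; auto. exfalso.
      destruct (Dser_real indE c) as [F1 F2]. intros n; unfold indE; destruct excluded_middle_informative; lra. apply indE_bounded. lra.
      unfold r, q in E. change ((c, 0) : C) with (RtoC c) in E. rewrite Rg in E by lra. rewrite <- RtoC_minus, csqrt_pos_real in E by lra.
      unfold FD in E. rewrite (real_C _ F2) in E.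
      assert (GP : 0 < GR c) by (apply sqrt_lt_R0; apply W2_pos; lra).
      rewrite <- RtoC_mult, <- RtoC_div in E by lra. simpl in E.
      assert (0 <= fst (Dser indE (RtoC c)) * sqrt (c - 1) / GR c); [|simpl in *; lra].
      apply Rdiv_le_0_compat; auto. apply Rmult_le_pos; auto. apply sqrt_pos. }
    (* A change of sign from 1 to -1 would force an intermediate zero. *)
    assert (Rt : fst (r t) = 1).
    { destruct (R1 t ltac:(lra)) as [_ [|E]]; auto. exfalso. destruct (Req_dec t 0) as [->|Nt]. lra.
      destruct (Ranalysis5.IVT_interv (fun v => - fst (r v)) 0 t) as [z [Hz Ez]]; try lra.
      - intros v Hv. apply continuity_pt_filterlim. apply (continuous_opp (V := R_NormedModule) (fun v => fst (r v))). exact (proj1 (Rc v Hv)).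
      - destruct (R1 z Hz) as [_ [|]]; lra. }
    assert (Er : r t = RtoC 1). { rewrite (real_C (r t)), Rt; auto. apply R1; lra. }
    unfold r in Er. assert (N := gn (c, t)). assert (N2 := qn t ltac:(lra)). fold (q t).
    transitivity (FD (c, t) * q t / g (c, t) * (g (c, t) / q t))%C. field; auto. rewrite Er. ring.
Qed.

(** * The error terms *)

(** Growth is known for W2, the square of g, so the estimate of g / csqrt(s - 1) is made on
    squares. *)
Lemma root_quotient_bound (w g q z : C) B : 0 <= B -> (g * g)%C = w -> (q * q)%C = z -> q <> RtoC 0 ->
  Cmod w <= B * B * Cmod z -> Cmod (g / q) <= B.
Proof.
  intros HB Eg Eq Nq H. rewrite <- Eg, <- Eq, !Cmod_mult in H. rewrite Cmod_div by auto.
  assert (Pq := proj1 (Cmod_gt_0 q) Nq). assert (Pg := Cmod_ge_0 g).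
  apply Rmult_le_reg_r with (Cmod q); auto. replace (Cmod g / Cmod q * Cmod q) with (Cmod g) by (field; lra).
  apply Rsqr_incr_0_var; [unfold Rsqr|]; nra.
Qed.

(** The four errors are the averaging, the truncation of Perron's integral, the left side and the
    top. Room beyond the contour, a' < a and T + 1, is required by Cauchy's theorem. The constants
    follow from h <= x: (x + h)^(c+1) <= 8 x^(c+1) and (x + h)^a <= 2 x^a. *)
Lemma contour_estimate x h c T a a' Bv Bt : 1 <= x -> 0 < h <= x -> 1 < c <= 2 -> 1 <= T -> 1/2 <= a' < a -> a < 1 ->
  (forall s, rect a' 3 (- (T + 1)) (T + 1) s -> W s <> RtoC 0) -> 0 <= Bv -> 0 <= Bt ->
  (forall t, 0 <= t <= T -> Cmod (W2 (a, t)) <= Bv * Bv * Cmod ((a, t) - 1)) ->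
  (forall u, a <= u <= c -> Cmod (W2 (u, T)) <= Bt * Bt * Cmod ((u, T) - 1)) ->
  Rabs (PI * countE x - Jint (fun u => GR u * fst (Kh x h (RtoC u))) a) <=
  PI * (h + 1) + 960 * Rpower x (c + 1) / (h * T) * (1 + / (c - 1)) + 24 * Bv * Rpower x a * ln (1 + T)
  + 64 * Bt * Rpower x (c + 1) / (h * (T * T)).
Proof.
  intros Hx Hh Hc HT Ha' Ha HW HBv HBt Lv Lt.
  destruct (analytic_root a' (T + 1) ltac:(lra) ltac:(lra) HW) as [g [Hg [Sg [Rg Fg]]]].
  set (D := rect a' 3 (- (T + 1)) (T + 1)) in *.
  assert (X2 : forall e, 0 <= e -> Rpower (x + h) e <= Rpower 2 e * Rpower x e).
  { intros e He. rewrite Rpower_mult_distr by lra. apply Rle_Rpower_l; lra. }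
  assert (P8 : Rpower 2 (c + 1) <= 8).
  { replace 8 with (2 ^ 3) by ring. rewrite <- Rpower_pow by lra. apply Rle_Rpower; simpl; lra. }
  assert (Pa2 : Rpower 2 a <= 2). { apply Rle_trans with (Rpower 2 1). apply Rle_Rpower; lra. rewrite Rpower_1; lra. }
  assert (Xc : Rpower (x + h) (c + 1) <= 8 * Rpower x (c + 1)).
  { eapply Rle_trans. apply X2; lra. apply Rmult_le_compat_r; auto. left; apply Rpower_pos. }
  assert (Xa : Rpower (x + h) a <= 2 * Rpower x a).
  { eapply Rle_trans. apply X2; lra. apply Rmult_le_compat_r; auto. left; apply Rpower_pos. }
  assert (Pxc := Rpower_pos x (c + 1)). assert (Pxa := Rpower_pos x a). assert (Phc := Rpower_pos (x + h) (c + 1)). assert (Pha := Rpower_pos (x + h) a).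
  assert (Per := perron_countE x h c T Hx ltac:(lra) Hc HT).
  set (Psi := fun s => (g s * Kh x h s)%C).
  set (d := Rmin ((a - a') / 2) (1/2)). assert (Hd : 0 < d /\ d <= (a - a') / 2 /\ d <= 1/2).
  { unfold d. split. apply Rmin_pos; lra. split. apply Rmin_l. apply Rmin_r. } clearbody d.
  assert (HK : holo D (Kh x h)) by (apply holo_Kh; [lra|intros s [S _]; lra]).
  assert (HPsi : holo D Psi) by (apply holo_mult; auto).
  assert (Sub : forall s, rect (a - d) (c + d) (- d) (T + d) s -> D s) by (intros s [S1 S2]; unfold D; split; lra).
  assert (KR : forall u, 0 < u -> snd (Kh x h (RtoC u)) = 0) by (intros u Hu; rewrite Kh_real by lra; auto).
  assert (SC := slit_contour Psi a c T d ltac:(lra) ltac:(lra) ltac:(lra) (holo_sub _ _ _ Sub HPsi)).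
  assert (Ereal : forall u, a' < u < 3 -> Psi (u, 0) = RtoC (GR u * fst (Kh x h (RtoC u)))).
  { intros u Hu. unfold Psi. change ((u, 0) : C) with (RtoC u). rewrite Rg by lra. rewrite (real_C _ (KR u ltac:(lra))) at 1. rewrite <- RtoC_mult. auto. }
  specialize (SC ltac:(intros u Hu; rewrite Ereal by lra; auto)).
  assert (EJ : Jint (fun u => fst (Psi (u, 0))) a = Jint (fun u => GR u * fst (Kh x h (RtoC u))) a).
  { unfold Jint. apply RInt_ext. intros v Hv. assert (E := sqrt_def (1 - a) ltac:(lra)). assert (P := sqrt_pos (1 - a)).
    rewrite Rmin_left, Rmax_right in Hv by lra. rewrite Ereal. auto. nra. }
  rewrite EJ in SC.
  rewrite (CInt_ext (fun t => FD (c, t) * Kh x h (c, t))%C (fun t => Psi (c, t) / csqrt ((c, t) - 1))%C) in Per.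
  2:{ intros t. rewrite Rmin_left, Rmax_right by lra. intros Ht. rewrite Fg by lra. unfold Psi, Cdiv. ring. }
  rewrite SC in Per.
  assert (qn : forall s, 0 <= snd s -> s <> RtoC 1 -> csqrt (s - 1) <> RtoC 0).
  { intros s S1 S2. apply csqrt_neq_0. simpl; lra. apply Cminus_neq_0; auto. }
  assert (Cont : forall s, D s -> 0 <= snd s -> s <> RtoC 1 -> Ccont (fun s => Psi s / csqrt (s - 1))%C s).
  { intros s S0 S1 S2. unfold Cdiv. apply Ccont_mult. apply (holo_cont D); auto. apply Ccont_inv; auto.
    apply (Ccont_comp csqrt (fun s => s - 1)%C). apply Ccont_plus. apply Ccont_id. apply Ccont_const. apply Ccont_csqrt. }
  assert (Bd : forall s B, D s -> 0 <= snd s -> s <> RtoC 1 -> 0 <= B -> Cmod (W2 s) <= B * B * Cmod (s - 1) ->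
     Cmod (Psi s / csqrt (s - 1)) <= B * Cmod (Kh x h s)).
  { intros s B S0 S1 S2 HB L. unfold Psi. replace (g s * Kh x h s / csqrt (s - 1))%C with (g s / csqrt (s - 1) * Kh x h s)%C by (unfold Cdiv; ring).
    rewrite Cmod_mult. apply Rmult_le_compat_r. apply Cmod_ge_0.
    apply (root_quotient_bound (W2 s) _ _ (s - 1)%C); auto. apply csqrt_sq. simpl; lra. }
  (* The majorant on the left side comes from |a + it| >= (1 + t) / 3, valid as a >= 1/2; it
     integrates to a logarithm. *)
  assert (IL : is_RInt (fun t => Bv * (2 * Rpower (x + h) a * 3) * / (1 + t)) 0 T (Bv * (2 * Rpower (x + h) a * 3) * ln (1 + T))).
  { replace (Bv * (2 * Rpower (x + h) a * 3) * ln (1 + T)) with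
      (minus (Bv * (2 * Rpower (x + h) a * 3) * ln (1 + T)) (Bv * (2 * Rpower (x + h) a * 3) * ln (1 + 0))).
    2:{ unfold minus, plus, opp; simpl. rewrite Rplus_0_r, ln_1. ring. }
    apply (is_RInt_derive (fun t => Bv * (2 * Rpower (x + h) a * 3) * ln (1 + t)) (fun t => Bv * (2 * Rpower (x + h) a * 3) * / (1 + t)));
    intros t; rewrite Rmin_left, Rmax_right by lra; intros Ht.
    auto_derive. lra. field. lra. apply (ex_derive_continuous (V := R_NormedModule)). auto_derive. lra. }
  assert (Left : Cmod (CInt (fun t => Psi (a, t) / csqrt ((a, t) - 1))%C 0 T) <= 24 * Bv * Rpower x a * ln (1 + T)).
  { eapply Rle_trans. apply (CInt_bound_fun _ (fun t => Bv * (2 * Rpower (x + h) a * 3) * / (1 + t)) 0 T). lra.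
    - intros t Ht. refine (pcont_Ccont_v (fun s => Psi s / csqrt (s - 1))%C a t _). apply Cont. unfold D; split; simpl; lra. simpl; lra.
      intros E; apply (f_equal fst) in E; simpl in E; lra.
    - eexists; exact IL.
    - intros t Ht. eapply Rle_trans. apply Bd with (B := Bv); auto. unfold D; split; simpl; lra. simpl; lra.
      intros E; apply (f_equal fst) in E; simpl in E; lra.
      rewrite Rmult_assoc. apply Rmult_le_compat_l; auto. eapply Rle_trans. apply Kh_bound; simpl; lra. simpl fst.
      unfold Rdiv. rewrite (Rmult_assoc (2 * _)). apply Rmult_le_compat_l. lra.
      assert (M1 := Cmod_fst (a, t)). assert (M2 := Cmod_snd (a, t)). simpl in M1, M2. rewrite Rabs_pos_eq in M1, M2 by lra.
      replace (3 * / (1 + t)) with (/ ((1 + t) / 3)) by (field; lra). apply Rinv_le_contravar; lra.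
    - rewrite (is_RInt_unique _ _ _ _ IL).
      assert (0 <= ln (1 + T)) by (apply ln_ge_0; lra).
      assert (0 <= Bv * ln (1 + T)) by (apply Rmult_le_pos; auto).
      replace (2 * (Bv * (2 * Rpower (x + h) a * 3) * ln (1 + T))) with (12 * (Bv * ln (1 + T)) * Rpower (x + h) a) by ring.
      replace (24 * Bv * Rpower x a * ln (1 + T)) with (12 * (Bv * ln (1 + T)) * (2 * Rpower x a)) by ring.
      apply Rmult_le_compat_l; lra. }
  assert (Top : Cmod (CInt (fun u => Psi (u, T) / csqrt ((u, T) - 1))%C a c) <= 64 * Bt * Rpower x (c + 1) / (h * (T * T))).
  { set (k := / (h * (T * T))). assert (Pk : 0 < k) by (apply Rinv_0_lt_compat; apply Rmult_lt_0_compat; nra).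
    eapply Rle_trans. apply (CInt_bound _ a c (Bt * (2 * Rpower (x + h) (c + 1) * k))). lra.
    - intros u Hu. refine (pcont_Ccont_h (fun s => Psi s / csqrt (s - 1))%C u T _). apply Cont. unfold D; split; simpl; lra. simpl; lra.
      intros E; apply (f_equal snd) in E; simpl in E; lra.
    - intros u Hu. eapply Rle_trans. apply Bd with (B := Bt); auto. unfold D; split; simpl; lra. simpl; lra.
      intros E; apply (f_equal snd) in E; simpl in E; lra.
      apply Rmult_le_compat_l; auto. eapply Rle_trans. apply Kh_bound_sq; simpl; lra. simpl fst.
      assert (M2 := Cmod_snd (u, T)). simpl in M2. rewrite Rabs_pos_eq in M2 by lra.
      unfold Rdiv. apply Rmult_le_compat. assert (Q := Rpower_pos (x + h) (u + 1)); lra.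
      left; apply Rinv_0_lt_compat. apply Rmult_lt_0_compat; nra.
      apply Rmult_le_compat_l. lra. apply Rpower_le1; lra.
      unfold k. apply Rinv_le_contravar. apply Rmult_lt_0_compat; nra. apply Rmult_le_compat_l; nra.
    - assert (0 <= Bt * k) by (apply Rmult_le_pos; lra).
      replace (2 * (Bt * (2 * Rpower (x + h) (c + 1) * k)) * (c - a)) with (4 * (Bt * k) * (Rpower (x + h) (c + 1) * (c - a))) by ring.
      replace (64 * Bt * Rpower x (c + 1) / (h * (T * T))) with (4 * (Bt * k) * (8 * Rpower x (c + 1) * 2)) by (unfold k, Rdiv; ring).
      apply Rmult_le_compat_l. lra. apply Rmult_le_compat; lra. }
  assert (Per2 : 120 * Rpower (x + h) (c + 1) / (h * T) * (1 + / (c - 1)) <= 960 * Rpower x (c + 1) / (h * T) * (1 + / (c - 1))).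
  { assert (0 < / (c - 1)) by (apply Rinv_0_lt_compat; lra). apply Rmult_le_compat_r. lra. unfold Rdiv.
    apply Rmult_le_compat_r. left; apply Rinv_0_lt_compat; nra. lra. }
  assert (Q1 := Rle_trans _ _ _ (Cmod_fst _) Left). assert (Q2 := Rle_trans _ _ _ (Cmod_snd _) Top).
  set (l1 := fst (CInt (fun t => Psi (a, t) / csqrt ((a, t) - 1))%C 0 T)) in *.
  set (l2 := snd (CInt (fun u => Psi (u, T) / csqrt ((u, T) - 1))%C a c)) in *.
  set (J := Jint (fun u => GR u * fst (Kh x h (RtoC u))) a) in *.
  replace (PI * countE x - J) with ((PI * countE x - (l1 + l2 + J)) + l1 + l2) by ring.
  eapply Rle_trans. apply Rabs_triang. eapply Rle_trans. apply Rplus_le_compat_r, Rabs_triang. lra.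
Qed.

(** * The main term and the choice of parameters *)

Definition psix (x u : R) : R := GR u * (Rpower x u / u).

Lemma psix_cont x u : 1/2 < u -> continuous (psix x) u.
Proof.
  intros Hu. apply (continuous_mult (K := R_AbsRing) GR (fun u => Rpower x u / u)). apply GR_cont; auto.
  apply (ex_derive_continuous (V := R_NormedModule)). unfold Rpower. auto_derive. lra.
Qed.

Lemma integrand_improper x a0 : 1/2 < a0 < 1 -> is_RInt_gen (integrand x) (at_point a0) (at_left 1) (Jint (psix x) a0).
Proof.
  intros Ha. apply (is_RInt_gen_ext (fun u => psix x u / sqrt (1 - u))).
  2: apply Jint_improper; [lra|]; intros; apply psix_cont; lra.
  apply (Filter_prod _ _ _ (fun t => t = a0) (fun b => a0 < b < 1)).
  - reflexivity.
  - assert (P : 0 < 1 - a0) by lra. exists (mkposreal _ P). intros b Hb Lb. unfold ball in Hb; simpl in Hb; unfold AbsRing_ball, abs, minus, plus, opp in Hb; simpl in Hb.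
    apply Rabs_lt_between in Hb. lra.
  - intros t b -> Hb u. simpl. rewrite Rmin_left, Rmax_right by lra. intros Hu. unfold integrand, psix. rewrite G_eq by lra.
    rewrite Rabs_left by lra. replace (- (u - 1)) with (1 - u) by ring. assert (0 < sqrt (1 - u)) by (apply sqrt_lt_R0; lra). field. lra.
Qed.

Lemma Kh_term_cont x h u : 1 <= x -> 0 < h -> 1/2 < u -> continuous (fun u => GR u * fst (Kh x h (RtoC u))) u.
Proof.
  intros Hx Hh Hu. apply (continuous_mult (K := R_AbsRing) GR (fun u => fst (Kh x h (RtoC u)))). apply GR_cont; auto.
  apply (Ccont_h (Kh x h) u 0). apply (holo_cont (fun s => 0 < fst s)). apply holo_Kh; auto. simpl; lra.
Qed.

Lemma sqrt_le_one a : 0 <= a < 1 -> 0 < sqrt (1 - a) <= 1.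
Proof. intros H. split. apply sqrt_lt_R0; lra. rewrite <- sqrt_1 at 2. apply sqrt_le_1; lra. Qed.

Lemma Jint_smooth x h d a M : 1 <= x -> 0 < h -> 0 < d -> 1/2 + d <= a < 1 -> (forall u, 1/2 + d <= u <= 1 -> 0 <= GR u <= M) ->
  Rabs (Jint (fun u => GR u * fst (Kh x h (RtoC u))) a - Jint (psix x) a) <= 2 * M * h.
Proof.
  intros Hx Hh Hd Ha HM. destruct (sqrt_le_one a ltac:(lra)) as [V0 V1]. assert (E := sqrt_def (1 - a) ltac:(lra)).
  unfold Jint. set (V := sqrt (1 - a)) in *.
  assert (X1 : ex_RInt (fun v => 2 * (GR (1 - v * v) * fst (Kh x h (RtoC (1 - v * v))))) 0 V).
  { apply (Jint_ex (fun u => GR u * fst (Kh x h (RtoC u))) a); fold V; try lra. intros; apply Kh_term_cont; lra. }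
  assert (X2 : ex_RInt (fun v => 2 * psix x (1 - v * v)) 0 V).
  { apply (Jint_ex (psix x) a); fold V; try lra. intros; apply psix_cont; lra. }
  set (f1 := fun v => 2 * (GR (1 - v * v) * fst (Kh x h (RtoC (1 - v * v))))) in *. set (f2 := fun v => 2 * psix x (1 - v * v)) in *.
  assert (Em := RInt_minus (V := R_CompleteNormedModule) _ _ 0 V X1 X2).
  change (RInt (fun v => f1 v - f2 v) 0 V = RInt f1 0 V - RInt f2 0 V) in Em. rewrite <- Em.
  eapply Rle_trans. apply (abs_RInt_le_const _ 0 V (2 * (M * h))). lra.
  apply (ex_RInt_minus (V := R_NormedModule) _ _ 0 V X1 X2).
  - intros v Hv. assert (U : 1/2 + d <= 1 - v * v <= 1) by nra. set (u := 1 - v * v) in *.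
    unfold f1, f2, psix. fold u. replace (2 * (GR u * fst (Kh x h (RtoC u))) - (2 * (GR u * (Rpower x u / u)))) with (2 * (GR u * (fst (Kh x h (RtoC u)) - Rpower x u / u))) by ring.
    rewrite !Rabs_mult, (Rabs_pos_eq 2), (Rabs_pos_eq (GR u)) by (try apply HM; lra).
    apply Rmult_le_compat_l. lra. apply Rmult_le_compat. apply HM; lra. apply Rabs_pos. apply HM; lra. apply Kh_approx; lra.
  - assert (0 <= M) by (destruct (HM 1 ltac:(lra)); lra). assert (0 <= M * h) by (apply Rmult_le_pos; lra). nra.
Qed.

(** The left edge of the contour is dictated by the zeros, not by 1/2 + eps. Replacing one by the
    other costs at most the integrand over the gap, where the exponent is at most b. *)
Lemma Jint_move x d a b M : 1 <= x -> 0 < d -> 1/2 + d <= a <= b -> b < 1 -> (forall u, 1/2 + d <= u <= 1 -> 0 <= GR u <= M) ->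
  Rabs (Jint (psix x) a - Jint (psix x) b) <= 4 * M * Rpower x b.
Proof.
  intros Hx Hd Ha Hb HM. destruct (sqrt_le_one a ltac:(lra)) as [V0 V1]. assert (E := sqrt_def (1 - a) ltac:(lra)).
  destruct (sqrt_le_one b ltac:(lra)) as [U0 U1]. assert (E' := sqrt_def (1 - b) ltac:(lra)).
  assert (Le : sqrt (1 - b) <= sqrt (1 - a)) by (apply sqrt_le_1; lra).
  unfold Jint. set (V := sqrt (1 - a)) in *. set (U := sqrt (1 - b)) in *. set (f := fun v => 2 * psix x (1 - v * v)).
  assert (X : forall p q, 0 <= p <= V -> 0 <= q <= V -> ex_RInt f p q).
  { intros p q Hp Hq. apply (Jint_ex (psix x) a); fold V; try lra. intros; apply psix_cont; lra. }
  assert (Ch := RInt_Chasles (V := R_CompleteNormedModule) f 0 U V (X 0 U ltac:(lra) ltac:(lra)) (X U V ltac:(lra) ltac:(lra))).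
  change (RInt f 0 U + RInt f U V = RInt f 0 V) in Ch.
  replace (RInt f 0 V - RInt f 0 U : R) with (RInt f U V : R) by (simpl in *; lra).
  assert (M0 : 0 <= M) by (destruct (HM 1 ltac:(lra)); lra). assert (Px := Rpower_pos x b).
  eapply Rle_trans. apply (abs_RInt_le_const f U V (2 * (M * (2 * Rpower x b)))). lra. apply X; lra.
  - intros v Hv. assert (Hu : 1/2 + d <= 1 - v * v <= b) by nra. unfold f. set (u := 1 - v * v) in *. unfold psix.
    assert (Pu := Rpower_pos x u). assert (Iu : 0 < / u <= 2). { split. apply Rinv_0_lt_compat; lra. replace 2 with (/ (1/2)) by field. apply Rinv_le_contravar; lra. }
    assert (Q : 0 <= Rpower x u / u <= 2 * Rpower x b).
    { assert (Rpower x u <= Rpower x b) by (apply Rpower_le1; lra). unfold Rdiv. nra. }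
    destruct (HM u ltac:(lra)) as [G0 G1]. rewrite Rabs_pos_eq.
    apply Rmult_le_compat_l. lra. apply Rmult_le_compat; lra. apply Rmult_le_pos. lra. apply Rmult_le_pos; lra.
  - assert (0 <= M * Rpower x b) by (apply Rmult_le_pos; lra). nra.
Qed.

Lemma divide_by_PI A J B : 0 <= B -> Rabs (PI * A - J) <= B -> Rabs (A - J / PI) <= B.
Proof.
  intros HB H. assert (P := PI_RGT_0). assert (P1 : 1 <= PI) by (assert (Q := PI2_1); lra).
  replace (A - J / PI) with (/ PI * (PI * A - J)) by (field; lra). rewrite Rabs_mult.
  rewrite (Rabs_pos_eq (/ PI)) by (left; apply Rinv_0_lt_compat; lra).
  assert (I : / PI <= 1) by (rewrite <- Rinv_1; apply Rinv_le_contravar; lra).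
  assert (0 < / PI) by (apply Rinv_0_lt_compat; lra). assert (Q := Rabs_pos (PI * A - J)). nra.
Qed.

Lemma Rpower_ge_1 x y : 1 <= x -> 0 <= y -> 1 <= Rpower x y.
Proof. intros Hx Hy. rewrite <- (Rpower_O x) at 1 by lra. apply Rpower_le1; auto. Qed.

Lemma one_le_sq K : 1 <= K -> K <= K * K.
Proof. nra. Qed.

Lemma error_RH eps : 0 < eps < 1/2 -> RH_zeta -> RH_L4 ->
  exists C x0 : R, forall x : R, x0 <= x -> exists I : R,
    is_RInt_gen (integrand x) (at_point (1/2 + eps)) (at_left 1) I /\
    Rabs (countE x - I / PI) <= C * Rpower x (1/2 + eps).
Proof.
  intros He R1 R2. set (M := 48384 * (1 + / (eps / 2))).
  assert (Ie : 0 < / eps) by (apply Rinv_0_lt_compat; lra).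
  assert (HM : forall u, 1/2 + eps / 2 <= u <= 1 -> 0 <= GR u <= M) by (intros; apply GR_bound; lra).
  assert (PM : 0 <= M) by (destruct (HM 1 ltac:(lra)); lra).
  (* The root halves this exponent to eps / 12; since 6 + x^2 <= x^3 for x >= 3, the growth factor
     at height T = x^2 is then at most x^(eps/4). *)
  destruct (W_growth_RH (eps / 2) (2 * (eps / 12)) R1 R2 ltac:(lra) ltac:(lra)) as [K [HK Gr]].
  set (K2 := 4 * (1 + / eps) * (K + 210000)). assert (HK2 : 1 <= K2) by (unfold K2; nra).
  exists (8 + 1920 + 24 * K2 * (3 * (4 / eps)) + 64 * K2 + 2 * M + 4 * M), 3. intros x Hx.
  exists (Jint (psix x) (1/2 + eps)). split. apply integrand_improper; lra.
  assert (Px := Rpower_pos x (1/2 + eps)).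
  assert (Pe : 0 < 4 / eps) by (apply Rdiv_lt_0_compat; lra).
  apply divide_by_PI.
  { apply Rmult_le_pos; [|lra]. assert (0 <= K2 * (4 / eps)) by (apply Rmult_le_pos; lra). lra. }
  (* With c = 2 and h = sqrt x the averaging error and the truncation error x^3 / (h T) are both of
     order sqrt x. The edge a lies eps / 2 below the target exponent, and that gap absorbs the
     growth and the logarithm, x^(eps/4) each. *)
  set (a := 1/2 + eps / 2). set (r := Rpower x (1/2)). set (T := x * x).
  assert (Er : r * r = x). { unfold r. rewrite <- Rpower_plus. replace (1/2 + 1/2) with 1 by field. apply Rpower_1; lra. }
  assert (Hr : 1 <= r) by (apply Rpower_ge_1; lra).
  assert (HT : 3 <= T) by (unfold T; nra).
  set (Q := Rpower (6 + T) (eps / 12)).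
  assert (HQ : 1 <= Q) by (apply Rpower_ge_1; lra).
  assert (Q2 : forall t, 0 <= t <= T -> Rpower (6 + t) (2 * (eps / 12)) <= Q * Q).
  { intros t Ht. unfold Q. rewrite <- Rpower_plus. replace (eps / 12 + eps / 12) with (2 * (eps / 12)) by ring. apply Rle_Rpower_l; lra. }
  assert (KQ : 0 <= K2 * Q) by nra.
  assert (KQ2 : K2 * (Q * Q) <= (K2 * Q) * (K2 * Q)).
  { replace ((K2 * Q) * (K2 * Q)) with ((K2 * K2) * (Q * Q)) by ring. apply Rmult_le_compat_r. nra. apply one_le_sq; auto. }
  assert (H3c : forall u, a <= u -> 1 + / (2 * u - 1) <= 1 + / eps).
  { intros u Hu. unfold a in Hu. assert (/ (2 * u - 1) <= / eps) by (apply Rinv_le_contravar; lra). lra. }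
  assert (Large : forall u t, a <= u <= 2 -> 3 <= t <= T -> Cmod (W2 (u, t)) <= (K2 * Q) * (K2 * Q) * Cmod ((u, t) - 1)).
  { intros u t Hu Ht. assert (B := W2_bound (u, t) ltac:(simpl; unfold a in Hu; lra)). simpl fst in B.
    assert (G0 := Gr u t ltac:(unfold a in Hu; lra) ltac:(rewrite Rabs_pos_eq; lra)). rewrite (Rabs_pos_eq t) in G0 by lra.
    assert (Q3 := Q2 t ltac:(lra)). assert (P1 := Cmod_ge_0 ((u, t) - 1)%C). specialize (H3c u ltac:(lra)).
    assert (B2 : Cmod (W (u, t)) <= (K + 210000) * (Q * Q) * Cmod ((u, t) - 1)).
    { eapply Rle_trans. exact G0. assert (0 <= K * Cmod ((u, t) - 1)) by (apply Rmult_le_pos; lra).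
      assert (0 <= Cmod ((u, t) - 1) * (Q * Q)) by (apply Rmult_le_pos; [lra|nra]).
      apply Rle_trans with (K * Cmod ((u, t) - 1) * (Q * Q)). apply Rmult_le_compat_l; auto. lra. }
    eapply Rle_trans. exact B. apply Rle_trans with (K2 * (Q * Q) * Cmod ((u, t) - 1)).
    - replace (K2 * (Q * Q) * Cmod ((u, t) - 1)) with (4 * (1 + / eps) * ((K + 210000) * (Q * Q) * Cmod ((u, t) - 1))) by (unfold K2; ring).
      assert (0 < / (2 * u - 1)) by (apply Rinv_0_lt_compat; unfold a in Hu; lra).
      apply Rmult_le_compat; try lra. apply Cmod_ge_0.
    - apply Rmult_le_compat_r; lra. }
  assert (Small : forall t, 0 <= t <= 3 -> Cmod (W2 (a, t)) <= (K2 * Q) * (K2 * Q) * Cmod ((a, t) - 1)).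
  { intros t Ht. assert (B := W2_bound (a, t) ltac:(simpl; unfold a; lra)). simpl fst in B. specialize (H3c a ltac:(lra)).
    assert (Wb := W_bound (a, t) ltac:(simpl; unfold a; lra)).
    assert (Ms := Cmod_le_sum (a, t)). simpl in Ms. rewrite !Rabs_pos_eq in Ms by (unfold a; lra).
    assert (Md := Cmod_fst ((a, t) - 1)%C). simpl in Md. rewrite Rabs_left in Md by (unfold a; lra).
    assert (Mq : 1/4 <= Cmod ((a, t) - 1)) by (unfold a in *; lra).
    assert (P3 : (1 + Cmod (a, t)) ^ 3 <= 125).
    { replace 125 with (5 ^ 3) by ring. apply pow_incr. assert (Q9 := Cmod_ge_0 (a, t)). unfold a in *; lra. }
    assert (B2 : Cmod (W (a, t)) <= (K + 210000) * Cmod ((a, t) - 1)) by nra.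
    eapply Rle_trans. exact B. apply Rle_trans with (K2 * Cmod ((a, t) - 1)).
    - replace (K2 * Cmod ((a, t) - 1)) with (4 * (1 + / eps) * ((K + 210000) * Cmod ((a, t) - 1))) by (unfold K2; ring).
      assert (0 < / (2 * a - 1)) by (apply Rinv_0_lt_compat; unfold a; lra).
      apply Rmult_le_compat; try lra. apply Cmod_ge_0.
    - apply Rmult_le_compat_r. lra. apply Rle_trans with (K2 * (Q * Q)); auto. nra. }
  assert (CE := contour_estimate x r 2 T a (1/2 + eps / 4) (K2 * Q) (K2 * Q) ltac:(lra) ltac:(nra) ltac:(lra) ltac:(lra)
     ltac:(unfold a; lra) ltac:(unfold a; lra)
     (fun s Hs => W_neq_RH s R1 R2 ltac:(destruct Hs; lra)) KQ KQ).
  assert (CE2 := CE (fun t Ht => match Rle_dec 3 t with left l => Large a t ltac:(unfold a; lra) (conj l (proj2 Ht)) | right n => Small t ltac:(lra) end)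
     (fun u Hu => Large u T Hu ltac:(lra))). clear CE.
  assert (Js := Jint_smooth x r (eps / 2) a M ltac:(lra) ltac:(lra) ltac:(lra) ltac:(unfold a; lra) HM).
  assert (Jm := Jint_move x (eps / 2) a (1/2 + eps) M ltac:(lra) ltac:(lra) ltac:(unfold a; lra) ltac:(lra) HM).
  set (B := Rpower x (1/2 + eps)) in *.
  assert (rB : r <= B) by (apply Rpower_le1; lra).
  assert (Qx : Q <= Rpower x (eps / 4)).
  { unfold Q. replace (Rpower x (eps / 4)) with (Rpower (x ^ 3) (eps / 12)).
    apply Rle_Rpower_l. lra. split. lra. unfold T. simpl. nra.
    rewrite <- Rpower_pow by lra. rewrite Rpower_mult. f_equal. simpl. field. }
  assert (Lx : ln (1 + T) <= 3 * (4 / eps) * Rpower x (eps / 4)).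
  { apply Rle_trans with (ln (x ^ 3)). assert (1 + T <= x ^ 3) by (unfold T; simpl; nra).
    destruct H as [H|H]; [left; apply ln_increasing; lra|rewrite H; lra].
    rewrite <- Rpower_pow by lra. unfold Rpower at 1. rewrite ln_exp. simpl INR.
    assert (L := ln_le_self (Rpower x (eps / 4)) (Rpower_pos _ _)). unfold Rpower in L at 1. rewrite ln_exp in L.
    replace ((1 + 1 + 1) * ln x) with (3 * (4 / eps) * (eps / 4 * ln x)) by (field; lra).
    apply Rmult_le_compat_l; auto. lra. }
  assert (PQ := Rpower_pos x (eps / 4)). set (Y := Rpower x (eps / 4)) in *.
  assert (L0 : 0 <= ln (1 + T)) by (apply ln_ge_0; lra).
  assert (EB : Rpower x a * Y * Y = B).
  { unfold Y, B, a. rewrite <- !Rpower_plus. f_equal. field. }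
  assert (Pa := Rpower_pos x a).
  assert (T3 : 24 * (K2 * Q) * Rpower x a * ln (1 + T) <= 24 * K2 * (3 * (4 / eps)) * B).
  { rewrite <- EB.
    replace (24 * (K2 * Q) * Rpower x a * ln (1 + T)) with (24 * K2 * Rpower x a * (Q * ln (1 + T))) by ring.
    replace (24 * K2 * (3 * (4 / eps)) * (Rpower x a * Y * Y)) with (24 * K2 * Rpower x a * (Y * (3 * (4 / eps) * Y))) by ring.
    apply Rmult_le_compat_l. apply Rmult_le_pos; lra. apply Rmult_le_compat; lra. }
  assert (X3 : Rpower x (2 + 1) = x * x * x). { rewrite Rpower_plus, Rpower_1 by lra. replace 2 with (1 + 1) by ring. rewrite Rpower_plus, Rpower_1 by lra. ring. }
  rewrite X3 in CE2.
  assert (T2 : 960 * (x * x * x) / (r * T) * (1 + / (2 - 1)) <= 1920 * B).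
  { replace (960 * (x * x * x) / (r * T) * (1 + / (2 - 1))) with (1920 * (x / r)) by (unfold T; field; lra).
    replace (x / r) with r by (rewrite <- Er; field; lra). lra. }
  assert (T4 : 64 * (K2 * Q) * (x * x * x) / (r * (T * T)) <= 64 * K2 * B).
  { replace (64 * (K2 * Q) * (x * x * x) / (r * (T * T))) with (64 * K2 * (Q / (r * x))) by (unfold T; field; lra).
    apply Rmult_le_compat_l. lra.
    assert (YB : Y <= B) by (unfold Y, B; apply Rpower_le1; lra).
    apply Rle_trans with Q; [|lra]. apply Rmult_le_reg_r with (r * x). nra. replace (Q / (r * x) * (r * x)) with Q by (field; lra).
    rewrite <- (Rmult_1_r Q) at 1. apply Rmult_le_compat_l; nra. }
  assert (T1 : PI * (r + 1) <= 8 * B). { assert (Q9 := PI_4). assert (Q8 := PI_RGT_0). nra. }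
  assert (T5 : 2 * M * r <= 2 * M * B) by (apply Rmult_le_compat_l; lra).
  set (J1 := Jint (fun u => GR u * fst (Kh x r (RtoC u))) a) in *. set (J2 := Jint (psix x) a) in *. set (J3 := Jint (psix x) (1/2 + eps)) in *.
  replace (PI * countE x - J3) with ((PI * countE x - J1) + (J1 - J2) + (J2 - J3)) by ring.
  eapply Rle_trans. apply Rabs_triang. eapply Rle_trans. apply Rplus_le_compat_r, Rabs_triang.
  rewrite !Rmult_plus_distr_r. lra.
Qed.

Lemma exp_ge_sq y : 0 <= y -> y * y <= 4 * exp y.
Proof.
  intros Hy. replace (exp y) with (exp (y / 2) * exp (y / 2)) by (rewrite <- exp_plus; f_equal; field).
  assert (E := exp_ineq1_le (y / 2)). nra.
Qed.

Lemma error_unconditional eps : 0 < eps < 1/2 ->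
  exists c : R, 0 < c /\ exists C x0 : R, forall x : R, x0 <= x -> exists I : R,
    is_RInt_gen (integrand x) (at_point (1/2 + eps)) (at_left 1) I /\
    Rabs (countE x - I / PI) <= C * (x * exp (- c * sqrt (ln x))).
Proof.
  intros He. set (d := Rmin (eps / 2) (1/4)).
  assert (Hd : 0 < d /\ d <= eps / 2 /\ d <= 1/4). { unfold d. split. apply Rmin_pos; lra. split. apply Rmin_l. apply Rmin_r. } clearbody d.
  set (M := 48384 * (1 + / d)).
  assert (HM : forall u, 1/2 + d <= u <= 1 -> 0 <= GR u <= M) by (intros; apply GR_bound; lra).
  assert (PM : 0 <= M) by (destruct (HM 1 ltac:(lra)); lra).
  (* The value k = c0 / 4 turns log T = k sqrt(log x) into the saving (1 - a) log x >= sqrt(log x)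
     on the left side. *)
  destruct zero_free as [c0 [Hc0 ZF]]. set (k := c0 / 4). assert (Hk : 0 < k <= 1/32) by (unfold k; lra).
  assert (Ic0 : 8 <= / c0). { replace 8 with (/ (1/8)) by field. apply Rinv_le_contravar; lra. }
  set (K1 := 544320 * / c0). assert (HK1 : 1 <= K1) by (unfold K1; lra).
  assert (kk : 0 < k * k) by (apply Rmult_lt_0_compat; lra).
  set (K3 := 1 + 64 / (k * k)). assert (HK3 : 1 <= K3). { unfold K3. assert (0 < 64 / (k * k)) by (apply Rdiv_lt_0_compat; lra). lra. }
  exists (k / 4). split. lra.
  (* Threshold for sqrt(log x): 2 / k ensures T >= 3, k / (1/2 - eps) ensures x^(1/2 + eps) <= x /
     T, and 1 ensures log x >= 1. *)
  set (S0 := 2 / k + k / (1/2 - eps) + 1).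
  assert (HS0 : 2 / k <= S0 /\ k / (1/2 - eps) <= S0 /\ 1 <= S0).
  { unfold S0. assert (0 < 2 / k) by (apply Rdiv_lt_0_compat; lra). assert (0 < k / (1/2 - eps)) by (apply Rdiv_lt_0_compat; lra). lra. }
  exists (8 + 960 * 3 * K3 + 48 * K1 + 64 * 568 * 3 + 2 * M + 4 * M), (exp (S0 * S0)). intros x Hx.
  assert (Px : 0 < x) by (eapply Rlt_le_trans; [apply exp_pos|exact Hx]).
  set (L := ln x). assert (HL : S0 * S0 <= L).
  { unfold L. rewrite <- (ln_exp (S0 * S0)). destruct Hx as [Hx|Hx]; [left; apply ln_increasing; auto; apply exp_pos|rewrite Hx; lra]. }
  assert (L1 : 1 <= L) by nra. assert (Ex : exp L = x) by (apply exp_ln; auto).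
  assert (Hx1 : 1 <= x). { rewrite <- Ex. rewrite <- exp_0. apply exp_mono. lra. }
  set (S := sqrt L). assert (ES : S * S = L) by (apply sqrt_def; lra).
  assert (HS : S0 <= S). { unfold S. rewrite <- (sqrt_square S0) by lra. apply sqrt_le_1; nra. }
  set (E := exp (k / 4 * S)).
  assert (kS : 2 <= k * S). { apply Rle_trans with (k * (2 / k)). right; field; lra. apply Rmult_le_compat_l; lra. }
  assert (HE : 1 < E). { unfold E. rewrite <- exp_0. apply exp_increasing. lra. }
  exists (Jint (psix x) (1/2 + eps)). split. apply integrand_improper; lra.
  replace (- (k / 4) * S) with (- (k / 4 * S)) by ring. rewrite exp_Ropp. fold E.
  assert (IE : 0 < / E) by (apply Rinv_0_lt_compat; lra).
  assert (PxE : 0 < x * / E) by (apply Rmult_lt_0_compat; auto).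
  apply divide_by_PI. { apply Rmult_le_pos; lra. }
  (* E is the saving to be reached. With T = E^4 and h = x / E^2 the truncation error x^2 log x / (h
     T) is x log x / E^2, and one factor E remains to absorb the logarithm. *)
  set (T := E * E * (E * E)).
  assert (ET : T = exp (k * S)). { unfold T, E. rewrite <- !exp_plus. f_equal. field. }
  assert (HT : 3 <= T). { rewrite ET. assert (Q := exp_ineq1_le (k * S)). lra. }
  set (h := x / (E * E)).
  assert (EE : 1 < E * E) by nra. assert (E2 : E <= E * E) by nra.
  assert (TE : E <= T). { unfold T. apply Rle_trans with (E * E * 1). lra. apply Rmult_le_compat_l; lra. }
  assert (TT : T <= T * T) by (apply one_le_sq; lra).
  assert (T3 : 1 <= T * (T * T)). { apply Rle_trans with (T * 1). lra. apply Rmult_le_compat_l; lra. }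
  assert (Hh : 0 < h <= x).
  { unfold h. split. apply Rdiv_lt_0_compat; lra. apply Rmult_le_reg_r with (E * E). lra. replace (x / (E * E) * (E * E)) with x by (field; lra). nra. }
  assert (hT : 0 < h * T) by (apply Rmult_lt_0_compat; lra). assert (hTT : 0 < h * (T * T)) by (apply Rmult_lt_0_compat; lra).
  assert (Hh1 : 1 <= h).
  { unfold h. apply Rmult_le_reg_r with (E * E). lra. replace (x / (E * E) * (E * E)) with x by (field; lra). rewrite Rmult_1_l, <- Ex. unfold E. rewrite <- exp_plus. apply exp_mono. nra. }
  set (l := ln (T + 1)). assert (Hl : 1 <= l) by (apply ln_ge_1; lra).
  assert (Hl2 : l <= 2 * (k * S)).
  { unfold l. replace (2 * (k * S)) with (ln (T * T)). left; apply ln_increasing; nra. rewrite ET, <- exp_plus, ln_exp. ring. }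
  assert (Hl3 : l <= T + 1) by (apply ln_le_self; lra).
  (* The edge a lies halfway between 1 and the boundary a' of the zero-free region, so that |s - 1|
     is bounded below on the left side and there is room to the left. *)
  set (a := 1 - c0 / (2 * l)). set (a' := 1 - c0 / l).
  assert (Ha : 15/16 <= a < 1).
  { unfold a. assert (0 < c0 / (2 * l)) by (apply Rdiv_lt_0_compat; lra). split; [|lra].
    assert (c0 / (2 * l) <= 1/16); [|lra]. apply Rmult_le_reg_r with (2 * l). lra. replace (c0 / (2 * l) * (2 * l)) with c0 by (field; lra). lra. }
  assert (Haa : 1 - a' = 2 * (1 - a)) by (unfold a, a'; field; lra).
  assert (Za : c0 / (4 * T) <= 1 - a).
  { unfold a. replace (1 - (1 - c0 / (2 * l))) with (c0 / (2 * l)) by ring. unfold Rdiv. apply Rmult_le_compat_l. lra. apply Rinv_le_contravar; lra. }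
  (* This gives x^(a-1) <= T^-4, which pays for the T^2 of the growth bound and for log(T + 1) <= 2
     T, leaving 1 / T. *)
  assert (Zc : 4 * (k * S) <= (1 - a) * L).
  { unfold a. replace ((1 - (1 - c0 / (2 * l))) * L) with (c0 * L / (2 * l)) by (field; lra).
    apply Rmult_le_reg_r with (2 * l). lra. replace (c0 * L / (2 * l) * (2 * l)) with (c0 * L) by (field; lra).
    rewrite <- ES. assert (Hc4 : c0 = 4 * k) by (unfold k; field). rewrite Hc4.
    assert (A1 : 4 * (k * S) * (2 * l) <= 4 * (k * S) * (4 * (k * S))) by (apply Rmult_le_compat_l; lra).
    assert (A2 : 4 * k * (k * (S * S)) <= 1 * (k * (S * S))) by (apply Rmult_le_compat_r; nra). nra. }
  assert (Xa : Rpower x a <= x * / T * / (T * (T * T))).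
  { unfold Rpower. fold L. rewrite ET, <- !exp_plus, <- !exp_Ropp, <- Ex, <- !exp_plus. apply exp_mono. lra. }
  (* The usual abscissa: x^c <= e x while 1 / (c - 1) is only log x. *)
  set (c := 1 + / L). assert (IL : 0 < / L <= 1). { split. apply Rinv_0_lt_compat; lra. rewrite <- Rinv_1. apply Rinv_le_contravar; lra. }
  assert (Xc : Rpower x (c + 1) <= 3 * (x * x)).
  { unfold c. replace (1 + / L + 1) with (1 + 1 + / L) by ring. rewrite !Rpower_plus, Rpower_1 by auto. unfold Rpower. fold L.
    rewrite Rinv_l by lra. assert (Q := exp_le_3). rewrite Rmult_comm. apply Rmult_le_compat_r; nra. }
  assert (HW : forall s, rect a' 3 (- (T + 1)) (T + 1) s -> W s <> RtoC 0).
  { intros s [S1 S2]. apply (ZF (T + 1)). lra. apply Rabs_le; lra. fold l. fold a'. lra. }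
  assert (WB : forall s, 15/16 <= fst s -> Cmod (W2 s) <= 5040 * (1 + Cmod s) ^ 3).
  { intros s Hs. assert (B1 := W2_bound s ltac:(lra)). assert (B2 := W_bound s ltac:(lra)).
    assert (I2 : 0 < / (2 * fst s - 1) <= 2). { split. apply Rinv_0_lt_compat; lra. replace 2 with (/ (1/2)) by field. apply Rinv_le_contravar; lra. }
    eapply Rle_trans. exact B1. replace (5040 * (1 + Cmod s) ^ 3) with (12 * (420 * (1 + Cmod s) ^ 3)) by ring.
    apply Rmult_le_compat; try lra. apply Cmod_ge_0. }
  (* On the left side 1 + |s| <= 3 T and |s - 1| >= c0 / (4 T); K1 is calibrated by 544320 = 4 * 27
     * 5040. *)
  assert (Lv : forall t, 0 <= t <= T -> Cmod (W2 (a, t)) <= (K1 * (T * T)) * (K1 * (T * T)) * Cmod ((a, t) - 1)).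
  { intros t Ht. assert (B := WB (a, t) ltac:(simpl; lra)).
    assert (Ms := Cmod_le_sum (a, t)). simpl in Ms. rewrite !Rabs_pos_eq in Ms by lra.
    assert (Md := Cmod_fst ((a, t) - 1)%C). simpl in Md. rewrite Rabs_left in Md by lra.
    assert (P3 : (1 + Cmod (a, t)) ^ 3 <= (3 * T) ^ 3) by (apply pow_incr; assert (Q9 := Cmod_ge_0 (a, t)); lra).
    assert (Md2 : c0 / (4 * T) <= Cmod ((a, t) - 1)) by lra.
    eapply Rle_trans. exact B.
    assert (Kc : K1 * c0 = 544320) by (unfold K1; field; lra).
    assert (PT4 : 0 <= T * T * (T * T)) by nra.
    apply Rle_trans with (K1 * (T * T * (T * T)) * (c0 / (4 * T))).
    - replace (K1 * (T * T * (T * T)) * (c0 / (4 * T))) with ((K1 * c0) / 4 * T ^ 3) by (field; lra). rewrite Kc.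
      replace ((3 * T) ^ 3) with (27 * T ^ 3) in P3 by ring. lra.
    - replace ((K1 * (T * T)) * (K1 * (T * T))) with ((K1 * K1) * (T * T * (T * T))) by ring.
      apply Rmult_le_compat; auto. apply Rmult_le_pos; lra. apply Rdiv_le_0_compat; lra.
      apply Rmult_le_compat_r; auto. apply one_le_sq; auto. }
  (* On the top 1 + |s| <= 4 T and |s - 1| >= T, and 568^2 just exceeds 5040 * 4^3. *)
  assert (Lt : forall u, a <= u <= c -> Cmod (W2 (u, T)) <= (568 * T) * (568 * T) * Cmod ((u, T) - 1)).
  { intros u Hu. unfold c in Hu. assert (B := WB (u, T) ltac:(simpl; lra)).
    assert (Ms := Cmod_le_sum (u, T)). simpl in Ms. rewrite !Rabs_pos_eq in Ms by lra.
    assert (Md := Cmod_snd ((u, T) - 1)%C). simpl in Md. rewrite Rabs_pos_eq in Md by lra.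
    assert (P3 : (1 + Cmod (u, T)) ^ 3 <= (4 * T) ^ 3) by (apply pow_incr; assert (Q9 := Cmod_ge_0 (u, T)); lra).
    replace ((4 * T) ^ 3) with (64 * T ^ 3) in P3 by ring. eapply Rle_trans. exact B.
    apply Rle_trans with (568 * T * (568 * T) * T). replace (568 * T * (568 * T) * T) with (322624 * T ^ 3) by ring.
    assert (0 <= T ^ 3) by (apply pow_le; lra). lra.
    apply Rmult_le_compat_l. nra. lra. }
  assert (CE := contour_estimate x h c T a a' (K1 * (T * T)) (568 * T) Hx1 Hh ltac:(unfold c; lra) ltac:(lra)
     ltac:(lra) ltac:(lra) HW ltac:(nra) ltac:(lra) Lv Lt).
  assert (Js := Jint_smooth x h d a M ltac:(lra) ltac:(lra) ltac:(lra) ltac:(lra) HM).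
  assert (XE : x * / T <= x * / E).
  { apply Rmult_le_compat_l. lra. apply Rinv_le_contravar; lra. }
  assert (XaE : Rpower x a <= x * / E).
  { eapply Rle_trans. exact Xa. apply Rle_trans with (x * / T); auto.
    rewrite <- (Rmult_1_r (x * / T)) at 2. apply Rmult_le_compat_l. left; apply Rmult_lt_0_compat; auto; apply Rinv_0_lt_compat; lra.
    rewrite <- Rinv_1. apply Rinv_le_contravar; lra. }
  (* The point 1/2 + eps may lie on either side of a; both powers x^a and x^(1/2 + eps) are within
     the error. *)
  assert (Jm : Rabs (Jint (psix x) a - Jint (psix x) (1/2 + eps)) <= 4 * M * (x * / E)).
  { destruct (Rle_dec a (1/2 + eps)) as [Le|Le].
    - eapply Rle_trans. apply (Jint_move x d a (1/2 + eps) M); auto; lra. apply Rmult_le_compat_l. lra.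
      eapply Rle_trans; [|exact XE]. unfold Rpower. fold L. rewrite ET, <- exp_Ropp, <- Ex, <- exp_plus. apply exp_mono.
      assert (k <= (1/2 - eps) * S). { apply Rle_trans with ((1/2 - eps) * (k / (1/2 - eps))). right; field; lra. apply Rmult_le_compat_l; lra. }
      assert (k * S <= (1/2 - eps) * S * S) by (apply Rmult_le_compat_r; lra). rewrite <- ES. lra.
    - rewrite Rabs_minus_sym. eapply Rle_trans. apply (Jint_move x d (1/2 + eps) a M); auto; lra. apply Rmult_le_compat_l; lra. }
  assert (hE : h <= x * / E). { unfold h, Rdiv. apply Rmult_le_compat_l. lra. apply Rinv_le_contravar; lra. }
  assert (T1 : PI * (h + 1) <= 8 * (x * / E)). { apply Rle_trans with (4 * (h + 1)). apply Rmult_le_compat_r. lra. apply PI_4. lra. }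
  assert (T5 : 2 * M * h <= 2 * M * (x * / E)) by (apply Rmult_le_compat_l; lra).
  assert (HLE : 1 + L <= K3 * E).
  { assert (Q := exp_ge_sq (k / 4 * S) ltac:(lra)). fold E in Q. unfold K3. rewrite <- ES.
    assert (S * S <= 64 / (k * k) * E). { replace (S * S) with (16 / (k * k) * (k / 4 * S * (k / 4 * S))) by (field; lra).
      replace (64 / (k * k) * E) with (16 / (k * k) * (4 * E)) by (field; lra). apply Rmult_le_compat_l; auto.
      left; apply Rdiv_lt_0_compat; lra. }
    lra. }
  assert (T2 : 960 * Rpower x (c + 1) / (h * T) * (1 + / (c - 1)) <= 960 * 3 * K3 * (x * / E)).
  { replace (/ (c - 1)) with L by (unfold c; field; lra).
    apply Rle_trans with (960 * (3 * (x * x)) / (h * T) * (K3 * E)).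
    - assert (0 < / (h * T)) by (apply Rinv_0_lt_compat; lra). assert (Q := Rpower_pos x (c + 1)).
      apply Rmult_le_compat; try lra. unfold Rdiv; apply Rmult_le_pos; lra.
      unfold Rdiv; apply Rmult_le_compat_r; lra.
    - right. unfold h, T. field. lra. }
  assert (T4 : 64 * (568 * T) * Rpower x (c + 1) / (h * (T * T)) <= 64 * 568 * 3 * (x * / E)).
  { apply Rle_trans with (64 * 568 * 3 * (x * / (E * E))).
    - apply Rle_trans with (64 * (568 * T) * (3 * (x * x)) / (h * (T * T))).
      + unfold Rdiv. apply Rmult_le_compat_r. left; apply Rinv_0_lt_compat; lra. apply Rmult_le_compat_l; lra.
      + right. unfold h, T. field. lra.
    - apply Rmult_le_compat_l. lra. apply Rmult_le_compat_l. lra. apply Rinv_le_contravar; lra. }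
  assert (T6 : 24 * (K1 * (T * T)) * Rpower x a * ln (1 + T) <= 48 * K1 * (x * / E)).
  { rewrite (Rplus_comm 1 T). fold l. assert (PT2 : 0 <= K1 * (T * T)) by (apply Rmult_le_pos; lra). assert (Pa := Rpower_pos x a).
    apply Rle_trans with (24 * (K1 * (T * T)) * (x * / T * / (T * (T * T))) * (2 * T)).
    - apply Rmult_le_compat; try lra. apply Rmult_le_pos; lra. apply Rmult_le_compat_l; lra.
    - replace (24 * (K1 * (T * T)) * (x * / T * / (T * (T * T))) * (2 * T)) with (48 * K1 * (x * / T)) by (field; lra).
      apply Rmult_le_compat_l; lra. }
  set (J1 := Jint (fun u => GR u * fst (Kh x h (RtoC u))) a) in *. set (J2 := Jint (psix x) a) in *. set (J3 := Jint (psix x) (1/2 + eps)) in *.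
  replace (PI * countE x - J3) with ((PI * countE x - J1) + (J1 - J2) + (J2 - J3)) by ring.
  eapply Rle_trans. apply Rabs_triang. eapply Rle_trans. apply Rplus_le_compat_r, Rabs_triang.
  rewrite !Rmult_plus_distr_r. lra.
Qed.

Theorem theorem2p4 (eps : R) (heps : 0 < eps < 1/2) :
  (exists c : R, 0 < c /\
     exists C x0 : R, forall x : R, x0 <= x ->
       exists I : R,
         is_RInt_gen (integrand x) (at_point (1/2 + eps)) (at_left 1) I /\
         Rabs (countE x - I / PI) <= C * (x * exp (- c * sqrt (ln x))))
  /\
  (RH_zeta -> RH_L4 ->
     exists C x0 : R, forall x : R, x0 <= x ->
       exists I : R,
         is_RInt_gen (integrand x) (at_point (1/2 + eps)) (at_left 1) I /\
         Rabs (countE x - I / PI) <= C * Rpower x (1/2 + eps)).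
Proof.
  split; [apply error_unconditional | apply error_RH]; exact heps.
Qed.
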